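(* Let $h$ be a function that is analytic on the complex half plane $\{z\in\mathbb C:\operatorname{Re}(z)>0\}$ and satisfies: (i) $h''(1)\neq 0$; (ii) for $t\in\mathbb R$, $|h(1-it)|=O(t^2)$ as $|t|\to\infty$; (iii) for $t\in\mathbb R$, $|h''(1-it)|=O(1)$ as $|t|\to\infty$. Let $\hat f_n$ be the Grenander estimator based on a sample $X_1,\dots,X_n$ from the uniform distribution on $[0,1]$, whose density is denoted by $f$. Put $\mu(h,g)=\int_0^1 h(g(x))\,dx$. Then, as $n\to\infty$, $$\frac{n\left\{\mu(h,\hat f_n)-\mu(h,f)\right\}-\tfrac12 h''(1)\log n}{\sqrt{\tfrac34 h''(1)^2\log n}}\ \stackrel{\mathcal D}{\longrightarrow}\ N(0,1),$$ where $N(0,1)$ denotes the standard normal distribution and $\stackrel{\mathcal D}{\longrightarrow}$ denotes convergence in distribution.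
   Context: The Grenander estimator $\hat f_n$ is the nonparametric maximum likelihood estimator of a decreasing density; it is the left-continuous slope of the least concave majorant of the empirical distribution function of the sample $X_1,\dots,X_n$. Since $f\equiv 1$ on $[0,1]$, $\mu(h,f)=h(1)$. *)

(* Defs.v *)
From HB Require Import structures.
From mathcomp Require Import all_boot all_order all_algebra.
From mathcomp Require Import complex.
From mathcomp Require Import all_classical all_reals all_analysis.

Set Implicit Arguments.
Unset Strict Implicit.
Unset Printing Implicit Defensive.

Import Order.TTheory GRing.Theory Num.Theory.
Import numFieldNormedType.Exports.

Local Open Scope classical_set_scope.
Local Open Scope ring_scope.
Local Open Scope complex_scope.

(* The library puts a topology on [R[i]] only through the regular module
   [R[i]^o]. Functions are typed [R[i] -> R[i]^o], so that [derive1n n h] is the n-th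
   derivative with respect to the complex variable. *)

Definition analytic_on (R : realType) (D : set R[i]) (h : R[i] -> R[i]^o) :=
  forall z0 : R[i], D z0 -> exists a : nat -> R[i],
    \forall z \near (z0 : R[i]^o),
      series (fun k => a k * (z - z0) ^+ k : R[i]^o) @ \oo --> h z.

Definition right_half_plane (R : realType) : set R[i] :=
  [set z | 0 < complex.Re z].

(* [`|z|] has type [R[i]]; this is the same modulus as a real number. *)
Definition modulus (R : realType) (z : R[i]) : R := complex.Re `|z|.

(* The product rule for all finite subfamilies. *)
Definition mutually_independent (R : realType) (d : measure_display)
    (T : measurableType d) (P : probability T R) (X : nat -> {RV P >-> R}) :=
  forall (s : seq nat) (A : nat -> set R), uniq s ->
    (forall i, measurable (A i)) ->
    P (\bigcap_(i in [set` s]) (X i @^-1` A i)) =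
    (\prod_(i <- s) P (X i @^-1` A i))%E.

Definition uniform01_sample (R : realType) (d : measure_display)
    (T : measurableType d) (P : probability T R) (X : nat -> {RV P >-> R}) :=
  mutually_independent X /\
  forall (i : nat) (A : set R), measurable A ->
    distribution P (X i) A = uniform_prob (@ltr01 R) A.

Definition empirical_cdf (R : realType) (n : nat) (x : 'I_n -> R) (t : R) : R :=
  (\sum_(i < n) \1_[set s | s <= t] (x i)) / n%:R.

Definition concave_majorant (R : realType) (F g : R -> R) :=
  convex_function (`[0, +oo[%classic : set R^o) (fun t => - g t) /\
  forall t, 0 <= t -> F t <= g t.

(* A pointwise infimum of concave functions is concave, so this is the least
   element of [concave_majorant F] on [0, +oo[ as soon as one exists. *)
Definition least_concave_majorant (R : realType) (F : R -> R) (t : R) : R :=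
  inf [set g t | g in concave_majorant F].

Definition left_slope (R : realType) (F : R -> R) (x : R) : R :=
  lim ((F (x + e) - F x) / e @[e --> 0^'-]).

Definition grenander (R : realType) (n : nat) (x : 'I_n -> R) : R -> R :=
  left_slope (least_concave_majorant (empirical_cdf x)).

(* The Grenander estimator vanishes to the right of the largest observation, so
   the value [h 0], at a boundary point of the half plane, enters this integral;
   [h] being a total function, that value is an arbitrary complex number. *)
Definition mu_functional (R : realType) (h : R[i] -> R[i]^o) (g : R -> R)
    : R[i] :=
  (\int[@lebesgue_measure R]_(x in `[0, 1]) complex.Re (h (g x)%:C)) +i*
  (\int[@lebesgue_measure R]_(x in `[0, 1]) complex.Im (h (g x)%:C)).

(* [Y n] converges in distribution to [Z], for random elements of a topological
   space [E] with its Borel sigma-algebra; [Z] may live on another probability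
   space. *)
Definition cvg_in_distribution (R : realType) (d d' : measure_display)
    (T : measurableType d) (T' : measurableType d') (E : topologicalType)
    (P : probability T R) (Q : probability T' R)
    (Y : nat -> T -> E) (Z : T' -> E) :=
  (forall (n : nat) (U : set E), open U -> measurable (Y n @^-1` U)) /\
  forall phi : E -> R, continuous phi ->
    (exists M : R, forall e, `|phi e| <= M) ->
    \int[P]_w phi (Y n w) @[n --> \oo] --> \int[Q]_w phi (Z w).

(* Main.v *)
(* The order statistics of a uniform sample are partial sums of independent standard
   exponential variables divided by their total. Expanding [h] to second order at 1, the
   centred functional becomes [n (mu (h, fhat_n) - h 1) = h''(1) / 2 * Q_n + O(1)] in
   probability, where [Q_n] is the sum of [(G - j) ^ 2 / j] over the faces of the concave
   majorant, [j] being the number of increments in a face and [G] their sum. By the cycle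
   lemma exactly one rotation of a block of increments stays below its chord; exchanging the
   block of a face to the front yields, for any sum [F_n] over the faces,
   [n E Phi(F_n) = sum_(1 <= j <= n) E Phi(psi_j(G_j) + F_(n - j))] with [G_j] a gamma
   variable independent of [F_(n - j)]. Comparing this recursion for [Q_n] with the one
   satisfied by Gaussian averages, with third order Taylor remainders in the manner of
   Lindeberg, gives a central limit theorem with centring [ln n] and variance [3 ln n].
   The same recursion gives the first moments that control the error terms. *)

Require Import Defs.
From HB Require Import structures.
From mathcomp Require Import all_boot all_order all_algebra.
From mathcomp Require Import complex.
From mathcomp Require Import all_classical all_reals all_analysis measurable_realfun.
From mathcomp Require Import ring lra zify.

Set Implicit Arguments.
Unset Strict Implicit.
Unset Printing Implicit Defensive.

Import Order.TTheory GRing.Theory Num.Theory.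
Import numFieldNormedType.Exports.

Local Open Scope classical_set_scope.
Local Open Scope ring_scope.

(** * Measurability on finite sequences of real numbers *)

(** Expectations are iterated integrals [It] of nonnegative functions of a finite sequence:
    Tonelli's theorem then asks for no integrability, and cutting, rotating and inserting blocks
    become concatenations. Signed expansions are recovered from linear inequalities between such
    integrals. The obstacle is that [h] is not controlled near 0 and near infinity, where the slope
    of a short face may fall. Hence the functional [err], whose mean is at most a constant times
    [e + 1 / K] for small [e]: where it is below 1, the slopes of all faces stay in a compact
    interval depending on [e], and the error of the expansion is bounded by a constant. That
    constant is then divided by a multiple of [sqrt (ln n)]. The factor 3 in the variance is a
    second moment, not a variance: faces of length [j] have mean number [1 / j], as in a Poisson
    process, and [(G - j) ^ 2 / j] has mean 1 and second moment [3 + 6 / j]. The denominator is a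
    complex square root, so the limit is first obtained along [kappa x] with [kappa] equal to 1 or
    -1; the symmetry of the normal law removes the sign. *)

Section seq_measurable.
Context {R : realType}.

(** The boxes generate the sigma-algebra of the disjoint union of the spaces [R^n]. Lengths may
    vary, so that blocks can be cut out and glued inside a single measurable space. *)
Definition seq_box (n : nat) (B : nat -> set R) : set (seq R) :=
  [set s | size s = n /\ forall i, (i < n)%N -> B i (nth 0 s i)].

Definition seq_boxes : set (set (seq R)) :=
  [set A | exists n B, (forall i, measurable (B i)) /\ A = seq_box n B].

HB.instance Definition _ := isPointed.Build (seq R) [::].

Definition seq_display : measure_display. Proof. exact: default_measure_display. Qed.

HB.instance Definition _ := @isMeasurable.Build seq_display (seq R)
  <<s seq_boxes >> (@sigma_algebra0 _ setT seq_boxes)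
  (@sigma_algebraC _ seq_boxes) (@sigma_algebra_bigcup _ setT seq_boxes).

Lemma seq_boxesI : setI_closed seq_boxes.
Proof.
move=> _ _ [n [B [mB ->]]] [m [C [mC ->]]].
have [<-|nm] := eqVneq n m.
  exists n, (fun i => B i `&` C i); split.
    by move=> i; exact: measurableI.
  apply/seteqP; split=> s /=.
    by move=> [[sn Bs] [_ Cs]]; split => // i ilt; split; [exact: Bs|exact: Cs].
  by move=> [sn BCs]; split; split=> // i /BCs[].
exists 1%N, (fun=> set0); split=> //.
apply/seteqP; split=> s /=; first by move=> [[sn _] [sm _]]; move: nm; rewrite -sn -sm eqxx.
by move=> [_ /(_ 0%N isT)].
Qed.

Lemma measurable_fun_seq d (X : measurableType d) (f : X -> seq R) :
  measurable_fun setT (fun x => size (f x)) ->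
  (forall i, measurable_fun setT (fun x => nth 0 (f x) i)) ->
  measurable_fun setT f.
Proof.
move=> ms mn.
apply: (measurability seq_boxes) => //.
move=> _ [_ [n [B [mB ->]] <-]]; rewrite setTI.
have -> : f @^-1` seq_box n B = (fun x => size (f x)) @^-1` [set n] `&`
    \bigcap_(i < n) ((fun x => nth 0 (f x) i) @^-1` B i).
  by apply/seteqP; split=> x /=; move=> [sn H]; split.
apply: measurableI; first by rewrite -[X in measurable X]setTI; exact: ms.
apply: bigcap_measurableType => i _.
by rewrite -[X in measurable X]setTI; exact: mn.
Qed.

Lemma measurable_size : measurable_fun setT (size : seq R -> nat).
Proof.
move=> _ Y _; rewrite setTI.
have -> : size @^-1` Y = \bigcup_(n in Y) seq_box n (fun=> setT).
  apply/seteqP; split=> s /=; first by move=> Ys; exists (size s).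
  by move=> [n Yn [-> _]].
apply: bigcup_measurable => n _; apply: sub_sigma_algebra.
by exists n, (fun=> setT).
Qed.

Lemma measurable_nth i : measurable_fun setT (fun s : seq R => nth 0 s i).
Proof.
move=> _ Y mY; rewrite setTI.
have -> : (fun s : seq R => nth 0 s i) @^-1` Y =
    (\bigcup_(n in [set n | (i < n)%N])
       seq_box n (fun k => if k == i then Y else setT)) `|`
    (\bigcup_(n in [set n | (n <= i)%N /\ Y 0]) seq_box n (fun=> setT)).
  apply/seteqP; split=> s /=.
    move=> Ys; have [si|si] := ltnP i (size s).
      left; exists (size s) => //; split=> // k ks.
      by case: eqP => // ->.
    by right; exists (size s) => //; rewrite nth_default in Ys.
  move=> [[n ni [sn]]|[n [ni Y0] [sn _]]]; last by rewrite nth_default // sn.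
  by move=> /(_ i ni); rewrite eqxx.
apply: measurableU; apply: bigcup_measurable => n _; apply: sub_sigma_algebra.
  exists n, (fun k => if k == i then Y else setT); split=> // k.
  by case: (k == i).
by exists n, (fun=> setT).
Qed.

(** The countably many level sets of [g] reduce the claim to a fixed index. *)
Lemma measurable_fun_natdep d (X : measurableType d) d' (Y : measurableType d')
  (g : X -> nat) (h : nat -> X -> Y) : measurable_fun setT g ->
  (forall n, measurable_fun setT (h n)) -> measurable_fun setT (fun x => h (g x) x).
Proof.
move=> mg mh _ Z mZ; rewrite setTI.
have -> : (fun x => h (g x) x) @^-1` Z =
    \bigcup_n (g @^-1` [set n] `&` h n @^-1` Z).
  apply/seteqP; split=> x /=; first by move=> Zx; exists (g x).
  by move=> [n _ [<-]].
apply: bigcup_measurable => n _; apply: measurableI.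
  by rewrite -[X in measurable X]setTI; exact: mg.
by rewrite -[X in measurable X]setTI; exact: mh.
Qed.

Section ops.
Context d (X : measurableType d).

Lemma measurable_fun_size (f : X -> seq R) : measurable_fun setT f ->
  measurable_fun setT (fun x => size (f x)).
Proof. by move=> mf; exact: (measurableT_comp measurable_size). Qed.

Lemma measurable_fun_nth (f : X -> seq R) i : measurable_fun setT f ->
  measurable_fun setT (fun x => nth 0 (f x) i).
Proof. by move=> mf; exact: (measurableT_comp (measurable_nth i)). Qed.

Lemma measurable_fun_cat (f g : X -> seq R) : measurable_fun setT f ->
  measurable_fun setT g -> measurable_fun setT (fun x => f x ++ g x).
Proof.
move=> mf mg; apply: measurable_fun_seq => [|i].
  under eq_fun do rewrite size_cat.
  apply: (measurable_fun_natdep (h := fun n x => n + size (g x))%N).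
    exact: measurable_fun_size.
  move=> n.
  by apply: (measurable_fun_natdep (g := size \o g) (h := fun m _ => n + m)%N) => //;
    exact: measurable_fun_size.
under eq_fun do rewrite nth_cat.
apply: (measurable_fun_natdep (g := size \o f) (h := fun n x =>
  if (i < n)%N then nth 0 (f x) i else nth 0 (g x) (i - n))).
  exact: measurable_fun_size.
by move=> n; case: (i < n)%N; exact: measurable_fun_nth.
Qed.

Lemma measurable_fun_cons (f : X -> R) (g : X -> seq R) : measurable_fun setT f ->
  measurable_fun setT g -> measurable_fun setT (fun x => f x :: g x).
Proof.
move=> mf mg; apply: measurable_fun_seq => [|[|i]] //=; last exact: measurable_fun_nth.
by apply: (measurable_fun_natdep (g := size \o g) (h := fun m _ => m.+1)) => //;
  exact: measurable_fun_size.
Qed.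

Lemma measurable_fun_rcons (f : X -> R) (g : X -> seq R) : measurable_fun setT f ->
  measurable_fun setT g -> measurable_fun setT (fun x => rcons (g x) (f x)).
Proof.
move=> mf mg; under eq_fun do rewrite -cats1.
by apply: measurable_fun_cat => //; exact: measurable_fun_cons.
Qed.

Lemma measurable_fun_take (f : X -> seq R) p : measurable_fun setT f ->
  measurable_fun setT (fun x => take p (f x)).
Proof.
move=> mf; apply: measurable_fun_seq => [|i].
  under eq_fun do rewrite size_take_min.
  by apply: (measurable_fun_natdep (g := size \o f) (h := fun m _ => minn p m)) => //;
    exact: measurable_fun_size.
have [ip|pi] := ltnP i p.
  by under eq_fun do rewrite nth_take//; exact: measurable_fun_nth.
under eq_fun do rewrite nth_default ?(leq_trans _ pi)// ?size_take_min ?geq_minl//.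
exact: measurable_cst.
Qed.

Lemma measurable_fun_drop (f : X -> seq R) p : measurable_fun setT f ->
  measurable_fun setT (fun x => drop p (f x)).
Proof.
move=> mf; apply: measurable_fun_seq => [|i].
  under eq_fun do rewrite size_drop.
  by apply: (measurable_fun_natdep (g := size \o f) (h := fun m _ => m - p)%N) => //;
    exact: measurable_fun_size.
by under eq_fun do rewrite nth_drop; exact: measurable_fun_nth.
Qed.

Lemma measurable_fun_mkseq (f : nat -> X -> R) n :
  (forall i, measurable_fun setT (f i)) ->
  measurable_fun setT (fun x => mkseq (f ^~ x) n).
Proof.
move=> mf; apply: measurable_fun_seq => [|i].
  by under eq_fun do rewrite size_mkseq; exact: measurable_cst.
have [ip|pi] := ltnP i n.
  by under eq_fun do rewrite nth_mkseq//; exact: mf.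
under eq_fun do rewrite nth_default ?size_mkseq//.
exact: measurable_cst.
Qed.

End ops.

End seq_measurable.

(** * Iterated integrals against a weight *)

Section iterated.
Context {R : realType}.
Local Notation mu := (@lebesgue_measure R).
Local Open Scope ereal_scope.

Record weight := Weight {
  weight_fun :> R -> R;
  measurable_weight : measurable_fun setT weight_fun;
  weight_ge0 : forall x, (0 <= weight_fun x)%R }.

(** Integral over [R^n] against the product of [n] copies of [w]. With recursion in place of a
    product measure, splitting a sequence after [j] coordinates holds almost by computation
    ([It_cat]). *)
Fixpoint It (w : weight) (n : nat) (F : seq R -> \bar R) : \bar R :=
  if n is n'.+1 then \int[mu]_x ((w x)%:E * It w n' (fun s => F (x :: s)))
  else F [::].

Implicit Types (w : weight) (F G : seq R -> \bar R).

Lemma measurable_weightE w : measurable_fun setT (fun x => (w x)%:E).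
Proof. by apply/measurable_EFinP; exact: measurable_weight. Qed.

Lemma It_ge0 w n F : (forall s, 0 <= F s) -> 0 <= It w n F.
Proof.
elim: n F => [|n IH] F F0 /=; first exact: F0.
by apply: integral_ge0 => x _; rewrite mule_ge0 ?lee_fin ?weight_ge0// IH.
Qed.

Lemma measurable_It w n d (X : measurableType d) (F : X -> seq R -> \bar R) :
  measurable_fun setT (fun p => F p.1 p.2) -> (forall x s, 0 <= F x s) ->
  measurable_fun setT (fun x => It w n (F x)).
Proof.
elim: n d X F => [|n IH] d X F mF F0 /=.
  apply: (measurableT_comp (f := fun p => F p.1 p.2) (g := fun x => (x, [::]))) => //.
apply: (@measurable_fun_fubini_tonelli_F _ _ _ _ _ mu
   (fun p : X * R => (w p.2)%:E * It w n (fun s => F p.1 (p.2 :: s)))).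
  apply: emeasurable_funM.
    by apply: (measurableT_comp (measurable_weightE w)).
  apply: (IH _ _ (fun (p : X * R) s => F p.1 (p.2 :: s))) => [|p s]; last exact: F0.
  apply: (measurableT_comp (f := fun p => F p.1 p.2)
    (g := fun q : (X * R) * seq R => (q.1.1, q.1.2 :: q.2))) => //.
  apply: measurable_fun_pair; first exact: (measurableT_comp measurable_fst).
  apply: measurable_fun_cons => //; exact: (measurableT_comp measurable_snd).
by move=> p; rewrite mule_ge0 ?lee_fin ?weight_ge0// It_ge0.
Qed.

Lemma measurable_It_cons w n F : measurable_fun setT F -> (forall s, 0 <= F s) ->
  measurable_fun setT (fun x => It w n (fun s => F (x :: s))).
Proof.
move=> mF F0; apply: (@measurable_It w _ _ _ (fun x s => F (x :: s))) => //.
by apply: (measurableT_comp mF); exact: measurable_fun_cons.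
Qed.

Lemma measurable_cons_r F x : measurable_fun setT F ->
  measurable_fun setT (fun s => F (x :: s)).
Proof. by move=> mF; apply: (measurableT_comp mF); exact: measurable_fun_cons. Qed.

Lemma measurable_weight_It w n F : measurable_fun setT F -> (forall s, 0 <= F s) ->
  measurable_fun setT (fun x => (w x)%:E * It w n (fun s => F (x :: s))).
Proof.
move=> mF F0; apply: emeasurable_funM; first exact: measurable_weightE.
exact: measurable_It_cons.
Qed.

Lemma It_ext w n F G : (forall s, size s = n -> F s = G s) -> It w n F = It w n G.
Proof.
elim: n F G => [|n IH] F G FG /=; first exact: FG.
by apply: eq_integral => x _; congr (_ * _); apply: IH => s sn; apply: FG; rewrite /= sn.
Qed.

Lemma le_It w n F G : measurable_fun setT F -> measurable_fun setT G ->
  (forall s, 0 <= F s) -> (forall s, 0 <= G s) ->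
  (forall s, size s = n -> F s <= G s) -> It w n F <= It w n G.
Proof.
elim: n F G => [|n IH] F G mF mG F0 G0 FG /=; first exact: FG.
apply: ge0_le_integral => //.
- by move=> x _; rewrite mule_ge0 ?lee_fin ?weight_ge0// It_ge0.
- exact: measurable_weight_It.
- exact: measurable_weight_It.
- move=> x _; apply: lee_wpmul2l; first by rewrite lee_fin weight_ge0.
  by apply: IH => //; [exact: measurable_cons_r..|move=> s sn; apply: FG; rewrite /= sn].
Qed.

Lemma ItD w n F G : measurable_fun setT F -> measurable_fun setT G ->
  (forall s, 0 <= F s) -> (forall s, 0 <= G s) ->
  It w n (fun s => F s + G s) = It w n F + It w n G.
Proof.
elim: n F G => [//|n IH] F G mF mG F0 G0 /=.
rewrite -ge0_integralD//; last 4 first.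
- by move=> x _; rewrite mule_ge0 ?lee_fin ?weight_ge0// It_ge0.
- exact: measurable_weight_It.
- by move=> x _; rewrite mule_ge0 ?lee_fin ?weight_ge0// It_ge0.
- exact: measurable_weight_It.
apply: eq_integral => x _; rewrite IH//; [|exact: measurable_cons_r..].
by rewrite ge0_muleDr// It_ge0.
Qed.

Lemma ItZl w n F c : measurable_fun setT F -> (forall s, 0 <= F s) -> 0 <= c ->
  It w n (fun s => c * F s) = c * It w n F.
Proof.
elim: n F => [//|n IH] F mF F0 c0 /=.
rewrite -ge0_integralZl//; last 2 first.
- exact: measurable_weight_It.
- by move=> x _; rewrite mule_ge0 ?lee_fin ?weight_ge0// It_ge0.
apply: eq_integral => x _; rewrite IH//; last exact: measurable_cons_r.
by rewrite muleCA.
Qed.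

Lemma It0 w n : It w n (fun=> 0) = 0.
Proof.
elim: n => [//|n IH] /=; rewrite IH.
by under eq_integral do rewrite mule0; rewrite integral0.
Qed.

Lemma It_sum w n I (r : seq I) (F : I -> seq R -> \bar R) :
  (forall i, measurable_fun setT (F i)) -> (forall i s, 0 <= F i s) ->
  It w n (fun s => \sum_(i <- r) F i s) = \sum_(i <- r) It w n (F i).
Proof.
move=> mF F0; elim: r => [|i r IH].
  by under eq_fun do rewrite big_nil; rewrite big_nil It0.
rewrite big_cons -IH -ItD//; last 2 first.
- exact: emeasurable_sum.
- by move=> s; apply: sume_ge0 => j _; exact: F0.
by apply: It_ext => s _; rewrite big_cons.
Qed.

Lemma integral_It w n d (X : measurableType d)
    (m : {sigma_finite_measure set X -> \bar R}) (F : X -> seq R -> \bar R) :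
  measurable_fun setT (fun p => F p.1 p.2) -> (forall x s, 0 <= F x s) ->
  \int[m]_x It w n (F x) = It w n (fun s => \int[m]_x F x s).
Proof.
elim: n F => [//|n IH] F mF F0 /=.
have mF' : measurable_fun setT (fun q : (X * R) * seq R => F q.1.1 (q.1.2 :: q.2)).
  apply: (measurableT_comp (f := fun p => F p.1 p.2)
    (g := fun q : (X * R) * seq R => (q.1.1, q.1.2 :: q.2))) => //.
  apply: measurable_fun_pair; first exact: (measurableT_comp measurable_fst).
  apply: measurable_fun_cons => //; exact: (measurableT_comp measurable_snd).
have mIt : measurable_fun setT
    (fun p : X * R => It w n (fun s => F p.1 (p.2 :: s))).
  by apply: (@measurable_It w _ _ _ (fun (p : X * R) s => F p.1 (p.2 :: s))).
rewrite (@fubini_tonelli _ _ _ _ _ m mu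
  (fun p : X * R => (w p.2)%:E * It w n (fun s => F p.1 (p.2 :: s)))).
- apply: eq_integral => y _ /=.
  rewrite ge0_integralZl//.
  + congr (_ * _); apply: (IH (fun x s => F x (y :: s))) => //.
    apply: (measurableT_comp mF'
      (g := fun q : X * seq R => ((q.1, y), q.2))).
    apply: measurable_fun_pair => //; exact: measurable_fun_pair.
  + apply: (measurableT_comp mIt (g := fun x => (x, y))).
    exact: measurable_fun_pair.
  + by move=> x _; exact: It_ge0.
  + by rewrite lee_fin weight_ge0.
- apply: emeasurable_funM => //.
  by apply: (measurableT_comp (measurable_weightE w)).
- by move=> p; rewrite mule_ge0 ?lee_fin ?weight_ge0// It_ge0.
Qed.

Lemma It_cat w j m F :
  It w (j + m) F = It w j (fun z => It w m (fun y => F (z ++ y))).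
Proof.
elim: j F => [//|j IH] F /=.
by apply: eq_integral => x _; rewrite IH.
Qed.

Lemma It_swap w w' j m (F : seq R -> seq R -> \bar R) :
  measurable_fun setT (fun p => F p.1 p.2) -> (forall x s, 0 <= F x s) ->
  It w j (fun z => It w' m (F z)) = It w' m (fun y => It w j (F ^~ y)).
Proof.
elim: j F => [//|j IH] F mF F0 /=.
have mF3 : measurable_fun setT (fun q : (R * seq R) * seq R => F (q.1.1 :: q.1.2) q.2).
  apply: (measurableT_comp mF (g := fun q : (R * seq R) * seq R => (q.1.1 :: q.1.2, q.2))).
  apply: measurable_fun_pair => //.
  by apply: measurable_fun_cons; apply: measurableT_comp.
have mF2 x : measurable_fun setT (fun p : seq R * seq R => F (x :: p.1) p.2).
  apply: (measurableT_comp mF (g := fun q : seq R * seq R => (x :: q.1, q.2))).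
  apply: measurable_fun_pair => //.
  by apply: measurable_fun_cons.
rewrite -(@integral_It _ _ _ _ mu (fun x y => (w x)%:E * It w j (fun s => F (x :: s) y))).
- apply: eq_integral => x _.
  rewrite IH// ItZl ?lee_fin ?weight_ge0//.
  + apply: (@measurable_It w _ _ _ (fun y s => F (x :: s) y)) => //.
    apply: (measurableT_comp (mF2 x) (g := fun q : seq R * seq R => (q.2, q.1))).
    exact: measurable_fun_pair.
  + by move=> y; exact: It_ge0.
- apply: emeasurable_funM.
    by apply: (measurableT_comp (measurable_weightE w)).
  apply: (@measurable_It w _ _ _ (fun (p : R * seq R) s => F (p.1 :: s) p.2)) => //.
  apply: (measurableT_comp mF3 (g := fun q : (R * seq R) * seq R => ((q.1.1, q.2), q.1.2))).
  apply: measurable_fun_pair; last by apply: measurableT_comp.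
  by apply: measurable_fun_pair => //; apply: measurableT_comp.
- by move=> x y; rewrite mule_ge0 ?lee_fin ?weight_ge0// It_ge0.
Qed.

Lemma It_cst w n c : \int[mu]_x (w x)%:E = 1 -> 0 <= c -> It w n (fun=> c) = c.
Proof.
move=> w1 c0; elim: n => [//|n IH] /=; rewrite IH.
under eq_integral do rewrite muleC.
rewrite ge0_integralZl ?w1 ?mule1//; first exact: measurable_weightE.
by move=> x _; rewrite lee_fin weight_ge0.
Qed.

Lemma measurable_b2E d (X : measurableType d) (b : X -> bool) :
  measurable_fun setT b -> measurable_fun setT (fun x => ((b x)%:R : R)%:E).
Proof.
move=> mb; apply/measurable_EFinP.
rewrite (_ : (fun x => _) = (fun x => if b x then 1 else 0 : R))%R; last first.
  by apply/funext => x; case: (b x).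
exact: measurable_fun_ifT.
Qed.

Definition It_negl w n (b : seq R -> bool) :=
  measurable_fun setT b /\ It w n (fun s => (b s)%:R%:E) = 0.

Lemma It_null w n F b : It_negl w n b -> measurable_fun setT F ->
  (forall s, 0 <= F s) -> It w n (fun s => (b s)%:R%:E * F s) = 0.
Proof.
move=> [mb b0] mF F0.
apply/eqP; rewrite eq_le It_ge0 ?andbT; last by move=> s; rewrite mule_ge0 ?lee_fin.
(* Since [+oo * 0 = 0], a null event absorbs every nonnegative [F], even an infinite one. *)
have -> : 0 = +oo * It w n (fun s => (b s)%:R%:E) by rewrite b0 mule0.
have mN' := measurable_b2E mb.
rewrite -ItZl//; apply: le_It => //.
- exact: emeasurable_funM.
- by apply: emeasurable_funM.
- by move=> s; rewrite mule_ge0 ?lee_fin.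
move=> s _ /=; case: (b s); last by rewrite mul0e mule0.
by rewrite mul1e mule1 leey.
Qed.

Lemma It_ae w n b F G : It_negl w n b ->
  measurable_fun setT F -> measurable_fun setT G ->
  (forall s, 0 <= F s) -> (forall s, 0 <= G s) ->
  (forall s, size s = n -> ~~ b s -> F s = G s) -> It w n F = It w n G.
Proof.
move=> bN mF mG F0 G0 FG.
have split_ H : measurable_fun setT H -> (forall s, 0 <= H s) ->
    It w n H = It w n (fun s => (~~ b s)%:R%:E * H s).
  move=> mH H0; rewrite -[RHS]add0e -(It_null bN mH H0) -ItD.
  - apply: It_ext => s _.
    by case: (b s); rewrite ?mul0e ?mul1e ?adde0 ?add0e.
  - by apply: emeasurable_funM => //; apply: measurable_b2E; case: bN.
  - apply: emeasurable_funM => //; apply: measurable_b2E.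
    by apply: measurable_neg; case: bN.
  - by move=> s; rewrite mule_ge0 ?lee_fin.
  - by move=> s; rewrite mule_ge0 ?lee_fin.
rewrite (split_ F)// (split_ G)//; apply: It_ext => s sn.
by case: (boolP (b s)) => bs; rewrite ?mul0e// FG.
Qed.

Lemma It_negl_sub w n (b c : seq R -> bool) : It_negl w n c -> measurable_fun setT b ->
  (forall s, size s = n -> b s -> c s) -> It_negl w n b.
Proof.
move=> [mc c0] mb bc; split=> //.
apply/eqP; rewrite eq_le It_ge0 ?andbT; last by move=> s; rewrite lee_fin.
rewrite -c0; apply: le_It; rewrite ?c0//; try exact: measurable_b2E.
move=> s sn; rewrite lee_fin ler_nat.
by have := bc s sn; case: (b s) (c s) => -[]// /(_ isT).
Qed.

Lemma It_negl_has w n (I : eqType) (r : seq I) (b : I -> seq R -> bool) :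
  (forall i, i \in r -> It_negl w n (b i)) -> It_negl w n (fun s => has (b ^~ s) r).
Proof.
elim: r => [|i r IH] bN /=.
  by split; [exact: measurable_cst|exact: It0].
have [mr r0] : It_negl w n (fun s => has (b ^~ s) r).
  by apply: IH => k kr; apply: bN; rewrite inE kr orbT.
have [mi i0] := bN i (mem_head _ _).
have mo : measurable_fun setT (fun s => b i s || has (b ^~ s) r).
  exact: measurable_or.
split=> //.
apply/eqP; rewrite eq_le It_ge0 ?andbT; last by move=> s; rewrite lee_fin.
have -> : 0 = It w n (fun s => (b i s)%:R%:E) + It w n (fun s => (has (b ^~ s) r)%:R%:E).
  by rewrite i0 r0 adde0.
have mi' := measurable_b2E mi; have mr' := measurable_b2E mr.
rewrite -ItD//; apply: le_It => //; first exact: measurable_b2E.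
- exact: emeasurable_funD.
- by move=> s; rewrite adde_ge0 ?lee_fin.
by move=> s _; rewrite -EFinD lee_fin -natrD ler_nat; case: (b i s) (has _ _) => -[].
Qed.

Lemma measurable_all d (X : measurableType d) I (r : seq I) (b : I -> X -> bool) :
  (forall i, measurable_fun setT (b i)) ->
  measurable_fun setT (fun x => all (b ^~ x) r).
Proof.
move=> mb; elim: r => [|i r IH]/=; first exact: measurable_cst.
exact: measurable_and.
Qed.

Lemma measurable_has d (X : measurableType d) I (r : seq I) (b : I -> X -> bool) :
  (forall i, measurable_fun setT (b i)) ->
  measurable_fun setT (fun x => has (b ^~ x) r).
Proof.
move=> mb; elim: r => [|i r IH]/=; first exact: measurable_cst.
exact: measurable_or.
Qed.

Lemma It_reweight w w' (g : R -> R) n F : measurable_fun setT g ->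
  (forall x, 0 <= g x)%R -> (forall x, w' x = w x * g x)%R ->
  measurable_fun setT F -> (forall s, 0 <= F s) ->
  It w' n F = It w n (fun s => (\prod_(k < n) g (nth 0 s k))%R%:E * F s).
Proof.
move=> mg g0 wg; elim: n F => [|n IH] F mF F0 /=.
  by rewrite big_ord0 mul1e.
have mp : measurable_fun setT (fun s : seq R => (\prod_(k < n) g (nth 0 s k))%R%:E).
  apply/measurable_EFinP; apply: measurable_prod => k _.
  by apply: (measurableT_comp mg); exact: measurable_nth.
have p0 s : 0 <= (\prod_(k < n) g (nth 0 s k))%R%:E by rewrite lee_fin prodr_ge0.
have mpF : measurable_fun setT
    (fun s : seq R => (\prod_(k < n.+1) g (nth 0 s k))%R%:E * F s).
  apply: emeasurable_funM => //.
  apply/measurable_EFinP; apply: measurable_prod => k _.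
  by apply: (measurableT_comp mg); exact: measurable_nth.
apply: eq_integral => x _; rewrite wg EFinM IH//; last exact: measurable_cons_r.
rewrite -muleA -[in RHS]ItZl//; last 3 first.
- exact: measurable_cons_r mpF.
- by move=> s; rewrite mule_ge0 ?lee_fin ?prodr_ge0.
- by rewrite lee_fin weight_ge0.
rewrite -[in LHS]ItZl//; last 3 first.
- by apply: emeasurable_funM => //; exact: measurable_cons_r.
- by move=> s; rewrite mule_ge0.
- by rewrite lee_fin.
rewrite -[in LHS]ItZl//; last 3 first.
- apply: emeasurable_funM; first exact: measurable_cst.
  by apply: emeasurable_funM => //; exact: measurable_cons_r.
- by move=> s; apply: mule_ge0; [rewrite lee_fin|apply: mule_ge0].
- by rewrite lee_fin weight_ge0.
by apply: It_ext => s _; rewrite big_ord_recl EFinM -!muleA.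
Qed.

End iterated.

(** * Affine changes of variables for Lebesgue measure *)

Section change_of_variables.
Context {R : realType}.
Local Notation mu := (@lebesgue_measure R).
Local Open Scope ereal_scope.

(** The image of Lebesgue measure under [x -> r x + a], multiplied by [r], gives half-open intervals
    their length, hence is Lebesgue measure. *)
Lemma integral_affine (r a : R) (f : R -> \bar R) : (0 < r)%R ->
  measurable_fun setT f -> (forall x, 0 <= f x) ->
  \int[mu]_x f x = r%:E * \int[mu]_x f (r * x + a)%R.
Proof.
move=> r0 mf f0.
pose phi : R -> measurableTypeR R := fun x => (r * x + a)%R.
have mphi : measurable_fun setT phi.
  by apply: measurable_funD => //; exact: measurable_funM.
pose pm := measure_function_pushforward__canonical__measure_function_Measure mu mphi.
transitivity (\int[mscale (NngNum (ltW r0)) pm]_x f x).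
  apply: eq_measure_integral => //= A mA _.
  apply: lebesgue_measure_unique => //= _ [[b c]] _ <-.
  rewrite /mscale/= /pushforward/=.
  have -> : phi @^-1` [set` `]b, c]] = [set` `]((b - a) / r)%R, ((c - a) / r)%R]].
    apply/seteqP; split=> x /=; rewrite !in_itv/= /phi;
      by rewrite ltr_pdivrMr// ler_pdivlMr// ltrBlDr lerBrDr mulrC.
  rewrite !lebesgue_measure_itv/= !lte_fin ltr_pM2r ?invr_gt0// ltrD2r.
  case: ifP => _; last by rewrite mule0.
  rewrite -!EFinB -EFinM; congr EFin; field; exact: lt0r_neq0.
rewrite ge0_integral_mscale//= ge0_integral_pushforward//.
Qed.

Lemma eq_integral_pt (a : R) (f g : R -> \bar R) : measurable_fun setT f ->
  measurable_fun setT g -> (forall x, 0 <= f x) -> (forall x, 0 <= g x) ->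
  (forall x, x != a -> f x = g x) -> \int[mu]_x f x = \int[mu]_x g x.
Proof.
move=> mf mg f0 g0 fg; apply: ae_eq_integral => //.
exists [set a]; split => //; first exact: lebesgue_measure_set1.
move=> x /= /not_implyP[_ nfg]; apply: contrapT => /eqP xa; exact/nfg/fg.
Qed.

End change_of_variables.

(** * Lebesgue and exponential weights, null hyperplanes *)

Section weights.
Context {R : realType}.
Local Notation mu := (@lebesgue_measure R).
Local Open Scope ereal_scope.

Lemma wpos_subproof : measurable_fun setT (fun x : R => (0 < x)%R%:R : R).
Proof. by apply/measurable_EFinP/measurable_b2E; exact: measurable_fun_ltr. Qed.

Definition wpos : @weight R := Weight wpos_subproof (fun x => ler0n _ _).

Lemma wint_subproof (L : R) : measurable_fun setT (fun x : R => (0 < x <= L)%R%:R : R).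
Proof.
apply/measurable_EFinP/measurable_b2E.
by apply: measurable_and; [exact: measurable_fun_ltr|exact: measurable_fun_ler].
Qed.

Definition wint (L : R) : @weight R := Weight (wint_subproof L) (fun x => ler0n _ _).

Lemma wexp_subproof : measurable_fun setT (fun x : R => ((0 < x)%R%:R * expR (- x))%R).
Proof. by apply: measurable_funM; [exact: wpos_subproof|exact: measurableT_comp]. Qed.

Lemma wexp_ge0 (x : R) : (0 <= (0 < x)%R%:R * expR (- x))%R.
Proof. by rewrite mulr_ge0 ?expR_ge0. Qed.

Definition wexp : @weight R := Weight wexp_subproof wexp_ge0.

Lemma integral_wpos (f : R -> \bar R) :
  \int[mu]_x ((wpos x)%:E * f x) = \int[mu]_(x in `]0%R, +oo[) f x.
Proof.
rewrite [RHS]integral_mkcond; apply: eq_integral => x _ /=.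
rewrite patchE mem_setE in_itv/= andbT.
by case: ifP; rewrite ?mul1e ?mul0e.
Qed.

Lemma integral_wint (L : R) (f : R -> \bar R) :
  \int[mu]_x ((wint L x)%:E * f x) = \int[mu]_(x in `]0%R, L]) f x.
Proof.
rewrite [RHS]integral_mkcond; apply: eq_integral => x _ /=.
rewrite patchE mem_setE in_itv/=.
by case: ifP; rewrite ?mul1e ?mul0e.
Qed.

Lemma wint1 : \int[mu]_x (wint 1 x)%:E = 1.
Proof.
under eq_integral do rewrite -[(_)%:E]mule1.
rewrite integral_wint integral_cst//= lebesgue_measure_itv/= lte_fin ltr01.
by rewrite mul1e oppr0 adde0.
Qed.

Lemma wexp1 : \int[mu]_x (wexp x)%:E = 1.
Proof.
under eq_integral do rewrite /= EFinM.
rewrite (integral_wpos (fun x => (expR (- x))%:E)).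
rewrite -(@integral_exponential_pdf R 1%R ltr01) integral_itv_obnd_cbnd; last first.
  by apply: measurable_funTS; apply/measurable_EFinP; exact: measurableT_comp.
rewrite integral_mkcond; apply: eq_integral => x _.
rewrite /exponential_pdf !patchE; case: ifP => // _.
by rewrite mulN1r mul1r.
Qed.

Lemma prod_nat_of_bool n (b : nat -> bool) :
  (\prod_(k < n) (b k)%:R)%R = (all b (iota 0 n))%:R :> R.
Proof.
elim: n => [|n IH]; first by rewrite big_ord0.
have -> : iota 0 n.+1 = rcons (iota 0 n) n by rewrite -cats1 -[n.+1]addn1 iotaD.
rewrite big_ord_recr/= IH all_rcons.
by case: (all _ _); case: (b n); rewrite ?mulr0 ?mul0r ?mulr1.
Qed.

Lemma prod_expRN n (s : seq R) :
  (\prod_(k < n) expR (- nth 0 s k))%R = expR (- \sum_(k < n) nth 0 s k)%R.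
Proof.
elim: n => [|n IH]; first by rewrite !big_ord0 oppr0 expR0.
by rewrite !big_ord_recr/= IH opprD expRD.
Qed.

Lemma measurable_lin n (c : nat -> R) :
  measurable_fun setT (fun s : seq R => (\sum_(k < n) c k * nth 0 s k)%R).
Proof.
apply: measurable_sum => k; apply: measurable_funM => //; exact: measurable_nth.
Qed.

Lemma integral_weight_pt w (y : R) :
  \int[mu]_x ((w x)%:E * (x == y)%R%:R%:E) = 0.
Proof.
transitivity (\int[mu]_(x in [set y]) (w x)%:E); last exact: integral_set1.
rewrite [RHS]integral_mkcond; apply: eq_integral => x _; rewrite patchE.
case: eqP => [->|xy]; first by rewrite mem_set// mule1.
by rewrite memNset// mule0.
Qed.

(** Integrating first over a coordinate with nonzero coefficient, the hyperplane leaves a single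
    point. The coordinates before it are absorbed in the constant [a]. Every genericity statement
    below is reduced to this one. *)
Lemma It_lin_null w n (c : nat -> R) (a : R) i : (i < n)%N -> c i != 0%R ->
  It_negl w n (fun s => (\sum_(k < n) c k * nth 0 s k == a)%R).
Proof.
move=> ilt ci; split.
  by apply: measurable_fun_eqr => //; exact: measurable_lin.
elim: n c i a ci ilt => [//|n IH] c i a ci ilt /=.
have E x s : (\sum_(k < n.+1) c k * nth 0 (x :: s) k)%R =
    (c 0%N * x + \sum_(k < n) c k.+1 * nth 0 s k)%R.
  by rewrite big_ord_recl/=; congr (_ + _)%R; apply: eq_bigr.
case: i ci ilt => [|i] ci ilt.
  have mF : measurable_fun setT (fun p : R * seq R =>
      ((p.1 == (a - \sum_(k < n) c k.+1 * nth 0 p.2 k) / c 0%N)%R%:R : R)%:E).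
    apply: measurable_b2E; apply: measurable_fun_eqr => //.
    apply: measurable_funM => //; apply: measurable_funB => //.
    by apply: (measurableT_comp (measurable_lin n (c \o S))).
  transitivity (\int[mu]_x It w n (fun s => (w x)%:E *
    ((x == (a - \sum_(k < n) c k.+1 * nth 0 s k) / c 0%N)%R%:R)%:E)).
    apply: eq_integral => x _; rewrite -ItZl//.
    - apply: It_ext => s _; congr (_ * (_ : bool)%:R%:E).
      by rewrite E; apply/eqP/eqP => [<-|->]; field.
    - apply: measurable_b2E; under eq_fun do rewrite E.
      apply: measurable_fun_eqr => //; apply: measurable_funD => //.
      exact: (measurable_lin n (c \o S)).
    - by rewrite lee_fin weight_ge0.
  rewrite integral_It.
  - rewrite -[RHS](It0 w n); apply: It_ext => s _.
    exact: integral_weight_pt.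
  - apply: emeasurable_funM => //.
    by apply: (measurableT_comp (measurable_weightE w)).
  - by move=> x s; rewrite mule_ge0 ?lee_fin ?weight_ge0.
transitivity (\int[mu]_x ((w x)%:E * 0)); last first.
  by under eq_integral do rewrite mule0; rewrite integral0.
apply: eq_integral => x _; congr (_ * _).
rewrite -(IH (c \o S) i (a - c 0%N * x)%R ci)//.
apply: It_ext => s _; rewrite E; congr ((_ : bool)%:R%:E).
by rewrite eq_sym addrC -subr_eq eq_sym.
Qed.

(** * Order statistics of a symmetric integrand *)

(** Without ties these indicators sum to 1 over [i] ([sum_amax]), a partition that can be integrated
    term by term. It serves for the largest observation, for the rotation in the cycle lemma and for
    the place where a block is inserted. *)
Definition amax (m : nat) (g : nat -> R) (i : nat) : bool :=
  all (fun k => g k <= g i)%R (iota 0 m).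

Lemma sum_amax (V : pzSemiRingType) m (g : nat -> R) : (0 < m)%N ->
  (forall i k, (i < k < m)%N -> g i != g k) ->
  (\sum_(i < m) (amax m g i)%:R = 1 :> V)%R.
Proof.
case: m => // m _ gi.
have [i0 _ gmax] := @Order.TotalTheory.arg_maxP _ R 'I_m.+1 ord0 xpredT g isT.
rewrite (bigD1 i0)//= big1 => [|i ii0].
  rewrite addr0 /amax; suff -> : all (fun k => g k <= g i0)%R (iota 0 m.+1) by [].
  apply/allP => k; rewrite mem_iota add0n => /= km.
  exact: (gmax (Ordinal km)).
rewrite /amax; case: allP => // /(_ i0); rewrite mem_iota/= ltn_ord => /(_ isT) ge0i.
have /eqP gE : g i0 == g i by rewrite eq_le ge0i; exact: (gmax i isT).
case: (ltngtP i i0) => [ii|ii|/val_inj/eqP]; last by rewrite (negbTE ii0).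
- by have := gi i i0; rewrite ii ltn_ord gE eqxx => /(_ isT).
- by have := gi i0 i; rewrite ii ltn_ord gE eqxx => /(_ isT).
Qed.

Definition has_tie n (s : seq R) : bool :=
  has (fun p : nat * nat => (p.1 < p.2 < n)%N && (nth 0 s p.1 == nth 0 s p.2)%R)
    (allpairs pair (iota 0 n) (iota 0 n)).

Lemma has_tie_negl w n : It_negl w n (has_tie n).
Proof.
apply: It_negl_has => -[i k] _ /=.
case: (boolP (i < k < n)%N) => [/andP[ik kn]|_]; last first.
  by split; [exact: measurable_cst|exact: It0].
have in_ : (i < n)%N by exact: ltn_trans kn.
apply: (It_negl_sub (@It_lin_null w n
    (fun l => (l == i)%:R - (l == k)%:R)%R 0%R i in_ _)).
- by rewrite eqxx (ltn_eqF ik) subr0 oner_neq0.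
- by apply: measurable_fun_eqr; exact: measurable_nth.
- move=> s _ /eqP sik /=.
  under eq_bigr do rewrite mulrBl.
  rewrite sumrB (bigD1 (Ordinal in_))//= eqxx mul1r big1 ?addr0; last first.
    by move=> l /negbTE; rewrite -val_eqE/= => ->; rewrite mul0r.
  rewrite (bigD1 (Ordinal kn))//= eqxx mul1r big1 ?addr0; last first.
    by move=> l /negbTE; rewrite -val_eqE/= => ->; rewrite mul0r.
  by rewrite sik subrr.
Qed.

Lemma all_nth_iota (p : pred R) s : all (fun k => p (nth 0%R s k)) (iota 0 (size s)) = all p s.
Proof. by rewrite -{3}(mkseq_nth 0%R s) /mkseq all_map. Qed.

(** The partition according to the position of the maximum has [n + 1] terms, all equal by symmetry
    of [F] to the one where the maximum comes first. *)
Lemma It_max_first w n (F : seq R -> \bar R) :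
  measurable_fun setT F -> (forall s, 0 <= F s) ->
  (forall s t, perm_eq s t -> F s = F t) ->
  It w n.+1 F = n.+1%:R%:E * \int[mu]_x ((w x)%:E *
    It w n (fun s => (all (fun k => nth 0 s k <= x)%R (iota 0 n))%:R%:E * F (x :: s))).
Proof.
move=> mF F0 Fperm.
pose M i (s : seq R) := amax n.+1 (nth 0%R s) i.
have mM i : measurable_fun setT (M i).
  by apply: measurable_all => k; apply: measurable_fun_ler; exact: measurable_nth.
have mMF i : measurable_fun setT (fun s => (M i s)%:R%:E * F s).
  by apply: emeasurable_funM => //; exact: measurable_b2E.
transitivity (It w n.+1 (fun s => \sum_(i < n.+1) ((M i s)%:R%:E * F s))).
  apply: (It_ae (has_tie_negl w n.+1)) => //.
  - exact: emeasurable_sum.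
  - by move=> s; apply: sume_ge0 => i _; rewrite mule_ge0 ?lee_fin.
  - move=> s sn /hasPn nt.
    rewrite -ge0_sume_distrl; last by move=> i _; rewrite lee_fin.
    rewrite sumEFin sum_amax ?mul1e// => i k /andP[ik kn].
    have /nt : (i, k) \in allpairs pair (iota 0 n.+1) (iota 0 n.+1).
      by apply: allpairs_f; rewrite mem_iota// add0n (ltn_trans ik kn).
    by rewrite /= ik kn.
rewrite It_sum//; last by move=> i s; rewrite mule_ge0 ?lee_fin.
rewrite (eq_bigr (fun _ => \int[mu]_x ((w x)%:E *
    It w n (fun s => (all (fun k => nth 0 s k <= x)%R (iota 0 n))%:R%:E * F (x :: s))))).
  by rewrite mule_natl sumr_const card_ord.
move=> j _; move: (nat_of_ord j) (ltn_ord j) => i ilt {j}.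
have mG : measurable_fun setT (fun p : R * seq R =>
    (all (fun k => nth 0 p.2 k <= p.1)%R (iota 0 n))%:R%:E * F (p.1 :: p.2)).
  apply: emeasurable_funM.
    apply: measurable_b2E; apply: measurable_all => k.
    by apply: measurable_fun_ler => //; exact: measurable_fun_nth.
  apply: (measurableT_comp mF); exact: measurable_fun_cons.
(* Position [i] is isolated between the blocks before and after it; Tonelli's theorem then moves it
   to the front. *)
have -> : n.+1 = (i + (1 + (n - i)))%N by lia.
rewrite It_cat.
transitivity (It w i (fun y1 => \int[mu]_x ((w x)%:E * It w (n - i) (fun y2 =>
    (all (fun k => nth 0 (y1 ++ y2) k <= x)%R (iota 0 n))%:R%:E * F (x :: y1 ++ y2))))).
  apply: It_ext => y1 sy1; rewrite It_cat /=; apply: eq_integral => x _.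
  congr (_ * _); apply: It_ext => y2 sy2.
  rewrite (_ : F _ = F (x :: y1 ++ y2)); last first.
    by apply: Fperm; rewrite -[x :: y2]cat1s -[x :: y1 ++ y2]cat1s perm_catCA.
  congr ((_ : bool)%:R%:E * _).
  rewrite /M /amax.
  have -> : nth 0%R (y1 ++ x :: y2) i = x by rewrite nth_cat sy1 ltnn subnn.
  have s1 : size (y1 ++ x :: y2) = n.+1 by rewrite size_cat/= sy1 sy2; lia.
  have s2 : size (y1 ++ y2) = n by rewrite size_cat/= sy1 sy2; lia.
  rewrite -{1}s1 -{1}s2 !(all_nth_iota (fun z => z <= x)%R) !all_cat/=.
  by rewrite lexx.
have mG3 : measurable_fun setT (fun p : (R * seq R) * seq R =>
    (all (fun k => nth 0 (p.1.2 ++ p.2) k <= p.1.1)%R (iota 0 n))%:R%:E *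
    F (p.1.1 :: p.1.2 ++ p.2)).
  apply: (measurableT_comp mG (g := fun p : (R * seq R) * seq R => (p.1.1, p.1.2 ++ p.2))).
  apply: measurable_fun_pair; first exact: measurableT_comp.
  by apply: measurable_fun_cat => //; exact: measurableT_comp.
have G0 x s : 0 <= (all (fun k => nth 0 s k <= x)%R (iota 0 n))%:R%:E * F (x :: s).
  by rewrite mule_ge0 ?lee_fin.
have mI : measurable_fun setT (fun p : R * seq R => It w (n - i) (fun y2 =>
    (all (fun k => nth 0 (p.2 ++ y2) k <= p.1)%R (iota 0 n))%:R%:E *
    F (p.1 :: p.2 ++ y2))).
  exact: (@measurable_It _ _ _ _ _ (fun (p : R * seq R) y2 => _) mG3 _).
rewrite -integral_It.
- apply: eq_integral => x _; rewrite ItZl.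
  + transitivity ((w x)%:E * It w (i + (n - i)) (fun s =>
      (all (fun k => nth 0 s k <= x)%R (iota 0 n))%:R%:E * F (x :: s))).
      by rewrite It_cat.
    by rewrite subnKC.
  + apply: (measurableT_comp mI (g := fun y1 => (x, y1))).
    exact: measurable_fun_pair.
  + by move=> s; exact: It_ge0.
  + by rewrite lee_fin weight_ge0.
- apply: emeasurable_funM => //.
  by apply: (measurableT_comp (measurable_weightE w)).
- by move=> x s; rewrite mule_ge0 ?lee_fin ?weight_ge0// It_ge0.
Qed.

(** Comparing [s] with [L :: s] position by position expresses [L >= s_0 >= s_1 >= ...]. *)
Definition desc n (L : R) (s : seq R) : bool :=
  all (fun k => nth 0 s k <= nth 0 (L :: s) k)%R (iota 0 n).

Definition Iord n (F : seq R -> \bar R) (L : R) : \bar R :=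
  It wpos n (fun s => (desc n L s)%:R%:E * F s).

Lemma Iord_ge0 n F L : (forall s, 0 <= F s) -> 0 <= Iord n F L.
Proof. by move=> F0; apply: It_ge0 => s; rewrite mule_ge0 ?lee_fin. Qed.

Lemma measurable_desc n d (X : measurableType d) (L : X -> R) (s : X -> seq R) :
  measurable_fun setT L -> measurable_fun setT s ->
  measurable_fun setT (fun x => desc n (L x) (s x)).
Proof.
move=> mL ms; apply: measurable_all => k; apply: measurable_fun_ler.
  exact: measurable_fun_nth.
by apply: measurable_fun_nth; exact: measurable_fun_cons.
Qed.

Lemma measurable_Iord n d (X : measurableType d) (F : X -> seq R -> \bar R) (L : X -> R) :
  measurable_fun setT (fun p => F p.1 p.2) -> measurable_fun setT L ->
  (forall x s, 0 <= F x s) ->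
  measurable_fun setT (fun x => Iord n (F x) (L x)).
Proof.
move=> mF mL F0.
apply: (@measurable_It _ _ _ _ _ (fun x s => (desc n (L x) s)%:R%:E * F x s)).
  apply: emeasurable_funM => //; apply: measurable_b2E.
  by apply: measurable_desc => //; exact: measurableT_comp.
by move=> x s; rewrite mule_ge0 ?lee_fin.
Qed.

Lemma Iord_ext n F G L : (forall s, size s = n -> F s = G s) -> Iord n F L = Iord n G L.
Proof. by move=> FG; apply: It_ext => s sn; rewrite FG. Qed.

Lemma IordS n F L : measurable_fun setT F -> (forall s, 0 <= F s) ->
  Iord n.+1 F L = \int[mu]_x ((wint L x)%:E * Iord n (fun s => F (x :: s)) x).
Proof.
move=> mF F0; rewrite {1}/Iord /=; apply: eq_integral => x _ /=.
rewrite (_ : (0 < x <= L)%R%:R = (0 < x)%R%:R * (x <= L)%R%:R :> R)%R; last first.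
  by case: (0 < x)%R; case: (x <= L)%R; rewrite ?mulr0 ?mulr1.
rewrite EFinM -muleA; congr (_ * _).
rewrite -ItZl ?lee_fin//; last 2 first.
- apply: emeasurable_funM; last exact: measurable_cons_r.
  by apply: measurable_b2E; apply: measurable_desc.
- by move=> s; rewrite mule_ge0 ?lee_fin.
apply: It_ext => s _; rewrite /desc /= (iotaDl 1 0 n) all_map.
rewrite (eq_all (a2 := fun k => nth 0 s k <= nth 0 (x :: s) k)%R)//.
by case: (x <= L)%R; case: all; rewrite ?mul1e ?mul0e.
Qed.

(** The maximum is extracted repeatedly: each step contributes one factor of the factorial and
    restricts the remaining variables to the interval below the extracted one. *)
Lemma It_wint_Iord n F L : measurable_fun setT F -> (forall s, 0 <= F s) ->
  (forall s t, perm_eq s t -> F s = F t) ->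
  It (wint L) n F = (n`!%:R)%:E * Iord n F L.
Proof.
elim: n F L => [|n IH] F L mF F0 Fperm.
  by rewrite /Iord /desc /= !mul1e.
rewrite It_max_first// factS natrM EFinM -muleA IordS//; congr (_ * _).
rewrite -ge0_integralZl ?lee_fin//; last 2 first.
- apply: emeasurable_funM; first exact: measurable_weightE.
  apply: (@measurable_Iord n _ _ (fun x s => F (x :: s))) => //.
  by apply: (measurableT_comp mF); exact: measurable_fun_cons.
- by move=> x _; rewrite mule_ge0 ?lee_fin ?Iord_ge0.
apply: eq_integral => x _; rewrite muleCA.
have [xL|xL] := boolP (0 < x <= L)%R; last by rewrite /= (negbTE xL) !mul0e.
congr (_ * _); rewrite -(IH (fun s => F (x :: s)))//; last 2 first.
- exact: measurable_cons_r.
- by move=> s t st; apply: Fperm; rewrite perm_cons.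
(* As [x <= L], restricting [wint L] to arguments at most [x] gives [wint x]. *)
rewrite [RHS](@It_reweight _ (wint L) (wint x) (fun y => (y <= x)%R%:R)).
- by apply: It_ext => s _; rewrite (prod_nat_of_bool n (fun k => nth 0 s k <= x)%R).
- by apply/measurable_EFinP/measurable_b2E; exact: measurable_fun_ler.
- by [].
- move=> y /=; move/andP: xL => [_ xL].
  case: (0 < y)%R; last by rewrite mul0r.
  case: (leP y x) => yx; last by rewrite mulr0.
  by rewrite (le_trans yx xL) mulr1.
- exact: measurable_cons_r.
- by [].
Qed.

(** * Spacings *)

Definition psum (s : seq R) (k : nat) : R := \sum_(l < k) nth 0 s l.

(** Decreasing order, as in [desc]: the total comes first. *)
Definition rpsum (n : nat) (s : seq R) : seq R := mkseq (fun k => psum s (n - k)) n.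

Lemma measurable_psum k : measurable_fun setT (psum ^~ k).
Proof. by apply: measurable_sum => l; exact: measurable_nth. Qed.

Lemma measurable_rpsum n : measurable_fun setT (rpsum n).
Proof.
by apply: (measurable_fun_mkseq (f := fun k s => psum s (n - k))) => k; exact: measurable_psum.
Qed.

Lemma psum_rcons s x k : (k <= size s)%N -> psum (rcons s x) k = psum s k.
Proof.
move=> ks; apply: eq_bigr => l _; rewrite nth_rcons.
by rewrite (leq_trans (ltn_ord l) ks).
Qed.

Lemma rpsumS n s x : size s = n ->
  rpsum n.+1 (rcons s x) = (x + psum s n)%R :: rpsum n s.
Proof.
move=> sn; rewrite /rpsum /mkseq /= subn0; congr (_ :: _).
  rewrite /psum big_ord_recr/= nth_rcons sn ltnn eqxx addrC; congr (_ + _)%R.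
  by rewrite -/(psum _ _) psum_rcons// sn.
rewrite (iotaDl 1 0 n) -map_comp; apply/eq_in_map => k; rewrite mem_iota => /andP[_ kn].
by rewrite /= add1n subSS psum_rcons// sn leq_subr.
Qed.

Lemma head_rpsum n s : head 0%R (rpsum n s) = psum s n.
Proof. by case: n => [|n]; rewrite ?subn0//= /psum big_ord0. Qed.

(** Passage from ordered points to their spacings. The largest variable [r] is written as [y + x]
    with [x] the next one; a translation has Jacobian 1, and the induction treats the remaining
    chain. *)
Lemma Iord_chain n (H : seq R -> \bar R) : measurable_fun setT H -> (forall s, 0 <= H s) ->
  \int[mu]_r ((wpos r)%:E * Iord n (fun s => H (r :: s)) r) =
  It wpos n.+1 (fun y => H (rpsum n.+1 y)).
Proof.
elim: n H => [|n IH] H mH H0.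
  rewrite /=; apply: eq_integral => r _; rewrite /Iord /desc /= mul1e.
  by congr (_ * H _); rewrite /rpsum /= /mkseq/= /psum big_ord1.
pose K (x : R) (s : seq R) : \bar R :=
  \int[mu]_y ((wpos y)%:E * H ((y + x)%R :: x :: s)).
have mH3 : measurable_fun setT (fun p : (R * R) * seq R => H (p.1.1 :: p.1.2 :: p.2)).
  apply: (measurableT_comp mH); apply: measurable_fun_cons.
    by apply: measurableT_comp.
  by apply: measurable_fun_cons => //; apply: measurableT_comp.
have mI : measurable_fun setT
    (fun p : R * R => Iord n (fun s => H (p.1 :: p.2 :: s)) p.2).
  by apply: (@measurable_Iord n _ _ (fun p s => H (p.1 :: p.2 :: s)) snd).
have mH3' : measurable_fun setT
    (fun q : (R * seq R) * R => (wpos q.2)%:E * H ((q.2 + q.1.1)%R :: q.1.1 :: q.1.2)).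
  apply: emeasurable_funM; first by apply: (measurableT_comp (measurable_weightE wpos)).
  apply: (measurableT_comp mH); apply: measurable_fun_cons.
    by apply: measurable_funD => //; apply: measurableT_comp.
  by apply: measurable_fun_cons; apply: measurableT_comp.
have mK : measurable_fun setT (fun q : R * seq R => K q.1 q.2).
  apply: (@measurable_fun_fubini_tonelli_F _ _ _ _ _ mu _ mH3').
  by move=> q; rewrite mule_ge0 ?lee_fin.
have K0 x s : 0 <= K x s by apply: integral_ge0 => y _; rewrite mule_ge0 ?lee_fin.
have mhead : measurable_fun setT (head 0%R : seq R -> R).
  by rewrite (_ : head _ = nth 0%R ^~ 0%N);
    [exact: measurable_nth|apply/funext => -[]].
transitivity (\int[mu]_x ((wpos x)%:E * Iord n (K x) x)).
  transitivity (\int[mu]_r \int[mu]_x ((wpos r)%:E * ((wint r x)%:E *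
      Iord n (fun s => H (r :: x :: s)) x))).
    apply: eq_integral => r _; rewrite IordS//; last exact: measurable_cons_r.
    rewrite ge0_integralZl//.
    - apply: emeasurable_funM; first exact: measurable_weightE.
      apply: (measurableT_comp mI (g := fun x => (r, x))); exact: measurable_fun_pair.
    - by move=> x _; rewrite mule_ge0 ?lee_fin// Iord_ge0.
    - by rewrite lee_fin.
  have mwint : measurable_fun setT (fun p : R * R => (wint p.1 p.2)%:E).
    apply: measurable_b2E; apply: measurable_and.
      exact: measurable_fun_ltr.
    exact: measurable_fun_ler.
  rewrite (@fubini_tonelli _ _ _ _ _ mu mu (fun p : R * R =>
     (wpos p.1)%:E * ((wint p.1 p.2)%:E * Iord n (fun s => H (p.1 :: p.2 :: s)) p.2))).
  - apply: eq_integral => x _ /=.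
    have mx : measurable_fun setT (fun r : R => ((0 < r)%R%:R)%:E * (((0 < x <= r)%R%:R)%:E *
        Iord n (fun s => H (r :: x :: s)) x)).
      apply: emeasurable_funM; first exact: (measurable_weightE wpos).
      apply: emeasurable_funM.
        by apply: (measurableT_comp mwint (g := fun r => (r, x))); exact: measurable_fun_pair.
      by apply: (measurableT_comp mI (g := fun r => (r, x))); exact: measurable_fun_pair.
    (* Substitution [r = y + x] for fixed [x]. *)
    rewrite (@integral_affine _ 1%R x)//; last first.
      by move=> r; rewrite !mule_ge0 ?lee_fin// Iord_ge0.
    have [x0|x0] := boolP (0 < x)%R; last first.
      rewrite mul0e mul1e; under eq_integral do rewrite /= mul0e mule0.
      exact: integral0.
    rewrite !mul1e.
    have mF : measurable_fun setT (fun p : R * seq R => (desc n x p.2)%:R%:E *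
        ((wpos p.1)%:E * H ((p.1 + x)%R :: x :: p.2))).
      apply: emeasurable_funM.
        by apply: measurable_b2E; exact: measurable_desc.
      apply: (measurableT_comp mH3' (g := fun p : R * seq R => ((x, p.2), p.1))).
      by apply: measurable_fun_pair => //; exact: measurable_fun_pair.
    have mF0 (y : R) s : 0 <= (desc n x s)%:R%:E * ((wpos y)%:E * H ((y + x)%R :: x :: s)).
      by rewrite mule_ge0 ?lee_fin// mule_ge0 ?lee_fin.
    transitivity (\int[mu]_y It wpos n (fun s => (desc n x s)%:R%:E *
        ((wpos y)%:E * H ((y + x)%R :: x :: s)))).
      (* The integrands may differ at [y = 0]: the constraint [x <= r] admits it, while [wpos]
         excludes it. *)
      apply: (@eq_integral_pt R 0%R).
      - rewrite x0 in mx.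
        apply: (measurableT_comp mx (g := fun y : R => (1 * y + x)%R)).
        by apply: measurable_funD => //; exact: measurable_funM.
      - exact: (@measurable_It R wpos n _ _ (fun (y : R) s => (desc n x s)%:R%:E *
          ((wpos y)%:E * H ((y + x)%R :: x :: s)))).
      - by move=> y; rewrite mule_ge0 ?lee_fin// mule_ge0 ?lee_fin// Iord_ge0.
      - by move=> y; apply: It_ge0 => s; exact: mF0.
      move=> y y0; rewrite mul1r/=.
      have [yp|yp] := ltP 0%R y.
        rewrite addr_gt0// lerDr (ltW yp) !mul1e.
        by rewrite /Iord; apply: It_ext => s _; rewrite mul1e.
      rewrite lerDr leNgt (lt_neqAle y) y0 yp/= mul0e mule0.
      rewrite -[LHS](It0 wpos n); apply: It_ext => s _.
      by rewrite mul0e mule0.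
    rewrite /Iord integral_It//; apply: It_ext => s _.
    rewrite ge0_integralZl//.
    - apply: (measurableT_comp mH3' (g := fun y => ((x, s), y))).
      exact: measurable_fun_pair.
    - by move=> y _; rewrite mule_ge0 ?lee_fin.
  - apply: emeasurable_funM; first by apply: (measurableT_comp (measurable_weightE wpos)).
    exact: emeasurable_funM.
  - by move=> p; rewrite mule_ge0 ?lee_fin// mule_ge0 ?lee_fin// Iord_ge0.
transitivity (\int[mu]_x ((wpos x)%:E * Iord n (fun s => K (head 0%R (x :: s)) (behead (x :: s))) x)).
  by [].
rewrite (IH (fun l => K (head 0%R l) (behead l))); last 2 first.
- apply: (measurableT_comp mK (g := fun l => (head 0%R l, behead l))).
  apply: measurable_fun_pair => //.
  rewrite (_ : behead = drop 1); first exact: measurable_fun_drop.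
  by apply/funext => -[]//= a l; rewrite drop0.
- by [].
rewrite -[in RHS](addn1 n.+1) It_cat; apply: It_ext => z sz /=.
apply: eq_integral => y _; congr (_ * H _).
by rewrite cats1 addn1 rpsumS// /rpsum /mkseq /= subn0.
Qed.

Lemma measurable_invr : measurable_fun setT (fun x : R => x^-1%R).
Proof.
rewrite -(setUv [set 0%R]); apply/measurable_funU => //; first exact: measurableC.
split; first exact: measurable_fun_set1.
apply: open_continuous_measurable_fun.
  by apply: closed_openC; exact: closed_eq.
by move=> x; rewrite inE /= => /eqP x0; exact: inv_continuous.
Qed.

Lemma measurable_fun_mapdiv d (X : measurableType d) (f : X -> R) (g : X -> seq R) :
  measurable_fun setT f -> measurable_fun setT g ->
  measurable_fun setT (fun x => map (fun y => y / f x)%R (g x)).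
Proof.
move=> mf mg; apply: measurable_fun_seq => [|i].
  under eq_fun do rewrite size_map.
  exact: measurable_fun_size.
rewrite (_ : (fun x => _) = (fun x => nth 0%R (g x) i / f x)%R); last first.
  apply/funext => x; have [ig|gi] := ltnP i (size (g x)); first by rewrite (nth_map 0%R).
  by rewrite !nth_default ?size_map// mul0r.
apply: measurable_funM; first exact: measurable_fun_nth.
by apply: (measurableT_comp measurable_invr).
Qed.

Lemma Iord_scale n (F : seq R -> \bar R) r L : (0 < r)%R ->
  measurable_fun setT F -> (forall s, 0 <= F s) ->
  Iord n (fun s => F (map (fun x => x / r)%R s)) (r * L) = (r ^+ n)%:E * Iord n F L.
Proof.
move=> r0; elim: n F L => [|n IH] F L mF F0.
  by rewrite /Iord /desc /= expr0 !mul1e.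
have mmap : measurable_fun setT (fun s : seq R => map (fun x => x / r)%R s).
  by apply: (measurable_fun_mapdiv (f := cst r)).
rewrite IordS//; last exact: measurableT_comp.
have mx : measurable_fun setT (fun x => (wint L x)%:E * Iord n (fun s => F (x :: s)) x).
  apply: emeasurable_funM; first exact: measurable_weightE.
  apply: (@measurable_Iord n _ _ (fun x s => F (x :: s))) => //.
  by apply: (measurableT_comp mF); exact: measurable_fun_cons.
rewrite (@integral_affine _ r 0%R)//; last 2 first.
- apply: emeasurable_funM; first exact: measurable_weightE.
  apply: (@measurable_Iord n _ _ (fun x s => F (map (fun y => y / r)%R (x :: s)))) => //.
  by apply: (measurableT_comp mF); apply: (measurableT_comp mmap); exact: measurable_fun_cons.
- by move=> x; rewrite mule_ge0 ?lee_fin// Iord_ge0.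
rewrite exprS EFinM -muleA IordS//; congr (_ * _).
rewrite -ge0_integralZl//; last 2 first.
- by move=> x _; rewrite mule_ge0 ?lee_fin// Iord_ge0.
- by rewrite lee_fin exprn_ge0// ltW.
apply: eq_integral => x _; rewrite addr0.
rewrite muleCA -(IH (fun s => F (x :: s)))//; last exact: measurable_cons_r.
rewrite /= pmulr_rgt0// ler_pM2l//; congr (_ * _).
by apply: Iord_ext => s _; rewrite mulrAC divff ?mul1r// gt_eqF.
Qed.

(** Cancellation in [\bar R]: a product equal to 1 has no zero or infinite factor. *)
Lemma ereal_mulIr1 (x : R) (c y : \bar R) : x%:E * y = 1 -> c * y = 1 -> c = x%:E.
Proof.
have [->|x0] := eqVneq x 0%R; first by rewrite mul0e => /esym/eqP; rewrite onee_eq0.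
case: y => [y|/=|/=].
- rewrite -EFinM => -[xy]; have y0 : y != 0%R.
    by apply/eqP => y0; move: xy; rewrite y0 mulr0 => /esym/eqP; rewrite oner_eq0.
  case: c => [c|/=|/=].
  + by rewrite -EFinM => -[cy]; congr EFin; apply: (mulIf y0); rewrite xy cy.
  + by rewrite mulyr; case: (ltgtP y 0%R) y0 => // y0 _;
      [rewrite ltr0_sg// EFinN mulN1e|rewrite gtr0_sg// mul1e].
  + by rewrite mulNyr; case: (ltgtP y 0%R) y0 => // y0 _;
      [rewrite ltr0_sg// EFinN mulN1e|rewrite gtr0_sg// mul1e].
- by rewrite mulry; case: (ltgtP x 0%R) x0 => // x0 _;
    [rewrite ltr0_sg// EFinN mulN1e|rewrite gtr0_sg// mul1e].
- by rewrite mulrNy; case: (ltgtP x 0%R) x0 => // x0 _;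
    [rewrite ltr0_sg// EFinN mulN1e|rewrite gtr0_sg// mul1e].
Qed.

Lemma It_wexp n (F : seq R -> \bar R) : measurable_fun setT F -> (forall s, 0 <= F s) ->
  It wexp n F = It wpos n (fun s => (expR (- psum s n))%:E * F s).
Proof.
move=> mF F0; rewrite (@It_reweight _ wpos wexp (fun x => expR (- x))%R)//.
- by apply: It_ext => s _; rewrite prod_expRN.
- exact: measurableT_comp.
Qed.

(* Renyi's representation of the order statistics of a uniform sample. *)
Lemma It_uniform_exp n (F : seq R -> \bar R) : measurable_fun setT F -> (forall s, 0 <= F s) ->
  (forall s t, perm_eq s t -> F s = F t) ->
  It (wint 1) n F = It wexp n.+1 (fun y => F (map (fun x => x / psum y n.+1)%R
     (behead (rpsum n.+1 y)))).
Proof.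
pose c : \bar R := \int[mu]_r ((wpos r)%:E * ((expR (- r))%:E * (r ^+ n)%:E)).
have E (G : seq R -> \bar R) : measurable_fun setT G -> (forall s, 0 <= G s) ->
    It wexp n.+1 (fun y => G (map (fun x => x / psum y n.+1)%R (behead (rpsum n.+1 y)))) =
    c * Iord n G 1%R.
  move=> mG G0.
  have mbeh : measurable_fun setT (behead : seq R -> seq R).
    rewrite (_ : behead = drop 1); first exact: measurable_fun_drop.
    by apply/funext => -[]//= a l; rewrite drop0.
  have mhead : measurable_fun setT (head 0%R : seq R -> R).
    rewrite (_ : head _ = nth 0%R ^~ 0%N); first exact: measurable_nth.
    by apply/funext => -[].
  rewrite It_wexp//; last first.
    apply: (measurableT_comp mG); apply: measurable_fun_mapdiv.
      exact: measurable_psum.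
    by apply: (measurableT_comp mbeh); exact: measurable_rpsum.
  pose H l := (expR (- head 0 l))%:E * G (map (fun x => x / head 0 l)%R (behead l)).
  transitivity (It wpos n.+1 (fun y => H (rpsum n.+1 y))).
    by apply: It_ext => y _; rewrite /H head_rpsum.
  have mH : measurable_fun setT H.
    apply: emeasurable_funM.
      by apply/measurable_EFinP; do 2 apply: measurableT_comp => //.
    by apply: (measurableT_comp mG); exact: measurable_fun_mapdiv.
  rewrite -Iord_chain//; last by move=> s; rewrite mule_ge0 ?lee_fin ?expR_ge0.
  rewrite -ge0_integralZr//; last 3 first.
  - apply: emeasurable_funM; first exact: measurable_weightE.
    apply: emeasurable_funM; apply/measurable_EFinP; first exact: measurableT_comp.
    exact: measurable_funX.
  - move=> r _ /=; case: (ltP 0%R r) => r0; last by rewrite mul0e.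
    by rewrite mul1e mule_ge0 ?lee_fin ?expR_ge0 ?exprn_ge0 ?(ltW r0).
  - exact: Iord_ge0.
  apply: eq_integral => r _; rewrite -!muleA /=.
  case: (ltP 0%R r) => r0; last by rewrite !mul0e.
  congr (_ * _); rewrite /H /Iord.
  transitivity ((expR (- r))%:E * Iord n (fun s => G (map (fun x => x / r)%R s)) (r * 1)%R).
    rewrite mulr1 /Iord -ItZl ?lee_fin ?expR_ge0//; last 2 first.
    - apply: emeasurable_funM; first by apply: measurable_b2E; exact: measurable_desc.
      by apply: (measurableT_comp mG); apply: (measurable_fun_mapdiv (f := cst r)).
    - by move=> s; rewrite mule_ge0 ?lee_fin.
    by apply: It_ext => s _; rewrite muleCA.
  by rewrite Iord_scale.
move=> mF F0 Fperm; rewrite E// It_wint_Iord//.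
(* Both formulas are tested on the constant 1. So the gamma integral [c] and the factorial have the
   same product with the volume of the ordered region, and [c] need not be evaluated. *)
have c1 : c * Iord n (cst 1) 1%R = 1.
  by rewrite -E//; exact: (It_cst _ wexp1).
have f1 : (n`!%:R)%:E * Iord n (cst 1) 1%R = 1.
  by rewrite -It_wint_Iord//; exact: (It_cst _ wint1).
by rewrite (ereal_mulIr1 f1 c1).
Qed.

End weights.

(** * The joint law of an independent uniform sample *)

Section sample.
Context {R : realType} d (T : measurableType d) (P : probability T R).
Variable X : nat -> {RV P >-> R}.
Hypothesis X_sample : uniform01_sample X.
Local Notation mu := (@lebesgue_measure R).
Local Open Scope ereal_scope.

Let V n (w : T) : seq R := mkseq (fun i => X i w) n.

Let mV n : measurable_fun setT (V n).
Proof. by apply: (measurable_fun_mkseq (f := fun i w => X i w)) => i; exact: measurable_funPT. Qed.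

Let V_box n C : V n @^-1` seq_box n C = \bigcap_(i in [set` iota 0 n]) (X i @^-1` C i).
Proof.
apply/seteqP; split=> w /=.
  move=> [_ H] i /=; rewrite mem_iota add0n => /andP[_ ilt].
  by have := H i ilt; rewrite nth_mkseq.
move=> H; split; first by rewrite size_mkseq.
by move=> i ilt; rewrite nth_mkseq//; apply: H; rewrite /= mem_iota add0n.
Qed.

(** Mutual independence is the product rule on boxes of length [n]; boxes of another length have
    empty preimage. Boxes are stable under intersection, so the two finite measures agree
    everywhere. *)
Let indep_step n (A : set (seq R)) (B : set R) : measurable A -> measurable B ->
  P (V n @^-1` A `&` X n @^-1` B) = P (V n @^-1` A) * P (X n @^-1` B).
Proof.
move=> mA mB.
have mXB : measurable (X n @^-1` B) by rewrite -[_ @^-1` _]setTI; exact: measurable_funPT.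
have PXB : (0 <= fine (P (X n @^-1` B)))%R by rewrite fine_ge0.
pose pm := measure_function_pushforward__canonical__measure_function_Measure P (mV n).
pose pm1 := measure_function_pushforward__canonical__measure_function_Measure
   (mrestr P mXB) (mV n).
have := @measure_unique _ R _ (@seq_boxes R) (fun k => seq_box k (fun=> setT)) erefl
  (@seq_boxesI R) _ _ pm1 (mscale (NngNum PXB) pm) _ _ A mA.
rewrite /pm1 /pm /= /mscale/= /mrestr/= /pushforward/= fineK ?fin_num_measure// muleC.
apply.
- by move=> k; exists k, (fun=> setT).
- by apply/seteqP; split=> // s _; exists (size s).
- move=> _ [m [C [mC ->]]].
  have [->|mn] := eqVneq m n; last first.
    have -> : V n @^-1` seq_box m C = set0.
      apply/seteqP; split=> // w /= [+ _]; rewrite size_mkseq => /esym nm.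
      by move: mn; rewrite nm eqxx.
    by rewrite set0I !measure0 mule0.
  rewrite V_box.
  have [ind _] := X_sample.
  rewrite (ind _ C) ?iota_uniq//.
  have := ind (iota 0 n.+1) (fun i => if (i < n)%N then C i else B) (iota_uniq _ _) _.
  have -> : iota 0 n.+1 = rcons (iota 0 n) n by rewrite -cats1 -[n.+1]addn1 iotaD.
  rewrite -cats1 big_cat/= big_seq1 ltnn muleC.
  have mite i : measurable (if (i < n)%N then C i else B) by case: ifP.
  move=> /(_ mite) E; transitivity (P (\bigcap_(i in [set` iota 0 n ++ [:: n]])
      X i @^-1` (if (i < n)%N then C i else B))); last first.
    rewrite E; congr (_ * _); apply: eq_big_seq => i.
    by rewrite mem_iota add0n => /andP[_ ->].
  congr (P _); apply/seteqP; split=> w /=.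
    move=> [H1 H2] i /=; rewrite mem_cat mem_iota add0n inE => /orP[/andP[_ ilt]|/eqP->].
      by rewrite ilt; apply: H1; rewrite /= mem_iota add0n.
    by rewrite ltnn.
  move=> H; split.
    move=> i /= ilt; have := H i; rewrite /= mem_cat ilt => /(_ isT).
    by move: ilt; rewrite mem_iota add0n => /andP[_ ->].
  by have := H n; rewrite /= mem_cat inE eqxx orbT ltnn => /(_ isT).
- move=> k; rewrite (le_lt_trans (probability_le1 _ _)) ?ltry//.
  by apply: measurableI => //; rewrite -[X in measurable X]setTI; apply: mV => //;
    apply: sub_sigma_algebra; exists k, (fun=> setT).
Qed.

(** By [indep_step] the first [n] observations and the next one have a product law, so Tonelli's
    theorem splits off the last coordinate. *)
Lemma integral_sample n (F : seq R -> \bar R) : measurable_fun setT F ->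
  (forall s, 0 <= F s) -> \int[P]_w F (mkseq (fun i => X i w) n) = It (wint 1) n F.
Proof.
elim: n F => [|n IH] F mF F0.
  by rewrite -[RHS]mule1 -(probability_setT P) -integral_cst.
pose mVm := isMeasurableFun.Build _ _ _ _ _ (mV n).
pose V' : {RV P >-> seq R} := HB.pack (V n) mVm.
have mpair : measurable_fun setT
    ((fun w => (V n w, X n w)) : T -> (seq R * measurableTypeR R)%type).
  by apply: measurable_fun_pair; [exact: mV|exact: (@measurable_funPT _ _ _ _ (X n))].
pose pm := measure_function_pushforward__canonical__measure_function_Measure P mpair.
pose G (p : seq R * measurableTypeR R) := F (rcons p.1 p.2).
have mG : measurable_fun setT G.
  by apply: (measurableT_comp mF); exact: measurable_fun_rcons.
transitivity (\int[pm]_p G p).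
  rewrite (_ : \int[pm]_p G p = \int[P]_w G (V n w, X n w)); last first.
    by rewrite ge0_integral_pushforward// => y _; exact: F0.
  apply: eq_integral => w _ /=; by rewrite /G /= /V /mkseq -[in LHS](addn1 n) iotaD map_cat cats1.
transitivity (\int[(distribution P V' \x uniform_prob (@ltr01 R))%E]_p G p).
  apply: (@eq_measure_integral _ _ _ setT (distribution P V' \x uniform_prob (@ltr01 R)) pm) => A mA _; apply/esym.
  apply: product_measure_unique => // B C mB mC.
  transitivity (P (V n @^-1` B) * P (X n @^-1` C)); first exact: indep_step.
  by congr (_ * _); exact: (X_sample.2 n C mC).
have G0 p : 0 <= G p by exact: F0.
rewrite fubini_tonelli1// /fubini_F.
rewrite ge0_integral_distribution//; last 2 first.
- exact: (@measurable_fun_fubini_tonelli_F _ _ _ _ _ (uniform_prob (@ltr01 R)) G).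
- by move=> s; exact: integral_ge0.
rewrite -[n.+1]addn1 It_cat.
pose F' s := \int[uniform_prob (@ltr01 R)]_x F (rcons s x).
rewrite (IH F'); last 2 first.
- exact: (@measurable_fun_fubini_tonelli_F _ _ _ _ _ (uniform_prob (@ltr01 R)) G).
- by move=> s; exact: integral_ge0.
apply: It_ext => s _; rewrite /F' integral_uniform//; last first.
  by apply: (measurableT_comp mF); exact: measurable_fun_rcons.
rewrite subr0 invr1 mul1e -integral_itv_obnd_cbnd; last first.
  by apply: measurable_funTS; apply: (measurableT_comp mF); exact: measurable_fun_rcons.
by rewrite /= -integral_wint; under eq_integral do rewrite -cats1.
Qed.

End sample.

(** * Faces of a concave majorant *)

Section faces.
Context {R : realFieldType}.
Implicit Types (u v S : nat -> R).

(* The points are [(u i, v i)]; the chord that is highest at the abscissa [t]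
   lies above all the points. *)
Lemma supporting_chord m u v (t : R) :
  (forall i, (i < m)%N -> u i != t) ->
  (exists2 i, (i < m)%N & u i < t) -> (exists2 i, (i < m)%N & t < u i) ->
  exists a b, [/\ (a < m)%N, (b < m)%N, u a < t, t < u b &
    forall i, (i < m)%N -> (v i - v a) * (u b - u a) <= (v b - v a) * (u i - u a)].
Proof.
move=> ut [i0 i0m ui0] [j0 j0m uj0].
pose h (p : 'I_m * 'I_m) : R :=
  ((u p.2 - t) * v p.1 + (t - u p.1) * v p.2) / (u p.2 - u p.1).
pose Q (p : 'I_m * 'I_m) := (u p.1 < t) && (t < u p.2).
have Q0 : Q (Ordinal i0m, Ordinal j0m) by rewrite /Q /= ui0 uj0.
have [[a b] /andP[/= ua ub] hmax] := Order.TotalTheory.arg_maxP h Q0.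
exists a, b; split => // i im.
have ab : 0 < u b - u a by rewrite subr_gt0 (lt_trans ua).
have [ui|ui|/eqP] := ltgtP (u i) t; last by rewrite (negbTE (ut i im)).
- have := hmax (Ordinal im, b); rewrite /Q /= ui ub => /(_ isT).
  rewrite /h /= ler_pdivrMr ?subr_gt0 ?(lt_trans ui)// mulrAC ler_pdivlMr// => H.
  have ub' : 0 < u b - t by rewrite subr_gt0.
  rewrite -(ler_pM2l ub'); move: H; nra.
- have := hmax (a, Ordinal im); rewrite /Q /= ui ua => /(_ isT).
  rewrite /h /= ler_pdivrMr ?subr_gt0 ?(lt_trans ua)// mulrAC ler_pdivlMr// => H.
  have ua' : 0 < t - u a by rewrite subr_gt0.
  rewrite -(ler_pM2l ua'); move: H; nra.
Qed.

(** For [S p < S q], the point [(S i, i)] lies on or below the line through [(S p, p)] and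
    [(S q, q)]. The slopes are cross-multiplied, so that division is avoided. *)
Definition below S (p q i : nat) : bool :=
  (i%:R - p%:R) * (S q - S p) <= (q%:R - p%:R) * (S i - S p).

Definition face n S (p q : nat) : bool := all (below S p q) (iota 0 n.+1).

Lemma faceP n S p q : reflect (forall i, (i <= n)%N -> below S p q i) (face n S p q).
Proof.
apply: (iffP allP) => [H i ilt|H i]; first by apply: H; rewrite mem_iota.
by rewrite mem_iota => ilt; apply: H.
Qed.

Definition quads n : seq ((nat * nat) * (nat * nat)) :=
  let prs := allpairs pair (iota 0 n.+1) (iota 0 n.+1) in
  allpairs pair prs prs.

Definition tie S (x : (nat * nat) * (nat * nat)) : bool :=
  [&& (x.1.1 < x.1.2)%N, (x.2.1 < x.2.2)%N, x.1 != x.2 &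
   (x.1.2%:R - x.1.1%:R) * (S x.2.2 - S x.2.1) == (x.2.2%:R - x.2.1%:R) * (S x.1.2 - S x.1.1)].

(** Apart from monotonicity, two distinct chords must not be parallel. Then no point lies on a face
    between its ends, and faces are exactly the edges between consecutive vertices. *)
Definition degenerate n S : bool :=
  has (fun i => S i.+1 <= S i) (iota 0 n) || has (tie S) (quads n).

Section generic.
Variables (n : nat) (S : nat -> R).
Hypothesis gen : ~~ degenerate n S.

Lemma generic_lt i k : (i < k <= n)%N -> S i < S k.
Proof.
have inc l : (l < n)%N -> S l < S l.+1.
  move: gen; rewrite negb_or => /andP[/hasPn H _] ln.
  by rewrite ltNge; apply: H; rewrite mem_iota.
elim: k => [|k IH]; first by rewrite ltn0.
rewrite ltnS leq_eqVlt => /andP[/orP[/eqP->|ik] kn]; first exact: inc.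
by rewrite (lt_trans (IH _) (inc k kn))// ik ltnW.
Qed.

Lemma generic_neq a b c e : (a < b <= n)%N -> (c < e <= n)%N -> (a, b) != (c, e) ->
  (b%:R - a%:R) * (S e - S c) != (e%:R - c%:R) * (S b - S a).
Proof.
move=> /andP[ab bn] /andP[ce en] neq.
move: gen; rewrite negb_or => /andP[_ /hasPn H].
have /H : ((a, b), (c, e)) \in quads n.
  by apply: allpairs_f; apply: allpairs_f; rewrite mem_iota/= add0n ltnS;
    lia.
by rewrite /tie/= ab ce neq.
Qed.

(** The supporting chord is taken over the midpoint of [S k] and [S k.+1], which is the abscissa of
    no point. *)
Lemma face_cover k : (k < n)%N -> exists p q, [/\ (p <= k)%N, (k < q <= n)%N & face n S p q].
Proof.
move=> kn; pose t := (S k + S k.+1) / 2.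
have kk : S k < S k.+1 by apply: generic_lt; rewrite leqnn.
have lk i : (i <= k)%N -> S i < t.
  rewrite leq_eqVlt => /orP[/eqP->|ik]; first by rewrite /t; lra.
  have : S i < S k by apply: generic_lt; rewrite ik ltnW.
  by rewrite /t; lra.
have gk i : (k < i <= n)%N -> t < S i.
  move=> /andP[]; rewrite leq_eqVlt => /orP[/eqP<- _|ik iN]; first by rewrite /t; lra.
  have : S k.+1 < S i by apply: generic_lt; rewrite ik.
  by rewrite /t; lra.
have [||| a [b [an bn Sa Sb H]]] := @supporting_chord n.+1 S (fun i => i%:R) t.
- move=> i ilt; have [/lk/lt_eqF->//|ki] := leqP i k.
  by rewrite gt_eqF// gk// ki.
- by exists 0%N => //; exact: lk.
- by exists n => //; apply: gk; rewrite kn leqnn.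
exists a, b; split.
- by rewrite leqNgt; apply/negP => ka; move: Sa; rewrite ltNge ltW// gk// ka.
- rewrite -(ltnS b) bn andbT ltnNge; apply/negP => bk.
  by move: Sb; rewrite ltNge ltW// lk.
- by apply/faceP => i ilt; exact: H.
Qed.

(** Each line lies above the end points of the other. Line [p'q'] minus line [pq] is therefore
    nonnegative at [p] and nonpositive at [q'], but nonpositive at [p'] and nonnegative at [q]. As
    [p < q'] and [p' < q], the lines are parallel, which is excluded. *)
Lemma face_uniq p q p' q' : (p < q <= n)%N -> (p' < q' <= n)%N -> (p < q')%N -> (p' < q)%N ->
  face n S p q -> face n S p' q' -> (p, q) = (p', q').
Proof.
move=> /andP[pq qn] /andP[pq' qn'] lpq lpq' /faceP F /faceP F'.
apply/eqP; apply/negPn/negP => neq.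
have := @generic_neq p q p' q'; rewrite pq qn pq' qn' neq => /(_ isT isT isT) sl.
have Fp' := F p' (ltnW (leq_trans pq' qn')); have Fq' := F q' qn'.
have F'p := F' p (ltnW (leq_trans pq qn)); have F'q := F' q qn.
have s1 : S p < S q by apply: generic_lt; rewrite pq.
have s2 : S p' < S q' by apply: generic_lt; rewrite pq'.
have s3 : S p < S q' by apply: generic_lt; rewrite lpq.
have s4 : S p' < S q by apply: generic_lt; rewrite lpq'.
have n1 : p%:R < q%:R :> R by rewrite ltr_nat.
have n2 : p'%:R < q'%:R :> R by rewrite ltr_nat.
move: Fp' Fq' F'p F'q; rewrite /below.
set a : R := p%:R; set b : R := q%:R; set a' : R := p'%:R; set b' : R := q'%:R.
rewrite -/a -/b -/a' -/b' in sl n1 n2.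
move=> Fp' Fq' F'p F'q.
have [lt|gt|/eqP] := ltgtP ((b - a) * (S q' - S p')) ((b' - a') * (S q - S p)); last first.
- by rewrite (negbTE sl).
- suff : (S q - S p') * ((b - a) * (S q' - S p') - (b' - a') * (S q - S p)) <= 0.
    by apply/negP; rewrite -ltNge mulr_gt0// subr_gt0.
  have D' : 0 <= S q' - S p' by rewrite subr_ge0 ltW.
  have D : 0 <= S q - S p by rewrite subr_ge0 ltW.
  by have := ler_wpM2l D' Fp'; have := ler_wpM2l D F'q; lra.
- suff : (S q' - S p) * ((b' - a') * (S q - S p) - (b - a) * (S q' - S p')) <= 0.
    by apply/negP; rewrite -ltNge mulr_gt0// subr_gt0.
  have D' : 0 <= S q' - S p' by rewrite subr_ge0 ltW.
  have D : 0 <= S q - S p by rewrite subr_ge0 ltW.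
  by have := ler_wpM2l D' Fq'; have := ler_wpM2l D F'p; lra.
Qed.

End generic.

Lemma face_left n S (j g : R) p a b : 0 < g -> 0 < j -> (a < b <= p)%N -> (p <= n)%N ->
  (forall i k, (i < k <= n)%N -> S i < S k) ->
  (forall i, (i <= n)%N -> i%:R * g - j * S i <= p%:R * g - j * S p) ->
  face n S a b = all (below S a b) (iota 0 p.+1).
Proof.
move=> g0 j0 /andP[ab bp] pn Sinc pmax.
apply/idP/idP => [/faceP H|/allP H].
  by apply/allP => i; rewrite mem_iota => /andP[_ ip]; apply: H; rewrite (leq_trans _ pn).
apply/faceP => i ilt.
have [ip|pi] := leqP i p; first by apply: H; rewrite mem_iota/= add0n ltnS.
have Hp : below S a b p by apply: H; rewrite mem_iota/= add0n ltnS.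
have Ba := pmax a (ltnW (leq_trans ab (leq_trans bp pn))).
have Bb := pmax b (leq_trans bp pn).
have Bi := pmax i ilt.
have sab : S a < S b by apply: Sinc; rewrite ab (leq_trans bp).
have spi : S p < S i by apply: Sinc; rewrite pi.
have nab : (a%:R < b%:R :> R) by rewrite ltr_nat.
have slope : j * (S b - S a) <= (b%:R - a%:R) * g.
  move: bp; rewrite leq_eqVlt => /orP[/eqP bp|bp]; first by rewrite -bp in Ba; lra.
  have nbp : (b%:R < p%:R :> R) by rewrite ltr_nat.
  move: Hp; rewrite /below => Hp.
  rewrite -(@ler_pM2l _ (p%:R - b%:R)) ?subr_gt0//.
  have c0 : 0 <= b%:R - a%:R :> R by rewrite subr_ge0 ltW.
  have Bbp : (p%:R - b%:R) * g >= j * (S p - S b) by lra.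
  have := ler_wpM2l c0 Bbp; have := ler_wpM2l (ltW j0) Hp; lra.
move: Hp; rewrite /below => Hp.
have c0 : 0 <= b%:R - a%:R :> R by rewrite subr_ge0 ltW.
have X0 : 0 <= S i - S p by rewrite subr_ge0 ltW.
have D0 : 0 <= S b - S a by rewrite subr_ge0 ltW.
rewrite -(ler_pM2l g0).
have Bi' : (i%:R - p%:R) * g <= j * (S i - S p) by lra.
have := ler_wpM2l D0 Bi'; have := ler_wpM2l X0 slope; have := ler_wpM2l (ltW g0) Hp; lra.
Qed.

Lemma face_right n S (j g : R) p a b : 0 < g -> 0 < j -> (p <= a)%N -> (a < b <= n)%N ->
  (forall i k, (i < k <= n)%N -> S i < S k) ->
  (forall i, (i <= n)%N -> i%:R * g - j * S i <= p%:R * g - j * S p) ->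
  face n S a b = all (below S a b) (iota p (n.+1 - p)).
Proof.
move=> g0 j0 pa /andP[ab bn] Sinc pmax.
have pn : (p <= n)%N by rewrite (leq_trans pa)// ltnW// (leq_trans ab).
apply/idP/idP => [/faceP H|/allP H].
  by apply/allP => i; rewrite mem_iota subnKC ?ltnS ?leqW// => /andP[_ ip]; apply: H.
have H' i : (p <= i <= n)%N -> below S a b i.
  by move=> /andP[pi ilt]; apply: H; rewrite mem_iota pi subnKC ?ltnS ?leqW.
apply/faceP => i ilt.
have [pi|ip] := leqP p i; first by apply: H'; rewrite pi.
have Hp : below S a b p by apply: H'; rewrite leqnn.
have Ba := pmax a (ltnW (leq_trans ab bn)).
have Bb := pmax b bn.
have Bi := pmax i ilt.
have sab : S a < S b by apply: Sinc; rewrite ab.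
have spi : S i < S p by apply: Sinc; rewrite ip.
have nab : (a%:R < b%:R :> R) by rewrite ltr_nat.
have slope : (b%:R - a%:R) * g <= j * (S b - S a).
  move: pa; rewrite leq_eqVlt => /orP[/eqP bp|bp]; first by rewrite -bp in Bb *; lra.
  have nbp : (p%:R < a%:R :> R) by rewrite ltr_nat.
  move: Hp; rewrite /below => Hp.
  rewrite -(@ler_pM2l _ (a%:R - p%:R)) ?subr_gt0//.
  have c0 : 0 <= b%:R - a%:R :> R by rewrite subr_ge0 ltW.
  have Bbp : (a%:R - p%:R) * g <= j * (S a - S p) by lra.
  have := ler_wpM2l c0 Bbp; have := ler_wpM2l (ltW j0) Hp; lra.
move: Hp; rewrite /below => Hp.
have c0 : 0 <= b%:R - a%:R :> R by rewrite subr_ge0 ltW.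
have X0 : 0 <= S p - S i by rewrite subr_ge0 ltW.
have D0 : 0 <= S b - S a by rewrite subr_ge0 ltW.
rewrite -(ler_pM2l g0).
have Bi' : j * (S p - S i) <= (p%:R - i%:R) * g by lra.
have := ler_wpM2l D0 Bi'; have := ler_wpM2l X0 slope; have := ler_wpM2l (ltW g0) Hp; lra.
Qed.

(** A point that alone touches a supporting line lies strictly above every chord passing over it. *)
Lemma face_across n S (j g : R) p a b : 0 < j -> (a < p < b)%N -> (b <= n)%N ->
  (forall i k, (i < k <= n)%N -> S i < S k) ->
  (forall i, (i <= n)%N -> i != p -> i%:R * g - j * S i < p%:R * g - j * S p) ->
  ~~ face n S a b.
Proof.
move=> j0 /andP[ap pb] bn Sinc pmax; apply/negP => /faceP /(_ p).
rewrite (ltnW (leq_trans pb bn)) => /(_ isT).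
have Ba := pmax a (ltnW (ltn_trans ap (leq_trans pb bn))); rewrite (ltn_eqF ap) in Ba.
have Bb := pmax b bn; rewrite (gtn_eqF pb) in Bb.
have nap : (a%:R < p%:R :> R) by rewrite ltr_nat.
have npb : (p%:R < b%:R :> R) by rewrite ltr_nat.
rewrite /below => Hp.
have {}Ba : j * (S p - S a) < (p%:R - a%:R) * g by have := Ba isT; lra.
have {}Bb : (b%:R - p%:R) * g < j * (S b - S p) by have := Bb isT; lra.
have m1 : 0 < b%:R - p%:R :> R by lra.
have m2 : 0 < p%:R - a%:R :> R by lra.
have h1 : (b%:R - p%:R) * (j * (S p - S a)) < (b%:R - p%:R) * ((p%:R - a%:R) * g).
  by rewrite ltr_pM2l.
have h2 : (p%:R - a%:R) * ((b%:R - p%:R) * g) < (p%:R - a%:R) * (j * (S b - S p)).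
  by rewrite ltr_pM2l.
have := ler_wpM2l (ltW j0) Hp; lra.
Qed.

(** * Sums over the faces *)

Definition Fsum (V : nmodType) (psi : nat -> R -> V) n S : V :=
  \sum_(0 <= a < n.+1) \sum_(a.+1 <= b < n.+1)
    if face n S a b then psi (b - a)%N (S b - S a) else 0.

Definition remove S (p j : nat) (i : nat) : R :=
  if (i <= p)%N then S i else S (i + j)%N - (S (p + j)%N - S p).

Section remove_face.
Variables (n : nat) (S : nat -> R) (p j : nat).
Hypothesis gen : ~~ degenerate n S.
Hypotheses (j0 : (0 < j)%N) (pjn : (p + j <= n)%N) (fpj : face n S p (p + j)).
Let g : R := S (p + j)%N - S p.
Let S' := remove S p j.

Let g0 : 0 < g.
Proof. by rewrite subr_gt0; apply: (generic_lt gen); rewrite pjn -[ltnLHS]addn0 ltn_add2l j0. Qed.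

Let jR : 0 < j%:R :> R. Proof. by rewrite ltr0n. Qed.

Let Smax i : (i <= n)%N -> i%:R * g - j%:R * S i <= p%:R * g - j%:R * S p.
Proof.
move=> ilt; move/faceP: fpj => /(_ i ilt); rewrite /below -/g natrD; lra.
Qed.

Let Smaxq i : (i <= n)%N -> i%:R * g - j%:R * S i <= (p + j)%:R * g - j%:R * S (p + j)%N.
Proof. by move=> /Smax; rewrite natrD /g; lra. Qed.

Let Smax_lt i : (i <= n)%N -> i != p -> i != (p + j)%N ->
  i%:R * g - j%:R * S i < p%:R * g - j%:R * S p.
Proof.
move=> ilt ip ipj; rewrite lt_neqAle Smax// andbT.
have pj : (p < p + j <= n)%N by rewrite pjn -[ltnLHS]addn0 ltn_add2l j0.
have [ilp|pli|/eqP] := ltngtP i p; last by rewrite (negbTE ip).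
- have ipn : (i < p <= n)%N by rewrite ilp (leq_trans (leq_addr j p)).
  have /= := generic_neq gen ipn pj; rewrite xpair_eqE (negbTE ip)/= => /(_ isT).
  apply: contraNneq => H; apply/eqP; rewrite -/g natrD; lra.
- have ipn : (p < i <= n)%N by rewrite pli.
  have /= := generic_neq gen ipn pj; rewrite xpair_eqE (negbTE ipj) andbF/= => /(_ isT).
  apply: contraNneq => H; apply/eqP; rewrite -/g natrD; lra.
Qed.

Let S'inc i k : (i < k <= n - j)%N -> S' i < S' k.
Proof.
move=> /andP[ik kn]; rewrite /S' /remove.
have [ip|pi] := leqP i p; have [kp|pk] := leqP k p.
- by apply: (generic_lt gen); rewrite ik (leq_trans kn) ?leq_subr.
- rewrite -/g; suff : S i <= S p /\ S (p + j)%N < S (k + j)%N by rewrite /g; lra.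
  split; last by apply: (generic_lt gen); rewrite ltn_add2r pk; lia.
  move: ip; rewrite leq_eqVlt => /orP[/eqP->//|ip].
  by apply/ltW/(generic_lt gen); rewrite ip; lia.
- by lia.
- by rewrite ltrD2r; apply: (generic_lt gen); rewrite ltn_add2r ik; lia.
Qed.

Let S'max i : (i <= n - j)%N -> i%:R * g - j%:R * S' i <= p%:R * g - j%:R * S' p.
Proof.
move=> ilt; rewrite /S' /remove leqnn; have [ip|pi] := leqP i p.
  by apply: Smax; lia.
have /Smax : (i + j <= n)%N by lia.
by rewrite natrD -/g; lra.
Qed.

Let S'max_lt i : (i <= n - j)%N -> i != p ->
  i%:R * g - j%:R * S' i < p%:R * g - j%:R * S' p.
Proof.
move=> ilt ip'; rewrite /S' /remove leqnn; have [ip|pi] := leqP i p.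
  by apply: Smax_lt => //; lia.
have : (i + j)%:R * g - j%:R * S (i + j)%N < p%:R * g - j%:R * S p.
  by apply: Smax_lt; lia.
by rewrite natrD -/g; lra.
Qed.

Let face_unique a b : (a < b <= n)%N -> (a < p + j)%N -> (p < b)%N ->
  (a, b) != (p, p + j)%N -> face n S a b = false.
Proof.
move=> abn apj pb neq; apply/negP => fab; move: neq.
have pj : (p < p + j <= n)%N by rewrite pjn -[ltnLHS]addn0 ltn_add2l j0.
by rewrite (face_uniq gen abn pj apj pb fab fpj) eqxx.
Qed.

(** The line of the removed face supports both configurations, so on either side of the face the
    other faces are decided by data that the removal does not change. Over the block itself there is
    only the removed face, and after the removal [p] is an exposed vertex that no face can cross. *)
Lemma Fsum_remove (V : nmodType) (psi : nat -> R -> V) :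
  Fsum psi n S = psi j g + Fsum psi (n - j) S'.
Proof.
rewrite /Fsum (big_cat_nat _ (n := p)) ?leq0n//=; last by lia.
rewrite [in RHS](big_cat_nat _ (n := p)) ?leq0n//=; last by lia.
rewrite addrCA; congr (_ + _).
  apply: eq_big_nat => a /andP[_ ap].
  rewrite (big_cat_nat _ (n := p.+1)) ?ltnS//=; [|exact: ltnW|by lia].
  rewrite [in RHS](big_cat_nat _ (n := p.+1)) ?ltnS//=; [|exact: ltnW|by lia].
  congr (_ + _).
    apply: eq_big_nat => b /andP[ab bp].
    rewrite (@face_left n S j%:R g p)//; [|by rewrite ab|by lia|exact: generic_lt gen].
    rewrite (@face_left (n - j) S' j%:R g p)//; [|by rewrite ab|by lia].
    rewrite [in RHS](eq_in_all (a2 := below S a b)).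
      by rewrite /S' /remove (ltnW ap) -ltnS bp.
    move=> i; rewrite mem_iota add0n ltnS => /andP[_ ip].
    by rewrite /below /S' /remove ip (ltnW ap) -ltnS bp.
  rewrite big_nat_cond big1 => [|b /andP[/andP[pb bn] _]]; last first.
    by rewrite face_unique ?xpair_eqE ?(ltn_eqF ap)//; lia.
  rewrite big_nat_cond big1 => // b /andP[/andP[pb bn] _].
  by rewrite (negbTE (@face_across _ S' j%:R g p _ _ _ _ _ _ _))// ap.
rewrite (big_cat_nat _ (n := (p + j)%N)) ?leq_addr//=; last by lia.
congr (_ + _).
  have pjlt : (p < p + j)%N by lia.
  rewrite (big_ltn pjlt).
  rewrite [X in _ + X]big_nat_cond [X in _ + X]big1 ?addr0 => [|a /andP[/andP[pa apj] _]]; last first.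
    rewrite big_nat_cond big1 => // b /andP[/andP[ab bn] _].
    by rewrite face_unique ?xpair_eqE ?(gtn_eqF pa)//; lia.
  rewrite (big_cat_nat _ (n := (p + j)%N))/=; [|by lia|by lia].
  rewrite big_nat_cond big1 ?add0r => [|b /andP[/andP[ab bn] _]]; last first.
    by rewrite face_unique ?xpair_eqE ?(ltn_eqF bn) ?andbF//; lia.
  rewrite big_ltn ?ltnS// fpj addKn -/g.
  rewrite big_nat_cond big1 ?addr0 => // b /andP[/andP[ab bn] _].
  by rewrite face_unique ?xpair_eqE ?(gtn_eqF ab) ?andbF//; lia.
rewrite big_addn subSn; last by lia.
apply: eq_big_nat => a /andP[pa an].
rewrite -addSn big_addn subSn; last by lia.
apply: eq_big_nat => b /andP[ab bn].
have Sj i : (p <= i)%N -> S (i + j)%N = S' i + g.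
  rewrite /S' /remove leq_eqVlt => /orP[/eqP<-|pi]; first by rewrite leqnn /g; ring.
  by rewrite leqNgt pi /= /g; ring.
rewrite subnDr !Sj//; last by lia.
rewrite (@face_right n S j%:R g (p + j))//; [|by lia|by lia|exact: generic_lt gen].
rewrite (@face_right (n - j) S' j%:R g p)//; [|by lia].
have -> : (n.+1 - (p + j) = (n - j).+1 - p)%N by lia.
rewrite [(p + j)%N]addnC iotaDl all_map.
rewrite (eq_in_all (a2 := below S' a b)).
  by rewrite opprD addrACA subrr addr0.
move=> i; rewrite mem_iota => /andP[pi _] /=.
rewrite /below [(j + i)%N]addnC !Sj//; last by lia.
rewrite !natrD; congr (_ <= _); ring.
Qed.

End remove_face.

Section cover.
Variables (n : nat) (S : nat -> R).
Hypothesis gen : ~~ degenerate n S.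

Lemma Fsum_cover (V : nmodType) k (x : nat -> nat -> V) (y : V) : (k < n)%N ->
  (forall a b, (a <= k)%N -> (k < b <= n)%N -> face n S a b -> x a b = y) ->
  \sum_(0 <= a < n.+1) \sum_(a.+1 <= b < n.+1)
    (if face n S a b && (a <= k < b)%N then x a b else 0) = y.
Proof.
move=> kn xy; have [p [q [pk kq f]]] := face_cover gen kn.
have pq : (p < q <= n)%N by lia.
have pn : (p < n.+1)%N by lia.
rewrite (bigD1_seq p) ?iota_uniq ?mem_index_iota//=.
rewrite (bigD1_seq q) ?iota_uniq ?mem_index_iota//=.
rewrite f pk; have -> : (k < q)%N by lia.
rewrite /= (xy p q)// big1_seq ?addr0; last first.
  move=> b /andP[bq]; rewrite mem_index_iota => pb; case: ifP => // /andP[fb kb].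
  have [qb] : (p, q) = (p, b) by apply: (face_uniq gen _ _ _ _ f fb); lia.
  by rewrite qb eqxx in bq.
rewrite big1_seq ?addr0// => a /andP[ap]; rewrite mem_index_iota => an.
rewrite big1_seq// => b; rewrite mem_index_iota => ab; case: ifP => // /andP[fb kb].
have [pa _] : (p, q) = (a, b) by apply: (face_uniq gen _ _ _ _ f fb); lia.
by rewrite pa eqxx in ap.
Qed.

(** Exactly one face lies over each index, so a sum over indices can be grouped by faces. *)
Lemma sum_faces (V : nmodType) (c : nat -> V) :
  \sum_(0 <= k < n) c k = \sum_(0 <= a < n.+1) \sum_(a.+1 <= b < n.+1)
    if face n S a b then \sum_(a <= k < b) c k else 0.
Proof.
rewrite [LHS](eq_big_nat _ _ (F2 := fun k => \sum_(0 <= a < n.+1) \sum_(a.+1 <= b < n.+1)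
    (if face n S a b && (a <= k < b)%N then c k else 0))); last first.
  by move=> k /andP[_ kn]; rewrite (@Fsum_cover V k (fun _ _ => c k) (c k)).
rewrite exchange_big_nat/=; apply: eq_big_nat => a /andP[_ an].
rewrite exchange_big_nat/=; apply: eq_big_nat => b /andP[ab bn].
case: (face n S a b) => /=; last by rewrite big1.
have aln : (a <= n)%N by lia.
have bln : (b <= n)%N by lia.
have alb : (a <= b)%N by lia.
rewrite (big_cat_nat _ (n := a))//=.
rewrite [X in X + _]big_nat_cond [X in X + _]big1 ?add0r => [|k /andP[/andP[_ ka] _]]; last first.
  by rewrite leqNgt ka.
rewrite (big_cat_nat _ (n := b))//=.
rewrite [X in _ + X]big_nat_cond [X in _ + X]big1 ?addr0 => [|k /andP[/andP[bk _] _]]; last first.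
  by rewrite [(k < b)%N]ltnNge bk andbF.
by apply: eq_big_nat => k /andP[ak kb]; rewrite ak kb.
Qed.

(** This identity is the origin of the factor [n] in the recursion. *)
Lemma Fsum_length : Fsum (fun j _ => j) n S = n.
Proof.
transitivity (\sum_(0 <= k < n) 1)%N; last by rewrite sum_nat_const_nat subn0 muln1.
rewrite sum_faces; apply: eq_big_nat => a _; apply: eq_big_nat => b _.
by case: ifP => // _; rewrite sum_nat_const_nat muln1.
Qed.

End cover.

End faces.

(** * The size-biased decomposition into faces *)

Section psum_facts.
Context {R : realType}.
Implicit Types s t : seq R.

Lemma psum0 s : psum s 0 = 0. Proof. by rewrite /psum big_ord0. Qed.

Lemma psumS s k : psum s k.+1 = psum s k + nth 0 s k.
Proof. by rewrite /psum big_ord_recr. Qed.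

Lemma psum_cat_l s t k : (k <= size s)%N -> psum (s ++ t) k = psum s k.
Proof.
move=> ks; apply: eq_bigr => l _; rewrite nth_cat.
by rewrite (leq_trans (ltn_ord l) ks).
Qed.

Lemma psum_cat_r s t k : psum (s ++ t) (size s + k) = psum s (size s) + psum t k.
Proof.
elim: k => [|k IH]; first by rewrite addn0 psum_cat_l// psum0 addr0.
by rewrite addnS !psumS IH nth_cat ltnNge leq_addr/= addrC addKn addrC addrA.
Qed.

Lemma psumB s i k n : (i <= k <= n)%N ->
  psum s k - psum s i = \sum_(l < n) ((i <= l < k)%N%:R * nth 0 s l).
Proof.
move=> /andP[ik kn].
have H m : (m <= n)%N -> psum s m = \sum_(l < n) ((l < m)%N%:R * nth 0 s l).
  move=> mn; rewrite /psum (big_ord_widen n (fun l => nth 0 s l))// big_mkcond/=.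
  by apply: eq_bigr => l _; case: (l < m)%N; rewrite ?mul1r ?mul0r.
rewrite !H//; last exact: leq_trans kn.
rewrite -sumrB; apply: eq_bigr => l _; rewrite -mulrBl; congr (_ * _).
have [li|il] := ltnP l i; first by rewrite (leq_trans li ik) subrr.
by rewrite subr0.
Qed.

Lemma measurable_psum_fun d (X : measurableType d) (f : X -> seq R) k :
  measurable_fun setT f -> measurable_fun setT (fun x => psum (f x) k).
Proof. by move=> mf; exact: (measurableT_comp (measurable_psum k)). Qed.

Lemma measurable_face d (X : measurableType d) (S : X -> nat -> R) n p q :
  (forall i, measurable_fun setT (S ^~ i)) ->
  measurable_fun setT (fun x => face n (S x) p q).
Proof.
move=> mS; apply: measurable_all => i; apply: measurable_fun_ler.
  by apply: measurable_funM => //; exact: measurable_funB.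
by apply: measurable_funM => //; exact: measurable_funB.
Qed.

Lemma measurable_Fsum d (X : measurableType d) (S : X -> nat -> R) n (psi : nat -> R -> R) :
  (forall i, measurable_fun setT (S ^~ i)) -> (forall j, measurable_fun setT (psi j)) ->
  measurable_fun setT (fun x => Fsum psi n (S x)).
Proof.
move=> mS mpsi; apply: measurable_sum => a; apply: measurable_sum => b.
apply: measurable_fun_ifT => //; first exact: measurable_face.
apply: (measurableT_comp (mpsi _)); exact: measurable_funB.
Qed.

Lemma Fsum_ext (V : nmodType) (psi : nat -> R -> V) n (S S' : nat -> R) :
  (forall i, (i <= n)%N -> S i = S' i) -> Fsum psi n S = Fsum psi n S'.
Proof.
move=> SS; apply: eq_big_nat => a /andP[_ an]; apply: eq_big_nat => b /andP[ab bn].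
rewrite !SS//; congr (if _ then _ else _).
apply: eq_in_all => i; rewrite mem_iota add0n ltnS => /andP[_ ilt].
by rewrite /below !SS.
Qed.

Lemma big_nat_triangle (V : nmodType) n (T : nat -> nat -> V) :
  \sum_(0 <= a < n.+1) \sum_(a.+1 <= b < n.+1) T a b =
  \sum_(1 <= j < n.+1) \sum_(0 <= a < (n - j).+1) T a (a + j)%N.
Proof.
transitivity (\sum_(0 <= a < n.+1) \sum_(1 <= j < n.+1) if (a + j <= n)%N then T a (a + j)%N else 0).
  apply: eq_big_nat => a /andP[_ an].
  rewrite -[a.+1]addn1 addnC big_addn (@big_cat_nat _ _ _ (n.+1 - a) 1 n.+1)/=; [|lia|lia].
  rewrite [X in _ = _ + X]big_nat_cond [X in _ = _ + X]big1 ?addr0; last first.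
    by move=> j /andP[/andP[aj _] _]; case: ifP => //; lia.
  apply: eq_big_nat => j /andP[j0 ja]; rewrite addnC.
  by have -> : (a + j <= n)%N by lia.
rewrite exchange_big_nat/=; apply: eq_big_nat => j /andP[j0 jn].
rewrite (@big_cat_nat _ _ _ (n - j).+1 0 n.+1)/=; [|lia|lia].
rewrite [X in _ + X]big_nat_cond [X in _ + X]big1 ?addr0; last first.
  by move=> a /andP[/andP[aj _] _]; case: ifP => //; lia.
by apply: eq_big_nat => a /andP[_ aj]; have -> : (a + j <= n)%N by lia.
Qed.

Lemma psum_size s : psum s (size s) = \sum_(x <- s) x.
Proof. by rewrite (big_nth 0) big_mkord. Qed.

Lemma psum_rot s k : psum (rot k s) (size s) = psum s (size s).
Proof. by rewrite -{1}(size_rot k s) !psum_size; apply: perm_big; rewrite perm_rot. Qed.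

End psum_facts.

Section decomposition.
Context {R : realType}.
Local Notation mu := (@lebesgue_measure R).
Local Open Scope ereal_scope.
Local Notation Ex := (It (@wexp R)).

Lemma wexp_pos_negl n i : (i < n)%N -> It_negl (@wexp R) n (fun y => nth 0 y i <= 0)%R.
Proof.
move=> ilt; have mb : measurable_fun setT (fun y : seq R => (nth 0 y i <= 0)%R).
  by apply: measurable_fun_ler => //; exact: measurable_nth.
split=> //.
rewrite (@It_reweight _ wexp wexp (fun x => (0 < x)%R%:R)).
- rewrite -[RHS](It0 wexp n); apply: It_ext => y _.
  rewrite (prod_nat_of_bool n (fun k => 0 < nth 0 y k)%R).
  case: (boolP (nth 0 y i <= 0)%R) => yi; last by rewrite mule0.
  case: allP => [/(_ i)|_]; last by rewrite mul0e.
  by rewrite mem_iota add0n ilt => /(_ isT); rewrite ltNge yi.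
- exact: wpos_subproof.
- by [].
- by move=> x /=; case: (0 < x)%R; rewrite ?mulr1 ?mulr0 ?mul0r.
- exact: measurable_b2E.
- by [].
Qed.

Lemma It_negl_or (w : weight) n (b c : seq R -> bool) : It_negl w n b -> It_negl w n c ->
  It_negl w n (fun y => b y || c y).
Proof.
move=> hb hc.
have := @It_negl_has _ w n bool [:: true; false] (fun i => if i then b else c).
move=> /(_ _)[|m0 e0]; first by case.
split; first by apply: measurable_or; [case: hb|case: hc].
rewrite -[RHS]e0; apply: It_ext => y _; by rewrite /= orbF.
Qed.

Lemma It_negl_false (w : weight) n : It_negl w n (fun _ : seq R => false).
Proof. by split; [exact: measurable_cst|exact: It0]. Qed.

(** A nonpositive increment is a null event for [wexp], and two parallel chords satisfy a nontrivial
    linear equation in the increments. *)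
Lemma degenerate_negl n : It_negl (@wexp R) n (fun y => degenerate n (psum y)).
Proof.
apply: It_negl_or.
  apply: (It_negl_sub (@It_negl_has _ wexp n _ (iota 0 n) (fun i y => (i < n)%N && (nth 0 y i <= 0)%R) _)).
  - move=> i _; case: (ltnP i n) => ilt; last exact: It_negl_false.
    exact: wexp_pos_negl.
  - by apply: measurable_has => i; apply: measurable_fun_ler; exact: measurable_psum.
  - move=> y _ H.
    case: (elimT hasP H) => i; rewrite mem_iota add0n => /andP[_ ilt] yi.
    apply/hasP; exists i; first by rewrite mem_iota.
    by rewrite ilt/=; move: yi; rewrite psumS gerDl.
apply: It_negl_has => -[[a b] [c e]] /allpairsP[[p q] [pin qin E]].
have le_n (r : nat * nat) : r \in allpairs pair (iota 0 n.+1) (iota 0 n.+1) -> (r.2 <= n)%N.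
  by case/allpairsP => -[i k] [_]; rewrite mem_iota add0n ltnS => kn ->.
have bn : (b <= n)%N by move: (le_n _ pin); case: E => <- _.
have en : (e <= n)%N by move: (le_n _ qin); case: E => _ <-.
rewrite /tie/=.
have [ab|_] := ltnP a b; last exact: It_negl_false.
have [ce|_] := ltnP c e; last exact: It_negl_false.
have [_|neq] := eqVneq (a, b) (c, e); first exact: It_negl_false.
have anb : (a < n)%N by exact: leq_trans bn.
have cne : (c < n)%N by exact: leq_trans en.
pose co (l : nat) : R := ((b%:R - a%:R) * (c <= l < e)%N%:R -
  (e%:R - c%:R) * (a <= l < b)%N%:R)%R.
(* Where the chords start at different indices, the smaller start lies under one of them only; where
   they start together, the increment at the smaller end lies under the longer one only. *)
have [i ilt ci] : exists2 i, (i < n)%N & co i != 0%R.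
  have ba0 : (b%:R - a%:R != 0 :> R)%R by rewrite subr_eq0 eqr_nat gtn_eqF.
  have ec0 : (e%:R - c%:R != 0 :> R)%R by rewrite subr_eq0 eqr_nat gtn_eqF.
  have [ac|ca|ac] := ltngtP a c.
  - exists a => //; rewrite /co leqnn ab leqNgt ac/= mulr0 mulr1 sub0r oppr_eq0.
    exact: ec0.
  - exists c => //; rewrite /co leqnn ce leqNgt ca/= mulr0 mulr1 subr0.
    exact: ba0.
  - have [be|eb|be] := ltngtP b e; last by move: neq; rewrite ac be eqxx.
    + exists b; first exact: leq_trans en.
      by rewrite /co -ac (ltnW ab) be ltnn/= mulr0 mulr1 subr0.
    + exists e; first exact: leq_trans bn.
      by rewrite /co ac (ltnW ce) eb ltnn/= mulr0 mulr1 sub0r oppr_eq0.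
apply: (It_negl_sub (@It_lin_null _ wexp n co 0%R i ilt ci)).
- apply: measurable_fun_eqr; apply: measurable_funM => //;
    by apply: measurable_funB; exact: measurable_psum.
- move=> y _ /eqP H; rewrite (@psumB _ _ c e n) ?(@psumB _ _ a b n) in H; [|lia..].
  apply/eqP; under eq_bigr do rewrite mulrBl -!mulrA.
  by rewrite sumrB -!mulr_sumr H subrr.
Qed.

Lemma It_rot w k j (F : seq R -> \bar R) : (k <= j)%N -> measurable_fun setT F ->
  (forall s, 0 <= F s) -> It w j (fun z => F (rot k z)) = It w j F.
Proof.
move=> kj mF F0.
transitivity (It w k (fun y1 => It w (j - k) (fun y2 => F (y2 ++ y1)))).
  rewrite -{1}(subnKC kj) It_cat; apply: It_ext => y1 s1; apply: It_ext => y2 s2.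
  by rewrite -s1 rot_size_cat.
rewrite It_swap//; last first.
  by apply: (measurableT_comp mF); exact: measurable_fun_cat.
by rewrite -{2}(subnK kj) It_cat.
Qed.

(** For [g > 0]: [g] times the vertical distance of the point [(S i, i)] from the line of slope
    [j / g] through the origin. Its maximisers are the points where a line of that slope touches the
    set from above. *)
Definition excess (j : nat) (g : R) (S : nat -> R) (i : nat) : R := (i%:R * g - j%:R * S i)%R.

(** The excess relative to the full chord vanishes at both ends and can be continued periodically.
    Rotating shifts it by a constant, so the chord lies above all points precisely when the rotation
    starts at a maximiser. *)
Lemma good_rot j (z : seq R) k : (k < j)%N -> size z = j ->
  face j (psum (rot k z)) 0 j = amax j (excess j (psum z j) (psum z)) k.
Proof.
move=> kj sz.
have sd : size (drop k z) = (j - k)%N by rewrite size_drop sz.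
have E0 i : (i <= k)%N -> psum (take k z) i = psum z i.
  by move=> ik; rewrite -{2}(cat_take_drop k z) psum_cat_l// size_takel ?sz// ltnW.
have E1 i : psum (drop k z) i = (psum z (k + i) - psum z k)%R.
  have st : size (take k z) = k by rewrite size_takel ?sz// ltnW.
  have := psum_cat_r (take k z) (drop k z) i.
  by rewrite cat_take_drop st E0// => ->; rewrite addrAC subrr add0r.
have P1 i : (i <= j - k)%N -> psum (rot k z) i = (psum z (k + i) - psum z k)%R.
  by move=> ij; rewrite /rot psum_cat_l ?sd// E1.
have P2 l : (l <= k)%N -> psum (rot k z) (j - k + l) = (psum z j - psum z k + psum z l)%R.
  by move=> lk; rewrite /rot -{1}sd psum_cat_r sd E1 E0// subnKC// ltnW.
have Pj : psum (rot k z) j = psum z j.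
  by have := P2 k (leqnn k); rewrite subnK ?(ltnW kj)// subrK.
apply/faceP/allP => [H i|H i ij]; rewrite /below ?Pj ?psum0 ?subr0.
  rewrite mem_iota add0n => /andP[_ ij]; rewrite /excess.
  have [ki|ik] := leqP k i.
    have := H (i - k)%N; rewrite leq_subLR (leq_trans (ltnW ij)) ?leq_addl// => /(_ isT).
    rewrite /below Pj psum0 !subr0 P1 ?leq_sub2r ?(ltnW ij)// subnKC// natrB//; lra.
  have := H (j - k + i)%N; rewrite -{2}(subnK (ltnW kj)) leq_add2l (ltnW ik) => /(_ isT).
  rewrite /below Pj psum0 !subr0 P2 ?(ltnW ik)// natrD natrB ?(ltnW kj)//; lra.
have [ijk|jki] := leqP i (j - k)%N.
  rewrite P1//; move: ijk; rewrite leq_eqVlt => /orP[/eqP ijk|ijk].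
    have := H 0%N; rewrite mem_iota add0n (leq_ltn_trans _ kj)// => /(_ isT).
    rewrite ijk subnKC ?(ltnW kj)// /excess psum0 natrB ?(ltnW kj)//; lra.
  have := H (k + i)%N; rewrite mem_iota add0n -(ltn_subRL) ijk => /(_ isT).
  rewrite /excess natrD; lra.
have {}H := H (i - (j - k))%N.
have ilk : (i - (j - k) <= k)%N by lia.
have := H; rewrite mem_iota add0n => /(_ _)/=.
have -> : (i - (j - k) < j)%N by lia.
move=> /(_ isT).
have -> : psum (rot k z) i = (psum z j - psum z k + psum z (i - (j - k)))%R.
  by rewrite -P2//; congr psum; lia.
rewrite /excess natrB ?(ltnW jki)// natrB ?(ltnW kj)//; lra.
Qed.

(** The inserted block is a face if and only if it stays below its own chord and the line of the
    same slope through the insertion point supports the remaining configuration. The two conditions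
    separate the shape of [z] from the place [a]. *)
Lemma face_insert n a j (y1 z y2 : seq R) : size y1 = a -> size z = j ->
  (size (y1 ++ z ++ y2) = n)%N ->
  face n (psum (y1 ++ z ++ y2)) a (a + j) =
  face j (psum z) 0 j && amax (n - j).+1 (excess j (psum z j) (psum (y1 ++ y2))) a.
Proof.
move=> s1 sz sn; set Y := y1 ++ z ++ y2.
have an : (a + j <= n)%N by rewrite -sn !size_cat s1 sz addnA leq_addr.
have P1 i : (i <= a)%N -> psum Y i = psum (y1 ++ y2) i.
  by move=> ia; rewrite !psum_cat_l ?s1.
have P2 i : (i <= j)%N -> psum Y (a + i) = (psum Y a + psum z i)%R.
  move=> ij; rewrite /Y -{1}s1 psum_cat_r psum_cat_l ?sz//.
  by rewrite psum_cat_l ?s1.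
have P3 i : psum Y (a + j + i) = (psum z j + psum (y1 ++ y2) (a + i))%R.
  have := psum_cat_r y1 (z ++ y2) (j + i); rewrite s1 addnA => ->.
  have := psum_cat_r z y2 i; rewrite sz => ->.
  by have := psum_cat_r y1 y2 i; rewrite s1 => ->; rewrite addrCA.
have G : (psum Y (a + j) - psum Y a = psum z j)%R by rewrite P2// addrC addKr.
apply/faceP/andP => [H|[/faceP Hz /allP Ha] i ilt].
  split.
    apply/faceP => i ij; have := H (a + i)%N.
    rewrite (leq_trans _ an) ?leq_add2l// => /(_ isT).
    rewrite /below G P2// psum0 !natrD; lra.
  apply/allP => i; rewrite mem_iota add0n ltnS => /andP[_ ilt].
  rewrite /excess -(P1 a)//; have [ia|ai] := leqP i a.
    have := H i; rewrite (leq_trans ilt) ?leq_subr// => /(_ isT).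
    rewrite /below G P1// natrD; lra.
  have := H (i + j)%N; have -> : (i + j <= n)%N by lia.
  move=> /(_ isT); rewrite /below G.
  have -> : psum Y (i + j) = (psum z j + psum (y1 ++ y2) i)%R.
    have -> : (i + j = a + j + (i - a))%N by lia.
    by rewrite P3 subnKC// ltnW.
  rewrite !natrD; lra.
rewrite /below G; have [ia|ai] := leqP i a.
  have := Ha i; rewrite mem_iota add0n ltnS => /(_ _)/=.
  have -> : (i <= n - j)%N by lia.
  move=> /(_ isT); rewrite /excess -(P1 a)// -(P1 i)// natrD; lra.
have [ij|ji] := leqP i (a + j)%N.
  have := Hz (i - a)%N; have -> : (i - a <= j)%N by lia.
  move=> /(_ isT); rewrite /below psum0.
  have -> : psum Y i = (psum Y a + psum z (i - a))%R.
    by rewrite -P2 ?subnKC// ?(ltnW ai)//; lia.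
  rewrite natrB ?(ltnW ai)// natrD; lra.
have := Ha (i - j)%N; rewrite mem_iota add0n ltnS => /(_ _)/=.
have -> : (i - j <= n - j)%N by lia.
move=> /(_ isT); rewrite /excess -(P1 a)//.
have -> : psum Y i = (psum z j + psum (y1 ++ y2) (i - j))%R.
  have {1}-> : (i = a + j + (i - a - j))%N by lia.
  by rewrite P3; congr (_ + psum _ _)%R; lia.
rewrite natrB ?natrD; [lra|lia].
Qed.

Lemma measurable_excess d (X : measurableType d) j (g : X -> R) (S : X -> nat -> R) i :
  measurable_fun setT g -> (forall i, measurable_fun setT (S ^~ i)) ->
  measurable_fun setT (fun x => excess j (g x) (S x) i).
Proof. by move=> mg mS; apply: measurable_funB; exact: measurable_funM. Qed.

Lemma measurable_amax d (X : measurableType d) m (f : X -> nat -> R) i :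
  (forall i, measurable_fun setT (f ^~ i)) ->
  measurable_fun setT (fun x => amax m (f x) i).
Proof. by move=> mf; apply: measurable_all => k; exact: measurable_fun_ler. Qed.

(* Exactly one rotation of a generic sequence stays below its chord. *)
Lemma It_good j (H : R -> \bar R) : (0 < j)%N -> measurable_fun setT H ->
  (forall g, 0 <= H g) ->
  Ex j (fun z => (face j (psum z) 0 j)%:R%:E * H (psum z j)) =
  (j%:R^-1)%:E * Ex j (fun z => H (psum z j)).
Proof.
move=> j0 mH H0.
have mHs : measurable_fun setT (fun z : seq R => H (psum z j)).
  by apply: (measurableT_comp mH); exact: measurable_psum.
have mgood : measurable_fun setT (fun z : seq R => (face j (psum z) 0 j)%:R%:E * H (psum z j)).
  apply: emeasurable_funM => //; apply: measurable_b2E; apply: measurable_face => i.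
  exact: measurable_psum.
have mex i : measurable_fun setT (fun z : seq R => excess j (psum z j) (psum z) i).
  by apply: measurable_excess => [|k]; exact: measurable_psum.
have mam k : measurable_fun setT (fun z : seq R =>
    (amax j (excess j (psum z j) (psum z)) k)%:R%:E * H (psum z j)).
  apply: emeasurable_funM => //; apply: measurable_b2E.
  exact: (@measurable_amax _ _ _ (fun z => excess j (psum z j) (psum z)) k).
set L := (LHS).
have -> : Ex j (fun z => H (psum z j)) = j%:R%:E * L.
  transitivity (Ex j (fun z => \sum_(k < j)
      (amax j (excess j (psum z j) (psum z)) k)%:R%:E * H (psum z j))).
    apply: (It_ae (degenerate_negl j)) => //.
    - exact: emeasurable_sum.
    - by move=> z; apply: sume_ge0 => i _; rewrite mule_ge0 ?lee_fin.
    move=> z sz gz; rewrite -ge0_sume_distrl; last by move=> i _; rewrite lee_fin.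
    rewrite sumEFin sum_amax ?mul1e// => i k /andP[ik kj].
    have ikj : (i < k <= j)%N by rewrite ik ltnW.
    have jj : (0 < j <= j)%N by rewrite j0 leqnn.
    have ne : (i, k) != (0%N, j) by rewrite xpair_eqE (ltn_eqF kj) andbF.
    have := generic_neq gz ikj jj ne; apply: contra_neq.
    rewrite /excess psum0 !subr0; lra.
  rewrite It_sum//; last by move=> i s; rewrite mule_ge0 ?lee_fin.
  rewrite (eq_bigr (fun=> L)) => [|k _]; first by rewrite mule_natl sumr_const card_ord.
  rewrite /L -[RHS](@It_rot _ k)//; last 2 first.
  - exact: ltnW.
  - by move=> s; rewrite mule_ge0 ?lee_fin.
  apply: It_ext => z sz; rewrite good_rot//.
  congr (_ * H _).
  by have := psum_rot z k; rewrite sz.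
by rewrite muleA -EFinM mulVf ?mul1e// pnatr_eq0 -lt0n.
Qed.

(** For given [g], a tie prescribes the sum of the increments between the two places. *)
Lemma excess_tie_negl m j (g : R) : (0 < j)%N -> It_negl (@wexp R) m (fun y =>
  has (fun p : nat * nat => (p.1 < p.2 <= m)%N &&
      (excess j g (psum y) p.1 == excess j g (psum y) p.2)%R)
    (allpairs pair (iota 0 m.+1) (iota 0 m.+1))).
Proof.
move=> j0; apply: It_negl_has => -[i k] _ /=.
case: (boolP (i < k <= m)%N) => [/andP[ik km]|_]; last exact: It_negl_false.
apply: (It_negl_sub (@It_lin_null _ wexp m (fun l => (i <= l < k)%N%:R)
    ((k%:R - i%:R) * g / j%:R)%R i _ _)).
- exact: leq_trans km.
- by rewrite leqnn ik oner_neq0.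
- apply: measurable_fun_eqr; apply: measurable_excess => // l; exact: measurable_psum.
- move=> y _ /eqP H /=; rewrite -(@psumB _ y i k m) ?(ltnW ik)//.
  have j1 : (j%:R != 0 :> R)%R by rewrite pnatr_eq0 -lt0n.
  apply/eqP; apply: (mulIf j1); rewrite mulfVK//.
  by move: H; rewrite /excess; lra.
Qed.

Definition cutout (p j : nat) (y : seq R) : seq R := take p y ++ drop (p + j) y.

Lemma measurable_cutout p j : measurable_fun setT (cutout p j).
Proof. by apply: measurable_fun_cat; [exact: measurable_fun_take|exact: measurable_fun_drop]. Qed.

Section size_bias.
Variable K : nat -> R -> seq R -> \bar R.
Hypothesis mK : forall j, measurable_fun setT (fun p => K j p.1 p.2).
Hypothesis K0 : forall j g y, 0 <= K j g y.

(** [K j g y] values a face of length [j] and total increment [g], where [y] is the sequence left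
    after its removal. *)
Definition sumfaces n (y : seq R) : \bar R :=
  \sum_(0 <= a < n.+1) \sum_(a.+1 <= b < n.+1)
    if face n (psum y) a b
    then K (b - a) (psum y b - psum y a)%R (cutout a (b - a) y) else 0.

Lemma measurable_sumfaces_term n a b : measurable_fun setT (fun y : seq R =>
  if face n (psum y) a b
    then K (b - a) (psum y b - psum y a)%R (cutout a (b - a) y) else 0).
Proof.
apply: measurable_fun_ifT => //; first by apply: measurable_face => i; exact: measurable_psum.
apply: (measurableT_comp (mK (b - a)) (g := fun y : seq R => ((psum y b - psum y a)%R, cutout a (b - a) y))).
apply: measurable_fun_pair; last exact: measurable_cutout.
by apply: measurable_funB; exact: measurable_psum.
Qed.

Lemma measurable_sumfaces n : measurable_fun setT (sumfaces n).
Proof.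
apply: emeasurable_sum => a; apply: emeasurable_sum => b; exact: measurable_sumfaces_term.
Qed.

Lemma sumfaces_ge0 n y : 0 <= sumfaces n y.
Proof. by apply: sume_ge0 => a _; apply: sume_ge0 => b _; case: ifP. Qed.

Let G m a j (z y : seq R) : \bar R := (face j (psum z) 0 j)%:R%:E *
  ((amax m (excess j (psum z j) (psum y)) a)%:R%:E * K j (psum z j) y).

Let mG m a j : measurable_fun setT (fun p => G m a j p.1 p.2).
Proof.
apply: emeasurable_funM.
  apply: measurable_b2E; apply: measurable_face => i.
  by apply: measurable_psum_fun.
apply: emeasurable_funM.
  apply: measurable_b2E.
  apply: (@measurable_amax _ _ _ (fun p : seq R * seq R => excess j (psum p.1 j) (psum p.2)) a) => i.
  by apply: measurable_excess => [|k]; apply: measurable_psum_fun.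
apply: (measurableT_comp (mK j) (g := fun p : seq R * seq R => (psum p.1 j, p.2))).
by apply: measurable_fun_pair => //; exact: measurable_psum_fun.
Qed.

Let G0 m a j z y : 0 <= G m a j z y. Proof. by rewrite !mule_ge0 ?lee_fin. Qed.

(** The sequence is split as [y1 ++ z ++ y2] with [z] the block of the face; [face_insert] factors
    the condition, and the integral over [z] is exchanged with the one over [y1]. *)
Lemma It_face_insert n a j : (0 < j)%N -> (a + j <= n)%N ->
  Ex n (fun y => if face n (psum y) a (a + j)
    then K (a + j - a) (psum y (a + j) - psum y a)%R (cutout a (a + j - a) y) else 0) =
  Ex j (fun z => Ex (n - j) (fun y => (face j (psum z) 0 j)%:R%:E *
    ((amax (n - j).+1 (excess j (psum z j) (psum y)) a)%:R%:E * K j (psum z j) y))).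
Proof.
move=> j0 ajn.
rewrite -{1}(subnKC ajn) -addnA It_cat.
transitivity (Ex a (fun y1 => Ex j (fun z => Ex (n - (a + j)) (fun y2 => G (n - j).+1 a j z (y1 ++ y2))))).
  apply: It_ext => y1 s1; rewrite It_cat; apply: It_ext => z sz; apply: It_ext => y2 s2.
  have sn : size (y1 ++ z ++ y2) = n by rewrite !size_cat s1 sz s2; lia.
  rewrite (face_insert s1 sz sn) /G addKn.
  case: (face j (psum z) 0 j) => /=; last by rewrite mul0e.
  rewrite mul1e; case: amax => /=; last by rewrite mul0e.
  rewrite mul1e; congr (K _ _ _).
    rewrite -{1}s1 psum_cat_r !psum_cat_l ?sz ?s1//.
    by rewrite addrAC subrr add0r.
  rewrite /cutout -{1}s1 take_size_cat// catA drop_cat size_cat s1 sz ltnn subnn drop0//.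
rewrite It_swap.
- apply: It_ext => z sz.
  transitivity (Ex (a + (n - (a + j))) (G (n - j).+1 a j z)); first by rewrite It_cat.
  by congr (Ex _ _); lia.
- apply: (@measurable_It _ _ _ _ _ (fun (p : seq R * seq R) y2 => G (n - j).+1 a j p.2 (p.1 ++ y2))) => //.
  apply: (measurableT_comp (mG _ _ _) (g := fun q : (seq R * seq R) * seq R => (q.1.2, q.1.1 ++ q.2))).
  apply: measurable_fun_pair; first by apply: measurableT_comp.
  by apply: measurable_fun_cat => //; apply: measurableT_comp.
- by move=> y1 z; exact: It_ge0.
Qed.

(* The block of increments of a face can be exchanged to the front: for a generic
   block below its chord there is exactly one place of the remaining sequence where
   it is a face. *)
Lemma It_sumfaces n : Ex n (sumfaces n) =
  \sum_(1 <= j < n.+1) (j%:R^-1)%:E *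
    Ex j (fun z => Ex (n - j) (fun y => K j (psum z j) y)).
Proof.
rewrite /sumfaces It_sum; last 2 first.
- by move=> a; apply: emeasurable_sum => b; exact: measurable_sumfaces_term.
- by move=> a s; apply: sume_ge0 => b _; case: ifP.
under eq_bigr => a _.
  rewrite It_sum; [|by move=> b; exact: measurable_sumfaces_term|by move=> b s; case: ifP].
  over.
rewrite big_nat_triangle; apply: eq_big_nat => j /andP[j0 jn].
under eq_big_nat => a /andP[_ aj].
  rewrite It_face_insert//; last by lia.
  over.
have mKz g : measurable_fun setT (K j g).
  by apply: (measurableT_comp (mK j) (g := fun y => (g, y))); exact: measurable_fun_pair.
have mamK z a : measurable_fun setT (fun y : seq R =>
    (amax (n - j).+1 (excess j (psum z j) (psum y)) a)%:R%:E * K j (psum z j) y).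
  apply: emeasurable_funM => //; apply: measurable_b2E.
  apply: (@measurable_amax _ _ _ (fun y : seq R => excess j (psum z j) (psum y)) a) => i.
  by apply: measurable_excess => [|k] //; exact: measurable_psum.
pose H g := Ex (n - j) (K j g).
have mH : measurable_fun setT H.
  by apply: (@measurable_It _ wexp (n - j) _ _ (K j)); [exact: mK|exact: K0].
have H0 g : 0 <= H g by exact: It_ge0.
rewrite -[RHS](@It_good j H)//.
rewrite -It_sum.
- apply: It_ext => z sz.
  rewrite /H -ItZl ?lee_fin// -It_sum; last 2 first.
  - move=> a; apply: emeasurable_funM => //; exact: measurable_cst.
  - by move=> a y; exact: (G0 (n - j).+1 a j z y).
  apply: (It_ae (excess_tie_negl (n - j) (psum z j) j0)).
  - by apply: emeasurable_sum => a; apply: emeasurable_funM => //; exact: measurable_cst.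
  - by apply: emeasurable_funM => //; exact: measurable_cst.
  - by move=> y; apply: sume_ge0 => a _; exact: (G0 (n - j).+1 a j z y).
  - by move=> y; rewrite mule_ge0 ?lee_fin.
  move=> y sy /hasPn nt.
  rewrite -ge0_sume_distrr; last by move=> a _; rewrite mule_ge0 ?lee_fin.
  congr (_ * _); rewrite -ge0_sume_distrl; last by move=> a _; rewrite lee_fin.
  rewrite big_mkord sumEFin sum_amax ?mul1e// => i k /andP[ik kn].
  have /nt : (i, k) \in allpairs pair (iota 0 (n - j).+1) (iota 0 (n - j).+1).
    by apply: allpairs_f; rewrite mem_iota// add0n (ltn_trans ik kn).
  by rewrite /= ik -ltnS kn.
- move=> a; exact: (@measurable_It _ _ _ _ _ (fun z y => G (n - j).+1 a j z y)).
- by move=> a z; apply: It_ge0 => y; exact: (G0 (n - j).+1 a j z y).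
Qed.

End size_bias.

Lemma psum_cutout n p j (y : seq R) i : (p + j <= n)%N -> size y = n -> (i <= n - j)%N ->
  psum (cutout p j y) i = remove (psum y) p j i.
Proof.
move=> pjn sy ilt; rewrite /remove /cutout.
have s1 : size (take p y) = p by rewrite size_takel// sy; lia.
have [ip|pi] := leqP i p.
  rewrite psum_cat_l ?s1// -{2}(cat_take_drop p y) psum_cat_l ?s1//.
have -> : (i = p + (i - p))%N by lia.
have := psum_cat_r (take p y) (drop (p + j) y) (i - p); rewrite s1 => ->.
have -> : (p + (i - p) + j = p + j + (i - p))%N by lia.
have s2 : size (take (p + j) y) = (p + j)%N by rewrite size_takel// sy.
have := psum_cat_r (take (p + j) y) (drop (p + j) y) (i - p).
rewrite cat_take_drop s2 => ->.
have -> : psum (take (p + j) y) (p + j) = psum y (p + j).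
  by rewrite -{2}(cat_take_drop (p + j) y) psum_cat_l ?s2.
have -> : psum (take p y) p = psum y p.
  by rewrite -{2}(cat_take_drop p y) psum_cat_l ?s1.
by rewrite opprB addrCA addrA addrAC [X in _ = (_ + X)%R]addrC; ring.
Qed.

Section recursion.
Variables (psi : nat -> R -> R).
Hypothesis mpsi : forall j, measurable_fun setT (psi j).

Lemma measurable_Fsum_psum n : measurable_fun setT (fun y : seq R => Fsum psi n (psum y)).
Proof. by apply: measurable_Fsum => // i; exact: measurable_psum. Qed.

(** Each face is valued by its length times [Phi] of the whole sum. The lengths add up to [n] on the
    left, and on the right they cancel the [1 / j] of the cycle lemma. [Fsum_remove] expresses the
    whole sum through the face and the sequence without it. *)
Lemma It_Fsum_rec n (Phi : R -> \bar R) : measurable_fun setT Phi -> (forall x, 0 <= Phi x) ->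
  n%:R%:E * Ex n (fun y => Phi (Fsum psi n (psum y))) =
  \sum_(1 <= j < n.+1) Ex j (fun z => Ex (n - j) (fun y =>
    Phi (psi j (psum z j) + Fsum psi (n - j) (psum y))%R)).
Proof.
move=> mPhi Phi0.
pose K j g y := j%:R%:E * Phi (psi j g + Fsum psi (n - j) (psum y))%R.
have mK0 j : measurable_fun setT (fun p : R * seq R =>
    Phi (psi j p.1 + Fsum psi (n - j) (psum p.2))%R).
  apply: (measurableT_comp mPhi); apply: measurable_funD.
    by apply: (measurableT_comp (mpsi j)).
  by apply: (measurableT_comp (measurable_Fsum_psum (n - j))).
have mK j : measurable_fun setT (fun p : R * seq R => K j p.1 p.2).
  by apply: emeasurable_funM => //; exact: measurable_cst.
have K0 j g y : 0 <= K j g y by rewrite mule_ge0 ?lee_fin.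
have mF : measurable_fun setT (fun y : seq R => Phi (Fsum psi n (psum y))).
  by apply: (measurableT_comp mPhi); exact: measurable_Fsum_psum.
transitivity (Ex n (sumfaces K n)).
  rewrite -ItZl ?lee_fin//; apply: (It_ae (degenerate_negl n)).
  - by apply: emeasurable_funM => //; exact: measurable_cst.
  - exact: measurable_sumfaces.
  - by move=> y; rewrite mule_ge0 ?lee_fin.
  - exact: sumfaces_ge0.
  move=> y sy gy; rewrite /sumfaces.
  have -> : n%:R%:E = \sum_(0 <= a < n.+1) \sum_(a.+1 <= b < n.+1)
      ((if face n (psum y) a b then b - a else 0)%N%:R : R)%:E.
    under eq_bigr do rewrite sumEFin -natr_sum.
    by rewrite sumEFin -natr_sum -{1}(Fsum_length gy).
  rewrite ge0_sume_distrl; last first.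
    by move=> a _; apply: sume_ge0 => b _; rewrite lee_fin.
  apply: eq_big_nat => a /andP[_ an].
  rewrite ge0_sume_distrl; last by move=> b _; rewrite lee_fin.
  apply: eq_big_nat => b /andP[ab bn].
  case: (boolP (face n (psum y) a b)) => fab; last by rewrite mul0e.
  rewrite /K; congr (_ * Phi _).
  have abn : (a + (b - a) = b)%N by lia.
  rewrite (@Fsum_remove _ n (psum y) a (b - a))//; [|lia|lia|by rewrite abn].
  rewrite abn; congr (_ + _)%R; apply: Fsum_ext => i ilt.
  by rewrite (psum_cutout (n := n))//; lia.
rewrite It_sumfaces//; apply: eq_big_nat => j /andP[j0 jn].
rewrite -ItZl.
- apply: It_ext => z sz; rewrite ItZl ?lee_fin//.
  + by rewrite muleA -EFinM mulVf ?mul1e// pnatr_eq0 -lt0n.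
  + apply: (measurableT_comp (mK0 j) (g := fun y => (psum z j, y))).
    exact: measurable_fun_pair.
- apply: (@measurable_It _ _ _ _ _ (fun (z : seq R) y => K j (psum z j) y)) => //.
  apply: (measurableT_comp (mK j) (g := fun q : seq R * seq R => (psum q.1 j, q.2))).
  by apply: measurable_fun_pair => //; exact: measurable_psum_fun.
- by move=> z; apply: It_ge0.
- by rewrite lee_fin invr_ge0.
Qed.

(** Here the value of a face does not depend on the rest, whose expectation is then trivial. The
    means of all error terms come from this formula. *)
Lemma It_Fsum n : (forall j g, 0 <= psi j g)%R ->
  Ex n (fun y => (Fsum psi n (psum y))%:E) =
  \sum_(1 <= j < n.+1) (j%:R^-1)%:E * Ex j (fun z => (psi j (psum z j))%:E).
Proof.
move=> psi0.
have mK j : measurable_fun setT (fun p : R * seq R => (psi j p.1)%:E).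
  by apply/measurable_EFinP; apply: (measurableT_comp (mpsi j)).
have K0 j g (y : seq R) : 0 <= (psi j g)%:E by rewrite lee_fin.
have := It_sumfaces (K := fun j g _ => (psi j g)%:E) mK K0 n.
under [in X in _ = X -> _]eq_bigr => j _.
  under It_ext => z _ do rewrite It_cst ?wexp1 ?lee_fin//.
  over.
move=> <-; apply: It_ext => y _; rewrite /sumfaces /Fsum -sumEFin.
apply: eq_bigr => a _; rewrite -sumEFin; apply: eq_bigr => b _.
by case: ifP.
Qed.

End recursion.

End decomposition.

(** * Moments of gamma variables *)

Section gamma.
Context {R : realType}.
Local Notation mu := (@lebesgue_measure R).
Local Open Scope ereal_scope.
Local Notation Ex := (It (@wexp R)).

Lemma It_wexp_ext n (F G : seq R -> \bar R) :
  (forall y, size y = n -> all (fun x => 0 < x)%R y -> F y = G y) -> Ex n F = Ex n G.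
Proof.
elim: n F G => [|n IH] F G FG /=; first exact: FG.
apply: eq_integral => x _; have [x0|x0] := ltP 0%R x; last first.
  by rewrite /wexp/= mul0r !mul0e.
by congr (_ * _); apply: IH => s ss s0; apply: FG; rewrite /= ?ss ?x0.
Qed.

Lemma psum_cons (x : R) s k : psum (x :: s) k.+1 = (x + psum s k)%R.
Proof. by rewrite /psum big_ord_recl. Qed.

Lemma psum_gt0 (y : seq R) k : (0 < k <= size y)%N -> all (fun x => 0 < x)%R y -> (0 < psum y k)%R.
Proof.
elim: y k => [|x y IH] [|k]//= ky /andP[x0 y0].
rewrite psum_cons; case: k ky => [|k] ky; first by rewrite psum0 addr0.
by rewrite addr_gt0// IH.
Qed.

(* The sum of two standard exponential variables has density [u e^{-u}]. *)
Lemma integral_wexp_conv (K : R -> \bar R) : measurable_fun setT K -> (forall u, 0 <= K u) ->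
  \int[mu]_x ((wexp x)%:E * \int[mu]_y ((wexp y)%:E * K (x + y)%R)) =
  \int[mu]_u ((wexp u)%:E * (`|u|%:E * K u)).
Proof.
move=> mK K0.
pose f (p : R * R) := (wexp p.1)%:E * ((wexp (p.2 - p.1)%R)%:E * K p.2).
have mf : measurable_fun setT f.
  apply: emeasurable_funM.
    by apply: (measurableT_comp (measurable_weightE wexp)).
  apply: emeasurable_funM; last exact: measurableT_comp.
  apply: (measurableT_comp (measurable_weightE wexp) (g := fun p : R * R => (p.2 - p.1)%R)).
  exact: measurable_funB.
have f0 p : 0 <= f p by rewrite !mule_ge0 ?lee_fin ?weight_ge0.
transitivity (\int[mu]_x \int[mu]_u f (x, u)).
  apply: eq_integral => x _.
  have mg : measurable_fun setT (fun u : R => (wexp (u - x)%R)%:E * K u).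
    apply: emeasurable_funM => //.
    apply: (measurableT_comp (measurable_weightE wexp) (g := fun u : R => (u - x)%R)).
    exact: measurable_funB.
  transitivity (\int[mu]_u ((wexp x)%:E * ((wexp (u - x)%R)%:E * K u))); last by [].
  have g0 (u : R) : 0 <= (wexp (u - x)%R)%:E * K u.
    by rewrite mule_ge0 ?lee_fin ?weight_ge0.
  have wx0 : 0 <= (wexp x)%:E by rewrite lee_fin weight_ge0.
  transitivity ((wexp x)%:E * \int[mu]_u ((wexp (u - x)%R)%:E * K u)); last first.
    apply/esym; apply: ge0_integralZl; [exact: measurableT|exact: mg|by move=> u _; exact: g0|exact: wx0].
  have E := integral_affine x ltr01 mg g0; rewrite mul1e in E.
  suff -> : \int[mu]_y ((wexp y)%:E * K (x + y)%R) = \int[mu]_u ((wexp (u - x)%R)%:E * K u).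
    by [].
  rewrite E; apply: eq_integral => y _; by rewrite mul1r addrK addrC.
transitivity (\int[mu]_u \int[mu]_x f (x, u)).
  exact: (@fubini_tonelli _ _ _ _ _ mu mu f mf f0).
apply: eq_integral => u _.
transitivity (\int[mu]_x ((\1_(`]0%R, u[%classic : set R) x)%:E * ((expR (- u))%:E * K u))).
  apply: eq_integral => x _; rewrite /f/= muleA; rewrite !muleA -!EFinM; congr (_%:E * _).
  rewrite indicE mem_setE in_itv/= subr_gt0.
  case: (0 < x)%R; case: (x < u)%R; rewrite ?(mul0r,mulr0,mul1r)//.
  by rewrite -expRD opprB addKr.
rewrite ge0_integralZr//; last 2 first.
- by apply/measurable_EFinP; apply: measurable_indic; exact: measurable_itv.
- by rewrite mule_ge0 ?lee_fin ?expR_ge0.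
rewrite integral_indic// setIT.
rewrite [X in X * _](_ : _ = lebesgue_measure (`]0%R, u[%classic : set R))//.
rewrite lebesgue_measure_itv/= lte_fin sube0.
have [u0|u0] := ltP 0%R u; last by rewrite !mul0r !mul0e.
by rewrite mul1r ger0_norm ?(ltW u0)// muleCA.
Qed.

Section functional.
Variable H : R -> \bar R.
Hypothesis mH : measurable_fun setT H.
Hypothesis H0 : forall g, 0 <= H g.

Lemma measurable_comp_psum n : measurable_fun setT (fun z : seq R => H (psum z n)).
Proof. by apply: (measurableT_comp mH); exact: measurable_psum. Qed.

(* Size-biasing a gamma variable raises its index by one. *)
Lemma It_wexp_size_bias j :
  Ex j (fun z => `|psum z j|%:E * H (psum z j)) = j%:R%:E * Ex j.+1 (fun z => H (psum z j.+1)).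
Proof.
have mn i : measurable_fun setT (fun z : seq R => `|nth 0%R z i|%:E).
  by apply/measurable_EFinP; apply: measurableT_comp => //; exact: measurable_nth.
have mnH i : measurable_fun setT (fun z : seq R => `|nth 0%R z i|%:E * H (psum z j)).
  by apply: emeasurable_funM => //; exact: measurable_comp_psum.
have nH0 i z : 0 <= `|nth 0%R z i|%:E * H (psum z j) by rewrite mule_ge0 ?lee_fin.
transitivity (Ex j (fun z => \sum_(i <- iota 0 j) `|nth 0%R z i|%:E * H (psum z j))).
  apply: It_wexp_ext => z sz z0; rewrite -ge0_sume_distrl; last first.
    by move=> i _; rewrite lee_fin.
  congr (_ * _); rewrite sumEFin; congr EFin.
  have -> : psum z j = (\sum_(i <- iota 0 j) nth 0 z i)%R.
    by rewrite /psum -(big_mkord xpredT (fun i => nth 0%R z i)) /index_iota subn0.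
  rewrite ger0_norm; last first.
    rewrite big_seq; apply: sumr_ge0 => i; rewrite mem_iota add0n => /andP[_ ij].
    by apply/ltW/(allP z0)/mem_nth; rewrite sz.
  apply: eq_big_seq => i; rewrite mem_iota add0n => /andP[_ ij].
  by rewrite gtr0_norm//; apply/(allP z0)/mem_nth; rewrite sz.
rewrite It_sum//.
transitivity (\sum_(i <- iota 0 j) Ex j (fun z => `|nth 0%R z 0|%:E * H (psum z j))).
  apply: eq_big_seq => i; rewrite mem_iota add0n => /andP[_ ij].
  rewrite -[RHS](@It_rot _ _ i)//; last exact: ltnW.
  apply: It_ext => z sz; congr (`|_|%:E * H _).
    by rewrite /rot nth_cat size_drop sz subn_gt0 ij nth_drop addn0.
  by have := psum_rot z i; rewrite sz => ->.
have -> : iota 0 j = index_iota 0 j by rewrite /index_iota subn0.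
transitivity (j%:R%:E * Ex j (fun z => `|nth 0%R z 0|%:E * H (psum z j))).
  by rewrite mule_natl sumr_const_nat subn0.
case: j mnH nH0 => [|j] mnH nH0; first by rewrite !mul0e.
congr (_ * _) => /=.
pose K u := Ex j (fun s => H (u + psum s j)%R).
have mHK : measurable_fun setT (fun p : R * seq R => H (p.1 + psum p.2 j)%R).
  apply: (measurableT_comp mH); apply: measurable_funD => //.
  exact: measurable_psum_fun.
have mK : measurable_fun setT K.
  pose Hu (u : R) (s : seq R) := H (u + psum s j)%R.
  by apply: (@measurable_It _ wexp j _ _ Hu) => // u s; exact: H0.
have K0 u : 0 <= K u by exact: It_ge0.
have mHu u : measurable_fun setT (fun s : seq R => H (u + psum s j)%R).
  by apply: (measurableT_comp mHK (g := fun s => (u, s))); exact: measurable_fun_pair.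
transitivity (\int[mu]_u ((wexp u)%:E * (`|u|%:E * K u))).
  apply: eq_integral => x _; congr (_ * _); rewrite /K -ItZl ?lee_fin//.
  by apply: It_ext => s ss; rewrite psum_cons.
apply: etrans (esym (integral_wexp_conv mK K0)) _; apply: eq_integral => x _; congr (_ * _).
apply: eq_integral => y _; congr (_ * _); apply: It_ext => s _.
by rewrite !psum_cons addrA.
Qed.

End functional.

(** The rising factorial [j (j + 1) ... (j + k - 1)], which is the [k]-th moment of a gamma variable
    of index [j]. *)
Definition rising (j k : nat) : R := (\prod_(i < k) (j + i)%:R)%R.

Lemma risingS j k : rising j k.+1 = (j%:R * rising j.+1 k)%R.
Proof.
rewrite /rising big_ord_recl addn0; congr (_ * _)%R; apply: eq_bigr => i _.
by rewrite /= /bump/= add1n addnS.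
Qed.

(** Repeated size-biasing. The absolute value makes the integrand nonnegative on all sequences, as
    [It] requires; [wexp] only charges positive ones. *)
Lemma It_wexp_moment j k : Ex j (fun z => (`|psum z j| ^+ k)%:E) = (rising j k)%:E.
Proof.
elim: k j => [|k IH] j.
  transitivity (Ex j (fun=> 1)); first by apply: It_ext => z _; rewrite expr0.
  by rewrite /rising big_ord0 It_cst ?wexp1.
rewrite risingS EFinM -IH -(@It_wexp_size_bias (fun g => (`|g| ^+ k)%:E)).
- by apply: It_ext => z _; rewrite exprS EFinM.
- by apply/measurable_EFinP; apply: measurable_funX; exact: normr_measurable.
- by move=> g; rewrite lee_fin exprn_ge0.
Qed.

End gamma.

Section linear_functional.
Context {R : realType}.
Local Open Scope ereal_scope.
Variables (w : @weight R) (n : nat).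

(* [It] is only linear on nonnegative functions; this lemma allows terms with
   negative coefficients. *)
Lemma It_lin_le (r : seq (R * (seq R -> R) * R)) :
  (forall t, List.In t r -> [/\ measurable_fun setT t.1.2, (forall y, 0 <= t.1.2 y)%R &
     It w n (fun y => (t.1.2 y)%:E) = t.2%:E]) ->
  (forall y, size y = n -> (\sum_(t <- r) t.1.1 * t.1.2 y <= 0)%R) ->
  (\sum_(t <- r) t.1.1 * t.2 <= 0)%R.
Proof.
move=> Hr Hle.
pose pos (t : R * (seq R -> R) * R) := Num.max t.1.1 0%R.
pose neg (t : R * (seq R -> R) * R) := Num.max (- t.1.1)%R 0%R.
have pn t : t.1.1 = (pos t - neg t)%R.
  by rewrite /pos /neg; case: (leP t.1.1 0%R); case: (leP (- t.1.1)%R 0%R); lra.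
have main (c : R * (seq R -> R) * R -> R) : (forall t, 0 <= c t)%R ->
   [/\ It w n (fun y => (\sum_(t <- r) c t * t.1.2 y)%R%:E) = (\sum_(t <- r) c t * t.2)%R%:E,
     measurable_fun setT (fun y => (\sum_(t <- r) c t * t.1.2 y)%R%:E) &
     forall y, 0 <= (\sum_(t <- r) c t * t.1.2 y)%R%:E].
  move=> c0; elim: r Hr {Hle} => [|t r IH] Hr.
    split; first by under It_ext do rewrite big_nil; rewrite big_nil It0.
      by under eq_fun do rewrite big_nil; exact: measurable_cst.
    by move=> y; rewrite big_nil.
  have [mt t0 Et] := Hr t (or_introl erefl).
  have [E1 m1 p1] := IH (fun t' H => Hr t' (or_intror H)).
  have mct : measurable_fun setT (fun y => (c t * t.1.2 y)%R%:E).
    by apply/measurable_EFinP; exact: measurable_funM.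
  have ct0 y : 0 <= (c t * t.1.2 y)%R%:E by rewrite lee_fin mulr_ge0.
  split.
  - under It_ext => y _ do rewrite big_cons EFinD.
    rewrite (@ItD _ w n (fun y => (c t * t.1.2 y)%R%:E))//.
    rewrite E1 big_cons EFinD; congr (_ + _).
    under It_ext => y _ do rewrite EFinM.
    by rewrite ItZl ?Et ?lee_fin//; exact/measurable_EFinP.
  - under eq_fun do rewrite big_cons EFinD.
    exact: emeasurable_funD.
  - by move=> y; rewrite big_cons EFinD adde_ge0.
have [|E1 m1 p1] := main pos; first by move=> t; rewrite le_max lexx orbT.
have [|E2 m2 p2] := main neg; first by move=> t; rewrite le_max lexx orbT.
rewrite (eq_bigr (fun t => pos t * t.2 - neg t * t.2)%R); last first.
  by move=> t _; rewrite {1}pn mulrBl.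
rewrite sumrB subr_le0 -lee_fin -E1 -E2; apply: le_It => // y sy.
rewrite lee_fin -subr_le0 -sumrB.
by under eq_bigr do rewrite -mulrBl -pn; exact: Hle.
Qed.

End linear_functional.

Section gamma_moments.
Context {R : realType}.
Local Open Scope ereal_scope.
Local Notation Ex := (It (@wexp R)).

Lemma psum_ge0 (y : seq R) k : (k <= size y)%N -> all (fun x => 0 < x)%R y -> (0 <= psum y k)%R.
Proof.
case: k => [|k] ky y0; first by rewrite psum0.
by apply/ltW/psum_gt0 => //; rewrite ky.
Qed.

(** The coefficients may be negative. The mean is first shown finite by the majorant with
    coefficients [|c k|], then determined by [It_lin_le] applied with both signs. *)
Lemma It_wexp_poly j (F : R -> R) N (c : nat -> R) : measurable_fun setT F ->
  (forall g, 0 <= g -> 0 <= F g)%R ->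
  (forall g, 0 <= g -> F g = \sum_(k < N) c k * g ^+ k)%R ->
  Ex j (fun z => (F (psum z j))%:E) = (\sum_(k < N) c k * rising j k)%R%:E.
Proof.
move=> mF F0 FE.
have mG : measurable_fun setT (fun z : seq R => `|psum z j|%R).
  by apply: measurableT_comp => //; exact: measurable_psum.
have mGk k : measurable_fun setT (fun z : seq R => (`|psum z j| ^+ k)%R).
  exact: measurable_funX.
have mFG : measurable_fun setT (fun z : seq R => F `|psum z j|%R).
  exact: (measurableT_comp mF).
transitivity (Ex j (fun z => (F `|psum z j|%R)%:E)).
  by apply: It_wexp_ext => z sz z0; rewrite ger0_norm// psum_ge0// sz.
have EG k := @It_wexp_moment R j k.
have fin : Ex j (fun z => (F `|psum z j|%R)%:E) \is a fin_num.
  rewrite ge0_fin_numE; last by apply: It_ge0 => z; rewrite lee_fin F0.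
  apply: (@le_lt_trans _ _ (\sum_(k <- iota 0 N) `|c k|%:E * (rising j k)%:E)); last first.
    by under eq_bigr do rewrite -EFinM; rewrite sumEFin ltry.
  under eq_bigr => k _.
    rewrite -EG -ItZl ?lee_fin//; first over.
    exact/measurable_EFinP.
  rewrite -It_sum.
  - apply: le_It => //.
    + exact/measurable_EFinP.
    + by apply: emeasurable_sum => k; apply: emeasurable_funM => //; exact/measurable_EFinP.
    + by move=> z; rewrite lee_fin F0.
    + by move=> z; apply: sume_ge0 => k _; rewrite mule_ge0 ?lee_fin ?exprn_ge0.
    + move=> z sz; rewrite FE// [X in _ <= X](eq_bigr (fun k => (`|c k| * `|psum z j| ^+ k)%R%:E))//.
      rewrite sumEFin lee_fin -(big_mkord xpredT (fun k => c k * `|psum z j| ^+ k)%R).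
      rewrite /index_iota subn0; apply: ler_sum => k _.
      by rewrite ler_wpM2r ?exprn_ge0// ler_norm.
  - by move=> k; apply: emeasurable_funM => //; exact/measurable_EFinP.
  - by move=> k z; rewrite mule_ge0 ?lee_fin ?exprn_ge0.
rewrite -(fineK fin); congr EFin; apply/eqP; rewrite eq_le -subr_le0 -[X in _ && X]subr_le0.
set m := fine _.
pose L (e : R) := ((e, fun z => F `|psum z j|%R, m) :: [seq ((- e * c k)%R, fun z => (`|psum z j| ^+ k)%R, rising j k) | k <- iota 0 N]).
have HL e : (\sum_(t <- L e) t.1.1 * t.2 = e * (m - \sum_(k < N) c k * rising j k))%R.
  rewrite big_cons big_map/= mulrBr mulr_sumr -sumrN; congr (_ + _)%R.
  rewrite -(big_mkord xpredT (fun k => - (e * (c k * rising j k)))%R) /index_iota subn0.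
  by apply: eq_bigr => k _; rewrite mulrA !mulNr.
have HL0 e : (e * (m - \sum_(k < N) c k * rising j k) <= 0)%R.
  rewrite -HL; apply: (@It_lin_le _ wexp j).
    move=> t; rewrite /L /= => -[<-/=|/List.in_map_iff[k [<- _]]/=].
      by split=> //; [move=> y; rewrite F0|rewrite fineK].
    by split.
  move=> y _; rewrite big_cons big_map/= FE//.
  rewrite -(big_mkord xpredT (fun k => c k * `|psum y j| ^+ k)%R) /index_iota subn0.
  rewrite mulr_sumr -big_split/= big1// => k _.
  by rewrite mulrA -mulrDl mulNr subrr mul0r.
by apply/andP; split; [have := HL0 1%R|have := HL0 (-1)%R]; rewrite ?mul1r// mulN1r opprB.
Qed.

(** This and the next two lemmas: the central gamma moments that give the first three moments of
    [(G - j) ^ 2 / j]. The lists are the coefficients of the binomial expansions in [g]. *)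
Lemma It_wexp_sq j : Ex j (fun z => ((psum z j - j%:R) ^+ 2)%:E) = j%:R%:E.
Proof.
rewrite (@It_wexp_poly j (fun g => (g - j%:R) ^+ 2)%R 3 (nth 0 [:: j%:R ^+ 2; - 2 * j%:R; 1])%R).
- congr EFin; rewrite !big_ord_recr big_ord0 /rising/= !big_ord_recr !big_ord0/= !natrD; ring.
- by apply: measurable_funX; exact: measurable_funB.
- by move=> g _; exact: sqr_ge0.
- by move=> g _; rewrite !big_ord_recr big_ord0/=; ring.
Qed.

Lemma It_wexp_four j : Ex j (fun z => ((psum z j - j%:R) ^+ 4)%:E) =
  (3 * j%:R ^+ 2 + 6 * j%:R)%R%:E.
Proof.
rewrite (@It_wexp_poly j (fun g => (g - j%:R) ^+ 4)%R 5
  (nth 0 [:: j%:R ^+ 4; - 4 * j%:R ^+ 3; 6 * j%:R ^+ 2; - 4 * j%:R; 1])%R).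
- congr EFin; rewrite !big_ord_recr big_ord0 /rising/= !big_ord_recr !big_ord0/= !natrD; ring.
- by apply: measurable_funX; exact: measurable_funB.
- by move=> g _; exact: exprn_even_ge0.
- by move=> g _; rewrite !big_ord_recr big_ord0/=; ring.
Qed.

Lemma It_wexp_six j : Ex j (fun z => ((psum z j - j%:R) ^+ 6)%:E) =
  (15 * j%:R ^+ 3 + 130 * j%:R ^+ 2 + 120 * j%:R)%R%:E.
Proof.
rewrite (@It_wexp_poly j (fun g => (g - j%:R) ^+ 6)%R 7
  (nth 0 [:: j%:R ^+ 6; - 6 * j%:R ^+ 5; 15 * j%:R ^+ 4; - 20 * j%:R ^+ 3;
             15 * j%:R ^+ 2; - 6 * j%:R; 1])%R).
- congr EFin; rewrite !big_ord_recr big_ord0 /rising/= !big_ord_recr !big_ord0/= !natrD; ring.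
- by apply: measurable_funX; exact: measurable_funB.
- by move=> g _; exact: exprn_even_ge0.
- by move=> g _; rewrite !big_ord_recr big_ord0/=; ring.
Qed.

(** With [l] large this bounds the probability that the sum of [j] exponential variables is much
    smaller than [j]. *)
Lemma It_wexp_laplace j (l : R) : (0 <= l)%R ->
  Ex j (fun z => (expR (- l * psum z j))%:E) = ((1 + l) ^- j)%:E.
Proof.
move=> l0; have l1 : (0 < 1 + l)%R by lra.
elim: j => [|j IH]; first by rewrite /= psum0 mulr0 expR0 expr0 invr1.
transitivity (\int[@lebesgue_measure R]_x ((wexp x)%:E * ((expR (- l * x))%:E * ((1 + l) ^- j)%:E))).
  apply: eq_integral => x _; congr (_ * _); rewrite -IH -ItZl ?lee_fin ?expR_ge0//.
  - by apply: It_ext => s _; rewrite psum_cons mulrDr expRD EFinM.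
  - apply/measurable_EFinP; apply: measurableT_comp => //.
    by apply: measurable_funM => //; exact: measurable_psum.
have mx : measurable_fun setT (fun x : R => (wexp ((1 + l) * x)%R)%:E).
  apply: (measurableT_comp (measurable_weightE wexp) (g := fun x : R => ((1 + l) * x)%R)).
  exact: measurable_funM.
transitivity (\int[@lebesgue_measure R]_x (((1 + l) ^- j)%:E * (wexp ((1 + l) * x)%R)%:E)).
  apply: eq_integral => x _; rewrite muleA muleC; congr (_ * _).
  rewrite /wexp/= pmulr_rgt0// -EFinM -mulrA -expRD; congr (_ * expR _)%:E; lra.
rewrite ge0_integralZl//; last 2 first.
- by move=> x _; rewrite lee_fin weight_ge0.
- by rewrite lee_fin invr_ge0 exprn_ge0// ltW.
have := @integral_affine R (1 + l)%R 0%R (fun x => (wexp x)%:E) l1 (measurable_weightE wexp).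
move=> /(_ (fun x => _)); rewrite wexp1 => /(_ (fun x => weight_ge0 wexp x)) E1.
rewrite (_ : \int[_]_x _ = ((1 + l)^-1)%:E); first by rewrite -EFinM exprSr invfM mulrC.
under eq_integral do rewrite -[((1 + l) * _)%R]addr0.
have l2 : (1 + l != 0)%R by rewrite gt_eqF.
move/(congr1 (fun t => ((1 + l)^-1)%R%:E * t)): E1.
by rewrite mule1 muleA -EFinM mulVf// mul1e => ->.
Qed.

End gamma_moments.

(** * Gaussian averages *)

Section normal_density_integral.
Context {R : realType}.
Local Notation mu := (@lebesgue_measure R).
Local Notation N := (@normal_prob R 0 1).
Local Open Scope ereal_scope.

Lemma wnorm_ge0 (x : R) : (0 <= normal_pdf 0 1 x)%R.
Proof. exact: normal_pdf_ge0. Qed.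

(** The opaque proof keeps the density from unfolding; it is known only through [wnorm_pdf]. *)
Lemma standard_normal_weight : {w : @weight R | forall x, w x = normal_pdf 0 1 x}.
Proof. by exists (Weight (@measurable_normal_pdf R 0 1) wnorm_ge0). Qed.

Definition wnorm := sval standard_normal_weight.

Lemma wnorm_pdf x : wnorm x = normal_pdf 0 1 x.
Proof. exact: (svalP standard_normal_weight). Qed.

Lemma wnorm1 : \int[mu]_x (wnorm x)%:E = 1.
Proof. by under eq_integral do rewrite wnorm_pdf; exact: integral_normal_pdf. Qed.

Import HBNNSimple.

Let integral_normal_nnsfun (f : {nnsfun (measurableTypeR R) >-> R}) :
  \int[N]_x (f x)%:E = \int[mu]_x ((wnorm x)%:E * (f x)%:E).
Proof.
have mw : measurable_fun setT (fun x => (wnorm x)%:E) by exact: measurable_weightE.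
under [LHS]eq_integral do rewrite fimfunE -fsumEFin//.
rewrite [LHS]ge0_integral_fsum//; last 2 first.
  - by move=> r; exact/measurable_EFinP/measurableT_comp.
  - by move=> n x _; rewrite EFinM nnfun_muleindic_ge0.
under [RHS]eq_integral.
  move=> x xD; rewrite fimfunE -fsumEFin// ge0_mule_fsumr; last first.
    by move=> r; rewrite EFinM nnfun_muleindic_ge0.
  over.
rewrite [RHS]ge0_integral_fsum//; last 2 first.
  - move=> r; apply: emeasurable_funM => //.
    by apply/measurable_EFinP; do 2 apply/measurableT_comp => //.
  - by move=> n x _; rewrite EFinM mule_ge0 ?nnfun_muleindic_ge0// lee_fin weight_ge0.
apply: eq_fsbigr => r _.
rewrite integralZl_indic_nnsfun//= integral_indic// setIT.
under [RHS]eq_integral do rewrite EFinM muleCA.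
have [r0|r0] := leP 0%R r.
  rewrite ge0_integralZl//; last 2 first.
  - apply: emeasurable_funM => //.
    by apply/measurable_EFinP; exact: measurable_indic.
  - by move=> x _; rewrite mule_ge0 ?lee_fin ?weight_ge0.
  congr (_ * _).
  transitivity (\int[mu]_(x in f @^-1` [set r]) (normal_pdf 0 1 x)%:E); first by [].
  rewrite [LHS]integral_mkcond; apply: eq_integral => x _.
  by rewrite patchE indicE wnorm_pdf; case: ifPn => xE; rewrite ?mule1 ?mule0.
rewrite (_ : f @^-1` [set r] = set0); last first.
  by apply/seteqP; split=> // x /= fx; move: r0; rewrite -fx ltNge fun_ge0.
rewrite measure0 mule0; under eq_integral do rewrite indic0 !mule0.
by rewrite integral0.
Qed.

(** The measure of a set is by definition the integral of the density over it; simple functions and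
    monotone convergence extend this to [f]. *)
Lemma integral_normal (f : _ -> \bar R) : measurable_fun setT f -> (forall x, 0 <= f x) ->
  \int[N]_x f x = \int[mu]_x ((wnorm x)%:E * f x).
Proof.
move=> mf f0.
have mw : measurable_fun setT (fun x => (wnorm x)%:E) by exact: measurable_weightE.
pose f_ := nnsfun_approx measurableT mf.
transitivity (lim (\int[N]_x (f_ n x)%:E @[n --> \oo])).
  rewrite -monotone_convergence//=.
  - apply: eq_integral => ? /[!inE] xD; apply/esym/cvg_lim => //=.
    exact: cvg_nnsfun_approx.
  - by move=> n; exact/measurable_EFinP/measurable_funTS.
  - by move=> n ? _; rewrite lee_fin.
  - by move=> ? _ ? ? mn; rewrite lee_fin; exact/lefP/nd_nnsfun_approx.
rewrite [RHS](_ : _ = lim (\int[mu]_x ((wnorm x)%:E * (f_ n x)%:E) @[n --> \oo])); last first.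
  rewrite -monotone_convergence//=.
  - apply: eq_integral => x /[!inE] xD; apply/esym/cvg_lim => //.
    by apply: cvgeZl => //; exact: cvg_nnsfun_approx.
  - by move=> n; apply: emeasurable_funM => //; exact/measurable_EFinP/measurable_funTS.
  - by move=> n x _; rewrite mule_ge0 ?lee_fin ?weight_ge0.
  - move=> x _ m n mn; rewrite lee_wpmul2l ?lee_fin ?weight_ge0//.
    exact/lefP/nd_nnsfun_approx.
by apply: congr_lim; apply/funext => n /=; exact: integral_normal_nnsfun.
Qed.

End normal_density_integral.

Section real_inequalities.
Context {R : realType}.

(** The hypothesis reads [(r - 1) / r <= (r - 1) (r + 1) / 2 * m]; dividing by [r - 1] and letting
    [r] tend to 1 from both sides leaves [m = 1]. It results from [1 - u <= expR (- u)] and the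
    Gaussian mean of [expR (- (r ^+ 2 - 1) / 2 * x ^+ 2)], so that no integration by parts
    occurs. *)
Lemma sq_moment_eq1 (m : R) : 0 <= m ->
  (forall r, 0 < r -> 1 - (r ^+ 2 - 1) / 2 * m - r^-1 <= 0) -> m = 1.
Proof.
move=> m_ge0 H; apply/eqP; rewrite eq_le; apply/andP; split.
- rewrite leNgt; apply/negP => m1; pose e := (m - 1) / (3 * m).
  have m0 : 0 < m by lra.
  have em : 3 * m * e = m - 1 by rewrite /e; field; lra.
  have e0 : 0 < e by rewrite divr_gt0; lra.
  have e1 : e < 1 / 3 by rewrite -(ltr_pM2l (_ : 0 < 3 * m)) ?em; lra.
  have r0 : 0 < 1 - e by lra.
  have := ler_wpM2l (ltW r0) (H _ r0); rewrite mulr0 mulrBr divff ?gt_eqF//.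
  nra.
- rewrite leNgt; apply/negP => m1; pose e := (1 - m) / 4.
  have em : m = 1 - 4 * e by rewrite /e; field.
  have e0 : 0 < e by rewrite divr_gt0; lra.
  have r0 : 0 < 1 + e by lra.
  have := ler_wpM2l (ltW r0) (H _ r0); rewrite mulr0 mulrBr divff ?gt_eqF//.
  rewrite em; nra.
Qed.

(** For [m] the Gaussian mean of [(x + 1) ^+ 2], the number [(m - 2) / 2] is the mean of [x]. The
    hypothesis comes from [1 + t x <= expR (t x)]; for small [t] of either sign it forces the mean
    to vanish. *)
Lemma mean_moment_eq2 (m : R) :
  (forall t, 1 + t / 2 * (m - 2) - expR (t ^+ 2 / 2) <= 0) -> m = 2.
Proof.
move=> H.
have H2 (t : R) : `|t| <= 1 -> t / 2 * (m - 2) <= t ^+ 2.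
  move=> t1; have t2 : t ^+ 2 <= 1 by rewrite -real_normK ?num_real// exprn_ile1.
  have := H t; have := expR_ge1Dx (- (t ^+ 2 / 2)); rewrite expRN.
  have e0 := expR_gt0 (t ^+ 2 / 2); have := sqr_ge0 t.
  move: (expR _) e0 => E e0 s0 H1 H3.
  have := ler_wpM2r (ltW e0) H1; rewrite mulVf ?lt0r_neq0//; nra.
apply/eqP; rewrite eq_le; apply/andP; split; rewrite leNgt; apply/negP => d0.
- pose t := Num.min 1 ((m - 2) / 4).
  have t0 : 0 < t by rewrite lt_min ltr01/= divr_gt0//; lra.
  have := H2 t; rewrite gtr0_norm// ge_min lexx/= => /(_ isT).
  have tm : t <= (m - 2) / 4 by rewrite ge_min lexx orbT.
  nra.
- pose t := Num.min 1 ((2 - m) / 4).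
  have t0 : 0 < t by rewrite lt_min ltr01/= divr_gt0//; lra.
  have := H2 (- t); rewrite normrN gtr0_norm// ge_min lexx/= => /(_ isT).
  have tm : t <= (2 - m) / 4 by rewrite ge_min lexx orbT.
  nra.
Qed.

End real_inequalities.

Section gaussian_moments.
Context {R : realType}.
Local Notation mu := (@lebesgue_measure R).
Local Open Scope ereal_scope.

Definition En (F : R -> R) : \bar R := It (@wnorm R) 1 (fun y => (F (nth 0%R y 0))%:E).

Lemma EnE (F : R -> R) : En F = \int[mu]_x ((wnorm x)%:E * (F x)%:E).
Proof. by []. Qed.

Lemma En_ge0 (F : R -> R) : (forall x, 0 <= F x)%R -> 0 <= En F.
Proof. by move=> F0; apply: It_ge0 => s; rewrite lee_fin. Qed.

Lemma measurable_En (F : R -> R) : measurable_fun setT F ->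
  measurable_fun setT (fun y : seq R => F (nth 0%R y 0)).
Proof. by move=> mF; apply: (measurableT_comp mF); exact: measurable_nth. Qed.

Lemma le_En (F G : R -> R) : measurable_fun setT F -> measurable_fun setT G ->
  (forall x, 0 <= F x)%R -> (forall x, F x <= G x)%R -> En F <= En G.
Proof.
move=> mF mG F0 FG; apply: le_It.
- by apply/measurable_EFinP; exact: measurable_En.
- by apply/measurable_EFinP; exact: measurable_En.
- by move=> s; rewrite lee_fin.
- by move=> s; rewrite lee_fin (le_trans _ (FG _)).
- by move=> s _; rewrite lee_fin.
Qed.

Lemma EnD (F G : R -> R) : measurable_fun setT F -> measurable_fun setT G ->
  (forall x, 0 <= F x)%R -> (forall x, 0 <= G x)%R ->
  En (fun x => F x + G x)%R = En F + En G.
Proof.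
move=> mF mG F0 G0; rewrite -ItD.
- by apply: It_ext => s _; rewrite EFinD.
- by apply/measurable_EFinP; exact: measurable_En.
- by apply/measurable_EFinP; exact: measurable_En.
- by move=> s; rewrite lee_fin.
- by move=> s; rewrite lee_fin.
Qed.

Lemma EnZ (F : R -> R) (c : R) : measurable_fun setT F -> (forall x, 0 <= F x)%R -> (0 <= c)%R ->
  En (fun x => c * F x)%R = c%:E * En F.
Proof.
move=> mF F0 c0; rewrite -ItZl ?lee_fin//.
- by apply/measurable_EFinP; exact: measurable_En.
- by move=> s; rewrite lee_fin.
Qed.

Lemma En_cst (c : R) : (0 <= c)%R -> En (fun=> c) = c%:E.
Proof. by move=> c0; rewrite /En It_cst ?wnorm1. Qed.

Lemma En_lin_le (r : seq (R * (R -> R) * R)) :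
  (forall t, List.In t r -> [/\ measurable_fun setT t.1.2, (forall y, 0 <= t.1.2 y)%R &
     En t.1.2 = t.2%:E]) ->
  (forall x, \sum_(t <- r) t.1.1 * t.1.2 x <= 0)%R ->
  (\sum_(t <- r) t.1.1 * t.2 <= 0)%R.
Proof.
move=> Hr Hle.
have := @It_lin_le R (@wnorm R) 1 [seq (t.1.1, fun y : seq R => t.1.2 (nth 0%R y 0), t.2) | t <- r].
rewrite !big_map/=; apply.
  move=> t /List.in_map_iff[u [<- ur]]/=; have [mu u0 Eu] := Hr u ur.
  by split=> //; exact: measurable_En.
by move=> y _; rewrite big_map/=.
Qed.

Lemma wnormE (x : R) : wnorm x = (normal_peak 1 * expR (- x ^+ 2 / 2))%R.
Proof.
rewrite wnorm_pdf normal_pdfE ?oner_neq0// /normal_fun subr0 expr1n.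
by congr (_ * expR (_ / _))%R; rewrite mulr2n.
Qed.

Lemma wnorm_comp_affine (r a : R) : (0 < r)%R ->
  \int[mu]_x (wnorm (r * x + a)%R)%:E = (r^-1)%:E.
Proof.
move=> r0; have := @integral_affine R r a (fun x => (wnorm x)%:E) r0 (measurable_weightE _).
rewrite wnorm1 => /(_ (fun x => weight_ge0 wnorm x)) E1.
move/(congr1 (fun t => (r^-1)%:E * t)): E1.
by rewrite mule1 muleA -EFinM mulVf ?gt_eqF// mul1e => ->.
Qed.

Lemma En_expR (t : R) : En (fun x => expR (t * x)) = (expR (t ^+ 2 / 2))%:E.
Proof.
rewrite EnE; transitivity (\int[mu]_x ((expR (t ^+ 2 / 2))%:E * (wnorm (1 * x + - t)%R)%:E)).
  apply: eq_integral => x _; rewrite -!EFinM; congr EFin.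
  rewrite !wnormE -mulrA [RHS]mulrCA -!expRD; congr (_ * expR _)%R; by field.
have m1 : measurable_fun setT (fun x : R => (wnorm (1 * x + - t)%R)%:E).
  apply: (measurableT_comp (measurable_weightE wnorm) (g := fun x : R => (1 * x + - t)%R)).
  by apply: measurable_funD => //; exact: measurable_funM.
rewrite ge0_integralZl ?lee_fin ?expR_ge0//; last first.
  by move=> x _; rewrite lee_fin weight_ge0.
have := @wnorm_comp_affine 1%R (- t)%R ltr01; rewrite invr1 => E.
by apply: etrans (mule1 _); congr (_ * _); exact: E.
Qed.

Lemma En_gauss (r : R) : (0 < r)%R ->
  En (fun x => expR (- ((r ^+ 2 - 1) / 2 * x ^+ 2))) = (r^-1)%:E.
Proof.
move=> r0; rewrite -(@wnorm_comp_affine r 0%R r0) EnE; apply: eq_integral => x _.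
rewrite -EFinM; congr EFin; rewrite !wnormE -[LHS]mulrA -expRD addr0; congr (_ * expR _)%R; by field.
Qed.

Lemma expR_norm_le (x : R) : (expR `|x| <= expR (1 * x) + expR (- 1 * x))%R.
Proof.
rewrite mul1r mulN1r; have [x0|x0] := leP 0%R x.
  by rewrite ger0_norm// lerDl expR_ge0.
by rewrite ltr0_norm// lerDr expR_ge0.
Qed.

(** The power is dominated by a term of the exponential series, whose Gaussian mean is explicit. *)
Lemma En_pow_fin k : En (fun x => `|x| ^+ k.+1)%R \is a fin_num.
Proof.
rewrite ge0_fin_numE; last by apply: En_ge0 => x; exact: exprn_ge0.
have mpow : measurable_fun setT (fun x : R => (`|x| ^+ k.+1)%R).
  by apply: measurable_funX; exact: normr_measurable.
have mexp (t : R) : measurable_fun setT (fun x : R => expR (t * x)).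
  by apply: measurableT_comp => //; exact: measurable_funM.
apply: (@le_lt_trans _ _ (En (fun x => (k.+1)`!%:R * (expR (1 * x) + expR (- 1 * x))))%R).
  apply: le_En => //.
  - by apply: measurable_funM => //; apply: measurable_funD.
  - move=> x; apply: le_trans (ler_wpM2l (ler0n _ _) (expR_norm_le x)).
    have := expR_ge1Dxn k (normr_ge0 x); have f0 : (0 < (k.+1)`!%:R :> R)%R by rewrite ltr0n fact_gt0.
    move=> H; rewrite mulrC -ler_pdivrMr//; lra.
rewrite EnZ//; last first.
  by apply: measurable_funD.
rewrite EnD//.
by rewrite !En_expR -EFinD -EFinM ltry.
Qed.

Let msq : measurable_fun setT (fun x : R => (x ^+ 2)%R).
Proof. exact: measurable_funX. Qed.

Lemma En_sq : En (fun x => x ^+ 2)%R = 1.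
Proof.
have fin : En (fun x => x ^+ 2)%R \is a fin_num.
  rewrite (_ : (fun x : R => x ^+ 2)%R = (fun x => `|x| ^+ 2)%R); first exact: En_pow_fin.
  by apply/funext => x; rewrite real_normK ?num_real.
set m := fine (En (fun x => x ^+ 2)%R).
have Em : En (fun x => x ^+ 2)%R = m%:E by rewrite fineK.
have H r : (0 < r)%R -> (1 - (r ^+ 2 - 1) / 2 * m - r^-1 <= 0)%R.
  move=> r0.
  have := @En_lin_le [:: (1, fun=> 1, 1); (- ((r ^+ 2 - 1) / 2), fun x => x ^+ 2, m);
    (-1, fun x => expR (- ((r ^+ 2 - 1) / 2 * x ^+ 2)), r^-1)]%R.
  rewrite !big_cons !big_nil/= => /(_ _ _) H; suff : (1 * 1 + (- ((r ^+ 2 - 1) / 2) * m +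
    (-1 * r^-1 + 0)) <= 0)%R by lra.
  apply: H => [t [<-|[<-|[<-|//]]]|x]/=.
  - by split=> //; rewrite En_cst.
  - by split=> // y; exact: sqr_ge0.
  - split; [|by move=> y; exact: expR_ge0|exact: En_gauss].
    apply: measurableT_comp => //; apply: measurableT_comp => //; exact: measurable_funM.
  - rewrite !big_cons !big_nil/=.
    have := expR_ge1Dx (- ((r ^+ 2 - 1) / 2 * x ^+ 2)); lra.
rewrite Em (sq_moment_eq1 _ H)// -lee_fin -Em; apply: En_ge0 => x; exact: sqr_ge0.
Qed.

(** This encodes that the mean is zero by a nonnegative integrand:
    [2 x = (x + 1) ^+ 2 - x ^+ 2 - 1]. *)
Lemma En_sqD1 : En (fun x => (x + 1) ^+ 2)%R = 2%:E.
Proof.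
have msq1 : measurable_fun setT (fun x : R => ((x + 1) ^+ 2)%R).
  by apply: measurable_funX; exact: measurable_funD.
have fin : En (fun x => (x + 1) ^+ 2)%R \is a fin_num.
  rewrite ge0_fin_numE; last by apply: En_ge0 => x; exact: sqr_ge0.
  apply: (@le_lt_trans _ _ (En (fun x => 2 * x ^+ 2 + 2)%R)).
    apply: le_En => //.
    - by apply: measurable_funD => //; exact: measurable_funM.
    - by move=> x; exact: sqr_ge0.
    - by move=> x; have := sqr_ge0 (x - 1); lra.
  rewrite EnD//; last 2 first.
  - exact: measurable_funM.
  - by move=> x; rewrite mulr_ge0 ?sqr_ge0.
  rewrite EnZ//; last by move=> x; exact: sqr_ge0.
  by rewrite En_sq En_cst// ltry.
set m := fine (En (fun x => (x + 1) ^+ 2)%R).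
have Em : En (fun x => (x + 1) ^+ 2)%R = m%:E by rewrite fineK.
have H (t : R) : (1 + t / 2 * (m - 2) - expR (t ^+ 2 / 2) <= 0)%R.
  have := @En_lin_le [:: (1 - t / 2, fun=> 1, 1); (t / 2, fun x => (x + 1) ^+ 2, m);
    (- (t / 2), fun x => x ^+ 2, 1);
    (-1, fun x => expR (t * x), expR (t ^+ 2 / 2))]%R.
  rewrite !big_cons !big_nil/= => /(_ _ _) H; suff : ((1 - t / 2) * 1 + (t / 2 * m +
    (- (t / 2) * 1 + (-1 * expR (t ^+ 2 / 2) + 0))) <= 0)%R by lra.
  apply: H => [u [<-|[<-|[<-|[<-|//]]]]|x]/=.
  - by split=> //; rewrite En_cst.
  - by split=> // y; exact: sqr_ge0.
  - by split=> //; [move=> y; exact: sqr_ge0|exact: En_sq].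
  - split; [|by move=> y; exact: expR_ge0|exact: En_expR].
    by apply: measurableT_comp => //; exact: measurable_funM.
  - rewrite !big_cons !big_nil/=; have := expR_ge1Dx (t * x); lra.
by rewrite Em (mean_moment_eq2 H).
Qed.

(* Completing the square: a linear combination of two independent Gaussian
   variables is Gaussian. *)
Lemma En_conv (a b c : R) (K : R -> R) : (0 <= a)%R -> (0 < b)%R -> (0 < c)%R ->
  (a ^+ 2 + b ^+ 2 = c ^+ 2)%R -> measurable_fun setT K -> (forall u, 0 <= K u)%R ->
  \int[mu]_x ((wnorm x)%:E * En (fun y => K (a * x + b * y)%R)) = En (fun x => K (c * x)%R).
Proof.
move=> a0 b0 c0 abc mK K0.
have mKE : measurable_fun setT (fun x => (K x)%:E) by exact/measurable_EFinP.
have scale (r e : R) : (0 < r)%R -> En (fun y => K (r * y + e)%R) =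
    (r^-1)%:E * \int[mu]_u ((wnorm ((u - e) / r)%R)%:E * (K u)%:E).
  move=> r0.
  have mf : measurable_fun setT (fun u : R => (wnorm ((u - e) / r)%R)%:E * (K u)%:E).
    apply: emeasurable_funM => //.
    apply: (measurableT_comp (measurable_weightE wnorm) (g := fun u : R => ((u - e) / r)%R)).
    by apply: measurable_funM => //; exact: measurable_funB.
  have f0 (u : R) : 0 <= (wnorm ((u - e) / r)%R)%:E * (K u)%:E.
    by rewrite mule_ge0 ?lee_fin ?weight_ge0.
  rewrite (integral_affine e r0 mf f0) muleA -EFinM mulVf ?gt_eqF// mul1e EnE.
  apply: eq_integral => y _; by rewrite addrK mulrAC mulfV ?gt_eqF// mul1r.
pose f (p : R * R) := (b^-1)%:E * ((wnorm p.1)%:E * ((wnorm ((p.2 - a * p.1) / b)%R)%:E * (K p.2)%:E)).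
have mf : measurable_fun setT f.
  apply: emeasurable_funM; first exact: measurable_cst.
  apply: emeasurable_funM; first by apply: (measurableT_comp (measurable_weightE wnorm)).
  apply: emeasurable_funM; last by apply: (measurableT_comp mKE).
  apply: (measurableT_comp (measurable_weightE wnorm) (g := fun p : R * R => ((p.2 - a * p.1) / b)%R)).
  by apply: measurable_funM => //; apply: measurable_funB => //; exact: measurable_funM.
have bi0 : (0 <= b^-1)%R by rewrite invr_ge0 ltW.
have f0 p : 0 <= f p by rewrite !mule_ge0 ?lee_fin ?weight_ge0.
transitivity (\int[mu]_x \int[mu]_u f (x, u)).
  apply: eq_integral => x _; rewrite (_ : En _ = En (fun y => K (b * y + a * x)%R)); last first.
    by congr En; apply/funext => y; rewrite addrC.
  rewrite scale// muleCA.
  have mg : measurable_fun setT (fun u : R => (wnorm ((u - a * x) / b)%R)%:E * (K u)%:E).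
    apply: emeasurable_funM => //.
    apply: (measurableT_comp (measurable_weightE wnorm) (g := fun u : R => ((u - a * x) / b)%R)).
    by apply: measurable_funM => //; exact: measurable_funB.
  have g0 (u : R) : 0 <= (wnorm ((u - a * x) / b)%R)%:E * (K u)%:E.
    by rewrite mule_ge0 ?lee_fin ?weight_ge0.
  have wx0 : 0 <= (wnorm x)%:E by rewrite lee_fin weight_ge0.
  have b0' : 0 <= (b^-1)%:E by rewrite lee_fin.
  rewrite /f/=; apply/esym.
  transitivity ((b^-1)%:E * \int[mu]_u ((wnorm x)%:E * ((wnorm ((u - a * x) / b)%R)%:E * (K u)%:E))).
    apply: ge0_integralZl; [exact: measurableT| |by move=> u _; exact: (mule_ge0 wx0 (g0 u))|exact: b0'].
    by apply: emeasurable_funM => //; exact: measurable_cst.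
  congr (_ * _); apply: ge0_integralZl; [exact: measurableT|exact: mg|by move=> u _; exact: g0|exact: wx0].
transitivity (\int[mu]_u \int[mu]_x f (x, u)).
  exact: (@fubini_tonelli _ _ _ _ _ mu mu f mf f0).
have -> : En (fun x => K (c * x)%R) = En (fun x => K (c * x + 0)%R).
  by congr En; apply/funext => x; rewrite addr0.
rewrite scale//.
have mc : measurable_fun setT (fun u : R => (wnorm ((u - 0) / c)%R)%:E * (K u)%:E).
  apply: emeasurable_funM => //.
  apply: (measurableT_comp (measurable_weightE wnorm) (g := fun u : R => ((u - 0) / c)%R)).
  by apply: measurable_funM => //; exact: measurable_funB.
have c0' : 0 <= (c^-1)%:E by rewrite lee_fin invr_ge0 ltW.
apply: etrans; last first.
  apply: ge0_integralZl; [exact: measurableT|exact: mc| |exact: c0'].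
  by move=> u _; rewrite mule_ge0 ?lee_fin ?weight_ge0.
apply: eq_integral => u _.
have mw : measurable_fun setT (fun x : R => (wnorm (c / b * x + - (a * u / (c * b)))%R)%:E).
  apply: (measurableT_comp (measurable_weightE wnorm) (g := fun x : R => (c / b * x + - (a * u / (c * b)))%R)).
  by apply: measurable_funD => //; exact: measurable_funM.
transitivity (\int[mu]_x (((b^-1 * wnorm ((u - 0) / c))%R%:E * (K u)%:E) *
    (wnorm (c / b * x + - (a * u / (c * b)))%R)%:E)).
  apply: eq_integral => x _; rewrite /f/= -!EFinM; congr EFin.
  have b1 : (b != 0)%R by rewrite gt_eqF.
  have c1 : (c != 0)%R by rewrite gt_eqF.
  have E : (wnorm x * wnorm ((u - a * x) / b) =
      wnorm ((u - 0) / c) * wnorm (c / b * x + - (a * u / (c * b))))%R.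
    rewrite !wnormE [LHS]mulrACA [RHS]mulrACA -!expRD; congr (_ * expR _)%R.
    apply/eqP; rewrite -subr_eq0; apply/eqP.
    transitivity ((a ^+ 2 + b ^+ 2 - c ^+ 2) * (u ^+ 2 / c ^+ 2 - x ^+ 2) / (2 * b ^+ 2))%R.
      by field; rewrite b1 c1.
    by rewrite abc subrr !mul0r.
  transitivity (b^-1 * K u * (wnorm x * wnorm ((u - a * x) / b)))%R; first by ring.
  by rewrite E; ring.
have k0 : 0 <= (b^-1 * wnorm ((u - 0) / c))%R%:E * (K u)%:E.
  by rewrite mule_ge0 ?lee_fin ?mulr_ge0 ?weight_ge0.
transitivity ((b^-1 * wnorm ((u - 0) / c))%R%:E * (K u)%:E *
    \int[mu]_x (wnorm (c / b * x + - (a * u / (c * b)))%R)%:E).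
  apply: ge0_integralZl; [exact: measurableT|exact: mw| |exact: k0].
  by move=> x _; rewrite lee_fin weight_ge0.
have -> : \int[mu]_x (wnorm (c / b * x + - (a * u / (c * b)))%R)%:E = ((c / b)^-1)%:E.
  by apply: wnorm_comp_affine; rewrite divr_gt0.
rewrite -!EFinM; congr EFin; field; by rewrite !gt_eqF.
Qed.

End gaussian_moments.

(** * A central limit theorem for sums over faces *)

Section smooth_averages.
Context {R : realType}.
Local Notation mu := (@lebesgue_measure R).
Local Notation N := (@normal_prob R 0 1).

(** [f1] and [f2] stand for the first two derivatives, but only the Taylor inequality is required.
    It survives averaging by integration, so that no differentiation under the integral sign
    occurs. *)
Definition taylor3 (C : R) (f f1 f2 : R -> R) := [/\ forall x, 0 <= f x <= C,
  forall x, `|f1 x| <= C, forall x, `|f2 x| <= C &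
  forall x h, `|f (x + h) - f x - f1 x * h - f2 x * (h ^+ 2 / 2)| <= C * `|h| ^+ 3].

(** The heat semigroup at time [c ^+ 2], up to normalisation. *)
Definition gau (g : R -> R) (c x : R) : R := \int[N]_z g (x + c * z).

Lemma Rintegral_normal_cst (r : R) : \int[N]_(z in setT) r = r.
Proof.
rewrite Rintegral_cst// [X in fine X](_ : _ = 1%E) ?mulr1//.
exact: (probability_setT N).
Qed.

Lemma measurable_affine_comp (g : R -> R) (c x : R) : measurable_fun setT g ->
  measurable_fun setT (fun z : R => g (x + c * z)).
Proof.
move=> mg; apply: (measurableT_comp mg (g := fun z : R => x + c * z)).
by apply: measurable_funD => //; exact: measurable_funM.
Qed.

Lemma normal_integrable_bounded (g : R -> R) (C : R) : measurable_fun setT g ->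
  (forall x, `|g x| <= C) -> N.-integrable setT (EFin \o g).
Proof.
move=> mg gC; apply: measurable_bounded_integrable => //.
  by rewrite (le_lt_trans (probability_le1 _ _)) ?ltry.
exists C; split; first exact: num_real.
by move=> M CM x _ /=; exact: le_trans (gC x) (ltW CM).
Qed.

Lemma EnE_fin (g : R -> R) (C : R) : measurable_fun setT g -> (forall x, 0 <= g x <= C) ->
  En g = (\int[N]_z g z)%:E.
Proof.
move=> mg gC; have g0 x : 0 <= g x by case/andP: (gC x).
rewrite EnE -(@integral_normal R (fun x => (g x)%:E)) ?fineK//.
- have := @normal_integrable_bounded g C mg; move=> /(_ _)/integrable_fin_num; apply => //.
  by move=> x; rewrite ger0_norm//; case/andP: (gC x).
- exact/measurable_EFinP.
Qed.

Lemma gau_bounds (g : R -> R) (C c x : R) : measurable_fun setT g -> (forall x, `|g x| <= C) ->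
  `|gau g c x| <= C.
Proof.
move=> mg gC; have mgx := measurable_affine_comp c x mg.
have ig := normal_integrable_bounded mgx (fun z => gC (x + c * z)).
apply: le_trans (le_normr_Rintegral measurableT ig) _.
rewrite [leRHS](_ : C = \int[N]_(z in setT) C); last first.
  by rewrite Rintegral_normal_cst.
apply: le_Rintegral => //.
- apply: (@normal_integrable_bounded _ C) => [|z]; first exact: measurableT_comp.
  by rewrite normr_id.
- by apply: (@normal_integrable_bounded _ `|C|) => [|z].
Qed.

Lemma gau_ge0 (g : R -> R) (c x : R) : (forall x, 0 <= g x) -> 0 <= gau g c x.
Proof. by move=> g0; apply: Rintegral_ge0 => z _; exact: g0. Qed.

Lemma taylor3_gau (C c : R) (f f1 f2 : R -> R) : measurable_fun setT f ->
  measurable_fun setT f1 -> measurable_fun setT f2 ->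
  taylor3 C f f1 f2 -> taylor3 C (gau f c) (gau f1 c) (gau f2 c).
Proof.
move=> mf mf1 mf2 [f0C f1C f2C fT].
have fC x : `|f x| <= C by case/andP: (f0C x) => f0 fC; rewrite ger0_norm.
split=> [x|x|x|x h].
- rewrite gau_ge0/=; last by move=> y; case/andP: (f0C y).
  by apply: le_trans (ler_norm _) _; exact: gau_bounds.
- exact: gau_bounds.
- exact: gau_bounds.
have C0 : 0 <= C by apply: le_trans (normr_ge0 _) (fC 0).
have I0 x' := normal_integrable_bounded (measurable_affine_comp c x' mf) (fun z => fC (x' + c * z)).
have I1 := normal_integrable_bounded (measurable_affine_comp c x mf1) (fun z => f1C (x + c * z)).
have I2 := normal_integrable_bounded (measurable_affine_comp c x mf2) (fun z => f2C (x + c * z)).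
have iD (a b : R -> R) : N.-integrable setT (EFin \o a) -> N.-integrable setT (EFin \o b) ->
   N.-integrable setT (EFin \o (fun z => a z - b z)).
  by move=> ia ib; exact: (integrableB measurableT ia ib).
have iZ (a : R -> R) k : N.-integrable setT (EFin \o a) ->
   N.-integrable setT (EFin \o (fun z => a z * k)).
  by move=> ia; exact: (integrableZr measurableT k ia).
have i1 := iD _ _ (I0 (x + h)) (I0 x).
have i2 := iD _ _ i1 (iZ _ h I1).
have i3 := iD _ _ i2 (iZ _ (h ^+ 2 / 2) I2).
have -> : gau f c (x + h) - gau f c x - gau f1 c x * h - gau f2 c x * (h ^+ 2 / 2) =
   \int[N]_z (f (x + h + c * z) - f (x + c * z) - f1 (x + c * z) * h - f2 (x + c * z) * (h ^+ 2 / 2)).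
  rewrite (RintegralB measurableT i2 (iZ _ (h ^+ 2 / 2) I2)).
  rewrite (RintegralB measurableT i1 (iZ _ h I1)) (RintegralB measurableT (I0 _) (I0 _)).
  by rewrite !RintegralZr.
apply: le_trans (le_normr_Rintegral measurableT i3) _.
have -> : C * `|h| ^+ 3 = \int[N]_(z in setT) (C * `|h| ^+ 3).
  by rewrite Rintegral_normal_cst.
apply: le_Rintegral => //.
- exact: (integrable_abse i3).
- by apply: (@normal_integrable_bounded _ `|C * `|h| ^+ 3|) => [|z].
- by move=> z _; rewrite -[x + h + _]addrAC; exact: fT.
Qed.

Lemma gauE (g : R -> R) (C c x : R) : measurable_fun setT g -> (forall x, 0 <= g x <= C) ->
  (gau g c x)%:E = En (fun z => g (x + c * z)).
Proof.
move=> mg gC; rewrite (@EnE_fin _ C)//; exact: measurable_affine_comp.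
Qed.

Lemma measurable_gau (g : R -> R) (C c : R) : measurable_fun setT g -> (forall x, 0 <= g x <= C) ->
  measurable_fun setT (gau g c).
Proof.
move=> mg gC; apply/measurable_EFinP.
rewrite (_ : EFin \o _ = fun x => En (fun z => g (x + c * z))); last first.
  by apply/funext => x; rewrite /= (@gauE _ C).
pose G (x : R) (s : seq R) := (g (x + c * nth 0 s 0))%:E.
apply: (@measurable_It _ (@wnorm R) 1 _ _ G).
  apply/measurable_EFinP; apply: (measurableT_comp mg (g := fun p : R * seq R => p.1 + c * nth 0 p.2 0)).
  apply: measurable_funD => //; apply: measurable_funM => //.
  have mn : measurable_fun setT (fun s : seq R => nth 0 s 0) by exact: measurable_nth.
  exact: (measurableT_comp mn).
by move=> x s; rewrite lee_fin; case/andP: (gC (x + c * nth 0 s 0)).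
Qed.

(** Semigroup property. The case [c = 0] is separate because the change of variables in [En_conv]
    divides by the second scale. *)
Lemma gau_conv (g : R -> R) (C a c c' x : R) : measurable_fun setT g ->
  (forall x, 0 <= g x <= C) -> 0 <= a -> 0 <= c -> 0 <= c' -> a ^+ 2 + c ^+ 2 = c' ^+ 2 ->
  (gau g c' x)%:E = En (fun z => gau g c (x + a * z)).
Proof.
move=> mg gC a0 c0 c'0 ac; have g0 u : 0 <= g u by case/andP: (gC u).
have [c_eq0|c_neq0] := eqVneq c 0.
  have -> : c' = a by apply/eqP; rewrite -(eqrXn2 (n := 2))// -ac c_eq0 expr0n addr0.
  rewrite (@gauE _ C)//; congr En; apply/funext => z.
  rewrite /gau c_eq0; under eq_Rintegral do rewrite mul0r addr0.
  by rewrite Rintegral_normal_cst.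
have cp : 0 < c by rewrite lt_neqAle eq_sym c_neq0.
have c'p : 0 < c'.
  rewrite lt_neqAle c'0 andbT eq_sym; apply/eqP => c'e.
  have := sqr_ge0 a; have : 0 < c ^+ 2 by rewrite exprn_gt0.
  by move: ac; rewrite c'e expr0n/=; lra.
rewrite (@gauE _ C)//.
have mK : measurable_fun setT (fun u => g (x + u)).
  by apply: (measurableT_comp mg (g := fun u : R => x + u)); exact: measurable_funD.
rewrite -(@En_conv R a c c' (fun u => g (x + u)) a0 cp c'p ac mK (fun u => g0 (x + u))).
rewrite EnE; apply: eq_integral => z _; congr (_ * _)%E.
by rewrite (@gauE _ C)//; congr En; apply/funext => y; rewrite addrA.
Qed.

Definition m3 : R := fine (En (fun z => `|z| ^+ 3)).

Lemma m3E : En (fun z => `|z| ^+ 3) = m3%:E.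
Proof. by rewrite fineK// En_pow_fin. Qed.

Lemma m3_ge0 : 0 <= m3.
Proof. by rewrite -lee_fin -m3E; apply: En_ge0 => x; exact: exprn_ge0. Qed.

Lemma norm_add_cube (a b : R) : `|a + b| ^+ 3 <= 4 * (`|a| ^+ 3 + `|b| ^+ 3).
Proof.
have := ler_normD a b; have := normr_ge0 (a + b).
have a0 := normr_ge0 a; have b0 := normr_ge0 b.
move: `|a + b| `|a| `|b| a0 b0 => c p q p0 q0 c0 cpq.
have : c ^+ 3 <= (p + q) ^+ 3 by rewrite lerXn2r// nnegrE// addr_ge0.
have : 0 <= (p + q) * (p - q) ^+ 2 by rewrite mulr_ge0 ?addr_ge0 ?sqr_ge0.
lra.
Qed.

(** The second order expansion is integrated against the normal law. In the list [L] the term linear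
    in [z] is spread over [(z + 1) ^+ 2], [z ^+ 2] and the constant, because the integrands must be
    nonnegative. *)
Lemma gauss_taylor (C al be x : R) (g g1 g2 : R -> R) (v : R) : measurable_fun setT g ->
  taylor3 C g g1 g2 -> En (fun z => g (x + al + be * z)) = v%:E ->
  `|v - g x - al * g1 x - (al ^+ 2 + be ^+ 2) / 2 * g2 x| <=
    C * (4 * (`|al| ^+ 3 + `|be| ^+ 3 * m3)).
Proof.
move=> mg [g0C g1C g2C gT] Ev.
have C0 : 0 <= C by apply: le_trans (normr_ge0 _) (g1C 0).
pose L (e : R) : seq (R * (R -> R) * R) :=
  [:: (e, fun z => g (x + al + be * z), v);
      (- e * (g x + g1 x * al + g2 x * (al ^+ 2 / 2)) + e / 2 * be * (g1 x + g2 x * al)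
         - C * (4 * `|al| ^+ 3), fun=> 1, 1);
      (- e / 2 * be * (g1 x + g2 x * al), fun z => (z + 1) ^+ 2, 2);
      (e / 2 * be * (g1 x + g2 x * al) - e * g2 x * (be ^+ 2 / 2), fun z => z ^+ 2, 1);
      (- (C * (4 * `|be| ^+ 3)), fun z => `|z| ^+ 3, m3)].
have HL (e : R) : `|e| = 1 -> e * (v - g x - al * g1 x - (al ^+ 2 + be ^+ 2) / 2 * g2 x) <=
    C * (4 * (`|al| ^+ 3 + `|be| ^+ 3 * m3)).
  move=> e1; suff : \sum_(t <- L e) t.1.1 * t.2 <= 0 by rewrite !big_cons big_nil/=; lra.
  apply: En_lin_le.
    move=> t [<-|[<-|[<-|[<-|[<-|//]]]]]/=.
    - split=> //; first exact: measurable_affine_comp.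
      by move=> y; case/andP: (g0C (x + al + be * y)).
    - by split=> //; exact: En_cst.
    - split; [|by move=> y; exact: sqr_ge0|exact: En_sqD1].
      by apply: measurable_funX; exact: measurable_funD.
    - by split; [exact: measurable_funX|move=> y; exact: sqr_ge0|exact: En_sq].
    - split; [|by move=> y; exact: exprn_ge0|exact: m3E].
      by apply: measurable_funX; exact: normr_measurable.
  move=> z; rewrite !big_cons big_nil/=.
  have T := gT x (al + be * z); rewrite addrA in T.
  have := norm_add_cube al (be * z); rewrite normrM exprMn => B.
  have CB := ler_wpM2l C0 B.
  have := ler_norm (e * (g (x + al + be * z) - g x - g1 x * (al + be * z) - g2 x * ((al + be * z) ^+ 2 / 2))).
  rewrite normrM e1 mul1r => U; have {}U := le_trans U T; have := le_trans U CB.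
  lra.
rewrite ler_norml; apply/andP; split.
  by have := HL (-1); rewrite normrN1 => /(_ erefl); lra.
by have := HL 1; rewrite normr1 => /(_ erefl); lra.
Qed.

Definition sqdev (j : nat) (g : R) : R := (g - j%:R) ^+ 2 / j%:R.

Lemma measurable_sqdev j : measurable_fun setT (sqdev j).
Proof.
by apply: measurable_funM => //; apply: measurable_funX; exact: measurable_funB.
Qed.

Lemma sqdev_ge0 j g : 0 <= sqdev j g.
Proof. by rewrite divr_ge0 ?sqr_ge0. Qed.

Local Notation Ex := (It (@wexp R)).

Lemma It_sqdev_pow j k (v m : R) : (0 < j)%N ->
  Ex j (fun z => ((psum z j - j%:R) ^+ (2 * k))%:E) = v%:E -> v / j%:R ^+ k = m ->
  Ex j (fun z => (sqdev j (psum z j) ^+ k)%:E) = m%:E.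
Proof.
move=> j0 E <-; rewrite mulrC EFinM -E -ItZl.
- by apply: It_ext => z _; rewrite /sqdev expr_div_n -exprM EFinM [RHS]muleC.
- apply/measurable_EFinP; apply: measurable_funX; apply: measurable_funB => //.
  exact: measurable_psum.
- by move=> z; rewrite lee_fin exprn_even_ge0// mul2n odd_double.
- by rewrite lee_fin invr_ge0 exprn_ge0.
Qed.

(** One step of the exchange argument: [V] is the true average after removal of a face, known within
    [e] of the Gaussian average [g], and only [g] is expanded. The coefficients 1 and [3 + 6 / j]
    are the first two moments of [sqdev]. *)
Lemma gamma_taylor j (C e s x : R) (V g g1 g2 : R -> R) (v : R) : (0 < j)%N ->
  measurable_fun setT V -> 0 <= s -> (forall y, 0 <= V y) ->
  taylor3 C g g1 g2 -> (forall y, `|V y - g y| <= e) ->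
  Ex j (fun z => (V (x + s * sqdev j (psum z j)))%:E) = v%:E ->
  `|v - g x - s * g1 x - s ^+ 2 / 2 * (3 + 6 / j%:R) * g2 x| <= e + C * (265 * s ^+ 3).
Proof.
move=> j0 mV s0 V0 [g0C g1C g2C gT] Ve Ev.
have C0 : 0 <= C by apply: le_trans (normr_ge0 _) (g1C 0).
have jp : (j%:R != 0 :> R) by rewrite pnatr_eq0 -lt0n.
have j1 : 1 <= (j%:R : R) by rewrite ler1n.
pose W (z : seq R) := sqdev j (psum z j).
have W0 z : 0 <= W z by exact: sqdev_ge0.
have mW : measurable_fun setT W.
  by apply: (measurableT_comp (measurable_sqdev j)); exact: measurable_psum.
(* The third moment of [sqdev]; since [j >= 1] it is at most [15 + 130 + 120 = 265]. *)
pose w3 : R := 15 + 130 / j%:R + 120 / j%:R ^+ 2.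
have w3_le : w3 <= 265.
  have h1 : 1 / j%:R <= 1 :> R by rewrite ler_pdivrMr ?mul1r// ltr0n.
  have h2 : 1 / j%:R ^+ 2 <= 1 :> R by rewrite ler_pdivrMr ?mul1r ?exprn_ege1// exprn_gt0// ltr0n.
  by rewrite /w3; lra.
pose L (e' : R) : seq (R * (seq R -> R) * R) :=
  [:: (e', fun z => V (x + s * W z), v);
      (- e' * g x - e, fun=> 1, 1);
      (- e' * (g1 x * s), fun z => W z ^+ 1, 1);
      (- e' * (g2 x * (s ^+ 2 / 2)), fun z => W z ^+ 2, 3 + 6 / j%:R);
      (- (C * s ^+ 3), fun z => W z ^+ 3, w3)].
have HL (e' : R) : `|e'| = 1 ->
    e' * (v - g x - s * g1 x - s ^+ 2 / 2 * (3 + 6 / j%:R) * g2 x) <= e + C * (265 * s ^+ 3).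
  move=> e1; suff H : \sum_(t <- L e') t.1.1 * t.2 <= 0.
    move: H; rewrite !big_cons big_nil/=.
    have := ler_wpM2l (mulr_ge0 C0 (exprn_ge0 3 s0)) w3_le; lra.
  apply: (@It_lin_le _ (@wexp R) j).
    move=> t [<-|[<-|[<-|[<-|[<-|//]]]]]/=.
    - split=> //; apply: (measurableT_comp mV (g := fun z => x + s * W z)).
      by apply: measurable_funD => //; exact: measurable_funM.
    - by split=> //; rewrite It_cst ?wexp1.
    - split; [exact: measurable_funX|by move=> y; exact: exprn_ge0|].
      by apply: (@It_sqdev_pow j 1 _ 1 j0 (It_wexp_sq j)); rewrite expr1 divff.
    - split; [exact: measurable_funX|by move=> y; exact: exprn_ge0|].
      by apply: (@It_sqdev_pow j 2 _ _ j0 (It_wexp_four j)); field.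
    - split; [exact: measurable_funX|by move=> y; exact: exprn_ge0|].
      by apply: (@It_sqdev_pow j 3 _ _ j0 (It_wexp_six j)); rewrite /w3; field.
  move=> z _; rewrite !big_cons big_nil/=.
  have T := gT x (s * W z).
  rewrite [X in _ <= C * X](_ : _ = s ^+ 3 * W z ^+ 3) in T; last first.
    by rewrite normrM !ger0_norm// exprMn.
  have := Ve (x + s * W z) => U.
  have := ler_norm (e' * (V (x + s * W z) - g (x + s * W z))); rewrite normrM e1 mul1r => U1.
  have := ler_norm (e' * (g (x + s * W z) - g x - g1 x * (s * W z) - g2 x * ((s * W z) ^+ 2 / 2))).
  rewrite normrM e1 mul1r => U2.
  have := le_trans U1 U; have := le_trans U2 T; lra.
rewrite ler_norml; apply/andP; split.
  by have := HL (-1); rewrite normrN1 => /(_ erefl); lra.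
by have := HL 1; rewrite normr1 => /(_ erefl); lra.
Qed.

Definition harmonic_sum (n : nat) : R := \sum_(1 <= k < n.+1) k%:R^-1.

Lemma harmonic_sum0 : harmonic_sum 0 = 0.
Proof. by rewrite /harmonic_sum big_geq. Qed.

Lemma harmonic_sumS n : harmonic_sum n.+1 = harmonic_sum n + n.+1%:R^-1.
Proof. by rewrite /harmonic_sum big_nat_recr. Qed.

Lemma harmonic_sum_ge0 n : 0 <= harmonic_sum n.
Proof. by apply: sumr_ge0 => k _; rewrite invr_ge0. Qed.

(** Precisely the inequality that closes the induction in [exp_avg_gauss_avg]. *)
Lemma harmonic_sum_ge n : 2 * n%:R / n.+1%:R <= harmonic_sum n.
Proof.
elim: n => [|n IH]; first by rewrite harmonic_sum0 mulr0 mul0r.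
rewrite harmonic_sumS; apply: le_trans (lerD IH (lexx _)).
have n1 : 0 < (n.+1%:R : R) by rewrite ltr0n.
have n2 : 0 < (n.+2%:R : R) by rewrite ltr0n.
rewrite -subr_ge0.
have -> : 2 * n%:R / n.+1%:R + n.+1%:R^-1 - 2 * n.+1%:R / n.+2%:R = n%:R / (n.+1%:R * n.+2%:R) :> R.
  have e1 : n.+1%:R = n%:R + 1 :> R by rewrite -natr1.
  have e2 : n.+2%:R = n%:R + 2 :> R by rewrite -[n.+2]addn2 natrD.
  rewrite e1 e2 in n1 n2 *; field.
  by rewrite (gt_eqF n1) (gt_eqF n2).
by rewrite divr_ge0// mulr_ge0 ?ltW.
Qed.

Lemma sum_harmonic_sum m : \sum_(0 <= k < m) harmonic_sum k = m%:R * harmonic_sum m - m%:R.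
Proof.
elim: m => [|m IH]; first by rewrite big_geq// mul0r subrr.
rewrite big_nat_recr//= IH harmonic_sumS.
have : m.+1%:R * m.+1%:R^-1 = 1 :> R by rewrite divff// pnatr_eq0.
rewrite -natr1; lra.
Qed.

(** * Inductive comparison of the recursion with Gaussian averages *)

Section induction.
Variables (C s : R) (f f1 f2 : R -> R).
Hypotheses (mf : measurable_fun setT f) (mf1 : measurable_fun setT f1)
  (mf2 : measurable_fun setT f2) (fT : taylor3 C f f1 f2) (s0 : 0 <= s).

Let f0C x : 0 <= f x <= C. Proof. by case: fT. Qed.
Let f0 x : 0 <= f x. Proof. by case/andP: (f0C x). Qed.
Let C0 : 0 <= C.
Proof. by case: fT => _ /(_ 0) H _ _; apply: le_trans (normr_ge0 _) H. Qed.

Definition exp_avg n x : R := fine (Ex n (fun y => (f (x + s * Fsum sqdev n (psum y)))%:E)).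

Lemma exp_avgE n x :
  (exp_avg n x)%:E = Ex n (fun y => (f (x + s * Fsum sqdev n (psum y)))%:E).
Proof.
rewrite fineK// ge0_fin_numE; last by apply: It_ge0 => y; rewrite lee_fin.
apply: (@le_lt_trans _ _ (Ex n (fun=> C%:E))); last by rewrite It_cst ?wexp1 ?ltry.
apply: le_It => //.
- apply/measurable_EFinP; apply: (measurableT_comp mf (g := fun y => x + s * Fsum sqdev n (psum y))).
  apply: measurable_funD => //; apply: measurable_funM => //.
  by apply: measurable_Fsum_psum => j; exact: measurable_sqdev.
- by move=> y; rewrite lee_fin.
- by move=> y _; rewrite lee_fin; case/andP: (f0C (x + s * Fsum sqdev n (psum y))).
Qed.

Lemma exp_avg_bounds n x : 0 <= exp_avg n x <= C.
Proof.
rewrite -!lee_fin exp_avgE; apply/andP; split.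
  by apply: It_ge0 => y; rewrite lee_fin.
apply: (@le_trans _ _ (Ex n (fun=> C%:E))); last by rewrite It_cst ?wexp1.
apply: le_It => //.
- apply/measurable_EFinP; apply: (measurableT_comp mf (g := fun y => x + s * Fsum sqdev n (psum y))).
  apply: measurable_funD => //; apply: measurable_funM => //.
  by apply: measurable_Fsum_psum => j; exact: measurable_sqdev.
- by move=> y; rewrite lee_fin.
- by move=> y _; rewrite lee_fin; case/andP: (f0C (x + s * Fsum sqdev n (psum y))).
Qed.

Lemma measurable_exp_avg n : measurable_fun setT (exp_avg n).
Proof.
apply/measurable_EFinP.
rewrite (_ : EFin \o _ = fun x => Ex n (fun y => (f (x + s * Fsum sqdev n (psum y)))%:E)); last first.
  by apply/funext => x; exact: exp_avgE.
pose G (x : R) (y : seq R) := (f (x + s * Fsum sqdev n (psum y)))%:E.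
apply: (@measurable_It _ (@wexp R) n _ _ G).
  apply/measurable_EFinP; apply: (measurableT_comp mf (g := fun p : R * seq R => p.1 + s * Fsum sqdev n (psum p.2))).
  apply: measurable_funD => //; apply: measurable_funM => //.
  apply: (measurableT_comp (f := fun y : seq R => Fsum sqdev n (psum y))) => //.
  by apply: measurable_Fsum_psum => j; exact: measurable_sqdev.
by move=> x y; rewrite lee_fin.
Qed.

Definition block_avg n j x : R :=
  fine (Ex j (fun z => (exp_avg (n - j) (x + s * sqdev j (psum z j)))%:E)).

Lemma block_avgE n j x :
  (block_avg n j x)%:E = Ex j (fun z => (exp_avg (n - j) (x + s * sqdev j (psum z j)))%:E).
Proof.
have e0 y : 0 <= exp_avg (n - j) y by case/andP: (exp_avg_bounds (n - j) y).
rewrite fineK// ge0_fin_numE; last by apply: It_ge0 => y; rewrite lee_fin.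
apply: (@le_lt_trans _ _ (Ex j (fun=> C%:E))); last by rewrite It_cst ?wexp1 ?ltry.
apply: le_It => //.
- apply/measurable_EFinP.
  apply: (measurableT_comp (measurable_exp_avg (n - j)) (g := fun z => x + s * sqdev j (psum z j))).
  apply: measurable_funD => //; apply: measurable_funM => //.
  by apply: (measurableT_comp (measurable_sqdev j)); exact: measurable_psum.
- by move=> y; rewrite lee_fin.
- by move=> y _; rewrite lee_fin; case/andP: (exp_avg_bounds (n - j) (x + s * sqdev j (psum y j))).
Qed.

Lemma exp_avg_rec n x : n%:R * exp_avg n x = \sum_(1 <= j < n.+1) block_avg n j x.
Proof.
apply: EFin_inj; rewrite EFinM exp_avgE -sumEFin.
rewrite (@It_Fsum_rec R sqdev measurable_sqdev n (fun q => (f (x + s * q))%:E)).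
- apply: eq_bigr => j _; rewrite block_avgE; apply: It_ext => z _.
  by rewrite exp_avgE; apply: It_ext => y _; rewrite mulrDr addrA.
- apply/measurable_EFinP; apply: (measurableT_comp mf (g := fun q => x + s * q)).
  by apply: measurable_funD => //; exact: measurable_funM.
- by move=> q; rewrite lee_fin.
Qed.

(** Normal law of mean [s H] and variance [3 s^2 H], with [H] the harmonic sum. Unlike [ln m], it
    grows by exactly [1 / (m + 1)] per step, as the recursion demands. *)
Definition gauss_avg (g : R -> R) m x : R :=
  gau g (s * Num.sqrt (3 * harmonic_sum m)) (x + s * harmonic_sum m).

Lemma taylor3_gauss_avg m : taylor3 C (gauss_avg f m) (gauss_avg f1 m) (gauss_avg f2 m).
Proof.
have [H0 H1 H2 HT] := taylor3_gau (s * Num.sqrt (3 * harmonic_sum m)) mf mf1 mf2 fT.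
split=> [x|x|x|x h]; [exact: H0|exact: H1|exact: H2|].
have E : x + h + s * harmonic_sum m = x + s * harmonic_sum m + h by rewrite addrAC.
by rewrite /gauss_avg E; exact: (HT (x + s * harmonic_sum m) h).
Qed.

Lemma measurable_gauss_avg m : measurable_fun setT (gauss_avg f m).
Proof.
apply: (measurableT_comp (f := gau f (s * Num.sqrt (3 * harmonic_sum m)))
  (g := fun x : R => x + s * harmonic_sum m)).
  exact: measurable_gau mf f0C.
exact: measurable_funD.
Qed.

(** One step adds an independent normal variable of mean [s / (m + 1)] and variance
    [3 s^2 / (m + 1)]. The summand [m.+1%:R^-1] next to 3 comes from the square of that mean. *)
Lemma gauss_avg_step m x :
  `|m.+1%:R * (gauss_avg f m.+1 x - gauss_avg f m x) - s * gauss_avg f1 m x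
    - s ^+ 2 / 2 * (3 + m.+1%:R^-1) * gauss_avg f2 m x| <= C * (4 * (1 + 6 * m3)) * s ^+ 3.
Proof.
pose k : R := m.+1%:R; have k1 : 1 <= k by rewrite ler1n.
have k0 : 0 < k by lra.
pose r := Num.sqrt (3 / k).
have r0 : 0 <= r by exact: sqrtr_ge0.
have r2 : r ^+ 2 = 3 / k by rewrite sqr_sqrtr// divr_ge0// ltW.
have E : En (fun z => gauss_avg f m (x + s / k + s * r * z)) = (gauss_avg f m.+1 x)%:E.
  rewrite /gauss_avg (@gau_conv f C (s * r) (s * Num.sqrt (3 * harmonic_sum m)) _ _ mf f0C).
  - congr En; apply/funext => z; congr (gau _ _ _).
    by rewrite harmonic_sumS -/k; ring.
  - by rewrite mulr_ge0.
  - by rewrite mulr_ge0 ?sqrtr_ge0.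
  - by rewrite mulr_ge0 ?sqrtr_ge0.
  - rewrite !exprMn r2 !sqr_sqrtr ?mulr_ge0 ?harmonic_sum_ge0// harmonic_sumS -/k; field.
    by rewrite gt_eqF.
have := gauss_taylor (measurable_gauss_avg m) (taylor3_gauss_avg m) E.
rewrite (exprMn 2 s r) r2 => H.
have {}H := ler_wpM2l (ltW k0) H.
have kn : k = `|k| by rewrite gtr0_norm.
rewrite {1}kn -normrM in H.
apply: le_trans (le_trans _ H) _.
  rewrite le_eqVlt; apply/orP; left; apply/eqP; congr (`|_|); rewrite -/k; field.
  by rewrite gt_eqF.
rewrite !normrM normfV -!kn (ger0_norm s0) (ger0_norm r0).
have ki : 0 < k^-1 by rewrite invr_gt0.
have kk : k * k^-1 = 1 by rewrite divff// gt_eqF.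
have ki1 : k^-1 <= 1 by rewrite invf_le1.
(* As [k r^2 = 3], the cubic term [k r^3 = 3 r] is at most 6, the constant in the statement. *)
have r_le2 : r <= 2.
  rewrite -(ler_pXn2r (n := 2)) ?nnegrE// r2; rewrite -(ler_pM2l k0) mulrCA divff ?gt_eqF// mulr1; lra.
have rr3 : k * r ^+ 3 <= 6.
  rewrite exprS r2 mulrCA [k * _]mulrCA divff ?gt_eqF//; lra.
have m30 := m3_ge0; have s3 : 0 <= s ^+ 3 by rewrite exprn_ge0.
have e1 : k * (s / k) ^+ 3 <= s ^+ 3.
  rewrite expr_div_n; have -> : k * (s ^+ 3 / k ^+ 3) = s ^+ 3 * (k^-1 * k^-1) by field; rewrite gt_eqF.
  by rewrite ler_piMr// mulr_ile1// ltW.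
have e2 : k * (s * r) ^+ 3 <= s ^+ 3 * 6 by rewrite exprMn mulrCA ler_wpM2l.
have -> : k * (C * (4 * ((s / k) ^+ 3 + (s * r) ^+ 3 * m3))) =
   C * (4 * (k * (s / k) ^+ 3 + (k * (s * r) ^+ 3) * m3)) by ring.
rewrite -[leRHS]mulrA; apply: ler_wpM2l => //.
have := ler_wpM2r m30 e2; move: e1; move: (k * (s / k) ^+ 3) (k * (s * r) ^+ 3) => A B.
by move: m30; move: (s ^+ 3) (m3 : R) => S M M0; lra.
Qed.

Definition clt_const : R := C * (265 + 4 * (1 + 6 * m3)).

Lemma clt_const_ge0 : 0 <= clt_const.
Proof.
have M : 0 <= 265 + 4 * (1 + 6 * (m3 : R)) by have := @m3_ge0; lra.
exact: mulr_ge0 C0 M.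
Qed.

(** The bound [eps m] must dominate the mean of [eps k] over [k < m], plus [s^3], plus [s^2 H / m],
    up to the factor [clt_const]. The [s^3 H] part reproduces itself exactly because the harmonic
    sums below [m] add up to [m H - m]; the [s^2] part stays bounded because [H >= 2 m / (m + 1)].
    With [s] of order [1 / sqrt (ln n)] the result tends to 0. *)
Lemma exp_avg_gauss_avg m x : `|exp_avg m x - gauss_avg f m x| <=
  clt_const * (s ^+ 2 * (2 - 2 / m.+1%:R) + s ^+ 3 * harmonic_sum m).
Proof.
have D0 := clt_const_ge0.
pose eps m := clt_const * (s ^+ 2 * (2 - 2 / m.+1%:R) + s ^+ 3 * harmonic_sum m).
rewrite -/(eps m); elim/ltn_ind: m x => m IH x.
have [->|m0] := posnP m.
  rewrite /eps /exp_avg /gauss_avg harmonic_sum0 /= /Fsum !mulr0 sqrtr0 mulr0 addr0.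
  rewrite big_nat1 big_geq// mulr0 addr0 /gau.
  under eq_Rintegral do rewrite mul0r addr0.
  by rewrite Rintegral_normal_cst subrr normr0 divr1 subrr mulr0 addr0 mulr0.
have mp : 0 < (m%:R : R) by rewrite ltr0n.
rewrite -(ler_pM2l mp) -{1}(gtr0_norm mp) -normrM mulrBr exp_avg_rec.
pose w := gauss_avg f.
(* Telescoping [(k + 1) w_(k+1) - k w_k] over [k = m - j] gives the Gaussian side the shape of the
   recursion. *)
have -> : m%:R * w m x = \sum_(1 <= j < m.+1) (w (m - j)%N x + (m - j).+1%:R * (w (m - j).+1 x - w (m - j)%N x)).
  rewrite (@big_nat_rev _ _ _ 1 m.+1)/= big_add1/=.
  transitivity (\sum_(0 <= k < m) (k.+1%:R * w k.+1 x - k%:R * w k x)).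
    by rewrite telescope_sumr// mul0r subr0.
  apply: eq_big_nat => k /andP[_ km]; rewrite add1n subSS.
  have -> : (m - (m - k) = k)%N by lia.
  by rewrite -natr1; ring.
rewrite -sumrB; apply: le_trans (ler_norm_sum _ _ _) _.
apply: (@le_trans _ _ (\sum_(1 <= j < m.+1) (eps (m - j)%N + clt_const * s ^+ 3 +
    clt_const * s ^+ 2 * (j%:R^-1 / 2 + (m - j).+1%:R^-1 / 2)))).
  apply: ler_sum_nat => j /andP[j0 jm].
  have mj : (m - j < m)%N by lia.
  have G := gamma_taylor j0 (measurable_exp_avg (m - j)) s0
    (fun y => proj1 (andP (exp_avg_bounds (m - j) y))) (taylor3_gauss_avg (m - j)) (IH _ mj)
    (esym (block_avgE m j x)).
  have S := gauss_avg_step (m - j) x.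
  have [_ _ /(_ x) w2C _] := taylor3_gauss_avg (m - j).
  rewrite -/w in G S.
  have M0 := m3_ge0.
  have jp : 0 < (j%:R^-1 : R) by rewrite invr_gt0 ltr0n.
  have kp : 0 < ((m - j).+1%:R^-1 : R) by rewrite invr_gt0 ltr0n.
  (* The terms in [s] and the coefficient 3 cancel between the two expansions. What remains in [s^2]
     is summable over [j] to a multiple of the harmonic sum. *)
  have Q : `|s ^+ 2 / 2 * (6 / j%:R - (m - j).+1%:R^-1) * gauss_avg f2 (m - j) x| <=
      clt_const * s ^+ 2 * (j%:R^-1 / 2 + (m - j).+1%:R^-1 / 2).
    rewrite 2!normrM (ger0_norm (divr_ge0 (sqr_ge0 s) (ler0n _ 2))).
    have q1 : `|6 / j%:R - (m - j).+1%:R^-1 : R| <= 6 * (j%:R^-1 + (m - j).+1%:R^-1).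
      move: jp kp; move: (j%:R^-1) ((m - j).+1%:R^-1) => p q p0 q0.
      by rewrite ler_norml; apply/andP; split; lra.
    have q2 : s ^+ 2 / 2 * `|6 / j%:R - (m - j).+1%:R^-1| * `|gauss_avg f2 (m - j) x| <=
       s ^+ 2 / 2 * (6 * (j%:R^-1 + (m - j).+1%:R^-1)) * C.
      apply: ler_pM => //; first by rewrite !mulr_ge0 ?sqr_ge0.
      by apply: ler_wpM2l => //; rewrite mulr_ge0 ?sqr_ge0.
    apply: le_trans q2 _; rewrite /clt_const.
    move: jp kp M0 C0 (sqr_ge0 s); clear.
    move: (j%:R^-1) ((m - j).+1%:R^-1) (m3 : R) (s ^+ 2) => p q M S p0 q0 M0 C0 S0.
    have pq0 : 0 <= p + q by rewrite addr_ge0// ltW.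
    have SpqC : 0 <= S * (p + q) * C by rewrite !mulr_ge0.
    have := mulr_ge0 SpqC M0; lra.
  move: G S Q; rewrite /clt_const.
  set a := block_avg _ _ _; set b := gauss_avg f1 _ _; set c := gauss_avg f2 _ _.
  move: ((m - j).+1%:R : R) (j%:R : R) => K J G S Q.
  have -> : a - (w (m - j)%N x + K * (w (m - j).+1 x - w (m - j)%N x)) =
    (a - w (m - j)%N x - s * b - s ^+ 2 / 2 * (3 + 6 / J) * c)
    - (K * (w (m - j).+1 x - w (m - j)%N x) - s * b - s ^+ 2 / 2 * (3 + K^-1) * c)
    + s ^+ 2 / 2 * (6 / J - K^-1) * c by ring.
  apply: le_trans (ler_normD _ _) _; apply: lerD => //.
  apply: le_trans (ler_normB _ _) _; apply: le_trans (lerD G S) _.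
  lra.
have rev_sum (F : nat -> R) : \sum_(1 <= j < m.+1) F (m - j)%N = \sum_(0 <= k < m) F k.
  rewrite (@big_nat_rev _ _ _ 1 m.+1)/= big_add1/=.
  by apply: eq_big_nat => k /andP[_ km]; congr F; lia.
have rs2 : \sum_(1 <= j < m.+1) (m - j).+1%:R^-1 = harmonic_sum m.
  by rewrite (rev_sum (fun k => k.+1%:R^-1)) /harmonic_sum big_add1.
rewrite big_split/= big_split/= (rev_sum eps) sumr_const_nat subn1/=.
rewrite -[X in _ + X <= _]mulr_sumr [X in _ + _ * X <= _]big_split/= -!mulr_suml rs2 -/(harmonic_sum m) -[X in _ + X + _]mulr_natl.
have -> : \sum_(0 <= k < m) eps k = clt_const * (s ^+ 2 * (2 * m%:R - 2 * harmonic_sum m) +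
    s ^+ 3 * (m%:R * harmonic_sum m - m%:R)).
  rewrite /eps -mulr_sumr big_split/= -!mulr_sumr sum_harmonic_sum sumrB -mulr_sumr.
  rewrite sumr_const_nat subn0 -[X in 2 *+ X]/m -mulr_natl [m%:R * 2]mulrC.
  by rewrite [X in _ - 2 * X](_ : _ = harmonic_sum m)// /harmonic_sum big_add1.
rewrite /eps; have H := harmonic_sum_ge m.
rewrite -subr_ge0 in H; have := mulr_ge0 (mulr_ge0 D0 (sqr_ge0 s)) H.
by move: clt_const (m.+1%:R^-1 : R) (harmonic_sum m) (m%:R : R) => D I h M; lra.
Qed.

End induction.

Lemma ln_harmonic_sum n : (0 < n)%N ->
  ln n%:R <= harmonic_sum n /\ harmonic_sum n <= 1 + ln n%:R.
Proof.
have lnS k : (0 < k)%N -> ln k.+1%:R - ln k%:R <= k%:R^-1 :> R /\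
    k.+1%:R^-1 <= ln k.+1%:R - ln k%:R :> R.
  move=> k0; have kp : 0 < (k%:R : R) by rewrite ltr0n.
  have kp1 : 0 < (k.+1%:R : R) by rewrite ltr0n.
  rewrite -ln_div ?posrE//; split.
    have -> : k.+1%:R / k%:R = 1 + k%:R^-1 :> R by rewrite -natr1 mulrDl divff ?gt_eqF// mul1r.
    by apply: le_ln1Dx; rewrite (lt_trans _ (_ : 0 < _)) ?invr_gt0// ltrN10.
  rewrite -[X in ln X]invrK lnV ?posrE ?invr_gt0 ?divr_gt0// invf_div lerNr.
  have -> : k%:R / k.+1%:R = 1 + - k.+1%:R^-1 :> R.
    by rewrite -natr1; field; rewrite natr1 gt_eqF.
  by apply: le_ln1Dx; rewrite ltrN2 invf_lt1// ltr1n ltnS.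
case: n => // n _; split.
  apply: (@le_trans _ _ (ln n.+2%:R)); first by rewrite ler_ln ?posrE ?ltr0n// ler_nat.
  elim: n => [|n IH].
    by have [+ _] := lnS 1%N isT; rewrite ln1 subr0 harmonic_sumS harmonic_sum0 add0r.
  have [+ _] := lnS n.+2 isT; rewrite harmonic_sumS; move: (n.+2%:R^-1) => t; move: IH; lra.
elim: n => [|n IH]; first by rewrite harmonic_sumS harmonic_sum0 add0r invr1 ln1 addr0.
have [_] := lnS n.+1 isT; rewrite [harmonic_sum n.+2]harmonic_sumS; move: (n.+2%:R^-1) => t; move: IH; lra.
Qed.

(** For [|h| <= 1] each of the three Taylor terms is at most [C |h|]; for larger [h] the range of
    [f] suffices. *)
Lemma taylor3_lip C (f f1 f2 : R -> R) x h : taylor3 C f f1 f2 ->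
  `|f (x + h) - f x| <= 3 * C * `|h|.
Proof.
move=> [f0C f1C f2C fT]; have C0 : 0 <= C by apply: le_trans (normr_ge0 _) (f1C 0).
have [h1|h1] := leP `|h| 1; last first.
  have := f0C x; have := f0C (x + h) => /andP[a0 aC] /andP[b0 bC].
  have : C * 1 <= C * `|h| by rewrite ler_wpM2l// ltW.
  rewrite -mulrA; move: (C * `|h|) => CH CH1; rewrite ler_norml; apply/andP; split; lra.
have -> : f (x + h) - f x = (f (x + h) - f x - f1 x * h - f2 x * (h ^+ 2 / 2)) + f1 x * h + f2 x * (h ^+ 2 / 2) by ring.
have -> : 3 * C * `|h| = C * `|h| + C * `|h| + C * `|h| by ring.
have hh0 := normr_ge0 h.
have hh : `|h| ^+ 2 <= `|h| by rewrite expr2 ler_piMr.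
apply: le_trans (ler_normD _ _) _; apply: lerD.
  apply: le_trans (ler_normD _ _) _; apply: lerD.
    apply: le_trans (fT x h) _; rewrite ler_wpM2l// exprS.
    by rewrite ler_piMr// exprn_ile1.
  by rewrite normrM ler_wpM2r.
have h2 : `|h ^+ 2 / 2| <= `|h|.
  rewrite normrM normrX normfV (ger0_norm (ler0n _ 2)).
  by rewrite ler_pdivrMr//; lra.
by rewrite normrM; apply: ler_pM.
Qed.

Definition m1 : R := fine (En (fun z => `|z| ^+ 1)).

Lemma m1E : En (fun z => `|z| ^+ 1) = m1%:E.
Proof. by rewrite fineK// En_pow_fin. Qed.

(** Both normal laws are coupled through the same [z], whose images differ by [y + (c - 1) z]. *)
Lemma gau_lip C (f f1 f2 : R -> R) c y : measurable_fun setT f -> taylor3 C f f1 f2 ->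
  `|gau f c y - \int[N]_z f z| <= 3 * C * (`|y| + `|c - 1| * m1).
Proof.
move=> mf fT; have [f0C f1C _ _] := fT.
have C0 : 0 <= C by apply: le_trans (normr_ge0 _) (f1C 0).
have f0 x : 0 <= f x by case/andP: (f0C x).
pose L (e : R) : seq (R * (R -> R) * R) :=
  [:: (e, fun z => f (y + c * z), gau f c y); (- e, f, \int[N]_z f z);
      (- (3 * C * `|y|), fun=> 1, 1); (- (3 * C * `|c - 1|), fun z => `|z| ^+ 1, m1)].
have HL (e : R) : `|e| = 1 ->
    e * (gau f c y - \int[N]_z f z) <= 3 * C * (`|y| + `|c - 1| * m1).
  move=> e1; suff : \sum_(t <- L e) t.1.1 * t.2 <= 0 by rewrite !big_cons big_nil/=; lra.
  apply: En_lin_le.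
    move=> t [<-|[<-|[<-|[<-|//]]]]/=.
    - split=> //; first exact: measurable_affine_comp.
      by rewrite (gauE _ _ mf f0C).
    - by split=> //; exact: EnE_fin mf f0C.
    - by split=> //; exact: En_cst.
    - split; [|by move=> z; exact: exprn_ge0|exact: m1E].
      by apply: measurable_funX; exact: normr_measurable.
  move=> z; rewrite !big_cons big_nil/=.
  have T := taylor3_lip z (y + (c - 1) * z) fT.
  have zz : z + (y + (c - 1) * z) = y + c * z by ring.
  rewrite zz in T.
  have B : 3 * C * `|y + (c - 1) * z| <= 3 * C * (`|y| + `|c - 1| * `|z|).
    by rewrite ler_wpM2l ?mulr_ge0// (le_trans (ler_normD _ _))// normrM.
  have := ler_norm (e * (f (y + c * z) - f z)); rewrite normrM e1 mul1r => U.
  have := le_trans U (le_trans T B); rewrite expr1.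
  move: (f (y + c * z)) (f z) `|y| `|c - 1| `|z| => a b p q r; lra.
rewrite ler_norml; apply/andP; split.
  by have := HL (-1); rewrite normrN1 => /(_ erefl); lra.
by have := HL 1; rewrite normr1 => /(_ erefl); lra.
Qed.

(** With [s = 1 / sqrt (3 ln n)], the comparison error and the cost of replacing the harmonic sum by
    [ln n], from which it differs by at most 1, are both of order [1 / sqrt (ln n)]. *)
Lemma Fsum_clt_bound C (f f1 f2 : R -> R) (n : nat) : measurable_fun setT f ->
  measurable_fun setT f1 -> measurable_fun setT f2 -> taylor3 C f f1 f2 ->
  1 <= ln (n%:R : R) ->
  `|fine (Ex n (fun y => (f ((Fsum sqdev n (psum y) - ln n%:R) / Num.sqrt (3 * ln n%:R)))%:E))
    - \int[N]_z f z| <= (4 * clt_const C + 3 * C * (1 + m1)) / Num.sqrt (ln n%:R).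
Proof.
move=> mf mf1 mf2 fT L1; set L := ln (n%:R : R) in L1 *.
have n0 : (0 < n)%N by case: n @L L1 => // L; rewrite /L ln0// ler10.
have [lnH Hln] := ln_harmonic_sum n0; rewrite -/L in lnH Hln.
set H := harmonic_sum n in lnH Hln.
have L0 : 0 < L by lra.
pose q := Num.sqrt (3 * L); pose s := q^-1; pose r := (Num.sqrt L)^-1.
have q0 : 0 < q by rewrite sqrtr_gt0; lra.
have s0 : 0 < s by rewrite invr_gt0.
have s2 : s ^+ 2 * (3 * L) = 1.
  by rewrite exprVn sqr_sqrtr ?mulVf//; [rewrite gt_eqF//; lra|lra].
have r0 : 0 < r by rewrite invr_gt0 sqrtr_gt0.
have sr : s <= r.
  have sq : Num.sqrt L <= q by rewrite /q; apply: ler_wsqrtr; lra.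
  by rewrite /s /r lef_pV2 ?posrE// sqrtr_gt0.
have r2 : r ^+ 2 * L = 1 by rewrite exprVn sqr_sqrtr ?mulVf ?gt_eqF// ltW.
have r1 : r <= 1 by rewrite invf_le1 ?sqrtr_gt0// -sqrtr1 ler_wsqrtr.
have E : fine (Ex n (fun y => (f ((Fsum sqdev n (psum y) - L) / q))%:E)) = exp_avg s f n (- (s * L)).
  by congr fine; apply: It_ext => y _; congr (f _)%:E; rewrite /s; ring.
rewrite E.
have B1 := exp_avg_gauss_avg mf mf1 mf2 fT (ltW s0) n (- (s * L)).
have B2 := gau_lip (s * Num.sqrt (3 * H)) (- (s * L) + s * H) mf fT.
have D0 := @clt_const_ge0 C f f1 f2 fT.
have C0 : 0 <= C by have [_ f1C _ _] := fT; apply: le_trans (normr_ge0 _) (f1C 0).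
have M0 : 0 <= m1 by rewrite -lee_fin -m1E; apply: En_ge0 => x; exact: exprn_ge0.
rewrite -/(gauss_avg s f n (- (s * L))) in B2.
have H0 : 0 <= H by exact: harmonic_sum_ge0.
have b1 : s ^+ 2 * (2 - 2 / n.+1%:R) + s ^+ 3 * H <= 4 * r.
  have k1 : 2 - 2 / n.+1%:R <= 2 :> R by rewrite lerBlDr lerDl divr_ge0.
  have ss0 : 0 <= s ^+ 2 by exact: sqr_ge0.
  have := ler_wpM2l ss0 k1; have s30 : 0 <= s ^+ 3 by rewrite exprn_ge0// ltW.
  have := ler_wpM2l s30 Hln.
  have s3L : s ^+ 3 * L = s / 3 by rewrite exprS -mulrA; have := congr1 (fun t => s * t) s2; lra.
  have s21 : s ^+ 2 <= r.
    by apply: le_trans (_ : s * 1 <= r); [rewrite expr2 ler_wpM2l ?(ltW s0)// (le_trans sr)|rewrite mulr1].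
  have s31 : s ^+ 3 <= r.
    by rewrite exprS; apply: le_trans (_ : 1 * s ^+ 2 <= r); [rewrite ler_wpM2r// (le_trans sr)|rewrite mul1r].
  rewrite mulrDr mulr1 s3L; move: (s ^+ 3 * H) (s ^+ 2 * (2 - 2 / n.+1%:R)) => a b; lra.
have b2 : `|- (s * L) + s * H| <= r.
  rewrite addrC -mulrBr ger0_norm ?mulr_ge0 ?subr_ge0 ?(ltW s0)//.
  apply: le_trans sr; rewrite ler_piMr ?(ltW s0)//; lra.
have b3 : `|s * Num.sqrt (3 * H) - 1| <= r.
  set c := s * _; have c2 : c ^+ 2 = H / L.
    rewrite exprMn sqr_sqrtr; last by lra.
    have L1' : L != 0 by rewrite gt_eqF.
    apply: (mulIf L1'); rewrite divfK//.
    rewrite (_ : _ * L = s ^+ 2 * (3 * L) * H); first by rewrite s2 mul1r.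
    by rewrite -!mulrA [H * _]mulrC.
  have c0 : 0 <= c by rewrite mulr_ge0 ?sqrtr_ge0 ?(ltW s0).
  have c1 : 1 <= c.
    by rewrite -(ler_pXn2r (n := 2)) ?nnegrE// expr1n c2 ler_pdivlMr// mul1r.
  have c1r : c ^+ 2 <= 1 + r.
    rewrite c2 ler_pdivrMr// mulrDl mul1r; apply: le_trans Hln _; rewrite addrC lerD2l.
    have rL : r * (r * L) = 1 by rewrite mulrA -expr2.
    rewrite -rL ler_piMl//; first by rewrite mulr_ge0 ?(ltW r0) ?(ltW L0).
  rewrite ger0_norm ?subr_ge0//; have : c <= c ^+ 2 by rewrite expr2 ler_pMr; lra.
  lra.
have := ler_distD (gauss_avg s f n (- (s * L))) (exp_avg s f n (- (s * L))) (\int[N]_z f z).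
move=> /le_trans; apply; apply: le_trans (lerD B1 B2) _.
have b3' := ler_wpM2r M0 b3; have b23 := lerD b2 b3'.
have C3 : 0 <= 3 * C by lra.
apply: le_trans (lerD (ler_wpM2l D0 b1) (ler_wpM2l C3 b23)) _.
suff -> : clt_const C * (4 * r) + 3 * C * (r + r * m1) =
  (4 * clt_const C + 3 * C * (1 + m1)) * r by [].
by ring.
Qed.

Theorem Fsum_clt C (f f1 f2 : R -> R) : measurable_fun setT f ->
  measurable_fun setT f1 -> measurable_fun setT f2 -> taylor3 C f f1 f2 ->
  fine (Ex n (fun y => (f ((Fsum sqdev n (psum y) - ln n%:R) / Num.sqrt (3 * ln n%:R)))%:E))
    @[n --> \oo] --> \int[N]_z f z.
Proof.
move=> mf mf1 mf2 fT; apply/cvgrPdist_le => e e0.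
set K := 4 * clt_const C + 3 * C * (1 + m1).
pose A := Num.max 1 ((K / e) ^+ 2).
have := nbhs_infty_ger (expR A); apply: filterS => n nA.
have An : A <= ln n%:R by rewrite -[A]expRK ler_ln ?posrE ?expR_gt0// (lt_le_trans _ nA) ?expR_gt0.
have A1 : 1 <= A by rewrite le_max lexx.
have A2 : (K / e) ^+ 2 <= A by rewrite le_max lexx orbT.
rewrite distrC; apply: le_trans (Fsum_clt_bound mf mf1 mf2 fT (le_trans A1 An)) _.
have l0 : 0 < Num.sqrt (ln n%:R : R) by rewrite sqrtr_gt0; apply: lt_le_trans An; lra.
rewrite ler_pdivrMr// -/K mulrC -ler_pdivrMr//.
apply: le_trans (ler_norm _) _; rewrite -sqrtr_sqr; apply: ler_wsqrtr.
exact: le_trans A2 An.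
Qed.

End smooth_averages.

(** * The Grenander estimator *)

Section least_concave_majorant.
Context {R : realType}.
Variable F : R -> R.

Lemma concave_majorant_chord g a b u : concave_majorant F g -> 0 <= a -> a < b ->
  a <= u <= b -> (b - u) / (b - a) * g a + (u - a) / (b - a) * g b <= g u.
Proof.
move=> [cg _] a0 ab /andP[au ub].
have ba0 : 0 < b - a by rewrite subr_gt0.
have th0 : 0 <= (b - u) / (b - a) by rewrite divr_ge0 ?subr_ge0// ltW.
have th1 : (b - u) / (b - a) <= 1 by rewrite ler_pdivrMr// mul1r lerD2l lerN2.
have aD : a \in (`[0, +oo[%classic : set R^o) by rewrite inE/= in_itv/= a0.
have bD : b \in (`[0, +oo[%classic : set R^o).
  by rewrite inE/= in_itv/= (le_trans a0 (ltW ab)).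
have th2 : 1 - (b - u) / (b - a) = (u - a) / (b - a).
  by field; rewrite gt_eqF.
have := cg (Itv01 th0 th1) a b aD bD; set c := conv _ _ _.
have -> : c = u.
  transitivity ((b - u) / (b - a) * a + (1 - (b - u) / (b - a)) * b); first by [].
  by field; rewrite gt_eqF.
rewrite convRE /= /unstable.onem th2; lra.
Qed.

(** The line is itself a concave majorant, and every concave majorant lies above the chord between
    the two points where the line meets [F]. *)
Lemma lcm_chord (l a b u : R) : 0 <= a -> a < b -> (forall v, 0 <= v -> F v <= F a + l * (v - a)) ->
  F b = F a + l * (b - a) -> a <= u <= b -> least_concave_majorant F u = F a + l * (u - a).
Proof.
move=> a0 ab Fl Fb aub; have /andP[au ub] := aub.
have u0 : 0 <= u by exact: le_trans a0 au.
have ba0 : 0 < b - a by rewrite subr_gt0.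
have line : concave_majorant F (fun v => F a + l * (v - a)).
  split=> // t x y _ _.
  have -> : conv t x y = t%:num * x + (1 - t%:num) * y :> R by [].
  rewrite convRE /= /unstable.onem; lra.
apply/eqP; rewrite eq_le; apply/andP; split.
  apply: ge_inf; last by exists (fun v => F a + l * (v - a)).
  by exists (F u) => _ [g [_ Fg] <-]; exact: Fg.
apply: lb_le_inf; first by exists (F a + l * (u - a)), (fun v => F a + l * (v - a)).
move=> _ [g cg <-]; have [_ Fg] := cg.
apply: le_trans (concave_majorant_chord cg a0 ab aub).
have ga := Fg _ a0; have gb := Fg _ (le_trans a0 (ltW ab)).
have p0 : 0 <= (b - u) / (b - a) by rewrite divr_ge0 ?subr_ge0// ltW.
have q0 : 0 <= (u - a) / (b - a) by rewrite divr_ge0 ?subr_ge0// ltW.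
apply: le_trans (lerD (ler_wpM2l p0 ga) (ler_wpM2l q0 gb)); rewrite Fb le_eqVlt.
by apply/orP; left; apply/eqP; field; rewrite gt_eqF.
Qed.

Lemma left_slope_chord (l a b t : R) : 0 <= a -> a < t <= b ->
  (forall v, 0 <= v -> F v <= F a + l * (v - a)) ->
  F b = F a + l * (b - a) -> left_slope (least_concave_majorant F) t = l.
Proof.
move=> a0 /andP[at_ tb] Fl Fb; have ab := lt_le_trans at_ tb.
apply: lim_near_cst => //; near=> e.
have e0 : e < 0 by near: e; exact: nbhs_left_lt.
have ea : a - t < e by near: e; apply: nbhs_left_gt; rewrite subr_lt0.
have aeb : a <= t + e <= b by apply/andP; split; lra.
have atb : a <= t <= b by rewrite tb ltW.
rewrite (lcm_chord a0 ab Fl Fb aeb) (lcm_chord a0 ab Fl Fb atb).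
by field; rewrite lt_eqF.
Unshelve. all: by end_near. Qed.

End least_concave_majorant.

(** * Min-max description and measurability of the estimator *)

Section grenander_seq.
Context {R : realType}.
Variable n : nat.
Implicit Types (s : seq R) (t u : R).

Definition ecdf s : R -> R := empirical_cdf (fun i : 'I_n => nth 0 s i).

Definition gren s : R -> R := grenander (fun i : 'I_n => nth 0 s i).

Lemma ecdfE s t : ecdf s t = (\sum_(i < n) (nth 0 s i <= t)%R%:R) / n%:R.
Proof.
congr (_ / _); apply: eq_bigr => i _; rewrite indicE; congr (_%:R).
by case: (boolP (nth 0 s i <= t)) => h; [rewrite mem_set|rewrite memNset//; exact/negP].
Qed.

Lemma ecdf_mono s t u : t <= u -> ecdf s t <= ecdf s u.
Proof.
move=> tu; rewrite !ecdfE ler_wpM2r ?invr_ge0//; apply: ler_sum => i _.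
by rewrite ler_nat; case: leP => // it; rewrite (le_trans it tu).
Qed.

Lemma ecdf_perm s s' : size s = n -> perm_eq s s' -> ecdf s = ecdf s'.
Proof.
move=> sn ss'; apply/funext => t; rewrite !ecdfE; congr (_ / _).
have H (r : seq R) : size r = n ->
    \sum_(i < n) (nth 0 r i <= t)%R%:R = \sum_(x <- r) (x <= t)%R%:R :> R.
  by move=> rn; rewrite (big_nth 0) big_mkord rn.
by rewrite !H// -?(perm_size ss')//; exact: perm_big.
Qed.

(** Candidate vertices of the majorant: the origin, the observations moved into [[0, +oo[] where
    concavity is imposed, and [t] itself as last point, so that every [t > 0] lies under a chord. *)
Definition pt s t (k : nat) : R :=
  if k == 0%N then 0 else if (k <= n)%N then Num.max 0 (nth 0 s k.-1) else t.

Lemma pt_ge0 s t k : 0 <= t -> 0 <= pt s t k.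
Proof. by move=> t0; rewrite /pt; case: ifP => // _; case: ifP => // _; rewrite le_max lexx. Qed.

Lemma pt_max s t u : 0 <= u -> exists2 k, (k <= n)%N & pt s t k <= u /\
  forall i, (i <= n)%N -> pt s t i <= u -> pt s t i <= pt s t k.
Proof.
move=> u0; pose Q (k : 'I_n.+1) := pt s t k <= u.
have Q0 : Q ord0 by rewrite /Q /pt.
have [k Qk kmax] := Order.TotalTheory.arg_maxP (fun k : 'I_n.+1 => pt s t k) Q0.
exists k; first by rewrite -ltnS.
by split=> // i ilt; exact: (kmax (Ordinal (ilt : (i < n.+1)%N))).
Qed.

Lemma ecdf_pt s t u : 0 <= u -> exists2 k, (k <= n)%N & pt s t k <= u /\
  ecdf s u = ecdf s (pt s t k).
Proof.
move=> u0; have [k kn [ku kmax]] := pt_max s t u0.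
exists k => //; split=> //; rewrite !ecdfE; congr (_ / _); apply: eq_bigr => i _.
congr (_%:R); congr nat_of_bool; apply/idP/idP => [iu|]; last by move/le_trans; exact.
have := kmax i.+1 (ltn_ord i); rewrite /pt/= ltn_ord ge_max u0 iu => /(_ isT).
by move=> H; apply: le_trans H; rewrite le_max lexx orbT.
Qed.

(** The left slope at [t] is that of a supporting chord over a point slightly to the left of [t].
    Between candidate vertices the empirical distribution function is constant, so checking the
    vertices suffices. *)
Lemma gren_chord s t : 0 < t -> exists a b (l : R),
  [/\ (a <= n)%N, (b <= n.+1)%N, pt s t a < t <= pt s t b & 0 <= l] /\
  [/\ forall u, 0 <= u -> ecdf s u <= ecdf s (pt s t a) + l * (u - pt s t a),
   ecdf s (pt s t b) = ecdf s (pt s t a) + l * (pt s t b - pt s t a) & gren s t = l].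
Proof.
move=> t0; have ptt : pt s t n.+1 = t by rewrite /pt /= ltnn.
pose Q (k : 'I_n.+1) := pt s t k < t.
have Q0 : Q ord0 by rewrite /Q /pt.
have [k Qk kmax] := Order.TotalTheory.arg_maxP (fun k : 'I_n.+1 => pt s t k) Q0.
rewrite /Q /= in Qk.
(* Halfway between the last vertex before [t] and [t]: no vertex lies in [[t', t[], so the chord
   over [t'] also reaches [t]. *)
pose t' := (pt s t k + t) / 2.
have kt' : pt s t k < t' by rewrite /t' ltr_pdivlMr//; lra.
have t't : t' < t by rewrite /t' ltr_pdivrMr//; lra.
have sep i : (i < n.+2)%N -> pt s t i < t' \/ t <= pt s t i.
  rewrite ltnS leq_eqVlt => /orP[/eqP->|ilt]; first by right; rewrite ptt.
  have [ti|it] := leP t (pt s t i); [by right|left].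
  by apply: le_lt_trans kt'; exact: (kmax (Ordinal ilt)).
have [|||a [b [am bm ua ub H]]] := @supporting_chord _ n.+2 (pt s t) (fun i => ecdf s (pt s t i)) t'.
- move=> i /sep[it|ti]; first by rewrite lt_eqF.
  by rewrite gt_eqF// (lt_le_trans t't).
- by exists (nat_of_ord k) => //; exact: leqW (ltn_ord k).
- by exists n.+1 => //; rewrite ptt.
have ta : pt s t a < t by exact: lt_trans t't.
have tb : t <= pt s t b by case: (sep b bm) => // /lt_trans /(_ ub); rewrite ltxx.
have an : (a <= n)%N.
  by move: am; rewrite ltnS leq_eqVlt => /orP[/eqP ae|//]; move: ta; rewrite ae ptt ltxx.
have ab : 0 < pt s t b - pt s t a by rewrite subr_gt0 (lt_le_trans ta).
pose l := (ecdf s (pt s t b) - ecdf s (pt s t a)) / (pt s t b - pt s t a).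
have l0 : 0 <= l.
  by rewrite divr_ge0 ?(ltW ab)// subr_ge0 ecdf_mono// ltW// -subr_gt0.
have eb : ecdf s (pt s t b) = ecdf s (pt s t a) + l * (pt s t b - pt s t a).
  by rewrite /l divfK ?gt_eqF// addrC subrK.
have eu u : 0 <= u -> ecdf s u <= ecdf s (pt s t a) + l * (u - pt s t a).
  move=> u0; have [i ilt [iu ->]] := ecdf_pt s t u0.
  have := H i (leqW (ilt : (i < n.+1)%N)); rewrite -ler_pdivlMr// mulrAC -/l => Hi.
  have := ler_wpM2l l0 iu; lra.
exists a, b, l; split; split=> //; first by rewrite ta tb.
by apply: (left_slope_chord _ _ eu eb); [exact/pt_ge0/ltW|rewrite ta tb].
Qed.

Lemma gren_ge0 s t : 0 < t -> 0 <= gren s t.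
Proof. by move=> t0; have [a [b [l [[_ _ _ l0] [_ _ ->]]]]] := gren_chord s t0. Qed.

(* The min-max formula for the slope of the least concave majorant. *)
Lemma gren_leE s t r : 0 < t -> (gren s t <= r) =
  has (fun a => (pt s t a < t) && all (fun b => (t <= pt s t b) ==>
    (ecdf s (pt s t b) - ecdf s (pt s t a) <= r * (pt s t b - pt s t a))) (iota 0 n.+2)) (iota 0 n.+1).
Proof.
move=> t0; have [a [b [l [[an bn /andP[ta tb] l0] [eu eb ->]]]]] := gren_chord s t0.
apply/idP/hasP => [lr|[a' _ /andP[ta' /allP H]]].
  exists a; first by rewrite mem_iota add0n ltnS.
  rewrite ta; apply/allP => c _; apply/implyP => tc.
  have := eu _ (pt_ge0 s c (ltW t0)).
  have ac : 0 <= pt s t c - pt s t a by rewrite subr_ge0 ltW// (lt_le_trans ta).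
  have := ler_wpM2r ac lr; lra.
have := H b; rewrite mem_iota add0n ltnS bn => /(_ isT)/implyP/(_ tb).
have ab : 0 < pt s t b - pt s t a' by rewrite subr_gt0 (lt_le_trans ta').
have := eu _ (pt_ge0 s a' (ltW t0)) => E1 E2.
rewrite -(ler_pM2r ab); move: E1 E2; rewrite eb; lra.
Qed.

Lemma measurable_pt d (X : measurableType d) (f : X -> seq R) (g : X -> R) k :
  measurable_fun setT f -> measurable_fun setT g ->
  measurable_fun setT (fun x => pt (f x) (g x) k).
Proof.
move=> mf mg; case: k => [|k]; first exact: measurable_cst.
rewrite /pt/=; case: (k < n)%N => //; apply: measurable_maxr; first exact: measurable_cst.
exact: measurable_fun_nth.
Qed.

Lemma measurable_ecdf d (X : measurableType d) (f : X -> seq R) (g : X -> R) :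
  measurable_fun setT f -> measurable_fun setT g ->
  measurable_fun setT (fun x => ecdf (f x) (g x)).
Proof.
move=> mf mg; under eq_fun do rewrite ecdfE.
apply: measurable_funM => //; apply: measurable_sum => i.
apply/measurable_EFinP; apply: measurable_b2E; apply: measurable_fun_ler => //.
exact: measurable_fun_nth.
Qed.

Definition gren_pos (p : seq R * R) : R := if 0 < p.2 then gren p.1 p.2 else 0.

(** By the min-max formula a sublevel set is a finite boolean combination of measurable comparisons,
    jointly in the sample and the point. *)
Lemma measurable_gren_pos : measurable_fun setT gren_pos.
Proof.
move=> mD; apply: (measurability _ (RGenOInfty.measurableE R)) => //.
move=> _ [_ [r ->] <-]; rewrite setTI.
pose b (p : seq R * R) := if 0 < p.2 then
  has (fun a => (pt p.1 p.2 a < p.2) && all (fun b => (p.2 <= pt p.1 p.2 b) ==>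
    (ecdf p.1 (pt p.1 p.2 b) - ecdf p.1 (pt p.1 p.2 a) <= r * (pt p.1 p.2 b - pt p.1 p.2 a)))
      (iota 0 n.+2)) (iota 0 n.+1) else 0 <= r.
have mp k : measurable_fun setT (fun p : seq R * R => pt p.1 p.2 k).
  exact: measurable_pt.
have mb : measurable_fun setT b.
  apply: measurable_fun_ifT.
  - exact: measurable_fun_ltr.
  - apply: measurable_has => a; apply: measurable_and; first exact: measurable_fun_ltr.
    apply: measurable_all => c.
    under eq_fun do rewrite implybE.
    apply: measurable_or.
      by apply: measurable_neg; exact: measurable_fun_ler.
    apply: measurable_fun_ler.
      by apply: measurable_funB; apply: measurable_ecdf.
    by apply: measurable_funM => //; exact: measurable_funB.
  - exact: measurable_cst.
have -> : gren_pos @^-1` `]r, +oo[ = b @^-1` [set false].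
  apply/seteqP; split=> p /=; rewrite in_itv/= andbT ltNge /gren_pos /b.
    by case: ifP => p0; rewrite ?gren_leE// => /negbTE.
  by case: ifP => p0; rewrite ?gren_leE// => ->.
by rewrite -[X in measurable X]setTI; exact: mb.
Qed.

End grenander_seq.

Section step_integral.
Context {R : realType}.
Local Notation mu := (@lebesgue_measure R).
Variables (t c : nat -> R) (G : R -> R).

Lemma step_integral m : (forall k, (k < m)%N -> t k <= t k.+1) ->
  (forall k x, (k < m)%N -> t k < x <= t k.+1 -> G x = c k) ->
  [/\ t 0 <= t m, measurable_fun `]t 0, t m] (EFin \o G) &
  (\int[mu]_(x in `]t 0, t m]) (G x)%:E)%E = (\sum_(0 <= k < m) (t k.+1 - t k) * c k)%:E].
Proof.
elim: m => [|m IH] tm Gm.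
  split=> //; rewrite ?set_itvoc0 ?big_geq ?integral_set0//; exact: measurable_fun_set0.
have [k km|k x km|t0m mG EG] := IH; first by apply: tm; exact: ltnW.
  by apply: Gm; exact: ltnW.
have tm1 : t m <= t m.+1 by exact: tm.
have GE : {in (`]t m, t m.+1]%classic : set R), G =1 cst (c m)}.
  by move=> x; rewrite inE/= in_itv/= => xm; apply: Gm.
have -> : `]t 0, t m.+1]%classic = `]t 0, t m] `|` `]t m, t m.+1].
  by rewrite -itv_bndbnd_setU ?bnd_simp.
have mc : measurable_fun (`]t m, t m.+1]%classic : set R) (EFin \o G).
  apply: (@eq_measurable_fun _ _ _ _ _ (fun=> (c m)%:E)); last exact: measurable_cst.
  by move=> x xm /=; rewrite GE.
have mU : measurable_fun (`]t 0, t m] `|` `]t m, t m.+1] : set R) (EFin \o G).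
  by apply/measurable_funU.
split=> //; first exact: le_trans tm1.
rewrite integral_setU_EFin//; last 2 first.
- exact/measurable_EFinP.
- apply/disj_setPS => x [/=]; rewrite !in_itv/= => /andP[_ xm] /andP[mx _].
  by move: mx; rewrite ltNge xm.
rewrite EG big_nat_recr//= EFinD; congr (_ + _)%E.
transitivity (\int[mu]_(x in `]t m, t m.+1]) (c m)%:E)%E.
  by apply: eq_integral => x xm; rewrite GE.
rewrite integral_cst// [X in (_ * X)%E](_ : _ = lebesgue_measure (`]t m, t m.+1]%classic : set R))//.
rewrite lebesgue_measure_itv/= lte_fin.
have [lt|ge] := ltP (t m) (t m.+1); first by rewrite EFinN -EFinB -EFinM mulrC.
by rewrite (le_anti (introT andP (conj ge tm1))) subrr mul0r mule0.
Qed.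

End step_integral.

(** * The estimator of a spacing sample, face by face *)

Section grenander_faces.
Context {R : realType}.
Local Notation mu := (@lebesgue_measure R).
Variables (n : nat) (y : seq R).
Hypotheses (n0 : (0 < n)%N) (sy : size y = n.+1) (y0 : all (fun x => 0 < x) y).
Let S := psum y.
Let T := S n.+1.

(** The order statistics in decreasing order; [behead] drops the total divided by itself. *)
Definition spacings_sample : seq R := [seq x / psum y n.+1 | x <- behead (rpsum n.+1 y)].
Let s := spacings_sample.

Lemma psum_lt i k : (i < k <= n.+1)%N -> psum y i < psum y k.
Proof.
elim: k => // k IH /andP[]; rewrite ltnS leq_eqVlt => ik kn.
have yk : 0 < nth 0 y k by apply: (allP y0); apply: mem_nth; rewrite sy.
rewrite psumS; case/orP: ik => [/eqP->|ik]; first by rewrite ltrDl.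
by apply: lt_trans (IH _) _; rewrite ?ik ?(ltnW kn)// ltrDl.
Qed.

Lemma psum_le i k : (i <= n.+1)%N -> (k <= n.+1)%N -> (psum y i <= psum y k) = (i <= k)%N.
Proof.
move=> iN kN; have [ik|ki] := leqP i k.
  by move: ik; rewrite leq_eqVlt => /orP[/eqP->|ik]; rewrite ?lexx// ltW// psum_lt// ik.
by apply/negbTE; rewrite -ltNge psum_lt// ki.
Qed.

Let T0 : 0 < T. Proof. by rewrite -(psum0 y) psum_lt/=. Qed.

Lemma size_spacings_sample : size s = n.
Proof. by rewrite size_map size_behead size_mkseq. Qed.

Lemma nth_spacings_sample i : (i < n)%N -> nth 0 s i = psum y (n - i) / T.
Proof.
move=> ilt; rewrite (nth_map 0) ?size_behead ?size_mkseq// nth_behead nth_mkseq ?ltnS//.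
Qed.

Lemma ecdf_spacings p : (p <= n)%N -> ecdf n s (psum y p / T) = p%:R / n%:R.
Proof.
move=> pn; rewrite ecdfE; congr (_ / _).
transitivity (\sum_(i < n) ((n - i <= p)%N%:R : R)).
  apply: eq_bigr => i _; rewrite nth_spacings_sample// ler_pM2r ?invr_gt0// psum_le//.
  - by rewrite (leq_trans (leq_subr _ _)).
  - exact: leqW.
rewrite -natr_sum; congr (_%:R).
rewrite -(big_mkord xpredT (fun i => ((n - i <= p)%N : nat))).
rewrite (big_cat_nat _ (n := (n - p)%N)) ?leq_subr//=.
rewrite big_nat_cond big1 ?add0n; last by move=> i /andP[/andP[_ ip] _]; lia.
rewrite (eq_big_nat _ _ (F2 := fun=> 1%N)) ?sum_nat_const_nat; lia.
Qed.

Lemma ecdf_spacings_ex u : 0 <= u ->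
  exists2 i, (i <= n)%N & psum y i / T <= u /\ ecdf n s u = i%:R / n%:R.
Proof.
move=> u0; have [[|k] kn [ku ->]] := ecdf_pt n s 0 u0.
  by exists 0%N => //; rewrite /pt/= -(ecdf_spacings (leq0n n)) psum0 mul0r.
have ptk : pt n s 0 k.+1 = psum y (n - k) / T.
  rewrite /pt/= kn nth_spacings_sample//; apply/max_idPr.
  by rewrite divr_ge0 ?(ltW T0)// -(psum0 y) psum_le// (leq_trans (leq_subr _ _)).
exists (n - k)%N; rewrite ?leq_subr//; by rewrite ptk ecdf_spacings ?leq_subr// -ptk.
Qed.

Lemma gren_line (l a b t : R) : 0 <= a -> a < t <= b ->
  (forall v, 0 <= v -> ecdf n s v <= ecdf n s a + l * (v - a)) ->
  ecdf n s b = ecdf n s a + l * (b - a) -> gren n s t = l.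
Proof. exact: left_slope_chord. Qed.

(** At the observations the empirical distribution function is [i / n], so [face] says that the
    chord of this slope is a majorant touching it at both ends. *)
Lemma gren_face a b t : (a < b <= n)%N -> face n (psum y) a b ->
  psum y a / T < t <= psum y b / T ->
  gren n s t = (b - a)%:R * T / (n%:R * (psum y b - psum y a)).
Proof.
move=> /andP[ab bn] /faceP fab tab.
have an : (a <= n)%N by exact: leq_trans (ltnW ab) bn.
have Sab : 0 < psum y b - psum y a by rewrite subr_gt0 psum_lt// ab leqW.
have np : 0 < (n%:R : R) by rewrite ltr0n.
set l := RHS.
have lE : l * (psum y b - psum y a) / T = (b%:R - a%:R) / n%:R.
  by rewrite /l natrB ?(ltnW ab)//; field; rewrite !gt_eqF.
have l0 : 0 <= l by rewrite /l divr_ge0 ?mulr_ge0// ?(ltW T0) ?(ltW Sab) ?(ltW np).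
have Sa0 : 0 <= psum y a / T by rewrite divr_ge0 ?(ltW T0)// -(psum0 y) psum_le// leqW.
apply: (gren_line Sa0 tab) => [v v0|]; last first.
  rewrite (ecdf_spacings bn) (ecdf_spacings an) -mulrBl mulrA lE; lra.
have [i ilt [iv ->]] := ecdf_spacings_ex v0.
rewrite (ecdf_spacings an).
have := fab i ilt; rewrite /below => H.
have {}H : (i%:R - a%:R) / n%:R <= l * (psum y i / T - psum y a / T).
  rewrite -mulrBl -(ler_pM2r np) divfK ?gt_eqF// -(ler_pM2r Sab).
  apply: le_trans H _; rewrite le_eqVlt; apply/orP; left; apply/eqP.
  by rewrite /l natrB ?(ltnW ab)//; field; rewrite !gt_eqF.
have := ler_wpM2l l0 iv; move: H; rewrite mulrBr mulrBr mulrBl; lra.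
Qed.

Lemma gren_last t : psum y n / T < t -> gren n s t = 0.
Proof.
move=> nt; have S0 : 0 <= psum y n / T.
  by rewrite divr_ge0 ?(ltW T0)// -(psum0 y) psum_le.
have np : (n%:R != 0 :> R) by rewrite pnatr_eq0 -lt0n.
have le1 v : 0 <= v -> ecdf n s v <= 1.
  move=> v0; have [i ilt [_ ->]] := ecdf_spacings_ex v0.
  by rewrite ler_pdivrMr ?ltr0n// mul1r ler_nat.
have e1 : ecdf n s (psum y n / T) = 1 by rewrite ecdf_spacings// divff.
apply: (@gren_line 0 (psum y n / T) t t) => //.
- by rewrite nt lexx.
- by move=> v v0; rewrite mul0r addr0 e1; exact: le1.
rewrite mul0r addr0 e1; apply/eqP; rewrite eq_le le1/=; last first.
  by rewrite ltW// (le_lt_trans S0).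
by rewrite -e1 ecdf_mono// ltW.
Qed.

(** The estimator is constant between consecutive order statistics, and [sum_faces] groups these
    intervals. Beyond the largest observation it vanishes, whence the term in [H 0]. *)
Lemma integral_gren (H : R -> R) : ~~ degenerate n (psum y) ->
  mu.-integrable `]0, 1] (EFin \o (fun x => H (gren n s x))) /\
  \int[mu]_(x in `[0, 1]) H (gren n s x) =
  Fsum (fun j g => g / T * H (j%:R * T / (n%:R * g))) n (psum y) + (1 - psum y n / T) * H 0.
Proof.
move=> gen.
pose t k := if (k <= n)%N then psum y k / T else 1.
pose c k := H (gren n s (t k.+1)).
have t0 : t 0 = 0 by rewrite /t psum0 mul0r.
have t1 : t n.+1 = 1 by rewrite /t ltnn.
have tn1 : psum y n / T < 1 by rewrite ltr_pdivrMr// mul1r psum_lt//= ltnS leqnn.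
have tlt k : (k < n.+1)%N -> t k < t k.+1.
  rewrite ltnS leq_eqVlt => /orP[/eqP->|kn]; first by rewrite t1 /t leqnn.
  by rewrite /t kn (ltnW kn) ltr_pM2r ?invr_gt0// psum_lt//; lia.
have cE k x : (k < n.+1)%N -> t k < x <= t k.+1 -> H (gren n s x) = c k.
  rewrite ltnS leq_eqVlt => /orP[/eqP->|kn] /andP[tx xt]; rewrite /c.
    have tn : t n = psum y n / T by rewrite /t leqnn.
    by rewrite !gren_last// -?tn ?t1// -t1 tlt.
  have [a [b [ak kb fab]]] := face_cover gen kn.
  have /andP[kb1 bn] := kb.
  have abn : (a < b <= n)%N by rewrite (leq_ltn_trans ak).
  have ta : psum y a / T <= t k.
    by rewrite /t (ltnW kn) ler_pM2r ?invr_gt0// psum_le//; lia.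
  have tb : t k.+1 <= psum y b / T.
    by rewrite /t kn ler_pM2r ?invr_gt0// psum_le//; lia.
  rewrite !(gren_face abn fab)//.
    by rewrite tb andbT (le_lt_trans ta)// tlt// ltnW.
  by rewrite (le_lt_trans ta)//= (le_trans xt).
have [_ mG EG] := step_integral (fun k kn => ltW (tlt k kn)) cE.
rewrite t0 t1 in mG EG.
have iG : mu.-integrable `]0, 1] (EFin \o (fun x => H (gren n s x))).
  apply/integrableP; split=> //.
  have [_ _] := step_integral (G := fun x => `|H (gren n s x)|) (fun k kn => ltW (tlt k kn))
    (fun k x kn kx => congr1 Num.norm (cE k x kn kx)).
  by rewrite t0 t1 => E; rewrite [X in (X < _)%E]E ltry.
split=> //.
rewrite -Rintegral_itv_obnd_cbnd// /Rintegral EG /=.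
rewrite big_nat_recr//=; congr (_ + _).
  rewrite (sum_faces gen); apply: eq_big_nat => a /andP[_ an]; apply: eq_big_nat => b /andP[ab bn].
  case: ifP => // fab.
  have abn : (a < b <= n)%N by rewrite ab.
  rewrite (eq_big_nat _ _ (F2 := fun k => (psum y k.+1 / T - psum y k / T) *
      H ((b - a)%:R * T / (n%:R * (psum y b - psum y a))))).
    by rewrite -mulr_suml telescope_sumr ?(ltnW ab)// -mulrBl.
  move=> k /andP[ak kb]; have kn : (k < n)%N by lia.
  rewrite /c /t kn (ltnW kn); congr (_ * H _); apply: gren_face => //.
  by rewrite ltr_pM2r ?ler_pM2r ?invr_gt0// psum_lt ?psum_le//; lia.
rewrite t1 /t leqnn; congr (_ * H _); rewrite t1; exact: gren_last.
Qed.

End grenander_faces.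

Section measurability.
Context {R : realType}.
Local Notation mu := (@lebesgue_measure R).

(** The estimator is nonnegative on []0, 1]], so [H] may be replaced by the measurable [H'];
    positive and negative parts are then integrated separately. *)
Lemma measurable_integral_gren n (H H' : R -> R) : measurable_fun setT H' ->
  (forall v, 0 <= v -> H v = H' v) ->
  measurable_fun setT (fun s => \int[mu]_(x in `[0, 1]) H (gren n s x)).
Proof.
move=> mH' HH'.
pose f (p : seq R * R) : \bar R := (H' (gren_pos n p) * (0 < p.2 <= 1)%R%:R)%:E.
have mf : measurable_fun setT f.
  apply/measurable_EFinP; apply: measurable_funM.
    by apply: (measurableT_comp mH'); exact: measurable_gren_pos.
  apply/measurable_EFinP; apply: measurable_b2E; apply: measurable_and.
    exact: measurable_fun_ltr.
  exact: measurable_fun_ler.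
have mfs s : measurable_fun setT (fun x => f (s, x)).
  by apply: (measurableT_comp mf (g := fun x => (s, x))); exact: measurable_fun_pair.
have fE s x : 0 < x <= 1 -> (H (gren n s x))%:E = f (s, x).
  move=> /andP[x0 x1]; rewrite /f /gren_pos /= x0 x1 mulr1.
  by rewrite HH'// gren_ge0.
have E s : \int[mu]_(x in `[0, 1]) H (gren n s x) = fine (\int[mu]_x f (s, x)).
  congr fine; rewrite -integral_itv_obnd_cbnd; last first.
    apply: (@eq_measurable_fun _ _ _ _ _ (fun x => f (s, x))); last exact: measurable_funTS.
    by move=> x; rewrite inE/= in_itv/= => /fE.
  rewrite integral_mkcond; apply: eq_integral => x _; rewrite patchE.
  case: ifPn; first by rewrite inE/= in_itv/= => /fE.
  rewrite notin_setE/= in_itv/= => /negP/negbTE x01.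
  by rewrite /f/= x01 mulr0.
rewrite (_ : (fun s => _) = fun s => fine (\int[mu]_x f (s, x))); last exact/funext.
apply: (measurableT_comp (f := @fine R)); first exact: fine_measurable.
have mp : measurable_fun setT (fun p => f^\+ p)%E by exact: measurable_funepos.
have mn : measurable_fun setT (fun p => f^\- p)%E by exact: measurable_funeneg.
have p0 p : (0 <= f^\+ p)%E by exact: funepos_ge0.
have n0 p : (0 <= f^\- p)%E by exact: funeneg_ge0.
have mint (g : (seq R * measurableTypeR R)%type -> \bar R) : measurable_fun setT g ->
    (forall p, 0 <= g p)%E -> measurable_fun setT (fun s => \int[mu]_x g (s, x))%E.
  by move=> mg g0; exact: (@measurable_fun_fubini_tonelli_F _ _ _ _ _ mu g).
rewrite (_ : (fun s => _) = (fun s => \int[mu]_x (f^\+ (s, x)) - \int[mu]_x (f^\- (s, x)))%E).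
  exact: (emeasurable_funB (mint _ mp p0) (mint _ mn n0)).
by apply/funext => s; rewrite integralE; congr (_ - _)%E; apply: eq_integral => x _;
  rewrite !unlock.
Qed.

End measurability.

(** * Taylor expansion of an analytic function *)

Section modulus_theory.
Context {R : realType}.
Local Open Scope complex_scope.
Implicit Types z w : R[i].

Lemma modulusE z : `|z| = (modulus z)%:C.
Proof. by rewrite /modulus normc_def. Qed.

Lemma modulus_ge0 z : 0 <= modulus z.
Proof. by rewrite -lecR -modulusE normr_ge0. Qed.

Lemma modulusD z w : modulus (z + w) <= modulus z + modulus w.
Proof. by rewrite -lecR rmorphD/= -!modulusE; exact: ler_normD. Qed.

Lemma modulusM z w : modulus (z * w) = modulus z * modulus w.
Proof. by apply/complexI; rewrite rmorphM/= -!modulusE normrM. Qed.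

Lemma modulusN z : modulus (- z) = modulus z.
Proof. by rewrite /modulus normrN. Qed.

Lemma modulus0 : modulus (0 : R[i]) = 0.
Proof. by rewrite /modulus normr0. Qed.

Lemma modulus_eq0 z : modulus z = 0 -> z = 0.
Proof. by move=> z0; apply/normr0_eq0; rewrite modulusE z0. Qed.

Lemma modulusX z k : modulus (z ^+ k) = modulus z ^+ k.
Proof. by apply/complexI; rewrite rmorphXn/= -!modulusE normrX. Qed.

Lemma modulusV z : modulus z^-1 = (modulus z)^-1.
Proof. by apply/complexI; rewrite fmorphV/= -!modulusE normfV. Qed.

Lemma modulus_real (x : R) : modulus x%:C = `|x|.
Proof. by rewrite /modulus normc_def/= expr0n addr0 sqrtr_sqr. Qed.

Lemma modulusB z w : modulus (z - w) = modulus (w - z).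
Proof. by rewrite -modulusN opprB. Qed.

Lemma Re_le_modulus z : `|complex.Re z| <= modulus z.
Proof. by rewrite -lecR -modulusE; exact: normc_ge_Re. Qed.

Lemma Im_le_modulus z : `|complex.Im z| <= modulus z.
Proof.
rewrite /modulus normc_def/= -sqrtr_sqr; apply: ler_wsqrtr.
by rewrite lerDr sqr_ge0.
Qed.

Lemma modulus_le_ReIm z : modulus z <= `|complex.Re z| + `|complex.Im z|.
Proof.
rewrite /modulus normc_def/= -[leRHS]ger0_norm ?addr_ge0// -sqrtr_sqr.
apply: ler_wsqrtr; rewrite sqrrD !real_normK ?num_real// addrAC lerDl.
by rewrite mulrn_wge0// mulr_ge0.
Qed.

Lemma modulus_sum I (r : seq I) (F : I -> R[i]) :
  modulus (\sum_(i <- r) F i) <= \sum_(i <- r) modulus (F i).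
Proof.
elim: r => [|i r IH]; first by rewrite !big_nil modulus0.
by rewrite !big_cons; apply: le_trans (modulusD _ _) _; rewrite lerD2l.
Qed.

Lemma cvgC_modulus (u : nat -> R[i]^o) (l : R[i]^o) : u @ \oo --> l ->
  forall e : R, 0 < e -> \forall n \near \oo, modulus (l - u n) < e.
Proof.
move=> ul e e0; move/cvgrPdist_lt : ul => /(_ e%:C).
rewrite ltcR => /(_ e0); apply: filterS => n.
by rewrite modulusE ltcR.
Qed.

Lemma modulus_limit_le (u : nat -> R[i]^o) (l c : R[i]) (B : R) : u @ \oo --> (l : R[i]^o) ->
  (\forall n \near \oo, modulus (u n - c) <= B) -> modulus (l - c) <= B.
Proof.
move=> ul uB; rewrite leNgt; apply/negP => lt.
have e0 : 0 < modulus (l - c) - B by rewrite subr_gt0.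
have ev := cvgC_modulus ul e0.
have [n [nB ne]] : exists n, modulus (u n - c) <= B /\ modulus (l - u n) < modulus (l - c) - B.
  have [N _ HN] := filterI uB ev; exists N; exact: (HN N (leqnn N)).
have := modulusD (l - u n) (u n - c); rewrite subrKA; lra.
Qed.

End modulus_theory.

Section taylor.
Context {R : realType}.
Local Open Scope complex_scope.
Implicit Types z w v : R[i].

Lemma pow_increment w v k :
  modulus ((w + v) ^+ k - w ^+ k) <= k%:R * modulus v * (modulus w + modulus v) ^+ k.-1.
Proof.
have q0 : 0 <= modulus w + modulus v by rewrite addr_ge0 ?modulus_ge0.
elim: k => [|k IH]; first by rewrite !expr0 subrr modulus0 !mul0r.
have -> : (w + v) ^+ k.+1 - w ^+ k.+1 = (w + v) * ((w + v) ^+ k - w ^+ k) + v * w ^+ k.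
  by rewrite !exprS; ring.
apply: le_trans (modulusD _ _) _; rewrite !modulusM modulusX.
have h1 : modulus (w + v) * modulus ((w + v) ^+ k - w ^+ k) <=
    k%:R * modulus v * (modulus w + modulus v) ^+ k.
  apply: (@le_trans _ _ ((modulus w + modulus v) * (k%:R * modulus v * (modulus w + modulus v) ^+ k.-1))).
    by apply: ler_pM => //; rewrite ?modulus_ge0 ?modulusD.
  case: k {IH} => [|k]; first by rewrite !mul0r mulr0.
  by rewrite mulrCA -exprS.
have h2 : modulus v * modulus w ^+ k <= modulus v * (modulus w + modulus v) ^+ k.
  apply: ler_wpM2l; first exact: modulus_ge0.
  by rewrite lerXn2r ?nnegrE ?modulus_ge0 ?addr_ge0// ?modulus_ge0// lerDl modulus_ge0.
apply: le_trans (lerD h1 h2) _; rewrite /= -natr1; lra.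
Qed.

Lemma geometric_half (n : nat) : \sum_(0 <= i < n) (2^-1 : R) ^+ i <= 2.
Proof.
suff -> : \sum_(0 <= i < n) (2^-1 : R) ^+ i = 2 - 2 * 2^-1 ^+ n.
  by rewrite lerBlDr lerDl mulr_ge0// exprn_ge0.
elim: n => [|n IH]; first by rewrite big_geq// expr0 mulr1 subrr.
rewrite big_nat_recr//= IH exprS; lra.
Qed.

Lemma three_pow2 k : (k + 3 <= 3 * 2 ^ k)%N.
Proof. by elim: k => // k IH; rewrite expnS; lia. Qed.

(* The remainder of order three is estimated for the increment between two points
   near [z0], not only between [z0] and a point. *)
Lemma analytic_taylor (h : R[i] -> R[i]^o) z0 (a : nat -> R[i]) :
  (\forall z \near (z0 : R[i]^o),
      series (fun k => a k * (z - z0) ^+ k : R[i]^o) @ \oo --> h z) ->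
  exists r K : R, [/\ 0 < r, 0 <= K & forall w v, modulus w < r -> modulus v < r ->
    modulus (h (z0 + w + v) - h (z0 + w) - a 1 * v - a 2 * ((w + v) ^+ 2 - w ^+ 2)) <=
    K * modulus v * (modulus w + modulus v) ^+ 2].
Proof.
move=> /nbhs_ballP[e /= e0 He].
have ee : e = (complex.Re e)%:C by case: e e0 {He} => x y /=; rewrite ltcE/= => /andP[/eqP -> _].
pose d := complex.Re e; have d0 : 0 < d by rewrite -ltcR -ee.
have conv w : modulus w < d -> series (fun k => a k * w ^+ k : R[i]^o) @ \oo --> h (z0 + w).
  move=> wd; have := He (z0 + w); rewrite /ball/=.
  have -> : z0 - (z0 + w) = - w by rewrite opprD addrA subrr add0r.
  rewrite normrN modulusE ee ltcR => /(_ wd).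
  by have -> : z0 + w - z0 = w by rewrite addrC addKr.
pose r := d / 2; have r0 : 0 < r by rewrite divr_gt0.
(* The terms of the series at the real increment [r] are differences of consecutive partial sums,
   within 1 of the limit from some rank on; this gives the bound 2, and the earlier terms are
   summed. *)
have [M [M0 HM]] : exists M : R, 0 <= M /\ forall k, modulus (a k) * r ^+ k <= M.
  have rd : modulus (r%:C) < d by rewrite modulus_real gtr0_norm// /r; lra.
  have C := cvgC_modulus (conv _ rd) ltr01.
  have [N _ HN] := C.
  exists (2 + \sum_(0 <= i < N) modulus (a i) * r ^+ i); split.
    by rewrite addr_ge0// sumr_ge0// => i _; rewrite mulr_ge0 ?modulus_ge0 ?exprn_ge0 ?(ltW r0).
  move=> k; have [kN|Nk] := ltnP k N.
    apply: (@le_trans _ _ (\sum_(0 <= i < N) modulus (a i) * r ^+ i)); last by rewrite lerDr.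
    rewrite big_mkord (bigD1 (Ordinal kN))//= lerDl sumr_ge0// => i _.
    by rewrite mulr_ge0 ?modulus_ge0 ?exprn_ge0 ?(ltW r0).
  have H1 := HN k Nk; have H2 := HN k.+1 (leqW Nk).
  rewrite /= in H1 H2.
  have E : modulus (a k) * r ^+ k = modulus (a k * r%:C ^+ k).
    by rewrite modulusM modulusX modulus_real gtr0_norm.
  rewrite E; apply: (@le_trans _ _ 2); last first.
    by rewrite lerDl sumr_ge0// => i _; rewrite mulr_ge0 ?modulus_ge0 ?exprn_ge0 ?(ltW r0).
  have -> : a k * r%:C ^+ k = (h (z0 + r%:C) - series (fun k => a k * r%:C ^+ k : R[i]^o) k)
     - (h (z0 + r%:C) - series (fun k => a k * r%:C ^+ k : R[i]^o) k.+1).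
    by rewrite /series/= big_nat_recr//=; ring.
  apply: le_trans (modulusD _ _) _; rewrite modulusN.
  by move: H1 H2; set A := modulus _; set B := modulus _; lra.
have ri : 0 < r^-1 by rewrite invr_gt0.
exists (r / 8), (6 * M * r^-1 ^+ 3); split; first by rewrite divr_gt0.
  by rewrite !mulr_ge0// ?exprn_ge0// ltW.
move=> w v wr vr.
set q := modulus w + modulus v.
have w0 := modulus_ge0 w; have v0 := modulus_ge0 v.
have q0 : 0 <= q by rewrite addr_ge0.
have q4 : q <= r / 4 by rewrite /q; lra.
have wd : modulus w < d by rewrite /r in wr r0; lra.
have wvd : modulus (w + v) < d by apply: le_lt_trans (modulusD _ _) _; rewrite /r in wr vr r0; lra.
have cw := conv _ wd; have cwv := conv _ wvd; rewrite addrA in cwv.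
have cs := cvgB cwv cw; have {}cs := cs (@eventually_filter).
apply: le_trans (_ : modulus (h (z0 + w + v) - h (z0 + w) - (a 1 * v + a 2 * ((w + v) ^+ 2 - w ^+ 2))) <= _).
  by rewrite opprD addrA.
apply: (modulus_limit_le cs); exists 3%N => // n /= n3.
have -> : series (fun k => a k * (w + v) ^+ k : R[i]^o) n - series (fun k => a k * w ^+ k : R[i]^o) n
   - (a 1 * v + a 2 * ((w + v) ^+ 2 - w ^+ 2)) =
   \sum_(3 <= k < n) a k * ((w + v) ^+ k - w ^+ k).
  rewrite /series/= -sumrB (big_cat_nat _ n3)//= (eq_bigr (fun k => a k * ((w + v) ^+ k - w ^+ k))); last first.
    by move=> k _; rewrite mulrBr.
  rewrite [X in _ + X - _](eq_bigr (fun k => a k * ((w + v) ^+ k - w ^+ k))); last first.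
    by move=> k _; rewrite mulrBr.
  rewrite unlock /=; ring.
apply: le_trans (modulus_sum _ _) _.
apply: (@le_trans _ _ (\sum_(3 <= k < n) M * r^-1 ^+ 3 * modulus v * q ^+ 2 * 3 * (2^-1) ^+ (k - 3))).
  apply: ler_sum_nat => k /andP[k3 _]; rewrite modulusM.
  apply: le_trans (ler_wpM2l (modulus_ge0 _) (pow_increment w v k)) _; rewrite -/q.
  have ak : modulus (a k) <= M * r^-1 ^+ k.
    by rewrite exprVn ler_pdivlMr ?exprn_gt0.
  have kk : k = (k - 3 + 3)%N by rewrite subnK.
  set i := (k - 3)%N in kk *.
  have k1 : k.-1 = (i + 2)%N by rewrite kk addn3 addn2.
  rewrite k1.
  have X0 : 0 <= k%:R * modulus v * q ^+ (i + 2).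
    by rewrite !mulr_ge0 ?exprn_ge0.
  apply: le_trans (ler_wpM2r X0 ak) _; rewrite {1}kk !exprD.
  have qr : r^-1 * q <= 4^-1 by rewrite mulrC ler_pdivrMr// mulrC.
  have qr0 : 0 <= r^-1 * q by rewrite mulr_ge0// ltW.
  have qri : r^-1 ^+ i * q ^+ i <= 4^-1 ^+ i by rewrite -exprMn lerXn2r ?nnegrE.
  (* With [k = i + 3] and [q / r <= 1 / 4], the factor [k] costs half of the geometric decay. The
     constant 6 is this 3 times the geometric sum 2. *)
  have ki : k%:R * 4^-1 ^+ i <= 3 * 2^-1 ^+ i :> R.
    have -> : (4^-1 : R) = 2^-1 * 2^-1 by field.
    rewrite exprMn mulrA ler_wpM2r ?exprn_ge0//.
    rewrite exprVn ler_pdivrMr ?exprn_gt0// -natrX -natrM ler_nat kk; exact: three_pow2.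
  have -> : M * (r^-1 ^+ i * r^-1 ^+ 3) * (k%:R * modulus v * (q ^+ i * q ^+ 2)) =
    M * r^-1 ^+ 3 * modulus v * q ^+ 2 * (k%:R * (r^-1 ^+ i * q ^+ i)) by ring.
  rewrite -[leRHS]mulrA; apply: ler_wpM2l.
    by rewrite !mulr_ge0 ?exprn_ge0 ?(ltW ri).
  by apply: le_trans ki; rewrite ler_wpM2l.
rewrite -mulr_sumr.
have -> : \sum_(3 <= k < n) (2^-1 : R) ^+ (k - 3) = \sum_(0 <= i < n - 3) (2^-1) ^+ i.
  by rewrite -{1}[3%N]add0n big_addn; apply: eq_bigr => i _; rewrite addnK.
have X0 : 0 <= M * r^-1 ^+ 3 * modulus v * q ^+ 2 * 3.
  by rewrite !mulr_ge0 ?exprn_ge0 ?(ltW ri).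
apply: le_trans (ler_wpM2l X0 (geometric_half (n - 3))) _.
by rewrite le_eqVlt; apply/orP; left; apply/eqP; ring.
Qed.

End taylor.

Section derivatives.
Context {R : realType}.
Local Open Scope complex_scope.
Implicit Types (h : R[i] -> R[i]^o) (z w v a : R[i]).

Lemma derive1_eq h z0 a (r K : R) : 0 < r -> 0 <= K ->
  (forall v, modulus v < r -> modulus (h (z0 + v) - h z0 - a * v) <= K * modulus v ^+ 2) ->
  derive1 h z0 = a.
Proof.
move=> r0 K0 hr; rewrite /derive1; apply: cvg_lim => //.
apply/cvgrPdist_le => e e0.
have ee : e = (complex.Re e)%:C by case: e e0 => x y; rewrite ltcE/= => /andP[/eqP -> _].
have E0 : 0 < complex.Re e by rewrite -ltcR -ee.
pose t := Num.min r (complex.Re e / (K + 1)).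
have K1 : 0 < K + 1 by lra.
have t0 : 0 < t by rewrite lt_min r0 divr_gt0.
have tC : (0 : R[i]) < t%:C by rewrite ltcR.
have := @dnbhs0_lt _ (R[i]^o) _ tC.
rewrite /= => nt; near=> v.
have vn0 : v != 0 by near: v; exact: (@nbhs_dnbhs_neq (R[i]^o) 0).
have vt : modulus v < t by rewrite -ltcR -modulusE; near: v.
have vp : 0 < modulus v.
  by rewrite lt_neqAle modulus_ge0 andbT eq_sym; apply: contra_neq vn0 => /modulus_eq0.
rewrite ee modulusE lecR.
have -> : a - v^-1 *: (h (v + z0) - h z0) = - (v^-1 * (h (z0 + v) - h z0 - a * v)).
  by rewrite [v + z0]addrC mulrBr mulrCA mulVf// mulr1 opprB.
rewrite modulusN modulusM modulusV.
have vr : modulus v < r by apply: lt_le_trans vt _; rewrite ge_min lexx.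
have ve : modulus v * (K + 1) <= complex.Re e.
  by rewrite -ler_pdivlMr//; apply: ltW; apply: lt_le_trans vt _; rewrite ge_min lexx orbT.
rewrite mulrC ler_pdivrMr//; apply: le_trans (hr _ vr) _.
rewrite expr2 mulrA ler_wpM2r ?(ltW vp)//; apply: le_trans ve; nra.
Unshelve. all: by end_near. Qed.

Lemma analytic_first_order h z0 (a : nat -> R[i]) :
  (\forall z \near (z0 : R[i]^o),
      series (fun k => a k * (z - z0) ^+ k : R[i]^o) @ \oo --> h z) ->
  derive1 h z0 = a 1 /\ exists r K : R, [/\ 0 < r, 0 <= K & forall v, modulus v < r ->
    modulus (h (z0 + v) - h z0 - a 1 * v) <= K * modulus v ^+ 2].
Proof.
move=> ha.
have [r [K [r0 K0 HK]]] := analytic_taylor ha.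
have K1 : 0 <= K * r + modulus (a 2) by rewrite addr_ge0 ?modulus_ge0// mulr_ge0 ?(ltW r0).
suff H v : modulus v < r -> modulus (h (z0 + v) - h z0 - a 1 * v) <= (K * r + modulus (a 2)) * modulus v ^+ 2.
  by split; [exact: (derive1_eq r0 K1 H)|exists r, (K * r + modulus (a 2))].
move=> vr; have := HK 0 v; rewrite modulus0 addr0 !add0r expr0n/= subr0 => /(_ r0 vr) H.
have -> : h (z0 + v) - h z0 - a 1 * v = (h (z0 + v) - h z0 - a 1 * v - a 2 * v ^+ 2) + a 2 * v ^+ 2.
  by rewrite subrK.
apply: le_trans (modulusD _ _) _; rewrite modulusM modulusX.
have v0 := modulus_ge0 v; have q0 : 0 <= modulus v ^+ 2 by rewrite sqr_ge0.
have : K * modulus v <= K * r by rewrite ler_wpM2l// ltW.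
move: H q0; set q := modulus v ^+ 2; set x := modulus (_ - _) => H q0 Kr.
have : K * modulus v * q <= K * r * q by rewrite ler_wpM2r.
lra.
Qed.

(** [derive1n 2] is the derivative of the derivative, and the series is not differentiated term by
    term. The increment of [h] from [1 + w] to [1 + w + t] is expanded at [1 + w] and, by the
    two-point remainder, at 1. Dividing by [t] gives [h'(1 + w) = a 1 + 2 * a 2 * w] up to a
    multiple of [|w|^2], from which [derive1_eq] reads off the second derivative. *)
Lemma analytic_second_order h : analytic_on (@right_half_plane R) h ->
  exists a, exists r K : R, [/\ 0 < r, 0 <= K & forall v, modulus v < r ->
    modulus (h (1 + v) - h 1 - a * v - derive1n 2 h 1 / 2 * v ^+ 2) <= K * modulus v ^+ 3].
Proof.
move=> hh; have R1 : 0 < complex.Re (1 : R[i]) by [].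
have [a ha] := hh _ R1; have [r [K [r0 K0 HK]]] := analytic_taylor ha.
have [d1 _] := analytic_first_order ha.
pose r' := Num.min r 1.
have r'0 : 0 < r' by rewrite lt_min r0 ltr01.
have r'r : r' <= r by rewrite ge_min lexx.
have r'1 : r' <= 1 by rewrite ge_min lexx orbT.
have fo w : modulus w < r' ->
    modulus (derive1 h (1 + w) - a 1 - 2 * a 2 * w) <= (2 + 4 * K) * modulus w ^+ 2.
  move=> wr'; have wr : modulus w < r by apply: lt_le_trans wr' _.
  have w0 := modulus_ge0 w.
  have Rw : 0 < complex.Re (1 + w).
    have := Re_le_modulus w; rewrite ler_norml => /andP[+ _].
    by rewrite raddfD/=; lra.
  have [b hb] := hh _ Rw; have [db] := analytic_first_order hb.
  rewrite -db => -[s [L [s0 L0 HL]]].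
  have key (t : R) : 0 < t -> t < s -> t < r ->
      modulus (derive1 h (1 + w) - a 1 - 2 * a 2 * w) <=
      (L + modulus (a 2)) * t + K * (modulus w + t) ^+ 2.
    move=> t0 ts tr; have mt : modulus (t%:C) = t by rewrite modulus_real gtr0_norm.
    have := HL t%:C; rewrite mt => /(_ ts); have := HK w t%:C; rewrite mt => /(_ wr tr).
    set D := derive1 h _; set A := h (1 + w + _) - _ => H1 H2.
    rewrite -(ler_pM2r t0) -[X in _ * X <= _]mt -modulusM.
    have -> : (D - a 1 - 2 * a 2 * w) * t%:C =
       (A - a 1 * t%:C - a 2 * ((w + t%:C) ^+ 2 - w ^+ 2)) + (- (A - D * t%:C) + a 2 * t%:C ^+ 2).
      by ring.
    apply: le_trans (modulusD _ _) _; apply: le_trans (lerD (lexx _) (modulusD _ _)) _.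
    rewrite modulusN [modulus (a 2 * _)]modulusM modulusX mt.
    move: H1 H2; set x := modulus _; set y := modulus (A - _) => H1 H2.
    have -> : ((L + modulus (a 2)) * t + K * (modulus w + t) ^+ 2) * t =
      K * t * (modulus w + t) ^+ 2 + (L * t ^+ 2 + modulus (a 2) * t ^+ 2) by ring.
    by rewrite !lerD.
  have a20 := modulus_ge0 (a 2).
  case: (ltgtP 0 (modulus w)) w0 => // [w0 _|w0 _]; last first.
    have -> : w = 0 by apply: modulus_eq0.
    rewrite addr0 d1.
    by rewrite subrr mulr0 subr0 modulus0 expr0n mulr0.
  pose B := L + modulus (a 2) + 1; have B0 : 0 < B by rewrite /B; lra.
  (* Within both radii of validity, at most [|w|], and small enough that the term linear in [t] is
     at most [|w|^2]. *)
  pose t := Num.min (Num.min (s / 2) (r / 2)) (Num.min (modulus w) (modulus w ^+ 2 / B)).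
  have t0 : 0 < t by rewrite !lt_min !divr_gt0// ?exprn_gt0// w0.
  have ts : t < s by apply: (@le_lt_trans _ _ (s / 2)); [rewrite !ge_min lexx|lra].
  have tr : t < r by apply: (@le_lt_trans _ _ (r / 2)); [rewrite !ge_min lexx ?orbT|lra].
  have tw : t <= modulus w by rewrite !ge_min lexx ?orbT.
  have tB : t * B <= modulus w ^+ 2 by rewrite -ler_pdivlMr// !ge_min lexx ?orbT.
  apply: le_trans (key t t0 ts tr) _.
  have E1 : (L + modulus (a 2)) * t <= modulus w ^+ 2.
    by apply: le_trans tB; rewrite /B; nra.
  have E2 : K * (modulus w + t) ^+ 2 <= 4 * K * modulus w ^+ 2.
    have -> : 4 * K * modulus w ^+ 2 = K * (modulus w + modulus w) ^+ 2 by ring.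
    apply: ler_wpM2l => //; apply: lerXn2r; rewrite ?nnegrE; lra.
  have q0 : 0 <= modulus w ^+ 2 by rewrite sqr_ge0.
  by lra.
have K4 : 0 <= 2 + 4 * K by lra.
have d2 : derive1n 2 h 1 = 2 * a 2.
  rewrite /=; apply: (derive1_eq r'0 K4) => v vr.
  by rewrite d1; exact: fo.
exists (a 1), r, K; split => // v vr; rewrite d2.
have := HK 0 v; rewrite modulus0 addr0 !add0r expr0n/= subr0 => /(_ r0 vr).
have -> : 2 * a 2 / 2 = a 2 by field.
by rewrite -mulrA -exprS.
Qed.

End derivatives.

(* Abstracts from the real and the imaginary part. *)
Definition real_part_like (R : realType) (p : R[i] -> R) :=
  [/\ forall z w, p (z - w) = p z - p w, forall (x : R) z, p (x%:C * z)%C = x * p z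
    & forall z, `|p z| <= modulus z].

Lemma real_part_like_Re (R : realType) : real_part_like (@complex.Re R).
Proof.
split; [exact: raddfB| |exact: Re_le_modulus].
by move=> x [y z] /=; rewrite mul0r subr0.
Qed.

Lemma real_part_like_Im (R : realType) : real_part_like (@complex.Im R).
Proof.
split; [exact: raddfB| |exact: Im_le_modulus].
by move=> x [y z] /=; rewrite mul0r addr0.
Qed.

Section component.
Context {R : realType} (h : R[i] -> R[i]^o) (p : R[i] -> R).
Hypothesis hh : analytic_on (@right_half_plane R) h.
Hypothesis pp : real_part_like p.
Local Open Scope complex_scope.

Let H (x : R) := p (h x%:C).

Lemma continuous_component (x : R) : 0 < x -> {for x, continuous H}.
Proof.
move=> x0; have [pB pZ pm] := pp.
have [a ha] := hh (x0 : right_half_plane x%:C).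
have [_ [r [K [r0 K0 HK]]]] := analytic_first_order ha.
pose B := K * r + modulus (a 1%N) + 1.
have B0 : 0 < B.
  have Kr0 : 0 <= K * r by rewrite mulr_ge0// ltW.
  by have := modulus_ge0 (a 1%N); rewrite /B; lra.
apply/cvgrPdist_lt => e e0.
pose t := Num.min r (e / B).
have t0 : 0 < t by rewrite lt_min r0 divr_gt0.
near=> y.
have : `|x - y| < t by near: y; apply: cvgr_dist_lt t0; exact: cvg_id.
rewrite lt_min distrC => /andP[yr]; rewrite ltr_pdivlMr// => yB.
apply: le_lt_trans yB; rewrite /H -pB; apply: le_trans (pm _) _; rewrite modulusB.
have yv : y%:C = x%:C + (y - x)%:C by rewrite -rmorphD/= addrC subrK.
have my : modulus (y - x)%:C = `|y - x| by exact: modulus_real.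
have := HK (y - x)%:C; rewrite my => /(_ yr); rewrite -yv => Hy.
have -> : h y%:C - h x%:C = (h y%:C - h x%:C - a 1%N * (y - x)%:C) + a 1%N * (y - x)%:C.
  by rewrite subrK.
apply: le_trans (modulusD _ _) _; rewrite modulusM my.
apply: le_trans (lerD Hy (lexx _)) _; rewrite /B expr2.
have v0 : 0 <= `|y - x| by [].
have : K * `|y - x| <= K * r by rewrite ler_wpM2l// ltW.
move: v0; set v := `|y - x| => v0 Kr.
have : K * v * v <= K * r * v by rewrite ler_wpM2r.
lra.
Unshelve. all: by end_near. Qed.

(** A measurable function that agrees with the component on [[0, +oo[], where the estimator takes
    its values; at 0 no continuity is available. *)
Lemma measurable_component :
  measurable_fun setT (fun x : R => if 0 < x then H x else p (h 0)).
Proof.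
have m0 : measurable_fun setT (fun x : R => 0 < x).
  by apply: measurable_fun_ltr => //; exact: measurable_cst.
apply: measurable_fun_if; [exact: measurableT|exact: m0| |exact: measurable_cst].
rewrite setTI; have -> : (fun x : R => 0 < x) @^-1` [set true] = `]0, +oo[%classic.
  by apply/seteqP; split => x /=; rewrite in_itv/= andbT.
apply: open_continuous_measurable_fun; first exact: interval_open.
by move=> x; rewrite inE/= in_itv/= andbT; exact: continuous_component.
Qed.

(* The cubic remainder is local; away from 1 it follows from boundedness. *)
Lemma taylor_component : exists a1 : R, forall e : R, 0 < e -> exists K : R, 0 <= K /\
  forall x, e <= x -> x <= e^-1 ->
    `|H x - H 1 - a1 * (x - 1) - p (derive1n 2 h 1 / 2) * (x - 1) ^+ 2| <= K * `|x - 1| ^+ 3.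
Proof.
have [pB pZ pm] := pp.
have [a [r [K [r0 K0 HK]]]] := analytic_second_order hh.
exists (p a) => e e0.
have [e1|e1] := leP e (e^-1); last by exists 0; split => // x ex /(le_trans ex); rewrite leNgt e1.
have cH : {within `[e, e^-1], continuous (fun x => `|H x|)}.
  apply: continuous_in_subspaceT => x; rewrite inE/= in_itv/= => /andP[ex _].
  apply: (@continuous_comp _ _ _ H (fun x : R => `|x|)); last exact: norm_continuous.
  by apply: continuous_component; lra.
have [c _ Hc] := EVT_max e1 cH.
pose M := `|H c|; have M0 : 0 <= M by exact: normr_ge0.
set b := p (derive1n 2 h 1 / 2).
have pN z x : p z * x = p (z * x%:C) by rewrite mulrC -pZ [z * _]mulrC.
pose L := e^-1 + 1.
pose B := M + `|H 1| + `|p a| * L + `|b| * L ^+ 2.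
have ei : 0 < e^-1 by rewrite invr_gt0.
have L0 : 0 < L by rewrite /L; lra.
have B0 : 0 <= B by rewrite /B !addr_ge0// mulr_ge0// ?exprn_ge0// ltW.
exists (K + B / r ^+ 3); split; first by rewrite addr_ge0// divr_ge0// exprn_ge0// ltW.
move=> x ex xe; set v := x - 1.
have [vr|rv] := ltP `|v| r.
  have mv : modulus v%:C = `|v| by exact: modulus_real.
  have := HK v%:C; rewrite mv => /(_ vr).
  have -> : 1 + v%:C = x%:C by rewrite /v rmorphB/= addrC subrK.
  move=> Hx; apply: (@le_trans _ _ (K * `|v| ^+ 3)).
    apply: le_trans Hx; apply: le_trans (pm _); rewrite !pB /H -/b.
    by rewrite !pN rmorphXn/= lexx.
  by rewrite ler_wpM2r ?exprn_ge0// lerDl divr_ge0// exprn_ge0// ltW.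
have r3 : 0 < r ^+ 3 by rewrite exprn_gt0.
have vL : `|v| <= L by rewrite /v ler_norml /L; apply/andP; split; lra.
apply: (@le_trans _ _ B).
  rewrite /B; apply: le_trans (ler_normB _ _) _; apply: lerD; last first.
    by rewrite normrM normrX ler_wpM2l// lerXn2r ?nnegrE ?(ltW L0).
  apply: le_trans (ler_normB _ _) _; apply: lerD; last by rewrite normrM ler_wpM2l.
  apply: le_trans (ler_normB _ _) _; apply: lerD => //.
  by apply: Hc; rewrite in_itv/= ex.
rewrite mulrDl -[leLHS]add0r; apply: lerD; first by rewrite mulr_ge0.
rewrite -mulrA ler_peMr// mulrC ler_pdivlMr// mul1r lerXn2r ?nnegrE//.
exact: ltW.
Qed.

End component.

(** * Smooth partitions of unity and the transfer of weak convergence *)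

Section bumps.
Context {R : realType}.

(** The truncated cube has a second derivative with Lipschitz constant 6, hence a third order
    remainder with constant 1. *)
Lemma taylor3_cubic_plus (x h : R) :
  `|Num.max (x + h) 0 ^+ 3 - Num.max x 0 ^+ 3 - 3 * Num.max x 0 ^+ 2 * h
    - 6 * Num.max x 0 * (h ^+ 2 / 2)| <= `|h| ^+ 3.
Proof.
rewrite -normrX ler_norml.
have [x0|x0] := leP x 0; have [xh|xh] := leP (x + h) 0.
- by rewrite !expr0n/= !(mulr0, mul0r) !subr0 oppr_le0 normr_ge0.
- rewrite !expr0n/= !(mulr0, mul0r) !subr0.
  have -> : `|h ^+ 3| = h ^+ 3 by rewrite ger0_norm// exprn_ge0//; lra.
  rewrite (le_trans _ (exprn_ge0 _ (ltW xh)))/=; last by rewrite oppr_le0 exprn_ge0//; lra.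
  by apply: lerXn2r; rewrite ?nnegrE; lra.
- rewrite expr0n/= sub0r.
  have -> : - x ^+ 3 - 3 * x ^+ 2 * h - 6 * x * (h ^+ 2 / 2) = h ^+ 3 - (x + h) ^+ 3 by field.
  have h0 : h <= 0 by lra.
  have -> : `|h ^+ 3| = (- h) ^+ 3 by rewrite normrX ler0_norm.
  have k : (- (x + h)) ^+ 3 <= (- h) ^+ 3 by apply: lerXn2r; rewrite ?nnegrE; lra.
  have k0 : 0 <= (- (x + h)) ^+ 3 by rewrite exprn_ge0//; lra.
  by apply/andP; split; lra.
have -> : (x + h) ^+ 3 - x ^+ 3 - 3 * x ^+ 2 * h - 6 * x * (h ^+ 2 / 2) = h ^+ 3 by field.
by rewrite -ler_norml.
Qed.

(** The integral of the quadratic B-spline with knots 0, 1, 2, 3. The difference [bump] of two such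
    steps is the cubic B-spline with knots 0 to 4, so sums of integer translates of [bump]
    telescope. *)
Definition smooth_step (x : R) : R :=
  (Num.max x 0 ^+ 3 - 3 * Num.max (x - 1) 0 ^+ 3 + 3 * Num.max (x - 2) 0 ^+ 3
   - Num.max (x - 3) 0 ^+ 3) / 6.

Definition bump (x : R) : R := smooth_step x - smooth_step (x - 1).

Definition bump1 (x : R) : R :=
  (Num.max x 0 ^+ 2 - 4 * Num.max (x - 1) 0 ^+ 2 + 6 * Num.max (x - 2) 0 ^+ 2
   - 4 * Num.max (x - 3) 0 ^+ 2 + Num.max (x - 4) 0 ^+ 2) / 2.

Definition bump2 (x : R) : R :=
  Num.max x 0 - 4 * Num.max (x - 1) 0 + 6 * Num.max (x - 2) 0
   - 4 * Num.max (x - 3) 0 + Num.max (x - 4) 0.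

Lemma bumpE x : bump x =
  (Num.max x 0 ^+ 3 - 4 * Num.max (x - 1) 0 ^+ 3 + 6 * Num.max (x - 2) 0 ^+ 3
   - 4 * Num.max (x - 3) 0 ^+ 3 + Num.max (x - 4) 0 ^+ 3) / 6.
Proof.
rewrite /bump /smooth_step.
have -> : x - 1 - 1 = x - 2 by ring. have -> : x - 1 - 2 = x - 3 by ring.
have -> : x - 1 - 3 = x - 4 by ring.
by field.
Qed.

(** Case distinction over the six polynomial pieces of a spline with knots 0 to 4. *)
Lemma knots (x : R) (Q : R -> R -> R -> R -> R -> Prop) :
  (x <= 0 -> Q 0 0 0 0 0) -> (0 < x <= 1 -> Q x 0 0 0 0) ->
  (1 < x <= 2 -> Q x (x - 1) 0 0 0) -> (2 < x <= 3 -> Q x (x - 1) (x - 2) 0 0) ->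
  (3 < x <= 4 -> Q x (x - 1) (x - 2) (x - 3) 0) ->
  (4 < x -> Q x (x - 1) (x - 2) (x - 3) (x - 4)) ->
  Q (Num.max x 0) (Num.max (x - 1) 0) (Num.max (x - 2) 0) (Num.max (x - 3) 0) (Num.max (x - 4) 0).
Proof.
move=> q0 q1 q2 q3 q4 q5.
case: (leP x 0) => h0; case: (leP (x - 1) 0) => h1; case: (leP (x - 2) 0) => h2;
  case: (leP (x - 3) 0) => h3; case: (leP (x - 4) 0) => h4; try by exfalso; lra.
- exact: q0.
- by apply: q1; lra.
- by apply: q2; lra.
- by apply: q3; lra.
- by apply: q4; lra.
- by apply: q5; lra.
Qed.

Lemma cube01 (u : R) : 0 <= u <= 1 -> [/\ 0 <= u ^+ 3, u ^+ 3 <= u ^+ 2 & u ^+ 2 <= u].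
Proof.
move=> /andP[u0 u1]; split; first exact: exprn_ge0.
  by rewrite exprS ler_piMl ?sqr_ge0.
by rewrite expr2 ler_piMl.
Qed.

Lemma smooth_step_bounds x : 0 <= smooth_step x <= 1.
Proof.
rewrite /smooth_step; pose Q (a b c d e : R) := 0 <= (a ^+ 3 - 3 * b ^+ 3 + 3 * c ^+ 3 - d ^+ 3) / 6 <= 1.
apply: (@knots x Q); rewrite /Q.
- by move=> _; rewrite !expr0n/=; lra.
- move=> /andP[x0 x1]; rewrite !expr0n/=; have := exprn_ge0 3 (ltW x0); have := exprn_ile1 3 (ltW x0) x1; lra.
- move=> x12; have [] := @cube01 (x - 1) _; first by lra.
  have [] := @cube01 (2 - x) _; first by lra.
  by rewrite !expr0n/=; lra.
- move=> x12; have [] := @cube01 (3 - x) _; first by lra.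
  by rewrite !expr0n/=; lra.
- move=> x12; have -> : (x ^+ 3 - 3 * (x - 1) ^+ 3 + 3 * (x - 2) ^+ 3 - (x - 3) ^+ 3) = 6 by ring.
  by lra.
- move=> x12; have -> : (x ^+ 3 - 3 * (x - 1) ^+ 3 + 3 * (x - 2) ^+ 3 - (x - 3) ^+ 3) = 6 by ring.
  by lra.
Qed.

Lemma smooth_step0 x : x <= 0 -> smooth_step x = 0.
Proof.
move=> x0; by rewrite /smooth_step !max_r; lra.
Qed.

Lemma smooth_step1 x : 3 <= x -> smooth_step x = 1.
Proof.
move=> x3; by rewrite /smooth_step !max_l; lra.
Qed.

Lemma bump_supp x : bump x != 0 -> 0 < x < 4.
Proof.
rewrite /bump => b0; apply/andP; split; rewrite ltNge; apply: contra b0 => x0.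
  by rewrite !smooth_step0 ?subrr//; lra.
by rewrite !smooth_step1 ?subrr//; lra.
Qed.

Lemma bump_ge0 x : 0 <= bump x.
Proof.
rewrite bumpE; pose Q (a b c d e : R) := 0 <= (a ^+ 3 - 4 * b ^+ 3 + 6 * c ^+ 3 - 4 * d ^+ 3 + e ^+ 3) / 6.
apply: (@knots x Q); rewrite /Q.
- by move=> _; rewrite !expr0n/=; lra.
- by move=> /andP[x0 x1]; rewrite !expr0n/=; have := exprn_ge0 3 (ltW x0); lra.
- move=> x12; have [] := @cube01 (x - 1) _; first by lra.
  by rewrite !expr0n/=; lra.
- move=> x12; have [] := @cube01 (3 - x) _; first by lra.
  by rewrite !expr0n/=; lra.
- move=> x34; have : 0 <= (4 - x) ^+ 3 by apply: exprn_ge0; lra.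
  by rewrite !expr0n/=; lra.
- move=> x12; have -> : (x ^+ 3 - 4 * (x - 1) ^+ 3 + 6 * (x - 2) ^+ 3 - 4 * (x - 3) ^+ 3 + (x - 4) ^+ 3) = 0 by ring.
  by lra.
Qed.

Lemma bump1_le x : `|bump1 x| <= 3.
Proof.
rewrite /bump1 ler_norml; pose Q (a b c d e : R) := -3 <= (a ^+ 2 - 4 * b ^+ 2 + 6 * c ^+ 2 - 4 * d ^+ 2 + e ^+ 2) / 2 <= 3.
apply: (@knots x Q); rewrite /Q.
- by move=> _; rewrite !expr0n/=; lra.
- by move=> x12; rewrite !expr0n/=; nra.
- by move=> x12; rewrite !expr0n/=; nra.
- by move=> x12; rewrite !expr0n/=; nra.
- by move=> x12; rewrite !expr0n/=; nra.
- move=> x12; have -> : (x ^+ 2 - 4 * (x - 1) ^+ 2 + 6 * (x - 2) ^+ 2 - 4 * (x - 3) ^+ 2 + (x - 4) ^+ 2) = 0 by ring.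
  by lra.
Qed.

Lemma bump2_le x : `|bump2 x| <= 3.
Proof.
rewrite /bump2 ler_norml; pose Q (a b c d e : R) := -3 <= a - 4 * b + 6 * c - 4 * d + e <= 3.
by apply: (@knots x Q); rewrite /Q => xx; lra.
Qed.

(** The weights 1, 4, 6, 4, 1 of the truncated cubes sum to 16, so the remainder has constant
    [16 / 6], below 3. *)
Lemma taylor3_bump : taylor3 3 bump bump1 bump2.
Proof.
split; [|exact: bump1_le|exact: bump2_le|].
  move=> x; rewrite bump_ge0/= /bump.
  by have := smooth_step_bounds x; have := smooth_step_bounds (x - 1); lra.
move=> x h; rewrite !bumpE /bump1 /bump2.
have H0 := taylor3_cubic_plus x h; have H1 := taylor3_cubic_plus (x - 1) h.
have H2 := taylor3_cubic_plus (x - 2) h; have H3 := taylor3_cubic_plus (x - 3) h.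
have H4 := taylor3_cubic_plus (x - 4) h.
rewrite !(addrAC x h).
move: H0 H1 H2 H3 H4; rewrite !ler_norml.
move: (Num.max (x + h) 0) (Num.max (x - 1 + h) 0) (Num.max (x - 2 + h) 0) (Num.max (x - 3 + h) 0) (Num.max (x - 4 + h) 0) (Num.max x 0) (Num.max (x - 1) 0) (Num.max (x - 2) 0) (Num.max (x - 3) 0) (Num.max (x - 4) 0) (`|h| ^+ 3).
move=> a0 a1 a2 a3 a4 b0 b1 b2 b3 b4 k.
by lra.
Qed.

Lemma measurable_maxr0 k (c : R) : measurable_fun setT (fun x : R => Num.max (x - c) 0 ^+ k).
Proof.
apply: (measurableT_comp (exprn_measurable k) (g := fun x : R => Num.max (x - c) 0)).
by apply: measurable_funrpos; exact: measurable_funB.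
Qed.

Lemma measurable_smooth_step : measurable_fun setT smooth_step.
Proof.
apply: measurable_funM => //; apply: measurable_funB; last exact: measurable_maxr0.
apply: measurable_funD; last by apply: measurable_funM => //; exact: measurable_maxr0.
apply: measurable_funB; last by apply: measurable_funM => //; exact: measurable_maxr0.
rewrite (_ : (fun x : R => _) = (fun x : R => Num.max (x - 0) 0 ^+ 3)); first exact: measurable_maxr0.
by apply/funext => x; rewrite subr0.
Qed.

Lemma measurable_bump : measurable_fun setT bump.
Proof.
apply: measurable_funB; first exact: measurable_smooth_step.
by apply: (measurableT_comp measurable_smooth_step (g := fun x : R => x - 1)); exact: measurable_funB.
Qed.

Lemma measurable_bump1 : measurable_fun setT bump1.
Proof.
apply: measurable_funM => //; apply: measurable_funD; last exact: measurable_maxr0.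
apply: measurable_funB; last by apply: measurable_funM => //; exact: measurable_maxr0.
apply: measurable_funD; last by apply: measurable_funM => //; exact: measurable_maxr0.
apply: measurable_funB; last by apply: measurable_funM => //; exact: measurable_maxr0.
rewrite (_ : (fun x : R => _) = (fun x : R => Num.max (x - 0) 0 ^+ 2)); first exact: measurable_maxr0.
by apply/funext => x; rewrite subr0.
Qed.

Lemma measurable_bump2 : measurable_fun setT bump2.
Proof.
have m1 c : measurable_fun setT (fun x : R => Num.max (x - c) 0) by exact: (measurable_maxr0 1 c).
apply: measurable_funD; last exact: m1.
apply: measurable_funB; last by apply: measurable_funM => //; exact: m1.
apply: measurable_funD; last by apply: measurable_funM => //; exact: m1.
apply: measurable_funB; last by apply: measurable_funM => //; exact: m1.
rewrite (_ : (fun x : R => _) = (fun x : R => Num.max (x - 0) 0)); first exact: m1.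
by apply/funext => x; rewrite subr0.
Qed.

Definition smooth_test (f : R -> R) := exists C : R, exists f1 f2 : R -> R,
  [/\ measurable_fun setT f, measurable_fun setT f1, measurable_fun setT f2 & taylor3 C f f1 f2].

Lemma smooth_test_affine f (a b : R) : smooth_test f -> smooth_test (fun x => f (a * x + b)).
Proof.
move=> [C [f1 [f2 [mf mf1 mf2 [f0 f1C f2C fT]]]]].
have C0 : 0 <= C by apply: le_trans (normr_ge0 _) (f1C 0).
have a0 : 0 <= `|a| by []. have a2 : 0 <= `|a| ^+ 2 by rewrite sqr_ge0.
have a3 : 0 <= `|a| ^+ 3 by rewrite exprn_ge0.
have maff : measurable_fun setT (fun x : R => a * x + b).
  by apply: measurable_funD => //; exact: measurable_funM.
pose A := 1 + `|a| + `|a| ^+ 2 + `|a| ^+ 3.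
exists (C * A), (fun x => a * f1 (a * x + b)), (fun x => a ^+ 2 * f2 (a * x + b)).
split; [exact: (measurableT_comp mf)| | |split].
- by apply: measurable_funM => //; exact: (measurableT_comp mf1).
- by apply: measurable_funM => //; exact: (measurableT_comp mf2).
- move=> x; have /andP[-> fC] := f0 (a * x + b); apply: (le_trans fC).
  by rewrite ler_peMr// /A; lra.
- move=> x; rewrite normrM mulrC; apply: ler_pM => //; by rewrite /A; lra.
- move=> x; rewrite normrM normrX mulrC; apply: ler_pM => //; by rewrite /A; lra.
move=> x h; have := fT (a * x + b) (a * h).
have -> : a * (x + h) + b = a * x + b + a * h by ring.
rewrite normrM [(`|a| * _) ^+ 3]exprMn => H.
apply: (@le_trans _ _ (C * (`|a| ^+ 3 * `|h| ^+ 3))).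
  by apply: (le_trans _ H); rewrite le_eqVlt; apply/orP; left; apply/eqP; congr `|_|; field.
by rewrite mulrA ler_wpM2r ?exprn_ge0// ler_wpM2l// /A; lra.
Qed.

Lemma smooth_testZ f (c : R) : 0 <= c -> smooth_test f -> smooth_test (fun x => c * f x).
Proof.
move=> c0 [C [f1 [f2 [mf mf1 mf2 [f0 f1C f2C fT]]]]].
exists (c * C), (fun x => c * f1 x), (fun x => c * f2 x).
split; try (by apply: measurable_funM); split.
- by move=> x; have /andP[f0x fC] := f0 x; rewrite mulr_ge0// ler_wpM2l.
- by move=> x; rewrite normrM ger0_norm// ler_wpM2l.
- by move=> x; rewrite normrM ger0_norm// ler_wpM2l.
move=> x h; rewrite -[leRHS]mulrA; apply: (le_trans _ (ler_wpM2l c0 (fT x h))).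
by rewrite -[X in X * `|_|](ger0_norm c0) -normrM le_eqVlt; apply/orP; left; apply/eqP; congr `|_|; ring.
Qed.

Lemma smooth_testD f g : smooth_test f -> smooth_test g -> smooth_test (fun x => f x + g x).
Proof.
move=> [C [f1 [f2 [mf mf1 mf2 [f0 f1C f2C fT]]]]] [D [g1 [g2 [mg mg1 mg2 [g0 g1D g2D gT]]]]].
exists (C + D), (fun x => f1 x + g1 x), (fun x => f2 x + g2 x).
split; try (by apply: measurable_funD); split.
- by move=> x; have /andP[? ?] := f0 x; have /andP[? ?] := g0 x; rewrite addr_ge0// lerD.
- by move=> x; apply: le_trans (ler_normD _ _) _; exact: lerD.
- by move=> x; apply: le_trans (ler_normD _ _) _; exact: lerD.
move=> x h; rewrite [leRHS]mulrDl; apply: (le_trans _ (lerD (fT x h) (gT x h))); apply: (le_trans _ (ler_normD _ _)).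
by rewrite le_eqVlt; apply/orP; left; apply/eqP; congr `|_|; ring.
Qed.

Lemma smooth_test0 : smooth_test (fun=> 0).
Proof.
exists 0, (fun=> 0), (fun=> 0); split; try exact: measurable_cst.
by split=> [x|x|x|x h]; rewrite ?normr0 ?lexx// !mul0r !subr0 normr0.
Qed.

Lemma smooth_test_sum I (r : seq I) (f : I -> R -> R) :
  (forall i, smooth_test (f i)) -> smooth_test (fun x => \sum_(i <- r) f i x).
Proof.
move=> sf; elim: r => [|i r IH].
  by rewrite (_ : (fun x => _) = fun=> 0); [exact: smooth_test0|apply/funext => x; rewrite big_nil].
rewrite (_ : (fun x => _) = fun x => f i x + \sum_(i <- r) f i x); first exact: smooth_testD.
by apply/funext => x; rewrite big_cons.
Qed.

Lemma smooth_test_bump : smooth_test bump.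
Proof.
exists 3, bump1, bump2; split; [exact: measurable_bump|exact: measurable_bump1|exact: measurable_bump2|].
exact: taylor3_bump.
Qed.

Lemma smooth_test_bounded f : smooth_test f -> measurable_fun setT f /\
  exists C : R, forall x, 0 <= f x <= C.
Proof. by move=> [C [f1 [f2 [mf _ _ [f0 _ _ _]]]]]; split => //; exists C. Qed.

(* A partition of unity on [-(m - 3) e, (m - 3) e] by bumps of width [4 e]. *)
Definition bump_at (e : R) (m i : nat) (x : R) : R := bump (e^-1 * x + (m%:R - i%:R)).

Lemma smooth_test_bump_at e m i : smooth_test (bump_at e m i).
Proof. exact: (smooth_test_affine e^-1 (m%:R - i%:R) smooth_test_bump). Qed.

Lemma bump_at_supp e m i x : 0 < e -> bump_at e m i x != 0 ->
  `|x - e * (i%:R - m%:R)| <= 4 * e.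
Proof.
move=> e0 /bump_supp /andP[b0 b4].
have E : x - e * (i%:R - m%:R) = e * (e^-1 * x + (m%:R - i%:R)).
  by field; rewrite gt_eqF.
by rewrite E normrM gtr0_norm// mulrC ler_pM2r// gtr0_norm// ltW.
Qed.

Lemma sum_bump_at e m x : \sum_(i < m + m) bump_at e m i x =
  smooth_step (e^-1 * x + m%:R) - smooth_step (e^-1 * x - m%:R).
Proof.
have H k : \sum_(i < k) bump_at e m i x =
    smooth_step (e^-1 * x + m%:R) - smooth_step (e^-1 * x + m%:R - k%:R).
  elim: k => [|k IH]; first by rewrite big_ord0 subr0 subrr.
  rewrite big_ord_recr/= IH /bump_at /bump -natr1.
  have -> : e^-1 * x + (m%:R - k%:R) - 1 = e^-1 * x + m%:R - (k%:R + 1) by ring.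
  have -> : e^-1 * x + (m%:R - k%:R) = e^-1 * x + m%:R - k%:R by ring.
  by rewrite addrA subrK.
by rewrite H; congr (_ - smooth_step _); rewrite natrD; ring.
Qed.

Lemma sum_bump_at_bounds e m x : 0 <= \sum_(i < m + m) bump_at e m i x <= 1.
Proof.
rewrite sumr_ge0 => [/=|i _]; last exact: bump_ge0.
rewrite sum_bump_at; have := smooth_step_bounds (e^-1 * x + m%:R).
by have := smooth_step_bounds (e^-1 * x - m%:R); lra.
Qed.

Lemma sum_bump_at1 e m x : 0 < e -> `|x| <= e * (m%:R - 3) ->
  \sum_(i < m + m) bump_at e m i x = 1.
Proof.
move=> e0; rewrite mulrC -ler_pdivrMr// -{1}[e]gtr0_norm// -normf_div mulrC ler_norml => /andP[x1 x2].
by rewrite sum_bump_at smooth_step1 ?smooth_step0 ?subr0//; lra.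
Qed.

End bumps.

(** * Expansion of the functional around the uniform density *)

Section Fsum_algebra.
Context {R : realFieldType}.
Implicit Types (psi phi : nat -> R -> R) (S : nat -> R).

Lemma le_Fsum psi phi n S :
  (forall a b, (a < b <= n)%N -> face n S a b -> psi (b - a)%N (S b - S a) <= phi (b - a)%N (S b - S a)) ->
  Fsum psi n S <= Fsum phi n S.
Proof.
move=> H; rewrite /Fsum; apply: ler_sum => a _.
rewrite big_nat_cond [leRHS]big_nat_cond; apply: ler_sum => b /andP[abn _].
by case: ifP => // f; exact: H.
Qed.

Lemma eq_Fsum psi phi n S :
  (forall a b, (a < b <= n)%N -> face n S a b -> psi (b - a)%N (S b - S a) = phi (b - a)%N (S b - S a)) ->
  Fsum psi n S = Fsum phi n S.
Proof. by move=> H; apply/le_anti/andP; split; apply: le_Fsum => a b ab f; rewrite H. Qed.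

Lemma Fsum_face_le psi n S a b : (forall j g, 0 <= psi j g) -> (a < b <= n)%N -> face n S a b ->
  psi (b - a)%N (S b - S a) <= Fsum psi n S.
Proof.
move=> p0 abn f; rewrite /Fsum (bigD1_seq a) ?iota_uniq ?mem_index_iota//=; last by lia.
rewrite (bigD1_seq b) ?iota_uniq ?mem_index_iota//= f -addrA lerDl addr_ge0//.
  by apply: sumr_ge0 => i _; case: ifP.
by apply: sumr_ge0 => i _; apply: sumr_ge0 => k _; case: ifP.
Qed.

Lemma FsumD psi phi n S : Fsum (fun j g => psi j g + phi j g) n S = Fsum psi n S + Fsum phi n S.
Proof.
rewrite /Fsum -big_split/=; apply: eq_bigr => a _; rewrite -big_split/=; apply: eq_bigr => b _.
by case: ifP => //; rewrite addr0.
Qed.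

Lemma FsumZ psi (c : R) n S : Fsum (fun j g => c * psi j g) n S = c * Fsum psi n S.
Proof.
rewrite /Fsum mulr_sumr; apply: eq_bigr => a _; rewrite mulr_sumr; apply: eq_bigr => b _.
by case: ifP => //; rewrite mulr0.
Qed.

Lemma Fsum_ge0 psi n S : (forall j g, 0 <= psi j g) -> 0 <= Fsum psi n S.
Proof. by move=> p0; apply: sumr_ge0 => a _; apply: sumr_ge0 => b _; case: ifP. Qed.

Lemma ler_norm_Fsum psi n S : `|Fsum psi n S| <= Fsum (fun j g => `|psi j g|) n S.
Proof.
rewrite /Fsum; apply: le_trans (ler_norm_sum _ _ _) _; apply: ler_sum => a _.
apply: le_trans (ler_norm_sum _ _ _) _; apply: ler_sum => b _.
by case: ifP => //; rewrite normr0.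
Qed.

Lemma Fsum_increment n S : ~~ degenerate n S -> Fsum (fun _ g => g) n S = S n - S 0.
Proof.
move=> gen; rewrite -telescope_sumr// (sum_faces gen) /Fsum.
apply: eq_big_nat => a _; apply: eq_big_nat => b /andP[ab _].
by case: ifP => // _; rewrite telescope_sumr// ltnW.
Qed.

Lemma Fsum_lengthR n S : ~~ degenerate n S -> Fsum (fun j _ => j%:R) n S = n%:R :> R.
Proof.
move=> gen; transitivity (\sum_(0 <= k < n) (1 : R)); last first.
  by rewrite sumr_const_nat subn0.
rewrite (sum_faces gen) /Fsum; apply: eq_big_nat => a _; apply: eq_big_nat => b _.
by case: ifP => // _; rewrite sumr_const_nat.
Qed.

End Fsum_algebra.

(** * A functional of small mean that controls all error terms *)

Section error_majorant.
Context {R : realType}.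
Local Notation Ex := (It (@wexp R)).
Local Notation sqrt := Num.sqrt.

Lemma It_wexp_take n m (F : seq R -> \bar R) : (forall s, 0 <= F s)%E ->
  (forall z y, size z = n -> F (z ++ y) = F z) -> Ex (n + m) F = Ex n F.
Proof.
move=> F0 FE; rewrite It_cat; apply: It_ext => z zn.
rewrite -[RHS](It_cst m (@wexp1 R) (F0 z)); apply: It_ext => y _; exact: FE.
Qed.

(** The three kinds of terms have explicit gamma means: Laplace transform, second and fourth central
    moments. *)
Definition poly_psi (l : R) (A B C : nat -> R) (j : nat) (g : R) : R :=
  A j * expR (- l * g) + B j * (g - j%:R) ^+ 2 + C j * (g - j%:R) ^+ 4.

Section poly_psi.
Variables (l : R) (A B C : nat -> R).
Hypothesis A0 : forall j, 0 <= A j.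
Hypothesis B0 : forall j, 0 <= B j.
Hypothesis C0 : forall j, 0 <= C j.

Lemma measurable_poly_psi j : measurable_fun setT (poly_psi l A B C j).
Proof.
have md k : measurable_fun setT (fun g : R => (g - j%:R) ^+ k).
  by apply: measurable_funX; exact: measurable_funB.
apply: measurable_funD; last exact: measurable_funM.
apply: measurable_funD; last exact: measurable_funM.
apply: measurable_funM => //.
by apply: (measurableT_comp (@measurable_expR R) (g := fun g : R => - l * g)); exact: measurable_funM.
Qed.

Lemma poly_psi_ge0 j g : 0 <= poly_psi l A B C j g.
Proof.
rewrite /poly_psi !addr_ge0// mulr_ge0 ?expR_ge0 ?sqr_ge0//.
by rewrite (exprM _ 2 2) sqr_ge0.
Qed.

Lemma It_Fsum_poly_psi n : 0 <= l -> Ex n (fun y => (Fsum (poly_psi l A B C) n (psum y))%:E) =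
  (\sum_(1 <= j < n.+1) j%:R^-1 * (A j * (1 + l) ^- j + B j * j%:R + C j * (3 * j%:R ^+ 2 + 6 * j%:R)))%:E.
Proof.
move=> l0; rewrite (It_Fsum measurable_poly_psi); last exact: poly_psi_ge0.
rewrite -sumEFin; apply: eq_bigr => j _; rewrite EFinM; congr (_ * _)%E.
have mp := @measurable_psum R j.
have md k : measurable_fun setT (fun z : seq R => ((psum z j - j%:R) ^+ k)%:E).
  by apply/measurable_EFinP; apply: measurable_funX; exact: measurable_funB.
have me : measurable_fun setT (fun z : seq R => (expR (- l * psum z j))%:E).
  apply/measurable_EFinP; apply: (measurableT_comp (@measurable_expR R) (g := fun z : seq R => - l * psum z j)).
  exact: measurable_funM.
have mM (c : R) (f : seq R -> \bar R) : measurable_fun setT f -> measurable_fun setT (fun z => c%:E * f z)%E.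
  by move=> mf; exact: emeasurable_funM.
transitivity ((A j)%:E * ((1 + l) ^- j)%:E + (B j)%:E * j%:R%:E
    + (C j)%:E * (3 * j%:R ^+ 2 + 6 * j%:R)%:E)%E; last by rewrite -!EFinM -!EFinD.
rewrite -(It_wexp_laplace j l0) -(It_wexp_sq j) -(It_wexp_four j).
have e0 (z : seq R) : (0 <= (expR (- l * psum z j))%:E)%E by rewrite lee_fin expR_ge0.
have d2 (z : seq R) : (0 <= ((psum z j - j%:R) ^+ 2)%:E)%E by rewrite lee_fin sqr_ge0.
have d4 (z : seq R) : (0 <= ((psum z j - j%:R) ^+ 4)%:E)%E.
  by rewrite lee_fin (exprM _ 2 2) sqr_ge0.
rewrite -!ItZl ?lee_fin//.
have p0 (c : R) (f : seq R -> \bar R) : 0 <= c -> (forall z, 0 <= f z)%E -> (forall z, 0 <= c%:E * f z)%E.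
  by move=> c0 f0 z; rewrite mule_ge0 ?lee_fin.
rewrite -!ItD//.
- by apply: emeasurable_funD; exact: mM.
- exact: mM.
- by move=> z; apply: adde_ge0; [exact: (p0 _ _ (A0 j) e0)|exact: (p0 _ _ (B0 j) d2)].
- exact: (p0 _ _ (C0 j) d4).
- exact: mM.
- exact: mM.
- exact: (p0 _ _ (A0 j) e0).
- exact: (p0 _ _ (B0 j) d2).
Qed.

End poly_psi.

(** Induction on the sharper bound [3 - 2 / sqrt (k + 1)], whose increments dominate the terms. *)
Lemma sum_inv_sqrt3 n : \sum_(1 <= j < n.+1) (j%:R * sqrt j%:R)^-1 <= 3 :> R.
Proof.
suff H k : \sum_(1 <= j < k.+2) (j%:R * sqrt j%:R)^-1 <= 3 - 2 / sqrt k.+1%:R :> R.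
  case: n => [|n]; first by rewrite big_geq.
  by apply: le_trans (H n) _; rewrite lerBlDr lerDl divr_ge0// sqrtr_ge0.
elim: k => [|k IH]; first by rewrite big_nat1 sqrtr1; lra.
rewrite big_nat_recr//=; apply: le_trans (lerD IH (lexx _)) _.
set x := sqrt k.+1%:R; set y := sqrt k.+2%:R.
have x0 : 0 < x by rewrite sqrtr_gt0.
have y0 : 0 < y by rewrite sqrtr_gt0.
have xx : x ^+ 2 = k.+1%:R by rewrite sqr_sqrtr.
have yy : y ^+ 2 = k.+2%:R by rewrite sqr_sqrtr.
have xy : x <= y by apply: ler_wsqrtr; rewrite ler_nat.
have D : y ^+ 2 - x ^+ 2 = 1 by rewrite xx yy -natr1; ring.
rewrite -yy -exprSr.
have -> : 3 - 2 / x + (y ^+ 3)^-1 = 3 - 2 / y - (2 / x - 2 / y - (y ^+ 3)^-1) by ring.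
rewrite gerBl subr_ge0.
have -> : 2 / x - 2 / y = 2 * (y - x) / (x * y) by field; rewrite !gt_eqF.
have -> : (y ^+ 3)^-1 = (y ^+ 2 - x ^+ 2) / y ^+ 3 by rewrite D mul1r.
rewrite ler_pdivrMr ?exprn_gt0// mulrAC ler_pdivlMr ?mulr_gt0//.
have -> : (y ^+ 2 - x ^+ 2) * (x * y) = (y - x) * ((y + x) * (x * y)) by ring.
have -> : 2 * (y - x) * y ^+ 3 = (y - x) * (2 * y ^+ 3) by ring.
apply: ler_wpM2l; first by lra.
have -> : 2 * y ^+ 3 = (y + y) * (y * y) by ring.
apply: ler_pM; [lra|by rewrite mulr_ge0 ?ltW|lra|].
by rewrite ler_wpM2r// ltW.
Qed.

(* Coefficients of the error functional: the exponential term detects a face whose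
   total length is much too small, [4 * e ^+ 2 / j ^+ 2] one whose length is much too
   large, and the others bound the third order remainders. *)
Definition err_A (j : nat) : R := expR 1 ^+ j.
Definition err_B (e K : R) (n j : nat) : R :=
  4 * e ^+ 2 / j%:R ^+ 2 + (sqrt j%:R / (2 * j%:R ^+ 2) + j%:R^-1 / (1 + ln n%:R)) / K.
Definition err_C (K : R) (j : nat) : R := (2 * j%:R ^+ 2 * sqrt j%:R)^-1 / K.

Definition err_psi (e K : R) (n : nat) := poly_psi e^-1 err_A (err_B e K n) (err_C K).

(** The last part controls what the faces do not see, namely the last increment and the total [T].
    Twice [(T - n - 1)^2 + 1] dominates [(T - n)^2]. *)
Definition err (e K : R) (n : nat) (y : seq R) : R :=
  Fsum (err_psi e K n) n (psum y)
  + K^-1 * (`|nth 0 y n| + 2 / n%:R * ((psum y n.+1 - n.+1%:R) ^+ 2 + 1)).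

Lemma err_total (E e q k x : R) : 0 <= e -> q <= E * e -> x <= e / 2 ->
  2 * q + (4 * x + 5 * k) * 3 + k + k * 7 <= (2 * E + 12) * e + 23 * k.
Proof. by move=> e0 qE xe; lra. Qed.

Section err.
Variables (e K : R) (n : nat).
Hypotheses (e0 : 0 < e) (K0 : 0 < K) (n0 : (0 < n)%N).

Let ln0 : 0 <= ln n%:R :> R. Proof. by rewrite ln_ge0// ler1n. Qed.

Lemma err_A_ge0 j : 0 <= err_A j. Proof. by rewrite exprn_ge0// expR_ge0. Qed.

Lemma err_B_ge0 j : 0 <= err_B e K n j.
Proof.
have l1 : 0 <= 1 + ln n%:R :> R by rewrite addr_ge0.
apply: addr_ge0; first by apply: divr_ge0; rewrite ?sqr_ge0// mulr_ge0// sqr_ge0.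
apply: divr_ge0; last exact: ltW.
apply: addr_ge0; first by apply: divr_ge0; rewrite ?sqrtr_ge0// mulr_ge0// sqr_ge0.
by rewrite divr_ge0// invr_ge0.
Qed.

Lemma err_C_ge0 j : 0 <= err_C K j.
Proof. by rewrite divr_ge0 ?(ltW K0)// invr_ge0 !mulr_ge0 ?sqrtr_ge0 ?sqr_ge0. Qed.

Lemma err_psi_ge0 j g : 0 <= err_psi e K n j g.
Proof. exact: (poly_psi_ge0 _ err_A_ge0 err_B_ge0 err_C_ge0). Qed.

Lemma measurable_err : measurable_fun setT (err e K n).
Proof.
apply: measurable_funD.
  by apply: measurable_Fsum_psum => j; exact: measurable_poly_psi.
apply: measurable_funM => //; apply: measurable_funD.
  by apply: measurableT_comp => //; exact: measurable_fun_nth.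
apply: measurable_funM => //; apply: measurable_funD => //.
by apply: measurable_funX; apply: measurable_funB => //; exact: measurable_psum.
Qed.

Lemma err_ge0 y : 0 <= err e K n y.
Proof.
apply: addr_ge0; first by apply: Fsum_ge0; exact: err_psi_ge0.
by rewrite mulr_ge0 ?invr_ge0 ?(ltW K0)// addr_ge0// mulr_ge0 ?divr_ge0// addr_ge0 ?sqr_ge0.
Qed.

Lemma sum_powers_half (q : R) m : 0 <= q -> q <= 2^-1 -> \sum_(1 <= j < m.+1) q ^+ j <= 2 * q.
Proof.
move=> q0 q1; rewrite big_add1/= (eq_bigr (fun i => q * q ^+ i)) => [|i _]; last by rewrite exprS.
rewrite -mulr_sumr mulrC ler_wpM2r//; apply: le_trans (geometric_half m).
by apply: ler_sum => i _; rewrite lerXn2r ?nnegrE.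
Qed.

(** The exponential terms form a geometric sum of ratio at most [expR 1 * e]. The quadratic and
    quartic terms of order [j^(-3/2)] have total weight 3 and coefficient [4 e^2 + 5 / K]. The
    squares, normalised by [1 + ln n], give [1 / K], and the last increment with the total gives
    [7 / K]; hence [23 = 15 + 1 + 7]. *)
Lemma It_err : e <= 2^-1 -> 2 * expR 1 * e <= 1 ->
  (Ex n.+1 (fun y => (err e K n y)%:E) <= ((2 * expR 1 + 12) * e + 23 / K)%:E)%E.
Proof.
move=> e2 ee.
have nR : 0 < n%:R :> R by rewrite ltr0n.
have l1 : 0 < 1 + ln n%:R :> R by exact: (ltr_pwDl ltr01 ln0).
have ei : 0 <= e^-1 by rewrite invr_ge0 ltW.
have Ki : 0 <= K^-1 by rewrite invr_ge0 ltW.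
have mF : measurable_fun setT (fun y : seq R => (Fsum (err_psi e K n) n (psum y))%:E).
  by apply/measurable_EFinP; apply: measurable_Fsum_psum => j; exact: measurable_poly_psi.
have mN : measurable_fun setT (fun y : seq R => (`|nth 0 y n|)%:E).
  by apply/measurable_EFinP; apply: measurableT_comp => //; exact: measurable_fun_nth.
have mS : measurable_fun setT (fun y : seq R => ((psum y n.+1 - n.+1%:R) ^+ 2)%:E).
  by apply/measurable_EFinP; apply: measurable_funX; apply: measurable_funB => //; exact: measurable_psum.
have -> : (fun y => (err e K n y)%:E) = (fun y => (Fsum (err_psi e K n) n (psum y))%:E
    + K^-1%:E * (`|nth 0 y n|%:E + (2 / n%:R)%:E * (((psum y n.+1 - n.+1%:R) ^+ 2)%:E + 1)))%E.
  by apply/funext => y; rewrite /err !EFinD !EFinM !EFinD !EFinM !EFinD.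
have F0 (y : seq R) : (0 <= (Fsum (err_psi e K n) n (psum y))%:E)%E.
  by rewrite lee_fin Fsum_ge0//; exact: err_psi_ge0.
have S0 (y : seq R) : (0 <= ((psum y n.+1 - n.+1%:R) ^+ 2)%:E)%E by rewrite lee_fin sqr_ge0.
have S1 (y : seq R) : (0 <= ((psum y n.+1 - n.+1%:R) ^+ 2)%:E + 1)%E by rewrite adde_ge0.
have S2 (y : seq R) : (0 <= (2 / n%:R)%:E * (((psum y n.+1 - n.+1%:R) ^+ 2)%:E + 1))%E.
  by rewrite mule_ge0// lee_fin divr_ge0.
have N0 (y : seq R) : (0 <= `|nth 0 y n|%:E)%E by rewrite lee_fin.
have m1 : measurable_fun setT (fun y : seq R => ((psum y n.+1 - n.+1%:R) ^+ 2)%:E + 1)%E.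
  exact: emeasurable_funD.
have m2 : measurable_fun setT (fun y : seq R => (2 / n%:R)%:E * (((psum y n.+1 - n.+1%:R) ^+ 2)%:E + 1))%E.
  exact: emeasurable_funM.
have m3 : measurable_fun setT (fun y : seq R => `|nth 0 y n|%:E
    + (2 / n%:R)%:E * (((psum y n.+1 - n.+1%:R) ^+ 2)%:E + 1))%E by exact: emeasurable_funD.
rewrite ItD//; last 2 first.
  exact: emeasurable_funM.
  by move=> y; apply: mule_ge0; [rewrite lee_fin|exact: adde_ge0].
rewrite ItZl ?lee_fin//; last by move=> y; exact: adde_ge0.
rewrite ItD// ItZl ?lee_fin ?divr_ge0// ItD//.
rewrite It_wexp_sq It_cst//; last exact: wexp1.
have -> : Ex n.+1 (fun y => `|nth 0 y n|%:E) = 1%E.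
  rewrite -addn1 It_cat.
  transitivity (Ex n (fun=> 1%E)); last by rewrite It_cst//; exact: wexp1.
  apply: It_ext => z zn; have := @It_wexp_moment R 1 1.
  rewrite /rising big_ord1 addn0 => <-; apply: It_ext => y _.
  by rewrite nth_cat zn ltnn subnn expr1 /psum big_ord1.
have -> : Ex n.+1 (fun y => (Fsum (err_psi e K n) n (psum y))%:E) =
    Ex n (fun y => (Fsum (err_psi e K n) n (psum y))%:E).
  rewrite -addn1; apply: It_wexp_take => // z y zn; congr EFin; apply: Fsum_ext => i ni.
  by rewrite psum_cat_l// zn.
rewrite /err_psi It_Fsum_poly_psi//; [|exact: err_A_ge0|exact: err_B_ge0|exact: err_C_ge0].
have -> : (K^-1%:E * (1 + (2 / n%:R)%:E * (n.+1%:R%:E + 1)))%E =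
    (K^-1 * (1 + 2 / n%:R * (n.+1%:R + 1)))%:E :> \bar R by [].
rewrite -EFinD lee_fin.
pose q := expR 1 / (1 + e^-1) : R.
have E1 : 0 < expR 1 :> R by exact: expR_gt0.
have qe : 0 <= q /\ q <= expR 1 * e.
  split; first by rewrite divr_ge0// ?expR_ge0//; lra.
  rewrite /q ler_pM2l// invf_ple ?posrE//; last by lra.
  by rewrite lerDr.
have q2 : q <= 2^-1 by case: qe => _ /le_trans; apply; lra.
have bound : \sum_(1 <= j < n.+1) j%:R^-1 * (err_A j * (1 + e^-1) ^- j + err_B e K n j * j%:R
     + err_C K j * (3 * j%:R ^+ 2 + 6 * j%:R)) <=
   \sum_(1 <= j < n.+1) (q ^+ j + (4 * e ^+ 2 + 5 / K) * (j%:R * sqrt j%:R)^-1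
       + (K * (1 + ln n%:R))^-1 * j%:R^-1).
  apply: ler_sum_nat => j /andP[j1 _].
  have jR : 1 <= j%:R :> R by rewrite ler1n.
  have s1 : 1 <= sqrt j%:R :> R by have := ler_wsqrtr jR; rewrite sqrtr1.
  have ss : sqrt j%:R ^+ 2 = j%:R :> R by rewrite sqr_sqrtr.
  have s0 : 0 < sqrt j%:R :> R by lra.
  have j0 : 0 < j%:R :> R by lra.
  have qj : err_A j * (1 + e^-1) ^- j = q ^+ j by rewrite /q exprMn exprVn.
  rewrite qj.
  have h1 : j%:R^-1 * q ^+ j <= q ^+ j.
    by rewrite ler_piMl ?exprn_ge0 ?qe.1// invf_le1.
  have u2 : (j%:R ^+ 2)^-1 <= (j%:R * sqrt j%:R)^-1 :> R.
    rewrite lef_pV2 ?posrE ?mulr_gt0 ?exprn_gt0// expr2 ler_pM2l//.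
    by rewrite -{2}ss expr2 ler_peMl// ltW.
  have us : sqrt j%:R / (2 * j%:R ^+ 2) = (j%:R * sqrt j%:R)^-1 / 2 :> R.
    by rewrite -{2 3}ss; field; rewrite gt_eqF.
  have h2 : j%:R^-1 * (err_B e K n j * j%:R) <= (4 * e ^+ 2 + 2^-1 / K) * (j%:R * sqrt j%:R)^-1
      + (K * (1 + ln n%:R))^-1 * j%:R^-1.
    have -> : j%:R^-1 * (err_B e K n j * j%:R) = err_B e K n j by field; rewrite gt_eqF.
    rewrite /err_B us; move: u2; set u := (_ * sqrt _)^-1; move: ((_ ^+ 2)^-1 : R) => w uw.
    have -> : (4 * e ^+ 2 + 2^-1 / K) * u + (K * (1 + ln n%:R))^-1 * j%:R^-1 =
        4 * e ^+ 2 * u + (u / 2 + j%:R^-1 / (1 + ln n%:R)) / K.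
      by field; rewrite !gt_eqF.
    by rewrite lerD2r ler_wpM2l// mulr_ge0// sqr_ge0.
  have h3 : j%:R^-1 * (err_C K j * (3 * j%:R ^+ 2 + 6 * j%:R)) <= 9 / 2 / K * (j%:R * sqrt j%:R)^-1.
    apply: (@le_trans _ _ (j%:R^-1 * (err_C K j * (9 * j%:R ^+ 2)))).
      apply: ler_wpM2l; first by rewrite invr_ge0.
      apply: ler_wpM2l; first exact: err_C_ge0.
      have : j%:R * 1 <= j%:R ^+ 2 :> R by rewrite expr2 ler_pM2l.
      by move: (j%:R : R) => x; lra.
    rewrite le_eqVlt; apply/orP; left; apply/eqP; rewrite /err_C.
    by field; rewrite !gt_eqF.
  rewrite [leLHS]mulrDr [X in X + _ <= _]mulrDr; apply: (le_trans (lerD (lerD h1 h2) h3)).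
  rewrite le_eqVlt; apply/orP; left; apply/eqP.
  move: (q ^+ j) ((_ * sqrt _)^-1) ((K * (1 + _))^-1 * _) => Q U V.
  by field; rewrite gt_eqF.
apply: le_trans (lerD bound (lexx _)) _.
rewrite !big_split/= -!mulr_sumr.
have [lH uH] := @ln_harmonic_sum R n n0; rewrite /harmonic_sum in lH uH.
have b1 := sum_powers_half n qe.1 q2.
have b2 : (4 * e ^+ 2 + 5 / K) * \sum_(1 <= j < n.+1) (j%:R * sqrt j%:R)^-1 <= (4 * e ^+ 2 + 5 / K) * 3.
  by apply: ler_wpM2l (sum_inv_sqrt3 n); rewrite addr_ge0 ?divr_ge0 ?mulr_ge0 ?sqr_ge0// ltW.
have b3 : (K * (1 + ln n%:R))^-1 * \sum_(1 <= j < n.+1) j%:R^-1 <= K^-1.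
  apply: (@le_trans _ _ ((K * (1 + ln n%:R))^-1 * (1 + ln n%:R))).
    by apply: ler_wpM2l uH; rewrite invr_ge0 mulr_ge0 ?ltW.
  by rewrite invfM -mulrA mulVf ?mulr1// gt_eqF.
have b4 : K^-1 * (1 + 2 / n%:R * (n.+1%:R + 1)) <= K^-1 * 7.
  apply: ler_wpM2l => //; rewrite -(natr1 n).
  have -> : 2 / n%:R * (n%:R + 1 + 1) = 2 + 4 / n%:R :> R by field; rewrite gt_eqF.
  have : n%:R^-1 <= 1 :> R by rewrite invf_le1// ler1n.
  by move: (n%:R^-1 : R) => I; lra.
have b5 : e ^+ 2 <= e / 2 by rewrite expr2 ler_pM2l.
apply: (le_trans (lerD (lerD (lerD b1 b2) b3) b4)).
by apply: err_total qe.2 b5; exact: ltW.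
Qed.

End err.

End error_majorant.

(** * Deterministic consequences of a small error functional *)

Section small_error.
Context {R : realType}.
Local Notation sqrt := Num.sqrt.
Variables (e K : R) (n : nat) (y : seq R).
Hypotheses (e0 : 0 < e) (e2 : e <= 2^-1) (K0 : 0 < K) (n0 : (0 < n)%N).
Hypotheses (sy : size y = n.+1) (y0 : all (fun x => 0 < x) y) (small : err e K n y < 1).

Let ln0 : 0 <= ln n%:R :> R. Proof. by rewrite ln_ge0// ler1n. Qed.

Let psi0 j g : 0 <= err_psi e K n j g. Proof. exact: err_psi_ge0. Qed.

Let e21 : 2 * e <= 1. Proof. by rewrite mulrC -ler_pdivlMr// div1r. Qed.

Lemma Fsum_err_lt1 : Fsum (err_psi e K n) n (psum y) < 1.
Proof.
apply: le_lt_trans small; rewrite /err lerDl mulr_ge0 ?invr_ge0 ?(ltW K0)// addr_ge0//.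
by rewrite mulr_ge0 ?divr_ge0// addr_ge0 ?sqr_ge0.
Qed.

Lemma err_psi_terms j g : [/\ expR (j%:R - g / e) <= err_psi e K n j g,
  4 * e ^+ 2 / j%:R ^+ 2 * (g - j%:R) ^+ 2 <= err_psi e K n j g,
  K^-1 * ((sqrt j%:R * (g - j%:R) ^+ 2 + (g - j%:R) ^+ 4 / sqrt j%:R) / (2 * j%:R ^+ 2)) <= err_psi e K n j g &
  (K * (1 + ln n%:R))^-1 * sqdev j g <= err_psi e K n j g].
Proof.
have l1 : 0 < 1 + ln n%:R :> R by exact: (ltr_pwDl ltr01 ln0).
rewrite /err_psi /poly_psi.
have X0 : 0 <= (g - j%:R) ^+ 2 by rewrite sqr_ge0.
have Y0 : 0 <= (g - j%:R) ^+ 4 by rewrite (exprM _ 2 2) sqr_ge0.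
have j20 : 0 <= j%:R ^+ 2 :> R by rewrite sqr_ge0.
have jj0 : 0 <= 2 * j%:R ^+ 2 :> R by rewrite mulr_ge0.
have Ki : 0 <= K^-1 by rewrite invr_ge0 ltW.
have EA : err_A j * expR (- e^-1 * g) = expR (j%:R - g / e).
  by rewrite /err_A -expRM_natl mulr1 -expRD mulNr [e^-1 * g]mulrC.
rewrite EA; set A := expR _; have A0 : 0 <= A by exact: expR_ge0.
have BE : err_B e K n j * (g - j%:R) ^+ 2 = 4 * e ^+ 2 / j%:R ^+ 2 * (g - j%:R) ^+ 2
   + K^-1 * (sqrt j%:R * (g - j%:R) ^+ 2 / (2 * j%:R ^+ 2)) + (K * (1 + ln n%:R))^-1 * sqdev j g.
  by rewrite /err_B /sqdev (invfM K); ring.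
have CE : err_C K j * (g - j%:R) ^+ 4 = K^-1 * ((g - j%:R) ^+ 4 / sqrt j%:R / (2 * j%:R ^+ 2)).
  by rewrite /err_C (invfM (2 * _)); ring.
have T1 : 0 <= 4 * e ^+ 2 / j%:R ^+ 2 * (g - j%:R) ^+ 2 by rewrite mulr_ge0// divr_ge0// mulr_ge0// sqr_ge0.
have T2 : 0 <= K^-1 * (sqrt j%:R * (g - j%:R) ^+ 2 / (2 * j%:R ^+ 2)).
  by rewrite mulr_ge0// divr_ge0// mulr_ge0// sqrtr_ge0.
have T3 : 0 <= K^-1 * ((g - j%:R) ^+ 4 / sqrt j%:R / (2 * j%:R ^+ 2)).
  by rewrite mulr_ge0// divr_ge0// divr_ge0// sqrtr_ge0.
have T4 : 0 <= (K * (1 + ln n%:R))^-1 * sqdev j g.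
  by rewrite mulr_ge0 ?sqdev_ge0// invr_ge0 mulr_ge0 ?ltW.
have E3 : K^-1 * ((sqrt j%:R * (g - j%:R) ^+ 2 + (g - j%:R) ^+ 4 / sqrt j%:R) / (2 * j%:R ^+ 2)) =
  K^-1 * (sqrt j%:R * (g - j%:R) ^+ 2 / (2 * j%:R ^+ 2))
  + K^-1 * ((g - j%:R) ^+ 4 / sqrt j%:R / (2 * j%:R ^+ 2)) by ring.
have P (u1 u2 u3 u4 : R) : 0 <= u1 -> 0 <= u2 -> 0 <= u3 -> 0 <= u4 ->
    [/\ A <= A + (u1 + u2 + u4) + u3, u1 <= A + (u1 + u2 + u4) + u3,
      u2 + u3 <= A + (u1 + u2 + u4) + u3 & u4 <= A + (u1 + u2 + u4) + u3].
  by move=> *; split; lra.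
by rewrite E3 BE CE; exact: P.
Qed.

(** If the increment is below [e j], the exponential term exceeds 1. If it is above [j / e], then
    its distance from [j] is at least [j / (2 e)], as [2 e <= 1], and the quadratic term reaches
    1. *)
Lemma small_face a b : (a < b <= n)%N -> face n (psum y) a b ->
  e * (b - a)%:R <= psum y b - psum y a <= (b - a)%:R / e.
Proof.
move=> abn f; set j := (b - a)%N; set g := psum y b - psum y a.
have j0 : 0 < j%:R :> R by rewrite ltr0n subn_gt0; case/andP: abn.
have lt1 : err_psi e K n j g < 1 by apply: le_lt_trans Fsum_err_lt1; apply: Fsum_face_le.
have [h1 h2 _ _] := err_psi_terms j g.
apply/andP; split; rewrite leNgt; apply/negP => gj.
  have : 0 < j%:R - g / e by rewrite subr_gt0 ltr_pdivrMr// mulrC.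
  by rewrite -expR_gt1 => /lt_le_trans /(_ h1); rewrite ltNge (ltW lt1).
have d : j%:R / (2 * e) <= g - j%:R.
  have : j%:R <= j%:R / (2 * e) by rewrite ler_peMr ?(ltW j0)// invf_ge1 ?mulr_gt0.
  have E : j%:R / e = 2 * (j%:R / (2 * e)) by field; rewrite gt_eqF.
  by move: gj; rewrite E lerBrDr mulr_natl mulr2n => /ltW gj wj; apply: le_trans gj; rewrite lerD2l.
suff : 1 <= 4 * e ^+ 2 / j%:R ^+ 2 * (g - j%:R) ^+ 2.
  by move=> /le_trans /(_ h2); rewrite leNgt lt1.
rewrite [leLHS](_ : 1 = 4 * e ^+ 2 / j%:R ^+ 2 * (j%:R / (2 * e)) ^+ 2); last by field; rewrite !gt_eqF.
apply: ler_wpM2l; first by rewrite divr_ge0 ?sqr_ge0// mulr_ge0// sqr_ge0.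
have d0 : 0 <= j%:R / (2 * e) by rewrite divr_ge0 ?mulr_ge0 ?ltW.
by apply: lerXn2r => //; rewrite nnegrE// (le_trans d0).
Qed.

Definition cubic_sum := Fsum (fun j g => `|g - j%:R| ^+ 3 / j%:R ^+ 2) n (psum y).

(* AM-GM: [2 |x| ^+ 3 <= s x ^+ 2 + x ^+ 4 / s] with [s = sqrt j]. *)
Lemma cubic_sum_le : cubic_sum <= K.
Proof.
have H : K^-1 * cubic_sum <= 1.
  rewrite -FsumZ; apply: le_trans (ltW Fsum_err_lt1); apply: le_Fsum => a b abn _.
  set j := (b - a)%N; set g := psum y b - psum y a; have [_ _ h _] := err_psi_terms j g.
  apply: le_trans h; apply: ler_wpM2l; first by rewrite invr_ge0 ltW.
  have j0 : 0 < j%:R :> R by rewrite ltr0n subn_gt0; case/andP: abn.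
  have s0 : 0 < sqrt j%:R :> R by rewrite sqrtr_gt0.
  rewrite (invfM 2) [leRHS]mulrA ler_wpM2r ?invr_ge0 ?sqr_ge0//.
  rewrite ler_pdivlMr//; set x := `|g - j%:R|; set s := sqrt _ in s0 *.
  have -> : (g - j%:R) ^+ 2 = x ^+ 2 by rewrite real_normK ?num_real.
  have -> : (g - j%:R) ^+ 4 = x ^+ 4 by rewrite (exprM _ 2 2) (exprM x 2 2) real_normK ?num_real.
  rewrite -subr_ge0.
  have -> : s * x ^+ 2 + x ^+ 4 / s - x ^+ 3 * 2 = x ^+ 2 * (s - x) ^+ 2 / s by field; rewrite gt_eqF.
  by rewrite divr_ge0 ?(ltW s0)// mulr_ge0 ?sqr_ge0.
by rewrite -(mulr1 K) -ler_pdivrMl.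
Qed.

Lemma sqdev_sum_le : Fsum sqdev n (psum y) <= K * (1 + ln n%:R).
Proof.
have l1 : 0 < 1 + ln n%:R :> R by exact: (ltr_pwDl ltr01 ln0).
have H : (K * (1 + ln n%:R))^-1 * Fsum sqdev n (psum y) <= 1.
  rewrite -FsumZ; apply: le_trans (ltW Fsum_err_lt1); apply: le_Fsum => a b _ _.
  by have [] := err_psi_terms (b - a)%N (psum y b - psum y a).
by rewrite -(mulr1 (K * _)) -ler_pdivrMl// mulr_gt0.
Qed.

Lemma small_gap : nth 0 y n <= K /\ (psum y n.+1 - n%:R) ^+ 2 / n%:R <= K.
Proof.
have nR : 0 < n%:R :> R by rewrite ltr0n.
set x := psum y n.+1 - n.+1%:R.
have x0 : 0 <= 2 / n%:R * (x ^+ 2 + 1) by rewrite mulr_ge0 ?divr_ge0// addr_ge0 ?sqr_ge0.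
have H : K^-1 * (`|nth 0 y n| + 2 / n%:R * (x ^+ 2 + 1)) <= 1.
  apply: le_trans (ltW small); rewrite /err lerDr; apply: Fsum_ge0; exact: psi0.
have {}H : `|nth 0 y n| + 2 / n%:R * (x ^+ 2 + 1) <= K by rewrite -(mulr1 K) -ler_pdivrMl.
split; first by apply: le_trans (ler_norm _) _; lra.
apply: (@le_trans _ _ (2 / n%:R * (x ^+ 2 + 1))); last by have := normr_ge0 (nth 0 y n); lra.
rewrite [leRHS]mulrAC; apply: ler_wpM2r; first by rewrite invr_ge0 ltW.
have -> : psum y n.+1 - n%:R = x + 1 by rewrite /x -(natr1 n); ring.
by have := sqr_ge0 (x - 1); lra.
Qed.

End small_error.

(** * Reduction of the functional to the sum of squared deviations *)

Section deviation.
Context {R : realType}.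
Variables (H : R -> R) (a1 a2 e K L : R).
Hypotheses (e0 : 0 < e) (e2 : e <= 2^-1) (K0 : 0 < K) (L0 : 0 <= L).
Hypothesis taylor : forall x, e / 2 <= x -> x <= (e / 2)^-1 ->
  `|H x - H 1 - a1 * (x - 1) - a2 * (x - 1) ^+ 2| <= L * `|x - 1| ^+ 3.

Let rho (x : R) := H x - H 1 - a1 * (x - 1) - a2 * (x - 1) ^+ 2.

Lemma cube_add_le (a b : R) : 0 <= a -> 0 <= b -> (a + b) ^+ 3 <= 4 * (a ^+ 3 + b ^+ 3).
Proof.
move=> a0 b0; rewrite -subr_ge0.
have -> : 4 * (a ^+ 3 + b ^+ 3) - (a + b) ^+ 3 = 3 * (a + b) * (a - b) ^+ 2 by ring.
by rewrite mulr_ge0 ?sqr_ge0// mulr_ge0// addr_ge0.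
Qed.

Lemma le_add1_sqr (z c : R) : 0 <= c -> z ^+ 2 <= c -> z <= 1 + c.
Proof. by move=> c0 zc; have := sqr_ge0 (z - 1); lra. Qed.

(** The slope [s j / g] lies in [[e / 2, (e / 2)^-1]], where [taylor] applies. Its distance from 1
    is at most [(|s - 1| j + |g - j|) / g], and the cube of the sum is split at the cost of a factor
    4. *)
Lemma remainder_bound (s j g : R) : 0 < j -> e * j <= g <= j / e -> `|s - 1| <= 2^-1 ->
  `|g / s * rho (s * j / g)| <= 8 * L / e ^+ 2 * (`|s - 1| ^+ 3 * j + `|g - j| ^+ 3 / j ^+ 2).
Proof.
move=> j0 /andP[gl gu]; pose dl : R := `|s - 1|; pose x : R := `|g - j|; rewrite -/dl -/x => sd.
have s1 : 2^-1 <= s /\ s <= 3 / 2.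
  by move: sd; rewrite /dl ler_norml => /andP[]; split; lra.
case: s1 => s1 s2; have s0 : 0 < s by lra.
have g0 : 0 < g by apply: lt_le_trans gl; rewrite mulr_gt0.
have ei : 0 < e^-1 by rewrite invr_gt0.
have jg1 : e <= j / g by rewrite ler_pdivlMr// mulrC -ler_pdivlMr.
have jg2 : j / g <= e^-1 by rewrite ler_pdivrMr// mulrC -ler_pdivrMr// invrK mulrC.
have vl : e / 2 <= s * j / g.
  by rewrite -mulrA mulrC; apply: ler_pM => //; rewrite ltW.
have vu : s * j / g <= (e / 2)^-1.
  rewrite invfM invrK -mulrA mulrC; apply: ler_pM => //; try by rewrite ltW// divr_gt0.
  by lra.
have v1 : `|s * j / g - 1| <= (dl * j + x) / g.
  have -> : s * j / g - 1 = ((s - 1) * j - (g - j)) / g by field; rewrite gt_eqF.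
  rewrite normrM [`|g^-1|]gtr0_norm ?invr_gt0// ler_wpM2r ?invr_ge0 ?(ltW g0)//.
  by apply: le_trans (ler_normB _ _) _; rewrite normrM (gtr0_norm j0).
have d0 : 0 <= dl by exact: normr_ge0.
have x0 : 0 <= x by exact: normr_ge0.
rewrite normrM gtr0_norm ?divr_gt0//.
apply: (@le_trans _ _ (g / s * (L * (4 * ((dl * j) ^+ 3 + x ^+ 3) / g ^+ 3)))).
  apply: ler_wpM2l; first by rewrite divr_ge0 ?ltW.
  apply: le_trans (taylor vl vu) _; apply: ler_wpM2l => //.
  apply: (@le_trans _ _ (((dl * j + x) / g) ^+ 3)).
    by apply: lerXn2r; rewrite ?nnegrE// (le_trans _ v1).
  rewrite expr_div_n ler_wpM2r ?invr_ge0 ?exprn_ge0 ?(ltW g0)//.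
  by apply: cube_add_le => //; rewrite mulr_ge0 ?(ltW j0).
have -> : g / s * (L * (4 * ((dl * j) ^+ 3 + x ^+ 3) / g ^+ 3)) =
  4 * L * (dl ^+ 3 * j + x ^+ 3 / j ^+ 2) * (s^-1 * (j / g) ^+ 2) by field; rewrite !gt_eqF.
have -> : 8 * L / e ^+ 2 * (dl ^+ 3 * j + x ^+ 3 / j ^+ 2) =
  4 * L * (dl ^+ 3 * j + x ^+ 3 / j ^+ 2) * (2 * e^-1 ^+ 2) by field; rewrite !gt_eqF.
apply: ler_wpM2l.
  apply: mulr_ge0; first exact: mulr_ge0.
  apply: addr_ge0; first by apply: mulr_ge0; [exact: exprn_ge0|exact: ltW].
  by apply: divr_ge0; [exact: exprn_ge0|exact: sqr_ge0].
apply: ler_pM; rewrite ?invr_ge0 ?(ltW s0) ?sqr_ge0//.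
  by rewrite invf_ple ?posrE.
by apply: lerXn2r; rewrite ?nnegrE ?(ltW ei)// divr_ge0 ?ltW.
Qed.

(** One summand per term of the final decomposition in [deviation_bound], in the same order. *)
Definition deviation_const : R :=
  2 * K * (`|a1| + `|H 0| + `|H 1|)
  + `|a2| * (K * (2 + 4 * K) + 3 / 2 * (K / e) + K + 3 / 2 * K) + 16 * L / e ^+ 2 * K.

(** Here [s = T / n], and a face with [j] increments of sum [g] has slope [s j / g] and width
    [g / T]. Summed over the faces, the constant and linear Taylor terms collapse because the [g]
    add up to [S] and the [j] to [n]; what is left is a boundary effect of the last increment and
    the quadratic term. *)
Lemma deviation_bound n (y : seq R) : 4 * K <= n%:R -> (0 < n)%N -> size y = n.+1 ->
  all (fun x => 0 < x) y -> ~~ degenerate n (psum y) -> err e K n y < 1 ->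
  `|n%:R * ((\int[@lebesgue_measure R]_(x in `[0, 1]) H (gren n (spacings_sample n y) x)) - H 1)
    - a2 * Fsum sqdev n (psum y)| <= deviation_const.
Proof.
move=> Kn n0 sy y0 gen small.
have nR : 0 < n%:R :> R by rewrite ltr0n.
set S := psum y n; set T := psum y n.+1; set gap := nth 0 y n.
have TE : T = S + gap by exact: psumS.
have gap0 : 0 < gap by apply: (allP y0); apply: mem_nth; rewrite sy.
have T0 : 0 < T by apply: psum_gt0 => //; rewrite sy leqnn.
have [gapK] := small_gap K0 n0 small; rewrite -/gap -/T => TK.
pose s := T / n%:R; have s0 : 0 < s by rewrite divr_gt0.
have Ts : T = s * n%:R by rewrite /s divfK ?gt_eqF.
have nsK : n%:R * (s - 1) ^+ 2 <= K.
  by apply: le_trans TK; rewrite le_eqVlt; apply/orP; left; apply/eqP; rewrite Ts; field; rewrite gt_eqF.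
pose dl : R := `|s - 1|; have dl0 : 0 <= dl by exact: normr_ge0.
have dl2 : dl ^+ 2 = (s - 1) ^+ 2 by rewrite real_normK ?num_real.
(* This is where [4 K <= n] enters: [n (s - 1)^2 <= K]. *)
have dlh : dl <= 2^-1.
  suff : dl ^+ 2 <= 2^-1 ^+ 2 by rewrite ler_pXn2r ?nnegrE.
  rewrite dl2 -(ler_pM2l nR).
  apply: le_trans nsK _; have : n%:R * 2^-1 ^+ 2 = n%:R / 4 :> R by field.
  by move=> ->; rewrite ler_pdivlMr// mulrC.
have face_ok a b : (a < b <= n)%N -> face n (psum y) a b ->
    e * (b - a)%:R <= psum y b - psum y a <= (b - a)%:R / e.
  by move=> abn f; apply: (@small_face _ e K n y).
have j_gt0 a b : (a < b <= n)%N -> 0 < (b - a)%:R :> R by rewrite ltr0n subn_gt0 => /andP[].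
have g_gt0 a b : (a < b <= n)%N -> 0 < psum y b - psum y a.
  by move=> /andP[ab bn]; rewrite subr_gt0; apply: (psum_lt sy y0); rewrite ab leqW.
have [_ ->] := integral_gren n0 sy y0 H gen.
pose q (j : nat) (g : R) := (g - j%:R) ^+ 2 / g.
pose P (j : nat) (g : R) := g / s * rho (s * j%:R / g).
set Q' := Fsum sqdev n (psum y); set I1 := Fsum _ n (psum y).
(* Face by face, with [j^2 / g = (g - j)^2 / g - g + 2 j] for the quadratic term. *)
have I1E : n%:R * I1 = (H 1 / s - a1 / s + a2 * (s^-1 - s)) * S + (a1 + a2 * (2 * s - 2)) * n%:R
    + a2 * s * Fsum q n (psum y) + Fsum P n (psum y).
  have FS : Fsum (fun _ g => g) n (psum y) = S by rewrite Fsum_increment// psum0 subr0.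
  transitivity ((H 1 / s - a1 / s + a2 * (s^-1 - s)) * Fsum (fun _ g => g) n (psum y)
      + (a1 + a2 * (2 * s - 2)) * Fsum (fun j _ => j%:R) n (psum y)
      + a2 * s * Fsum q n (psum y) + Fsum P n (psum y)); last by rewrite FS Fsum_lengthR.
  rewrite -!FsumZ -!FsumD.
  apply: eq_Fsum => a b abn f; rewrite /P /rho /q.
  move: (g_gt0 _ _ abn) (j_gt0 _ _ abn); set g := psum y b - psum y a; set j := (b - a)%:R => g0 j0.
  rewrite -/T Ts; have -> : j * (s * n%:R) / (n%:R * g) = s * j / g by field; rewrite !gt_eqF.
  by move: (H (s * j / g)) => h; field; rewrite !gt_eqF.
set Q := Fsum q n (psum y) in I1E; set PP := Fsum P n (psum y) in I1E.
have cK : cubic_sum n y <= K by apply: (@cubic_sum_le _ e K n y).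
(* Replacing the denominator [g] by [j] costs [|g - j|^3 / (g j)], at most [|g - j|^3 / (e j^2)],
   which [cubic_sum] controls. *)
have QQ : `|Q - Q'| <= K / e.
  have -> : Q - Q' = Fsum (fun j g => q j g + -1 * sqdev j g) n (psum y).
    by rewrite FsumD FsumZ mulN1r.
  apply: le_trans (ler_norm_Fsum _ _ _) _.
  apply: (@le_trans _ _ (e^-1 * cubic_sum n y)); last by rewrite mulrC ler_wpM2r// invr_ge0 ltW.
  rewrite -FsumZ; apply: le_Fsum => a b abn f; have /andP[fl fu] := face_ok a b abn f.
  move: (g_gt0 _ _ abn) (j_gt0 _ _ abn) fl; rewrite /q /sqdev.
  set g := psum y b - psum y a; set j := (b - a)%:R => g0 j0 fl.
  have -> : (g - j) ^+ 2 / g + -1 * ((g - j) ^+ 2 / j) = (g - j) ^+ 2 * (j - g) / (g * j).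
    by field; rewrite !gt_eqF.
  rewrite normrM [`|(g * j)^-1|]gtr0_norm ?invr_gt0 ?mulr_gt0//.
  rewrite (normrM (_ ^+ 2)) normrX [`|j - g|]distrC -exprSr.
  rewrite mulrCA; apply: ler_wpM2l; first exact: exprn_ge0.
  have -> : e^-1 * j ^- 2 = ((e * j) * j)^-1 by field; rewrite !gt_eqF.
  by rewrite lef_pV2 ?posrE ?mulr_gt0// ler_wpM2r// ltW.
have PK : `|PP| <= 16 * L / e ^+ 2 * K.
  apply: le_trans (ler_norm_Fsum _ _ _) _.
  apply: (@le_trans _ _ (8 * L / e ^+ 2 * (dl ^+ 3 * n%:R + cubic_sum n y))).
    rewrite -{1}(Fsum_lengthR gen) -FsumZ -FsumD -FsumZ; apply: le_Fsum => a b abn f.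
    by apply: remainder_bound => //; [exact: j_gt0|exact: face_ok].
  have -> : 16 * L / e ^+ 2 * K = 8 * L / e ^+ 2 * (K + K) by field; rewrite gt_eqF.
  apply: ler_wpM2l; first by rewrite divr_ge0 ?sqr_ge0// mulr_ge0.
  apply: lerD => //.
  have -> : dl ^+ 3 * n%:R = dl * (n%:R * (s - 1) ^+ 2) by rewrite -dl2; ring.
  apply: (@le_trans _ _ (1 * K)); last by rewrite mul1r.
  apply: ler_pM => //; first by rewrite mulr_ge0 ?sqr_ge0.
  by apply: le_trans dlh _; lra.
have s12 : 2^-1 <= s /\ s <= 3 / 2 by move: dlh; rewrite /dl ler_norml => /andP[]; split; lra.
case: s12 => s1 s2.
have si : s^-1 <= 2 by rewrite invf_ple ?posrE.
have si0 : 0 <= s^-1 by rewrite invr_ge0 ltW.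
have lnn : 0 <= ln n%:R :> R by rewrite ln_ge0// ler1n.
have dln : dl * ln n%:R <= 1 + 4 * K.
  have ln4 : (ln n%:R) ^+ 2 <= 4 * n%:R :> R.
    have sn0 : 0 < Num.sqrt n%:R :> R by rewrite sqrtr_gt0.
    have nn : n%:R = Num.sqrt n%:R ^+ 2 :> R by rewrite sqr_sqrtr.
    rewrite {2}nn; have -> : 4 * Num.sqrt n%:R ^+ 2 = (2 * Num.sqrt n%:R) ^+ 2 :> R by ring.
    apply: lerXn2r; rewrite ?nnegrE// ?mulr_ge0 ?(ltW sn0)//.
    rewrite {1}nn lnXn// mulr2n [leRHS]mulr_natl mulr2n.
    by apply: lerD; rewrite ltW// ln_sublinear.
  have dq : (dl * ln n%:R) ^+ 2 <= 4 * K.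
    rewrite exprMn dl2; apply: (@le_trans _ _ ((s - 1) ^+ 2 * (4 * n%:R))).
      by rewrite ler_wpM2l// sqr_ge0.
    by move: nsK; rewrite [n%:R * _]mulrC mulrCA => nsK; rewrite ler_pM2l.
  by apply: le_add1_sqr dq; rewrite mulr_ge0 ?(ltW K0).
have Q'0 : 0 <= Q' by apply: Fsum_ge0 => j g; exact: sqdev_ge0.
have dQ : `|(s - 1) * Q'| <= K * (2 + 4 * K).
  rewrite normrM -/dl (ger0_norm Q'0).
  apply: (@le_trans _ _ (dl * (K * (1 + ln n%:R)))).
    by apply: ler_wpM2l => //; apply: (@sqdev_sum_le _ e K n y).
  rewrite mulrCA ler_wpM2l ?(ltW K0)// mulrDr mulr1; lra.
have sQQ : `|s * (Q - Q')| <= 3 / 2 * (K / e).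
  by rewrite normrM (gtr0_norm s0); apply: ler_pM => //; rewrite ltW.
have nsK' : `|n%:R * (s - 1) ^+ 2| <= K by rewrite ger0_norm// mulr_ge0 ?sqr_ge0.
have ss : `|gap * (s - s^-1)| <= 3 / 2 * K.
  rewrite normrM (gtr0_norm gap0) mulrC; apply: ler_pM; rewrite ?(ltW gap0)//.
  by rewrite ler_norml; apply/andP; split; lra.
have gs : `|gap / s| <= 2 * K.
  rewrite normrM (gtr0_norm gap0) (gtr0_norm (_ : 0 < s^-1)) ?invr_gt0// mulrC.
  by apply: ler_pM; rewrite ?(ltW gap0).
have -> : n%:R * (I1 + (1 - S / T) * H 0 - H 1) - a2 * Q' = (a1 + H 0 - H 1) * (gap / s)
    + a2 * ((s - 1) * Q' + s * (Q - Q') - n%:R * (s - 1) ^+ 2 + gap * (s - s^-1)) + PP.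
  have SE : S = s * n%:R - gap by rewrite -Ts TE addrK.
  rewrite mulrBr mulrDr I1E SE Ts; field; rewrite !gt_eqF//.
rewrite /deviation_const; apply: le_trans (ler_normD _ _) _; apply: lerD => //.
apply: le_trans (ler_normD _ _) _; apply: lerD.
  rewrite normrM mulrC; apply: ler_pM => //.
  apply: le_trans (ler_normB _ _) _; apply: lerD => //; exact: ler_normD.
rewrite normrM; apply: ler_wpM2l => //.
apply: le_trans (ler_normD _ _) _; apply: lerD => //.
apply: le_trans (ler_normB _ _) _; apply: lerD => //.
by apply: le_trans (ler_normD _ _) _; apply: lerD.
Qed.

End deviation.

(** * Approximation of a test function *)

Section test_functions.
Context {R : realType}.
Local Open Scope complex_scope.
Local Notation N := (@normal_prob R 0 1).
Implicit Types (phi : R[i]^o -> R).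

(** Compactness of [[-B, B]] gives one radius for the whole segment, also for points [z] off the
    line. *)
Lemma continuous_near_segment phi (kappa : R[i]) (B eta : R) : continuous phi -> 0 < eta ->
  exists2 r : R, 0 < r & forall t, `|t| <= B -> forall z, modulus (z - kappa * t%:C) <= r ->
    `|phi z - phi (kappa * t%:C)| <= eta.
Proof.
move=> cphi eta0.
have cpt : compact (`[- B, B]%classic : set R) by exact: segment_compact.
pose Q (r t : R) := forall z, modulus (z - kappa * t%:C) <= r -> `|phi z - phi (kappa * t%:C)| <= eta.
have k1 : 0 < modulus kappa + 1 by rewrite ltr_wpDl ?modulus_ge0.
have := (compact_near_coveringP _).1 cpt R (0^'+) Q _.
move=> /(_ _) [|r0 /= r00 Hr].
  move=> x _.
  have := cphi (kappa * x%:C) => /cvgrPdist_lt /(_ (eta / 2)).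
  rewrite divr_gt0// => /(_ isT) /nbhs_ballP[d /= d0 Hd].
  have dd : d = (complex.Re d)%:C by case: d d0 {Hd} => u v; rewrite ltcE/= => /andP[/eqP -> _].
  pose d' := complex.Re d; have d'0 : 0 < d' by rewrite -ltcR -dd.
  have close z : modulus (z - kappa * x%:C) < d' -> `|phi (kappa * x%:C) - phi z| < eta / 2.
    by move=> zd; apply: Hd; rewrite /ball/= modulusE dd ltcR modulusB.
  pose r1 := d' / 2 / (modulus kappa + 1).
  have r10 : 0 < r1 by rewrite !divr_gt0.
  exists (ball x r1, [set r | r < d' / 2]); first split.
  - exact: nbhsx_ballx.
  - by apply: nbhs_right_lt; rewrite divr_gt0.
  move=> [t r] /= [xt rd] z zr.
  have tx : modulus (kappa * t%:C - kappa * x%:C) <= d' / 2.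
    rewrite -mulrBr modulusM -rmorphB/= modulus_real distrC.
    apply: (@le_trans _ _ (modulus kappa * r1)); first by rewrite ler_wpM2l ?modulus_ge0// ltW.
    apply: (@le_trans _ _ ((modulus kappa + 1) * r1)); first by rewrite ler_wpM2r ?(ltW r10)// lerDl.
    by rewrite /r1 mulrC divfK// gt_eqF.
  have c1 : `|phi (kappa * x%:C) - phi (kappa * t%:C)| < eta / 2 by apply: close; lra.
  have c2 : `|phi (kappa * x%:C) - phi z| < eta / 2.
    apply: close; have -> : z - kappa * x%:C = (z - kappa * t%:C) + (kappa * t%:C - kappa * x%:C).
      by rewrite subrKA.
    by apply: le_lt_trans (modulusD _ _) _; lra.
  have -> : phi z - phi (kappa * t%:C) =
    (phi (kappa * x%:C) - phi (kappa * t%:C)) - (phi (kappa * x%:C) - phi z) by ring.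
  by apply: le_trans (ler_normB _ _) _; lra.
exists (r0 / 2); first by rewrite divr_gt0.
move=> t tB; apply: Hr => //=; last by rewrite in_itv/= -ler_norml.
  by rewrite sub0r normrN gtr0_norm ?divr_gt0//; lra.
by rewrite divr_gt0.
Qed.

Lemma smooth_test_measurable (f : R -> R) : smooth_test f -> measurable_fun setT f.
Proof. by move=> [C [f1 [f2 []]]]. Qed.

(** [q] is the sum of the bumps, and [g] weights them by the values of [phi] at their nodes on the
    line. Only bumps with a node near [x] contribute to the difference; the missing mass [1 - q x]
    is charged at the price [M]. *)
Lemma smooth_approx phi (kappa : R[i]) (M eta : R) : continuous phi ->
  (forall z, 0 <= phi z <= M) -> 0 < eta ->
  exists g q : R -> R, exists r : R, [/\ smooth_test g, smooth_test q, 0 < r,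
    forall x, [/\ 0 <= q x, q x <= 1, 0 <= g x & g x <= M] &
    (forall z x, modulus (z - kappa * x%:C) <= r -> `|phi z - g x| <= eta + M * (1 - q x))
    /\ 1 - eta <= \int[N]_x q x].
Proof.
move=> cphi phiM eta0.
have M0 : 0 <= M by have /andP[a b] := phiM 0; exact: le_trans b.
(* This makes [B ^- 2 <= eta], the Chebyshev bound used at the end for the mass outside
   [[-B, B]]. *)
pose B := eta^-1 + 1; have B1 : 1 <= B by rewrite /B lerDr invr_ge0 ltW.
have B0 : 0 < B by lra.
have [r' r'0 Hr'] := continuous_near_segment kappa (B + 4) cphi eta0.
pose k := modulus kappa + 1; have k0 : 0 < k by rewrite ltr_wpDl ?modulus_ge0.
(* A bump reaches at most [4 e] from its node, which moves the point on the line by at most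
   [r' / 2]. *)
pose e := Num.min 1 (r' / 2 / (4 * k)).
have e0 : 0 < e by rewrite lt_min ltr01 !divr_gt0// mulr_gt0.
have e1 : e <= 1 by rewrite ge_min lexx.
have ek : modulus kappa * (4 * e) <= r' / 2.
  have : e <= r' / 2 / (4 * k) by rewrite ge_min lexx orbT.
  rewrite ler_pdivlMr ?mulr_gt0// => H; apply: le_trans H.
  have -> : modulus kappa * (4 * e) = e * (4 * modulus kappa) by ring.
  by rewrite ler_pM2l// ler_pM2l// lerDl.
(* The bumps sum to 1 for [|x| <= e (m - 3)], which must cover [[-B, B]], while all nodes stay
   within [B + 4], the range chosen for [Hr']. *)
pose m := (Num.truncn (B / e)).+4.
have Be0 : 0 <= B / e by rewrite divr_ge0 ?ltW.
have /andP[tl tu] := truncn_itv Be0.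
have mE : m%:R = (Num.truncn (B / e))%:R + 4 :> R by rewrite /m -addn4 natrD.
have mB1 : B <= e * (m%:R - 3).
  by rewrite mulrC -ler_pdivrMr// mE; move: tu; rewrite -natr1; lra.
have mB2 : e * m%:R <= B + 4.
  have -> : B + 4 = e * (B / e) + 4 by rewrite mulrC divfK// gt_eqF.
  rewrite mE mulrDr; apply: lerD; first by rewrite ler_pM2l.
  by rewrite mulrC ler_piMr.
pose t i : R := e * (i%:R - m%:R).
have tB (i : 'I_(m + m)) : `|t i| <= B + 4.
  apply: le_trans mB2; rewrite /t normrM gtr0_norm// ler_pM2l// ler_norml.
  have : (i : nat)%:R <= (m + m)%:R :> R by rewrite ler_nat ltnW.
  rewrite natrD => im; have i0 : 0 <= (i : nat)%:R :> R by [].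
  by apply/andP; split; lra.
pose q x := \sum_(i < m + m) bump_at e m i x.
pose g x := \sum_(i < m + m) phi (kappa * (t i)%:C) * bump_at e m i x.
have sq : smooth_test q by apply: smooth_test_sum => i; exact: smooth_test_bump_at.
have b0 i x : 0 <= bump_at e m i x by exact: bump_ge0.
have sg : smooth_test g.
  apply: smooth_test_sum => i; apply: smooth_testZ; first by case/andP: (phiM (kappa * (t i)%:C)).
  exact: smooth_test_bump_at.
have gq x : g x <= M * q x.
  rewrite /g /q mulr_sumr; apply: ler_sum => i _; rewrite ler_wpM2r//.
  by case/andP: (phiM (kappa * (t i)%:C)).
have q01 x : 0 <= q x <= 1 by exact: sum_bump_at_bounds.
exists g, q, (r' / 2); split => //; first by rewrite divr_gt0.
  move=> x; have /andP[q0 q1] := q01 x; split => //.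
    by apply: sumr_ge0 => i _; rewrite mulr_ge0//; case/andP: (phiM (kappa * (t i)%:C)).
  by apply: le_trans (gq x) _; rewrite ler_piMr.
split.
  move=> z x zx; have /andP[q0 q1] := q01 x.
  have -> : phi z - g x = phi z * (1 - q x) + \sum_(i < m + m) (phi z - phi (kappa * (t i)%:C)) * bump_at e m i x.
    rewrite (eq_bigr (fun i : 'I_(m + m) => phi z * bump_at e m i x - phi (kappa * (t i)%:C) * bump_at e m i x)).
      by rewrite sumrB -mulr_sumr -/(g x) -/(q x); ring.
    by move=> i _; rewrite mulrBl.
  rewrite addrC; apply: le_trans (ler_normD _ _) _; apply: lerD; last first.
    have /andP[z0 zM] := phiM z; have q1' : 0 <= 1 - q x by rewrite subr_ge0.
    by rewrite normrM (ger0_norm z0) (ger0_norm q1') ler_wpM2r.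
  apply: le_trans (ler_norm_sum _ _ _) _; apply: (@le_trans _ _ (eta * q x)); last by rewrite ler_piMr// ltW.
  rewrite /q mulr_sumr; apply: ler_sum => i _; rewrite normrM (ger0_norm (b0 _ _)).
  have [->|bn0] := eqVneq (bump_at e m i x) 0; first by rewrite !mulr0.
  apply: ler_wpM2r => //; apply: Hr'; first exact: tB.
  have xt := bump_at_supp e0 bn0.
  have -> : z - kappa * (t i)%:C = (z - kappa * x%:C) + kappa * (x - t i)%:C.
    by rewrite rmorphB/=; ring.
  apply: le_trans (modulusD _ _) _; rewrite modulusM modulus_real.
  have : modulus kappa * `|x - t i| <= modulus kappa * (4 * e) by rewrite ler_wpM2l ?modulus_ge0.
  by move: zx ek; lra.
have mq := smooth_test_measurable sq.
have Eq : En q = (\int[N]_x q x)%:E by exact: EnE_fin.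
have : (1 <= (\int[N]_x q x)%:E + (B ^- 2)%:E)%E.
  rewrite -Eq -[(B ^- 2)%:E]mule1 -[X in (_ * X)%E](@En_sq R) -EnZ//; last first.
  - by rewrite invr_ge0 sqr_ge0.
  - by move=> x; rewrite sqr_ge0.
  rewrite -EnD//; last 3 first.
  - by apply: measurable_funM => //; exact: exprn_measurable.
  - by move=> x; case/andP: (q01 x).
  - by move=> x; rewrite mulr_ge0 ?invr_ge0 ?sqr_ge0.
  rewrite -(En_cst ler01); apply: le_En => //.
    by apply: measurable_funD => //; apply: measurable_funM => //; exact: exprn_measurable.
  move=> x; have /andP[q0 q1] := q01 x; have [xB|Bx] := leP `|x| B.
    have -> : q x = 1 by apply: sum_bump_at1 => //; exact: le_trans xB mB1.
    by rewrite lerDl mulr_ge0 ?invr_ge0 ?sqr_ge0.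
  apply: (@le_trans _ _ (B ^- 2 * x ^+ 2)); last by rewrite lerDr.
  rewrite -[x ^+ 2]real_normK ?num_real// mulrC ler_pdivlMr ?exprn_gt0// mul1r.
  by apply: lerXn2r; rewrite ?nnegrE ?(ltW B0)// ltW.
rewrite -EFinD lee_fin => H.
have : B ^- 2 <= eta.
  rewrite invf_ple ?posrE ?exprn_gt0//; apply: (@le_trans _ _ B); first by rewrite /B lerDl.
  by rewrite expr2 ler_peMr// ltW.
by lra.
Qed.

End test_functions.

Section reflection.
Context {R : realType}.
Local Notation mu := (@lebesgue_measure R).
Local Open Scope ereal_scope.

Lemma integral_oppr (f : R -> \bar R) : measurable_fun setT f -> (forall x, 0 <= f x) ->
  \int[mu]_x f x = \int[mu]_x f (- x)%R.
Proof.
move=> mf f0.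
pose phi : R -> measurableTypeR R := fun x => (- x)%R.
have mphi : measurable_fun setT phi by exact: oppr_measurable.
pose pm := measure_function_pushforward__canonical__measure_function_Measure mu mphi.
transitivity (\int[pm]_x f x); last by rewrite ge0_integral_pushforward.
apply: eq_measure_integral => //= A mA _.
apply: lebesgue_measure_unique => //= _ [[b c]] _ <-.
rewrite /pushforward/=.
have -> : phi @^-1` [set` `]b, c]] = [set` `[(- c)%R, (- b)%R[].
  by apply/seteqP; split=> x /=; rewrite !in_itv/= /phi lerNl ltrNr andbC.
rewrite !lebesgue_measure_itv/= !lte_fin ltrN2.
by case: ifP => // _; rewrite -!EFinB opprK addrC.
Qed.

Lemma En_oppr (F : R -> R) : measurable_fun setT F -> (forall x, 0 <= F x)%R ->
  En (fun x => F (- x)%R) = En F.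
Proof.
move=> mF F0; rewrite !EnE [RHS]integral_oppr.
- by apply: eq_integral => x _; rewrite !wnormE sqrrN.
- by apply: emeasurable_funM; [exact: measurable_weightE|exact/measurable_EFinP].
- by move=> x; rewrite mule_ge0 ?lee_fin ?weight_ge0.
Qed.

End reflection.

(** * Weak convergence under a perturbation of small probability *)

Section limit.
Context {R : realType}.
Local Open Scope complex_scope.
Local Notation N := (@normal_prob R 0 1).
Local Notation Ex := (It (@wexp R)).

Definition std_sqdev (n : nat) (y : seq R) : R :=
  (Fsum sqdev n (psum y) - ln n%:R) / Num.sqrt (3 * ln n%:R).

Lemma measurable_std_sqdev n : measurable_fun setT (std_sqdev n).
Proof.
apply: measurable_funM => //; apply: measurable_funB => //.
by apply: measurable_Fsum_psum => j; exact: measurable_sqdev.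
Qed.

Lemma It_wexp_fin n (F : seq R -> R) (C : R) : measurable_fun setT F -> (forall y, 0 <= F y <= C) ->
  Ex n (fun y => (F y)%:E) = (fine (Ex n (fun y => (F y)%:E)))%:E.
Proof.
move=> mF FC; have F0 y : 0 <= F y by case/andP: (FC y).
rewrite fineK// ge0_fin_numE; last by apply: It_ge0 => y; rewrite lee_fin.
have C0 : 0 <= C by apply: le_trans (F0 [::]) _; case/andP: (FC [::]).
apply: (@le_lt_trans _ _ (Ex n (fun=> C%:E))); last by rewrite It_cst ?wexp1 ?ltry.
apply: le_It => //; first exact/measurable_EFinP.
by move=> y _; rewrite lee_fin; case/andP: (FC y).
Qed.

Lemma smooth_test_clt (f : R -> R) : smooth_test f ->
  fine (Ex n.+1 (fun y => (f (std_sqdev n y))%:E)) @[n --> \oo] --> \int[N]_z f z.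
Proof.
move=> sf; have [_ [C f0C]] := smooth_test_bounded sf.
have [D [f1 [f2 [mf mf1 mf2 fT]]]] := sf.
rewrite (_ : (fun n => _) = (fun n => fine (Ex n (fun y => (f (std_sqdev n y))%:E)))).
  exact: Fsum_clt mf mf1 mf2 fT.
apply/funext => n; congr fine; rewrite -addn1 It_wexp_take//.
  by move=> y; rewrite lee_fin; case/andP: (f0C (std_sqdev n y)).
move=> z y zn; congr (f _)%:E; rewrite /std_sqdev; congr ((_ - _) / _).
by apply: Fsum_ext => i ni; rewrite psum_cat_l// zn.
Qed.

Lemma continuous_complex_line (kappa : R[i]) : continuous (fun x : R => kappa * x%:C : R[i]^o).
Proof.
move=> x; apply/cvgrPdist_lt => e e0.
have ee : e = (complex.Re e)%:C by case: e e0 => u v; rewrite ltcE/= => /andP[/eqP -> _].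
have e'0 : 0 < complex.Re e by rewrite -ltcR -ee.
have k0 : 0 < modulus kappa + 1 by rewrite ltr_wpDl ?modulus_ge0.
have r0 : 0 < complex.Re e / (modulus kappa + 1) by rewrite divr_gt0.
near=> y.
rewrite ee modulusE ltcR -mulrBr -rmorphB/= modulusM modulus_real.
have : `|x - y| < complex.Re e / (modulus kappa + 1).
  by near: y; apply: cvgr_dist_lt r0; exact: cvg_id.
rewrite ltr_pdivlMr//; apply: le_lt_trans.
by rewrite mulrC ler_wpM2l// lerDl.
Unshelve. all: by end_near. Qed.

Variables (phi : R[i]^o -> R) (kappa : R[i]) (M : R) (V : nat -> seq R -> R[i]^o).
Hypotheses (cphi : continuous phi) (phiM : forall z, 0 <= phi z <= M).
Hypothesis mphiV : forall n, measurable_fun setT (fun y => phi (V n y)).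

(* [W n] plays the role of the indicator of an event of small probability outside
   of which [V n] is close to its linearisation. *)
Hypothesis close : forall eta r : R, 0 < eta -> 0 < r -> exists W : nat -> seq R -> R,
  (forall n, measurable_fun setT (W n) /\ forall y, 0 <= W n y) /\
  \forall n \near \oo, (Ex n.+1 (fun y => (W n y)%:E) <= eta%:E)%E /\
    forall y, size y = n.+1 -> W n y < 1 -> modulus (V n y - kappa * (std_sqdev n y)%:C) <= r.

Let phik (x : R) := phi (kappa * x%:C).

Lemma measurable_phik : measurable_fun setT phik.
Proof.
apply: continuous_measurable_fun => x.
by apply: (@continuous_comp _ _ _ (fun x : R => kappa * x%:C : R[i]^o) phi x); [exact: continuous_complex_line|exact: cphi].
Qed.

(** [phi] is replaced by the smooth [g] both in the limit and along the sequence. The central limit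
    theorem applied to [q] supplies the tightness, since the mean of [1 - q] is eventually at most
    [2 eta]; where [W] is at least 1 the difference is at most [M W]. *)
Lemma weak_limit : fine (Ex n.+1 (fun y => (phi (V n y))%:E)) @[n --> \oo] --> \int[N]_x phik x.
Proof.
have M0 : 0 <= M by have /andP[a b] := phiM 0; exact: le_trans b.
apply/cvgrPdist_le => eps eps0.
(* The errors add up to [3 eta + 4 M eta]. *)
pose eta := eps / (4 * (M + 1)).
have M1 : 0 < M + 1 by lra.
have eta0 : 0 < eta by rewrite divr_gt0// mulr_gt0.
have epsE : 3 * eta + 4 * M * eta <= eps.
  have -> : eps = 4 * (M + 1) * eta by rewrite mulrC divfK// gt_eqF// mulr_gt0.
  by lra.
have [g [q [r [sg sq r0 gqb [near_g c1]]]]] := smooth_approx kappa cphi phiM eta0.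
have [W [mW evW]] := close eta0 r0.
have mg := smooth_test_measurable sg; have mq := smooth_test_measurable sq.
have g0 x : 0 <= g x <= M by have [_ _ -> ->] := gqb x.
have q0 x : 0 <= q x <= 1 by have [-> -> _ _] := gqb x.
set a := \int[N]_x phik x.
have Ea : En phik = a%:E by apply: (EnE_fin measurable_phik (C := M)) => x; exact: phiM.
have Eb : En g = (\int[N]_x g x)%:E by exact: EnE_fin mg g0.
have Ec : En q = (\int[N]_x q x)%:E by exact: EnE_fin mq q0.
set b := \int[N]_x g x in Eb; set c := \int[N]_x q x in Ec c1.
have near_k x : `|phik x - g x| <= eta + M * (1 - q x).
  by apply: near_g; rewrite subrr modulus0 ltW.
have ab : `|a - b| <= eta + M * eta.
  suff H e' : `|e'| = 1 -> e' * (a - b) <= eta + M * (1 - c).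
    have Mc : M * (1 - c) <= M * eta by rewrite ler_wpM2l//; lra.
    rewrite ler_norml; apply/andP; split.
      by have := H (-1); rewrite normrN1 => /(_ erefl); lra.
    by have := H 1; rewrite normr1 => /(_ erefl); lra.
  move=> e'1.
  pose L : seq (R * (R -> R) * R) := [:: (e', phik, a); (- e', g, b); (M, q, c); (- (eta + M), fun=> 1, 1)].
  suff : \sum_(t <- L) t.1.1 * t.2 <= 0 by rewrite !big_cons big_nil/=; lra.
  apply: En_lin_le.
    move=> t [<-|[<-|[<-|[<-|//]]]]/=.
    - by split=> //; [exact: measurable_phik|move=> x; case/andP: (phiM (kappa * x%:C))].
    - by split=> // x; case/andP: (g0 x).
    - by split=> // x; case/andP: (q0 x).
    - by split=> //; exact: En_cst.
  move=> x; rewrite !big_cons big_nil/=.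
  have := ler_norm (e' * (phik x - g x)); rewrite normrM e'1 mul1r => u1.
  by have := le_trans u1 (near_k x); lra.
have /cvgrPdist_le /(_ _ eta0) evb := smooth_test_clt sg.
have /cvgrPdist_le /(_ _ eta0) evc := smooth_test_clt sq.
apply: filterS3 evW evb evc => n [EW cl].
have mT := measurable_std_sqdev n.
have Eg := @It_wexp_fin n.+1 (fun y => g (std_sqdev n y)) M (measurableT_comp mg mT) (fun y => g0 _).
have Eq := @It_wexp_fin n.+1 (fun y => q (std_sqdev n y)) 1 (measurableT_comp mq mT) (fun y => q0 _).
have EV := @It_wexp_fin n.+1 (fun y => phi (V n y)) M (mphiV n) (fun y => phiM _).
have [mWn W0] := mW n.
have Wfin : Ex n.+1 (fun y => (W n y)%:E) = (fine (Ex n.+1 (fun y => (W n y)%:E)))%:E.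
  rewrite fineK// ge0_fin_numE; last by apply: It_ge0 => y; rewrite lee_fin.
  by apply: le_lt_trans EW _; rewrite ltry.
move: EW; rewrite Wfin lee_fin; move: Wfin.
set w := fine _ => Wfin wle.
move: Eg Eq EV; set bn := fine (Ex n.+1 (fun y => (g _)%:E)); set cn := fine (Ex n.+1 (fun y => (q _)%:E)).
set an := fine _ => Eg Eq EV; rewrite -/b -/c => bbn ccn.
have abn : `|an - bn| <= eta + M * (1 - cn) + M * w.
  suff H e' : `|e'| = 1 -> e' * (an - bn) <= eta + M * (1 - cn) + M * w.
    rewrite ler_norml; apply/andP; split.
      by have := H (-1); rewrite normrN1 => /(_ erefl); lra.
    by have := H 1; rewrite normr1 => /(_ erefl); lra.
  move=> e'1.
  pose L : seq (R * (seq R -> R) * R) := [:: (e', fun y => phi (V n y), an); (- e', fun y => g (std_sqdev n y), bn);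
    (M, fun y => q (std_sqdev n y), cn); (- M, W n, w); (- (eta + M), fun=> 1, 1)].
  suff : \sum_(t <- L) t.1.1 * t.2 <= 0 by rewrite !big_cons big_nil/=; lra.
  apply: (@It_lin_le _ (@wexp R) n.+1).
    move=> t [<-|[<-|[<-|[<-|[<-|//]]]]]/=.
    - by split=> // y; case/andP: (phiM (V n y)).
    - by split=> //; [exact: (measurableT_comp mg mT)|move=> y; case/andP: (g0 (std_sqdev n y))].
    - by split=> //; [exact: (measurableT_comp mq mT)|move=> y; case/andP: (q0 (std_sqdev n y))].
    - by split.
    - by split=> //; exact: (@It_cst _ (@wexp R) n.+1 1%E (@wexp1 R) lee01).
  move=> y sy; rewrite !big_cons big_nil/=.
  have := ler_norm (e' * (phi (V n y) - g (std_sqdev n y))); rewrite normrM e'1 mul1r => u1.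
  have W0y := W0 y; have /andP[q00 q11] := q0 (std_sqdev n y).
  have MW : 0 <= M * W n y by rewrite mulr_ge0.
  have [W1|W1] := ltP (W n y) 1.
    have u2 := near_g _ _ (cl y sy W1).
    by have := le_trans u1 u2; lra.
  have u2 : `|phi (V n y) - g (std_sqdev n y)| <= M.
    have /andP[? ?] := phiM (V n y); have /andP[? ?] := g0 (std_sqdev n y).
    by rewrite ler_norml; apply/andP; split; lra.
  have MW1 : M <= M * W n y by rewrite ler_peMr.
  have Mq : 0 <= M * (1 - q (std_sqdev n y)) by rewrite mulr_ge0// subr_ge0.
  by have := le_trans u1 u2; lra.
have -> : a - an = (a - b) + (b - bn) - (an - bn) by ring.
apply: le_trans (ler_normB _ _) _; apply: le_trans (lerD (ler_normD _ _) (lexx _)) _.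
have Mw : M * w <= M * eta by rewrite ler_wpM2l.
have Mcn : M * (1 - cn) <= M * (2 * eta).
  by rewrite ler_wpM2l//; move: ccn; rewrite ler_norml => /andP[]; lra.
by move: ab bbn abn; lra.
Qed.

End limit.

(** * Convergence in distribution *)

Section complex_measurability.
Context {R : realType}.
Local Open Scope complex_scope.
Context {d : measure_display} {X : measurableType d}.

(** An open set is the union of the squares with rational centre and radius [1 / (k + 1)] that it
    contains; [unpickle] enumerates them. *)
Lemma measurable_complex_open (u v : X -> R) (U : set R[i]^o) : measurable_fun setT u ->
  measurable_fun setT v -> open U -> measurable ((fun s => u s +i* v s : R[i]^o) @^-1` U).
Proof.
move=> mu mv oU.
pose rect (a b : rat) (k : nat) : set R[i]^o :=
  [set z | `|complex.Re z - ratr a| < k.+1%:R^-1 /\ `|complex.Im z - ratr b| < k.+1%:R^-1].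
pose A (m : nat) : set X :=
  if unpickle m is Some (a, b, k) then
    [set s | rect a b k `<=` U /\ rect a b k (u s +i* v s)] else set0.
have -> : (fun s => u s +i* v s : R[i]^o) @^-1` U = \bigcup_m A m.
  apply/seteqP; split => [s /= Us|s [m _]]; last first.
    by rewrite /A; case: unpickle => [[[a b] k] [sub]|//]; exact: sub.
  have /nbhs_ballP[e /= e0 He] : nbhs (u s +i* v s : R[i]^o) U by exact: open_nbhs_nbhs.
  have ee : e = (complex.Re e)%:C by case: e e0 {He} => x y /=; rewrite ltcE/= => /andP[/eqP -> _].
  pose d' := complex.Re e; have d'0 : 0 < d' by rewrite -ltcR -ee.
  pose k := Num.truncn (4 / d').
  pose r : R := k.+1%:R^-1.
  have r0 : 0 < r by rewrite invr_gt0.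
  have r4 : 4 * r < d'.
    rewrite /r ltr_pdivrMr// mulrC -ltr_pdivrMr//.
    by have /andP[_] := truncn_itv (divr_ge0 (ler0n R 4) (ltW d'0)).
  have [a /andP[a1 a2]] : exists a : rat, u s - r < ratr a < u s + r.
    have H : u s - r < u s + r by lra.
    by have [q] := rat_in_itvoo H; rewrite in_itv/=; exists q.
  have [b /andP[b1 b2]] : exists b : rat, v s - r < ratr b < v s + r.
    have H : v s - r < v s + r by lra.
    by have [q] := rat_in_itvoo H; rewrite in_itv/=; exists q.
  have [m mE] : exists m, unpickle m = Some (a, b, k).
    by exists (pickle (a, b, k)); exact: pickleK.
  exists m; first exact: I.
  rewrite /A mE; split; last first.
    by split=> /=; rewrite ltr_norml -/r; apply/andP; split; lra.
  move=> z [/= za zb]; apply: He; rewrite /ball/= modulusE ee ltcR -/d'.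
  apply: le_lt_trans r4; apply: le_trans (modulus_le_ReIm _) _.
  move: za zb; rewrite -/r !ltr_norml => /andP[za1 za2] /andP[zb1 zb2].
  have -> : complex.Re (u s +i* v s - z) = u s - complex.Re z by case: z {za1 za2 zb1 zb2}.
  have -> : complex.Im (u s +i* v s - z) = v s - complex.Im z by case: z {za1 za2 zb1 zb2}.
  have h1 : `|u s - complex.Re z| <= 2 * r by rewrite ler_norml; apply/andP; split; lra.
  have h2 : `|v s - complex.Im z| <= 2 * r by rewrite ler_norml; apply/andP; split; lra.
  lra.
apply: bigcupT_measurable => m; rewrite /A; case: unpickle => [[[a b] k]|]; last exact: measurable0.
have [sub|nsub] := pselect (rect a b k `<=` U); last first.
  rewrite (_ : [set s | _] = set0); first exact: measurable0.
  by apply/seteqP; split=> // s [].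
rewrite (_ : [set s | _] = [set s | `|u s - ratr a| < k.+1%:R^-1] `&` [set s | `|v s - ratr b| < k.+1%:R^-1]).
  have ms (w : X -> R) (q : rat) : measurable_fun setT w -> measurable [set s | `|w s - ratr q| < k.+1%:R^-1].
    move=> mw; have mb : measurable_fun setT (fun s => `|w s - ratr q| < k.+1%:R^-1).
      apply: measurable_fun_ltr; last exact: measurable_cst.
      by apply: measurableT_comp => //; exact: measurable_funB.
    by have := mb measurableT [set true] I; rewrite setTI.
  by apply: measurableI; exact: ms.
by apply/seteqP; split=> s /=; [case=> _ []|case].
Qed.

Lemma measurable_complex_affine (u v : X -> R) (a b : R[i]) (U : set R[i]^o) :
  measurable_fun setT u -> measurable_fun setT v -> open U ->
  measurable ((fun s => a * (u s +i* v s) + b : R[i]^o) @^-1` U).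
Proof.
move=> mu mv oU; case: a => a1 a2; case: b => b1 b2.
rewrite (_ : (fun s => _) = (fun s => (a1 * u s - a2 * v s + b1) +i* (a1 * v s + a2 * u s + b2) : R[i]^o)).
  apply: measurable_complex_open => //.
    by apply: measurable_funD => //; apply: measurable_funB; exact: measurable_funM.
  by apply: measurable_funD => //; apply: measurable_funD; exact: measurable_funM.
by apply/funext.
Qed.

Lemma measurable_continuous_comp (Y : X -> R[i]^o) (phi : R[i]^o -> R) : continuous phi ->
  (forall U, open U -> measurable (Y @^-1` U)) -> measurable_fun setT (fun s => phi (Y s)).
Proof.
move=> /continuousP cphi mY; apply: (measurability _ (RGenOpens.measurableE R)).
move=> _ [_ [a [b ->] <-]]; rewrite setTI; apply: (mY (phi @^-1` `]a, b[%classic)).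
exact/cphi/interval_open.
Qed.

End complex_measurability.

Section functional.
Context {R : realType} (h : R[i] -> R[i]^o).
Hypothesis hh : analytic_on (@right_half_plane R) h.
Local Open Scope complex_scope.
Local Notation mu := (@lebesgue_measure R).

Definition sample_functional (n : nat) (s : seq R) : R[i] := mu_functional h (gren n s).

Lemma mu_functional_uniform : mu_functional h (uniform_pdf 0 1) = h 1.
Proof.
have E (p : R[i] -> R) : \int[mu]_(x in `[0, 1]) p (h (uniform_pdf 0 1 x)%:C) = p (h 1).
  transitivity (\int[mu]_(x in `[0, 1]) p (h 1)).
    apply: eq_Rintegral => x; rewrite inE/= in_itv/= => x01.
    by rewrite /uniform_pdf x01 subr0 invr1.
  rewrite Rintegral_cst//= lebesgue_measure_itv/= lte_fin ltr01.
  by rewrite -EFinB/= subr0 mulr1.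
by rewrite /mu_functional !E; case: (h 1).
Qed.

Lemma mu_functional_sample (T : Type) (X : nat -> T -> R) n w :
  mu_functional h (grenander (fun i : 'I_n => X i w)) =
  sample_functional n (mkseq (fun i => X i w) n).
Proof.
rewrite /sample_functional /gren; congr (mu_functional h (grenander _)).
by apply/funext => i; rewrite nth_mkseq.
Qed.

Lemma measurable_sample_part (p : R[i] -> R) n : real_part_like p ->
  measurable_fun setT (fun s => \int[mu]_(x in `[0, 1]) p (h (gren n s x)%:C)).
Proof.
move=> pp; apply: (@measurable_integral_gren R n (fun v => p (h v%:C)) _ (measurable_component hh pp)).
move=> v; rewrite le_eqVlt => /orP[/eqP <-|v0]; first by rewrite ltxx.
by rewrite v0.
Qed.

Lemma sample_functional_perm n s t : size s = n -> perm_eq s t ->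
  sample_functional n s = sample_functional n t.
Proof.
move=> sn st; rewrite /sample_functional; congr (mu_functional h _).
rewrite /gren /grenander; congr (left_slope (least_concave_majorant _)).
exact: (ecdf_perm sn st).
Qed.

Definition standardized (n : nat) (z : R[i]) : R[i]^o :=
  (n%:R * (z - h 1) - 1 / 2 * derive1n 2 h 1 * (ln n%:R)%:C)
  / sqrtC (3 / 4 * derive1n 2 h 1 ^+ 2 * (ln n%:R)%:C).

Lemma measurable_standardized n (U : set R[i]^o) : open U ->
  measurable ((fun s => standardized n (sample_functional n s)) @^-1` U).
Proof.
move=> oU; pose D := (sqrtC (3 / 4 * derive1n 2 h 1 ^+ 2 * (ln n%:R)%:C))^-1.
rewrite (_ : (fun s => _) = (fun s => (n%:R * D) * sample_functional n s
   + (- (n%:R * h 1) - 1 / 2 * derive1n 2 h 1 * (ln n%:R)%:C) * D : R[i]^o)).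
  apply: measurable_complex_affine => //; apply: measurable_sample_part.
    exact: real_part_like_Re.
  exact: real_part_like_Im.
by apply/funext => s; rewrite /standardized -/D; ring.
Qed.

End functional.

(** * Closeness of the standardised functional to its linear approximation *)

Section closeness.
Context {R : realType} (h : R[i] -> R[i]^o).
Hypothesis hh : analytic_on (@right_half_plane R) h.
Hypothesis h2_neq0 : derive1n 2 h 1 != 0.
Local Open Scope complex_scope.
Local Notation Ex := (It (@wexp R)).

Lemma degenerate_ext n (S S' : nat -> R) : (forall i, (i <= n)%N -> S i = S' i) ->
  degenerate n S = degenerate n S'.
Proof.
move=> SS'; congr (_ || _); apply: eq_in_has.
  by move=> i; rewrite mem_iota => /andP[_ i_n]; rewrite !SS'//; lia.
move=> x /allpairsP[p [p1 p2 ->]].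
case/allpairsP: p1 => a [a1 a2 ->]; case/allpairsP: p2 => b [b1 b2 ->].
by move: a1 a2 b1 b2; rewrite !mem_iota !add0n !ltnS => *; rewrite /tie/= !SS'.
Qed.

Definition bad (n : nat) (y : seq R) : bool :=
  degenerate n (psum y) || has (fun i => nth 0 y i <= 0) (iota 0 n.+1).

Lemma bad_negl n : It_negl (@wexp R) n.+1 (bad n).
Proof.
apply: It_negl_or; last first.
  by apply: It_negl_has => i; rewrite mem_iota => /andP[_ i_n]; exact: wexp_pos_negl.
have [md d0] := @degenerate_negl R n; split=> //; rewrite -d0 -[in LHS]addn1 It_wexp_take//.
move=> z y zn; congr (_%:R%:E); congr nat_of_bool; apply: degenerate_ext => i i_n.
by rewrite psum_cat_l// zn.
Qed.

Lemma not_bad n y : size y = n.+1 -> ~~ bad n y ->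
  ~~ degenerate n (psum y) /\ all (fun x => 0 < x) y.
Proof.
move=> sy; rewrite negb_or => /andP[gen /hasPn pos]; split => //.
apply/(all_nthP 0) => i; rewrite sy => i_n.
by have := pos i; rewrite mem_iota /= add0n i_n => /(_ isT); rewrite -ltNge.
Qed.

Let h2 := derive1n 2 h 1.
Let D := sqrtC (3 / 4 * h2 ^+ 2).

Let D_neq0 : D != 0.
Proof.
rewrite sqrtC_eq0 mulf_neq0 ?expf_neq0// mulf_neq0 ?invr_neq0// pnatr_eq0//.
Qed.

(** [D] is the root of [3 / 4 * h2 ^+ 2] on the branch chosen by [sqrtC], which need not be
    [h2 / 2 * sqrt 3]. Only the square of this quotient is determined. *)
Definition slope_sign : R[i] := h2 / 2 * (Num.sqrt 3 : R)%:C / D.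

Lemma slope_sign_pm1 : slope_sign = 1 \/ slope_sign = -1.
Proof.
suff : slope_sign ^+ 2 == 1 by rewrite sqrf_eq1 => /orP[/eqP ->|/eqP ->]; [left|right].
have s3 : (Num.sqrt 3 : R)%:C ^+ 2 = 3.
  by rewrite -rmorphXn/= sqr_sqrtr// rmorph_nat.
have D2 : D ^+ 2 = 3 / 4 * h2 ^+ 2 by exact: sqrtCK.
by rewrite /slope_sign expr_div_n exprMn s3 D2; apply/eqP; field; rewrite h2_neq0.
Qed.

Lemma sqrtC_scale (x : R) : 0 <= x -> sqrtC (3 / 4 * h2 ^+ 2 * x%:C) = D * (Num.sqrt x)%:C.
Proof.
move=> x0; rewrite rootCMr ?lecR//; congr (_ * _).
have -> : x%:C = (Num.sqrt x)%:C ^+ 2 by rewrite -rmorphXn/= sqr_sqrtr.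
by rewrite sqrCK// lecR sqrtr_ge0.
Qed.

Definition numerator_error (n : nat) (y : seq R) : R[i] :=
  n%:R * (sample_functional h n (spacings_sample n y) - h 1)
  - h2 / 2 * (Fsum sqdev n (psum y))%:C.

Lemma standardizedB n y : 0 < ln (n%:R : R) ->
  standardized h n (sample_functional h n (spacings_sample n y)) - slope_sign * (std_sqdev n y)%:C =
  numerator_error n y / (D * (Num.sqrt (ln n%:R : R))%:C).
Proof.
move=> l0; rewrite /standardized -/h2 sqrtC_scale ?(ltW l0)// /slope_sign /numerator_error /std_sqdev.
rewrite sqrtrM// !(rmorphM, rmorphB, fmorphV)/=.
have s3 : (Num.sqrt (3 : R))%:C != 0 by rewrite fmorph_eq0 gt_eqF// sqrtr_gt0.
have sl : (Num.sqrt (ln n%:R : R))%:C != 0 by rewrite fmorph_eq0 gt_eqF// sqrtr_gt0.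
move: s3 sl D_neq0; set S := sample_functional _ _ _; set Q := (Fsum _ _ _)%:C.
set s3 := (Num.sqrt 3)%:C; set sl := (Num.sqrt _)%:C => s30 sl0 D0.
by field; rewrite s30 sl0 D0.
Qed.

(** [deviation_bound] is applied to the real function [x -> p (h x)], whose quadratic coefficient at
    1 is [p (h2 / 2)]. *)
Lemma numerator_error_part (p : R[i] -> R) (e K : R) : real_part_like p ->
  (forall n s, p (sample_functional h n s) =
     \int[@lebesgue_measure R]_(x in `[0, 1]) p (h (gren n s x)%:C)) ->
  0 < e -> e <= 2^-1 -> 0 < K ->
  exists C : R, 0 <= C /\ forall n y, 4 * K <= n%:R -> (0 < n)%N -> size y = n.+1 ->
    all (fun x => 0 < x) y -> ~~ degenerate n (psum y) -> err e K n y < 1 ->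
    `|p (numerator_error n y)| <= C.
Proof.
move=> pp pE e0 e2 K0; have [pB pZ _] := pp.
have [a1 Ha1] := taylor_component hh pp.
have eh0 : 0 < e / 2 by rewrite divr_gt0.
have [L [L0 HL]] := Ha1 _ eh0.
exists `|deviation_const (fun x : R => p (h x%:C)) a1 (p (h2 / 2)) e K L|; split; first exact: normr_ge0.
move=> n y Kn n0 sy y0 gen small.
apply: le_trans (ler_norm _).
have := deviation_bound e0 e2 K0 L0 HL Kn n0 sy y0 gen small.
rewrite -pE; congr (`|_| <= _).
have nC : n%:R = (n%:R : R)%:C :> R[i] by rewrite rmorph_nat.
rewrite /numerator_error pB nC pZ pB.
by rewrite [h2 / 2 * _]mulrC pZ mulrC [X in _ - X]mulrC; congr (_ * _ - _); rewrite mulrC.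
Qed.

(** Given [eta], the parameters [e] and [K] are fixed first, so that the numerator error is bounded
    by a constant; afterwards [n] is taken large enough for the denominator to make it small. *)
Lemma standardized_close (eta r : R) : 0 < eta -> 0 < r ->
  exists W : nat -> seq R -> R,
  (forall n, measurable_fun setT (W n) /\ forall y, 0 <= W n y) /\
  \forall n \near \oo, (Ex n.+1 (fun y => (W n y)%:E) <= eta%:E)%E /\
    forall y, size y = n.+1 -> W n y < 1 ->
    modulus (standardized h n (sample_functional h n (spacings_sample n y))
             - slope_sign * (std_sqdev n y)%:C) <= r.
Proof.
move=> eta0 r0.
pose E : R := expR 1; have E0 : 0 < E by exact: expR_gt0.
have E12 : 0 < 2 * E + 12 by lra.
(* The first two bounds are the conditions of [It_err]; the third makes its term in [e] at most
   [eta / 2]. The choice of [K] below makes [23 / K] the other half. *)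
pose e : R := Num.min 2^-1 (Num.min (2 * E)^-1 (eta / (2 * (2 * E + 12)))).
have e0 : 0 < e by rewrite !lt_min invr_gt0 ltr0n /= invr_gt0 mulr_gt0//= divr_gt0// mulr_gt0.
have e2 : e <= 2^-1 by rewrite ge_min lexx.
have eE : 2 * E * e <= 1.
  by rewrite mulrC -ler_pdivlMr ?mulr_gt0// div1r !ge_min lexx orbT.
have eeta : (2 * E + 12) * e <= eta / 2.
  have : e <= eta / (2 * (2 * E + 12)) by rewrite !ge_min lexx !orbT.
  by rewrite ler_pdivlMr ?mulr_gt0//; lra.
pose K : R := 46 / eta; have K0 : 0 < K by rewrite divr_gt0.
have Keta : 23 / K = eta / 2 by rewrite /K; field; rewrite gt_eqF.
have [C1 [C10 H1]] := numerator_error_part (@real_part_like_Re R) (fun _ _ => erefl) e0 e2 K0.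
have [C2 [C20 H2]] := numerator_error_part (@real_part_like_Im R) (fun _ _ => erefl) e0 e2 K0.
have mb n : measurable_fun setT (fun y : seq R => ((bad n y)%:R : R)).
  by apply/measurable_EFinP; apply: measurable_b2E; case: (bad_negl n).
(* The indicator of [bad] has mean zero but forces [W >= 1] on degenerate or nonpositive sequences,
   so [W < 1] provides genericity and positivity. *)
exists (fun n y => if (0 < n)%N then err e K n y + (bad n y)%:R else 0); split.
  move=> n; have [n0|_] := boolP (0 < n)%N; last by split.
  split; last by move=> y; rewrite addr_ge0// err_ge0.
  by apply: measurable_funD => //; exact: measurable_err.
have mD : 0 < modulus D.
  by rewrite lt_neqAle modulus_ge0 andbT eq_sym; apply: contra_neq D_neq0 => /modulus_eq0.
(* [ln n >= A] makes [(C1 + C2) / (modulus D * sqrt (ln n))] at most [r]. *)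
pose A : R := Num.max 1 (((C1 + C2) / (modulus D * r)) ^+ 2).
have A1 : 1 <= A by rewrite le_max lexx.
near=> n.
have n0 : (0 < n)%N by near: n; exact: nbhs_infty_gt.
have Kn : 4 * K <= n%:R by near: n; exact: nbhs_infty_ger.
have nA : expR A <= n%:R by near: n; exact: nbhs_infty_ger.
rewrite n0; split.
  have -> : (fun y : seq R => (err e K n y + (bad n y)%:R)%:E) =
      (fun y => (err e K n y)%:E + ((bad n y)%:R : R)%:E)%E by apply/funext => y; rewrite EFinD.
  rewrite ItD.
  - have [_ ->] := bad_negl n; rewrite adde0.
    apply: le_trans (It_err e0 K0 n0 e2 eE) _.
    by rewrite lee_fin -/E Keta; lra.
  - by apply/measurable_EFinP; exact: measurable_err.
  - exact/measurable_EFinP.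
  - by move=> y; rewrite lee_fin err_ge0.
  - by move=> y; rewrite lee_fin.
move=> y sy Wy.
have nb : ~~ bad n y.
  by apply/negP => b; move: Wy; rewrite b /= ltNge lerDr err_ge0.
have small : err e K n y < 1 by apply: le_lt_trans Wy; rewrite lerDl.
have [gen y0] := not_bad sy nb.
have lA : A <= ln n%:R :> R.
  by rewrite -[A]expRK ler_ln ?posrE ?expR_gt0// (lt_le_trans _ nA) ?expR_gt0.
have l0 : 0 < ln n%:R :> R by apply: lt_le_trans lA; lra.
rewrite standardizedB// modulusM modulusV modulusM modulus_real ger0_norm ?sqrtr_ge0//.
have sl0 : 0 < Num.sqrt (ln n%:R : R) by rewrite sqrtr_gt0.
rewrite ler_pdivrMr ?mulr_gt0//.
apply: le_trans (modulus_le_ReIm _) _.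
apply: le_trans (lerD (H1 n y Kn n0 sy y0 gen small) (H2 n y Kn n0 sy y0 gen small)) _.
rewrite mulrA [r * _]mulrC -ler_pdivrMl ?mulr_gt0// mulrC.
apply: le_trans (ler_norm _) _; rewrite -sqrtr_sqr; apply: ler_wsqrtr.
by apply: le_trans lA; rewrite [_^-1 * _]mulrC [r * _]mulrC le_max lexx orbT.
Unshelve. all: by end_near. Qed.

End closeness.

(** * From the uniform sample to exponential spacings *)

Section transfer.
Context {R : realType} (h : R[i] -> R[i]^o).
Hypothesis hh : analytic_on (@right_half_plane R) h.
Context {d : measure_display} {T : measurableType d} {P : probability T R}.
Context {X : nat -> {RV P >-> R}}.
Hypothesis X_sample : uniform01_sample X.
Local Open Scope complex_scope.
Local Notation Ex := (It (@wexp R)).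
Local Notation sample n := (fun w => mkseq (fun i => X i w) n).

Lemma measurable_sample n : measurable_fun setT (sample n : T -> seq R).
Proof. by apply: measurable_fun_mkseq => i; exact: measurable_funP. Qed.

Lemma measurable_standardized_sample n (U : set R[i]^o) : open U ->
  measurable ((fun w => standardized h n (sample_functional h n (sample n w))) @^-1` U).
Proof.
move=> oU; have := measurable_sample n measurableT (measurable_standardized hh n oU).
by rewrite setTI.
Qed.

Lemma expectation_sample n (phi : R[i]^o -> R) : continuous phi -> (forall z, 0 <= phi z) ->
  (\int[P]_w (phi (standardized h n (sample_functional h n (sample n w))))%:E)%E =
  Ex n.+1 (fun y => (phi (standardized h n (sample_functional h n (spacings_sample n y))))%:E).
Proof.
move=> cphi phi0.
(* [gren n] reads the first [n] entries only and is symmetric on sequences of length [n]; the size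
   test makes [F] symmetric on all sequences. *)
pose F (s : seq R) : \bar R :=
  if size s == n then (phi (standardized h n (sample_functional h n s)))%:E else 0%E.
have F0 s : (0 <= F s)%E by rewrite /F; case: ifP => // _; rewrite lee_fin.
have mF : measurable_fun setT F.
  apply: measurable_fun_ifT; [|apply/measurable_EFinP|exact: measurable_cst].
    apply: (measurableT_comp (f := fun k : nat => k == n)); last exact: measurable_size.
    by move=> _ Y _; exact: I.
  by apply: measurable_continuous_comp => // U; exact: measurable_standardized.
have Fperm s t : perm_eq s t -> F s = F t.
  move=> st; rewrite /F (perm_size st).
  have [tn|_] := eqVneq (size t) n; last by [].
  by rewrite (sample_functional_perm h (n := n) (s := s) (t := t))// (perm_size st).
transitivity (\int[P]_w F (sample n w))%E.
  by apply: eq_integral => w _; rewrite /F size_mkseq eqxx.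
rewrite (integral_sample X_sample n mF F0) (It_uniform_exp n mF F0 Fperm).
by apply: It_ext => y _; rewrite -/(spacings_sample n y) /F size_spacings_sample eqxx.
Qed.

End transfer.

(** Adding its bound makes a test function nonnegative, as [It] and [smooth_approx] require. *)
Lemma Rintegral_bounded_shift (R : realType) (d : measure_display) (T : measurableType d)
    (P : probability T R) (f : T -> R) (M : R) : measurable_fun setT f -> (forall x, `|f x| <= M) ->
  \int[P]_x f x = \int[P]_x (f x + M) - M.
Proof.
move=> mf fM.
have int (g : T -> R) : measurable_fun setT g -> (exists C : R, forall x, `|g x| <= C) ->
    P.-integrable setT (EFin \o g).
  move=> mg [C gC]; apply: measurable_bounded_integrable => //.
    by rewrite (le_lt_trans (probability_le1 _ _)) ?ltry.
  exists C; split; first exact: num_real.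
  by move=> B CB x _ /=; exact: le_trans (gC x) (ltW CB).
rewrite RintegralD//; [|by apply: int => //; exists M|by apply: int => //; exists `|M|].
rewrite Rintegral_cst//= [X in fine X](_ : _ = 1%E) ?mulr1 ?addrK//.
exact: probability_setT.
Qed.

Section standardized_cvg.
Context {R : realType} (h : R[i] -> R[i]^o).
Hypothesis h_analytic : analytic_on (@right_half_plane R) h.
Hypothesis h2_neq0 : derive1n 2 h 1 != 0.
Context {d : measure_display} {T : measurableType d} {P : probability T R}.
Context {X : nat -> {RV P >-> R}}.
Hypothesis X_sample : uniform01_sample X.
Local Open Scope complex_scope.

Lemma measurable_spacings_sample n : measurable_fun setT (@spacings_sample R n).
Proof.
apply: measurable_fun_mapdiv; first exact: measurable_psum.
rewrite (_ : (fun y : seq R => _) = (fun y => drop 1 (rpsum n.+1 y))).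
  by apply: measurable_fun_drop; exact: measurable_rpsum.
by apply/funext => y; rewrite drop1.
Qed.

(** [weak_limit] gives the limit along [kappa x]; for [kappa = -1] the reflection [En_oppr] of the
    normal law brings it back to [x]. *)
Lemma standardized_cvg : cvg_in_distribution (E := R[i]^o) P (normal_prob (0 : R) 1)
  (fun n w => standardized h n (sample_functional h n (mkseq (fun i => X i w) n)))
  (fun x : R => x%:C).
Proof.
split; first by move=> n U oU; exact: (measurable_standardized_sample h_analytic (X := X) n oU).
move=> phi cphi [M phiM].
have M0 : 0 <= M by apply: le_trans (phiM 0).
pose psi (z : R[i]^o) := phi z + M.
have psi_bd z : 0 <= psi z <= 2 * M.
  by have := phiM z; rewrite ler_norml /psi => /andP[]; lra.
have psi0 z : 0 <= psi z by case/andP: (psi_bd z).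
have cpsi : continuous psi.
  by move=> z; apply: (@continuousD _ R^o (R[i]^o) phi (fun=> M)); [exact: cphi|exact: cst_continuous].
pose kappa := slope_sign h.
pose V n (y : seq R) : R[i]^o := standardized h n (sample_functional h n (spacings_sample n y)).
have mV n : measurable_fun setT (fun y => psi (V n y)).
  apply: measurable_continuous_comp => // U oU.
  have ms : measurable_fun setT (@spacings_sample R n).
    exact: measurable_spacings_sample.
  have := ms measurableT _ (measurable_standardized h_analytic n oU).
  by rewrite setTI.
have lim := weak_limit cpsi psi_bd mV (standardized_close h_analytic h2_neq0).
have mline (c : R[i]) : measurable_fun setT (fun x : R => phi (c * x%:C)).
  apply: continuous_measurable_fun => x.
  by apply: (@continuous_comp _ _ _ (fun x : R => c * x%:C : R[i]^o) phi x);
    [exact: continuous_complex_line|exact: cphi].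
have mpsi (c : R[i]) : measurable_fun setT (fun x : R => psi (c * x%:C)).
  by apply: measurable_funD => //; exact: mline.
have symm : \int[normal_prob 0 1]_x psi (kappa * x%:C) = \int[normal_prob 0 1]_x psi (x%:C).
  have E1 : (fun x : R => psi x%:C) = (fun x : R => psi (1 * x%:C)).
    by apply/funext => x; rewrite mul1r.
  rewrite /kappa; have [->|->] := slope_sign_pm1 h2_neq0; first by rewrite E1.
  have m1 : measurable_fun setT (fun x : R => psi x%:C) by rewrite E1; exact: mpsi.
  apply: EFin_inj; rewrite -(EnE_fin (mpsi (-1)) (fun x => psi_bd _)) -(EnE_fin m1 (fun x => psi_bd _)).
  rewrite -(En_oppr m1 (fun x => psi0 _)); congr En; apply/funext => x.
  by rewrite mulN1r rmorphN.
have EN : \int[normal_prob 0 1]_x phi (x%:C) = \int[normal_prob 0 1]_x psi (kappa * x%:C) - M.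
  rewrite symm; apply: Rintegral_bounded_shift => //.
  by have := mline 1; congr (measurable_fun setT _); apply/funext => x; rewrite mul1r.
rewrite EN.
pose Y n w : R[i]^o := standardized h n (sample_functional h n (mkseq (fun i => X i w) n)).
have EP n : \int[P]_w phi (Y n w) = fine (It (@wexp R) n.+1 (fun y => (psi (V n y))%:E)) - M.
  rewrite (Rintegral_bounded_shift P (M := M)) => [|//|w]; last exact: phiM.
    by congr (fine _ - M); exact: (expectation_sample h_analytic X_sample n cpsi psi0).
  apply: measurable_continuous_comp => // U oU.
  exact: (measurable_standardized_sample h_analytic (X := X) n oU).
rewrite (_ : (fun n => _) = (fun n => fine (It (@wexp R) n.+1 (fun y => (psi (V n y))%:E)) - M)).
  by apply: cvgB lim _; exact: cvg_cst.
by apply/funext => n; rewrite -EP.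
Qed.

End standardized_cvg.

Local Open Scope complex_scope.

Theorem theorem1p2 (R : realType) (h : R[i] -> R[i]^o)
  (h_analytic : analytic_on (@right_half_plane R) h)
  (h2_neq0 : derive1n 2 h 1 != 0)
  (h_bigO : exists C A : R, forall t : R, A <= `|t| ->
     modulus (h (1 -i* t)) <= C * t ^+ 2)
  (h2_bigO : exists C A : R, forall t : R, A <= `|t| ->
     modulus (derive1n 2 h (1 -i* t)) <= C)
  (d : measure_display) (T : measurableType d) (P : probability T R)
  (X : nat -> {RV P >-> R})
  (X_sample : uniform01_sample X) :
  let f : R -> R := uniform_pdf 0 1 in
  let fhat (n : nat) (w : T) : R -> R := grenander (fun i : 'I_n => X i w) in
  let h2 : R[i] := derive1n 2 h 1 in
  let logn (n : nat) : R[i] := (ln (n%:R : R))%:C in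
  cvg_in_distribution (E := R[i]^o) P (normal_prob (0 : R) 1)
    (fun n w =>
      (n%:R * (mu_functional h (fhat n w) - mu_functional h f)
        - 1 / 2 * h2 * logn n)
      / sqrtC (3 / 4 * h2 ^+ 2 * logn n))
    (fun x : R => x%:C).
Proof.
move=> f fhat h2 logn; have := standardized_cvg h_analytic h2_neq0 X_sample.
rewrite (_ : (fun n w => standardized h n _) = (fun n w =>
    (n%:R * (mu_functional h (fhat n w) - mu_functional h f) - 1 / 2 * h2 * logn n)
    / sqrtC (3 / 4 * h2 ^+ 2 * logn n)))//.
apply/funext => n; apply/funext => w.
by rewrite /f mu_functional_uniform /fhat (mu_functional_sample h (fun i w => X i w)).
Qed.
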